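(* (i) Let $(\mathcal K,\sigma)$ be an oriented, tame Kuranishi atlas with reduction $\mathcal V$, and let $\nu$ be an admissible, precompact, transverse perturbation of $\mathfrak s_{\mathcal K}|_{\mathcal V}$. Then the zero set $|\mathbf Z^\nu|$ inherits the structure of an oriented closed manifold. (ii) Let $(\mathcal K,\sigma)$ be an oriented, tame Kuranishi cobordism with reduction $\mathcal V$ and admissible, precompact, transverse perturbation $\nu$. Then the corresponding zero set $|\mathbf Z^\nu|$ inherits the structure of an oriented cobordism from $|\mathbf Z^{\nu^0}|$ to $|\mathbf Z^{\nu^1}|$ for $\nu^\alpha:=\nu|_{\partial^\alpha\mathcal V}$, with boundary orientations induced as in (i) by $\sigma^\alpha:=\partial^\alpha\sigma$.
   Context: \textbf{Charts and atlases.} A Kuranishi chart (trivial isotropy) for a compact metrizable $X$ with footprint a nonempty open $F\subset X$ is $\mathbf K=(U,E,s,\psi)$ with $U$ a finite-dimensional smooth manifold (without boundary), $E$ a finite-dimensional real vector space, $s:U\to E$ smooth, $\psi:s^{-1}(0)\to X$ a homeomorphism onto $F$; $\dim\mathbf K=\dim U-\dim E$. A coordinate change $\widehat\Phi_{IJ}:\mathbf K_I\to\mathbf K_J$ ($F_I\cap F_J\neq\emptyset$) consists of an open $U_{IJ}\subset U_I$ with $U_{IJ}\cap s_I^{-1}(0)=\psi_I^{-1}(F_I\cap F_J)$, a smooth embedding $\phi_{IJ}:U_{IJ}\to U_J$ and a linear injection $\widehat\phi_{IJ}:E_I\to E_J$ with $s_J\circ\phi_{IJ}=\widehat\phi_{IJ}\circ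 s_I$, $\phi_{IJ}=\psi_J^{-1}\circ\psi_I$ on $U_{IJ}\cap s_I^{-1}(0)$, and the index condition: for all $u\in U_{IJ}$, $d_u\phi_{IJ}(\ker d_us_I)=\ker d_{\phi_{IJ}(u)}s_J$, and $E_I=\operatorname{im}d_us_I\oplus C$ implies $E_J=\operatorname{im}d_{\phi_{IJ}(u)}s_J\oplus\widehat\phi_{IJ}(C)$. A Kuranishi atlas $\mathcal K$ of dimension $d$ on $X$ consists of basic charts $\mathbf K_1,\dots,\mathbf K_N$ with footprints covering $X$; with $\mathcal I_{\mathcal K}=\{\emptyset\neq I\subset\{1,\dots,N\}:F_I:=\bigcap_{i\in I}F_i\neq\emptyset\}$, charts $\mathbf K_I$ with footprint $F_I$ for $I\in\mathcal I_{\mathcal K}$ ($\mathbf K_{\{i\}}=\mathbf K_i$), all of dimension $d$; and coordinate changes $\widehat\Phi_{IJ}$ for $I\subsetneq J$, such that for $I\subsetneq J\subsetneq L$: $\widehat\phi_{JL}\widehat\phi_{IJ}=\widehat\phi_{IL}$, $\phi_{IJ}^{-1}(U_{JL})\subset U_{IL}$, $\phi_{JL}\phi_{IJ}=\phi_{IL}$ on $\phi_{IJ}^{-1}(U_{JL})$. Conventions: $U_{II}=U_I$, $\phi_{II}=\mathrm{id}$, $s_J^{-1}(E_I)=s_J^{-1}(\widehat\phi_{IJ}(E_I))$. It is tame if additive (each $\prod_{i\in I}E_i\to E_I$, $(e_i)\mapsto\sum\widehat\phi_{iI}(e_i)$ is an isomorphism) and, for all indices (equalities allowed), $U_{IJ}\cap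 U_{IL}=U_{I(J\cup L)}$ for $I\subset J,L$ (with $U_{IH}=\emptyset$ for $H\notin\mathcal I_{\mathcal K}$) and $\phi_{IJ}(U_{IL})=U_{JL}\cap s_J^{-1}(E_I)$ for $I\subset J\subset L$. $|\mathcal K|=\bigsqcup_IU_I/\!\sim$, with $\sim$ generated by $(I,x)\sim(J,\phi_{IJ}(x))$, has projection $\pi_{\mathcal K}$; $\iota_{\mathcal K}:X\to|\mathcal K|$, $p\mapsto[I,\psi_I^{-1}(p)]$. $A\sqsubset B$ means precompact inclusion. \textbf{Cobordisms.} Let $A^0_\delta=[0,\delta)$, $A^1_\delta=(1-\delta,1]$. A collared cobordism $(Y,\iota_Y^0,\iota_Y^1)$ is a separable, locally compact metrizable space with disjoint (possibly empty) closed subsets $\partial^0Y,\partial^1Y$ and maps $\iota^\alpha_Y:A^\alpha_\varepsilon\times\partial^\alpha Y\to Y$ with $\iota^\alpha_Y(\alpha,\cdot)$ the inclusion, which are homeomorphisms onto disjoint open neighbourhoods of $\partial^\alpha Y$. An open $F\subset Y$ is collared if with $\partial^\alpha F=F\cap\partial^\alpha Y$ one has $F\cap\iota_Y^\alpha(A^\alpha_\delta\times\partial^\alpha Y)=\iota_Y^\alpha(A^\alpha_\delta\times\partial^\alpha F)$ for some $\delta>0$, and $F\cap\operatorname{im}\iota^\alpha_Y=\emptyset$ if $\partial^\alpha F=\emptyset$. A chart with collared boundary for $Y$ is $(U,E,s,\psi)$ with $E$ a finite-dimensional real vector space, $s:U\to E$ smooth, $\psi:s^{-1}(0)\to Y$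 a homeomorphism onto an open footprint $F\subset Y$, and $U$ a finite-dimensional smooth manifold with boundary $\partial^0U\sqcup\partial^1U$ with collar diffeomorphisms $\iota^\alpha_U:A^\alpha_\varepsilon\times\partial^\alpha U\to U$ onto neighbourhoods of $\partial^\alpha U$, footprint $F$ collared and meeting some $\partial^\alpha Y$, $\partial^\alpha U\ne\emptyset$ iff $\partial^\alpha F\neq\emptyset$, and charts $\partial^\alpha\mathbf K=(\partial^\alpha U,E,s^\alpha,\psi^\alpha)$ for $\partial^\alpha Y$ with footprint $\partial^\alpha F$ such that $s(\iota_U^\alpha(t,x))=s^\alpha(x)$, $\psi(\iota^\alpha_U(t,x))=\iota^\alpha_Y(t,\psi^\alpha(x))$ near the boundary. A coordinate change with collared boundary from such $\mathbf K_I$ to $\mathbf K_J$ (with or without boundary) has collared domain $U_{IJ}$; if $F_J\cap\partial^\alpha Y\neq\emptyset$ it equals, in collar coordinates near the boundary, the product of $\mathrm{id}_{A^\alpha_\varepsilon}$ with a coordinate change $\partial^\alpha\widehat\Phi_{IJ}:\partial^\alpha\mathbf K_I\to\partial^\alpha\mathbf K_J$ of domain $\partial^\alpha U_{IJ}$ (including equality of domains and images in the collars); if $F_J\cap\partial^\alpha Y=\emptyset$ its domain is disjoint from a collar of $\partial^\alpha U_I$. A Kuranishi cobordism on a compact collared cobordism $Y$ is defined as a Kuranishi atlas on $Y$, with charts that have collared boundary or are ordinary charts with footprints $\sqsubset Y\setminus(\partial^0Y\cup\partial^1Y)$, and coordinate changes of the corresponding type; tameness as for atlases. $\partial^\alpha\mathcal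 K$ is the atlas on $\partial^\alpha Y$ of the restrictions, with index set $\mathcal I_{\partial^\alpha\mathcal K}=\{I:F_I\cap\partial^\alpha Y\neq\emptyset\}$. \textbf{Reductions and perturbations.} A reduction is $\mathcal V=\bigsqcup V_I$ with open $V_I\sqsubset U_I$, $V_I\cap s_I^{-1}(0)\neq\emptyset$ if $V_I\neq\emptyset$; $\pi_{\mathcal K}(\overline{V_I})\cap\pi_{\mathcal K}(\overline{V_J})\neq\emptyset$ only if $I\subset J$ or $J\subset I$; $\iota_{\mathcal K}(X)\subset\pi_{\mathcal K}(\mathcal V)$ ($Y$ instead of $X$ for cobordisms). For a cobordism, reductions are required to be collared: for $I\in\mathcal I_{\partial^\alpha\mathcal K}$, $(\iota^\alpha_{U_I})^{-1}(V_I)\cap(A^\alpha_\varepsilon\times\partial^\alpha U_I)=A^\alpha_\varepsilon\times\partial^\alpha V_I$ for some $\varepsilon>0$, $\partial^\alpha V_I\subset\partial^\alpha U_I$, with $\partial^\alpha V_I\neq\emptyset$ iff $V_I\cap\psi_I^{-1}(\partial^\alpha F_I)\neq\emptyset$; $\partial^\alpha\mathcal V=\bigsqcup\partial^\alpha V_I$. A nested reduction $\mathcal C\sqsubset\mathcal V$ is a pair of reductions with precompact inclusion. A perturbation of $\mathfrak s_{\mathcal K}|_{\mathcal V}=(s_I|_{V_I})$ is a family of smooth $\nu_I:V_I\to E_I$ with $\nu_J\circ\phi_{IJ}=\widehat\phi_{IJ}\circ\nu_I$ on $V_I\cap\phi_{IJ}^{-1}(V_J)$, and for cobordisms $\nu_I(\iota^\alpha_{U_I}(t,x))=\nu_I^\alpha(x)$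 near the boundary; $\nu|_{\partial^\alpha\mathcal V}=(\nu_I^\alpha)$. It is admissible if $d_y\nu_J(T_yV_J)\subset\operatorname{im}\widehat\phi_{IJ}$ for all $I\subsetneq J$, $y\in V_J\cap\phi_{IJ}(V_I\cap U_{IJ})$; transverse if all $s_I|_{V_I}+\nu_I\pitchfork0$ (on the interior, for cobordisms); precompact if $\pi_{\mathcal K}(\bigsqcup_IZ_I)\subset\pi_{\mathcal K}(\mathcal C)$ for some nested reduction $\mathcal C\sqsubset\mathcal V$, where $Z_I=(s_I|_{V_I}+\nu_I)^{-1}(0)$. $|\mathbf Z^\nu|$ is the quotient of $\bigsqcup_IZ_I$ by the relation generated by $(I,x)\sim(J,\phi_{IJ}(x))$, with quotient topology; its smooth structure is the one for which $Z_I\to|\mathbf Z^\nu|$ are diffeomorphisms onto open subsets. \textbf{Orientations.} For linear $D:V\to W$, $\det D=\Lambda^{\max}\ker D\otimes(\Lambda^{\max}(W/\operatorname{im}D))^*$ and $\mathfrak C_D:\Lambda^{\max}V\otimes(\Lambda^{\max}W)^*\to\det D$ maps $(v_1\wedge\dots\wedge v_n)\otimes(w_1\wedge\dots\wedge w_m)^*\mapsto(v_1\wedge\dots\wedge v_k)\otimes([w_1]\wedge\dots\wedge[w_{m-n+k}])^*$ for bases with $\ker D=\operatorname{span}(v_1,\dots,v_k)$ and $w_{m-n+i}=Dv_i$ for $i>k$. The line bundle $\det(ds_I)\to U_I$ has fibres $\det(d_xs_I)$ and the smooth structure making $\mathfrak C_{ds_I}$ a smooth isomorphism from $\Lambda^{\max}TU_I\otimes(\Lambda^{\max}E_I)^*$.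 An orientation of $\mathcal K$ is a family of nowhere vanishing smooth sections $\sigma_I$ of $\det(ds_I)$ with $\Lambda_{IJ}(x)\sigma_I(x)=\sigma_J(\phi_{IJ}(x))$, where $\Lambda_{IJ}(x):\det(d_xs_I)\to\det(d_{\phi_{IJ}(x)}s_J)$ is induced by the isomorphisms $d\phi_{IJ}$ of kernels and $[\widehat\phi_{IJ}]$ of cokernels. For cobordisms one also requires, near the boundary, $\sigma_I(\iota^\alpha_{U_I}(t,x))=\tilde\iota(t,x)(\sigma^\alpha_I(x))$ where $\tilde\iota(t,x)(\eta\otimes\zeta)=\Lambda_{d\iota^\alpha_{U_I}}(1\wedge\eta)\otimes\zeta$, $1\in\mathbb R=T_tA^\alpha_\varepsilon$; $\partial^\alpha\sigma=(\sigma^\alpha_I)$. The orientation of $|\mathbf Z^\nu|$ in question is $\mathfrak C_{d(s_I+\nu_I)}\circ\mathfrak C_{ds_I}^{-1}\circ\sigma_I$ on $Z_I$, using $\det(d_z(s_I+\nu_I))=\Lambda^{\max}T_zZ_I$. Boundaries of oriented manifolds are oriented by outward normal first; an oriented cobordism from $Z^0$ to $Z^1$ is a compact oriented manifold with boundary $(-Z^0)\sqcup Z^1$. *)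

(* Defs.v *)
Set Warnings "-notation-overridden,-ambiguous-paths,-notation-incompatible-prefix".
From HB Require Import structures.
From Stdlib Require Import Relations.
From mathcomp Require Import all_boot all_order all_algebra.
From mathcomp Require Import all_classical all_reals all_analysis.

Set Implicit Arguments.
Unset Strict Implicit.
Unset Printing Implicit Defensive.

Import Order.TTheory GRing.Theory Num.Theory.
Import numFieldNormedType.Exports.

Local Open Scope classical_set_scope.
Local Open Scope ring_scope.

Definition homeo_onto (S T : topologicalType) (A : set S) (B : set T)
    (f : S -> T) : Prop :=
  [/\ set_bij A B f,
      {within A, continuous f}
    & forall O : set S, open O ->
        exists2 O' : set T, open O' & f @` (A `&` O) = B `&` O'].

Definition open_in (T : topologicalType) (X F : set T) : Prop :=
  exists2 O : set T, open O & F = X `&` O.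

Definition precompact_in (T : topologicalType) (A B : set T) : Prop :=
  compact (closure A) /\ closure A `<=` B.

Section GeneratedQuotient.
Variables (T : topologicalType) (r : T -> T -> Prop).

Let e (x y : T) : bool := `[< clos_refl_sym_trans T r x y >].

Let e_refl : reflexive e.
Proof. by move=> x; apply/asboolP; exact: rst_refl. Qed.

Let e_sym : symmetric e.
Proof. by move=> x y; apply/asboolP/asboolP; exact: rst_sym. Qed.

Let e_trans : transitive e.
Proof.
by move=> y x z /asboolP xy /asboolP yz; apply/asboolP; exact: rst_trans xy yz.
Qed.

Definition gen_equiv : equiv_rel T := EquivRel e e_refl e_sym e_trans.

Definition gen_quot := quotient_topology {eq_quot gen_equiv}%qT.

Definition gen_proj (x : T) : gen_quot := (\pi_gen_quot x)%qT.
End GeneratedQuotient.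

Section Manifolds.
Variable R : realType.

Fixpoint Ck (V W : normedModType R) (k : nat) (O : set V) (f : V -> W) : Prop :=
  match k with
  | 0 => forall x, O x -> {for x, continuous f}
  | k'.+1 => (forall x, O x -> differentiable f x) /\
             (forall v : V, Ck k' O (fun x => 'd f x v))
  end.

Definition smooth_open (V W : normedModType R) (O : set V) (f : V -> W) : Prop :=
  forall k, Ck k O f.

(* A smooth atlas is given by one chart around every point p, with domain
   [cdom p] and coordinate map [cmap p]; every smooth structure is generated by
   such a family. *)
Record charts (n : nat) (T : topologicalType) := Charts {
  cdom : T -> set T;
  cmap : T -> T -> 'rV[R]_n }.

(* These are data only: the manifold axioms are [is_manifold] below. *)
Record mfd := Mfd {
  mcar :> topologicalType;
  mdim : nat;
  mcharts : charts mdim mcar }.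

Definition mdom (M : mfd) : M -> set M := cdom (mcharts M).
Definition mmap (M : mfd) : M -> M -> 'rV[R]_(mdim M) := cmap (mcharts M).

(* The tangent space at p is R^n, read in the chart around p. *)
Definition tangent (M : mfd) (p : M) : vectType R := 'rV[R]_(mdim M).

Definition half_space n : set 'rV[R]_n :=
  [set v | forall i : 'I_n, i = 0%N :> nat -> 0 <= v ord0 i].

(* g is, near p, a smooth extension to an open subset of R^m of the expression
   of h : S -> R^n in the chart around x0. *)
Definition coord_rep (M : mfd) n (x0 : M) (S : set M) (h : M -> 'rV[R]_n)
    (p : M) (O : set 'rV[R]_(mdim M)) (g : 'rV[R]_(mdim M) -> 'rV[R]_n) : Prop :=
  [/\ open O, O (mmap x0 p), smooth_open O g
    & forall q, S q -> mdom x0 q -> O (mmap x0 q) -> g (mmap x0 q) = h q].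

Definition rsmooth_at (M : mfd) n (S : set M) (h : M -> 'rV[R]_n) (p : M) : Prop :=
  exists O g, coord_rep p S h p O g.

(* All differentials below are taken at points of sets S for which the
   differential does not depend on the extension g: relatively open subsets of
   manifolds with boundary, or a half-open interval times a manifold. *)
Definition rdiff (M : mfd) n (S : set M) (h : M -> 'rV[R]_n) (p : M) :
    'Hom(tangent p, 'rV[R]_n) :=
  xget 0 [set L : 'Hom(tangent p, 'rV[R]_n) |
    exists O g, coord_rep p S h p O g /\ forall v, 'd g (mmap p p) v = L v].

Definition smooth_on (M N : mfd) (S : set M) (f : M -> N) : Prop :=
  forall p, S p ->
    (f x @[x --> within S (nbhs p)] --> f p) /\
    rsmooth_at (S `&` f @^-1` mdom (f p)) (mmap (f p) \o f) p.

Definition mdiff (M N : mfd) (S : set M) (f : M -> N) (p : M) :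
    'Hom(tangent p, tangent (f p)) :=
  rdiff (S `&` f @^-1` mdom (f p)) (mmap (f p) \o f) p.

Definition vsmooth_on (M : mfd) (E : vectType R) (S : set M) (s : M -> E) : Prop :=
  forall p, S p -> rsmooth_at S (passmx.rVof (vbasis {:E}) \o s) p.

Definition vdiff (M : mfd) (E : vectType R) (S : set M) (s : M -> E) (p : M) :
    'Hom(tangent p, E) :=
  (linfun (passmx.vecof (vbasis {:E})) \o rdiff S (passmx.rVof (vbasis {:E}) \o s) p)%VF.

Definition is_manifold (M : mfd) : Prop :=
  [/\ hausdorff_space M, @second_countable M
    & forall x : M,
      [/\ open (mdom x), mdom x x,
          homeo_onto (mdom x) (mmap x @` mdom x) (mmap x),
          open (mmap x @` mdom x) \/ open_in (@half_space (mdim M)) (mmap x @` mdom x)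
        & forall y p : M, mdom x p -> mdom y p ->
            exists O g, coord_rep x (mdom x `&` mdom y) (mmap y) p O g]].

Definition mboundary (M : mfd) : set M :=
  [set p | ~ nbhs (mmap p p) (mmap p @` mdom p)].
Arguments mboundary M : clear implicits.

(* At a boundary point p the chart around p takes values in the half space. *)
Definition outward (M : mfd) (p : M) (v : tangent p) : Prop :=
  forall i : 'I_(mdim M), i = 0%N :> nat -> (v : 'rV[R]_(mdim M)) ord0 i < 0.

Definition embedding (M N : mfd) (S : set M) (f : M -> N) : Prop :=
  [/\ smooth_on S f, homeo_onto S (f @` S) f
    & forall p, S p -> lker (mdiff S f p) = 0%VS].

(* The guard covers S empty, where no total g : N -> M need exist. *)
Definition diffeo (M N : mfd) (S : set M) (S' : set N) (f : M -> N) : Prop :=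
  [/\ set_bij S S' f, smooth_on S f
    & S' !=set0 ->
      exists g : N -> M, (forall x, S x -> g (f x) = x) /\ smooth_on S' g].

Definition cylinder (B : mfd) : mfd :=
  @Mfd (R * B)%type (1 + mdim B)
    (Charts (fun p => setT `*` mdom p.2)
            (fun p q => row_mx (const_mx q.1) (mmap p.2 q.2))).

Definition cyl_dt (B : mfd) (p : cylinder B) : tangent p :=
  row_mx (const_mx 1 : 'rV[R]_1) (0 : 'rV[R]_(mdim B)).

Definition cyl_tangent (B : mfd) (p : cylinder B) (v : tangent p.2) : tangent p :=
  row_mx (0 : 'rV[R]_1) (v : 'rV[R]_(mdim B)).

(* An element c of Lambda^max(ker D) (x) (Lambda^max(W / im D))^*, for
   D : V -> W, is encoded by its coordinates: for a basis v of ker D and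
   vectors w representing a basis [w] of W / im D,
     element = c v w . (v_1 /\ .. /\ v_k) (x) ([w_1] /\ .. /\ [w_l])^*.
   For D = 0 this is Lambda^max V (x) (Lambda^max W)^*. *)
Definition detelt (V W : vectType R) : Type :=
  forall k l : nat, k.-tuple V -> l.-tuple W -> R.

Definition coker_basis (V W : vectType R) (D : 'Hom(V, W)) l (w : l.-tuple W) : bool :=
  [&& free w, (limg D + <<w>>)%VS == fullv & (limg D :&: <<w>>)%VS == 0%VS].

Definition is_detelt (V W : vectType R) (D : 'Hom(V, W)) (c : detelt V W) : Prop :=
  forall k l (v v' : k.-tuple V) (w w' : l.-tuple W) (A : 'M[R]_k) (B : 'M[R]_l),
    basis_of (lker D) v -> basis_of (lker D) v' ->
    coker_basis D w -> coker_basis D w' ->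
    (forall i, tnth v' i = \sum_j A i j *: tnth v j) ->
    (forall i, tnth w' i - \sum_j B i j *: tnth w j \in limg D) ->
    \det A * c k l v' w' = \det B * c k l v w.

Definition det_nonzero (V W : vectType R) (D : 'Hom(V, W)) (c : detelt V W) : Prop :=
  forall k l (v : k.-tuple V) (w : l.-tuple W),
    basis_of (lker D) v -> coker_basis D w -> c k l v w != 0.

(* c = C_D(lam), for the contraction isomorphism
   C_D : Lambda^max V (x) (Lambda^max W)^* -> det D. *)
Definition is_contraction (V W : vectType R) (D : 'Hom(V, W))
    (lam c : detelt V W) : Prop :=
  [/\ is_detelt 0 lam, is_detelt D c
    & forall k l r (v1 : k.-tuple V) (v2 : r.-tuple V) (w1 : l.-tuple W),
      basis_of (lker D) v1 ->
      basis_of fullv [tuple of v1 ++ v2] ->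
      basis_of fullv [tuple of w1 ++ map_tuple D v2] ->
      lam (k + r)%N (l + r)%N [tuple of v1 ++ v2] [tuple of w1 ++ map_tuple D v2]
        = c k l v1 w1].

(* A smooth section of Lambda^max TM (x) (Lambda^max E)^*: its coefficient with
   respect to the coordinate frame of a chart and a basis of E is smooth. *)
Definition smooth_top (M : mfd) (E : vectType R)
    (lam : forall p : M, detelt (tangent p) E) : Prop :=
  (forall p, is_detelt 0 (lam p)) /\
  forall (x0 : M) l (w : l.-tuple E), basis_of fullv w ->
    exists2 h : M -> R^o, vsmooth_on (mdom x0) h
      & forall (p : M) (v : (mdim M).-tuple (tangent p)), mdom x0 p ->
          (forall i, rdiff (mdom x0) (mmap x0) p (tnth v i) = delta_mx ord0 i) ->
          lam p (mdim M) l v w = h p.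

(* Lambda^max TM is encoded as Lambda^max TM (x) (Lambda^max 0)^*. *)
Definition is_orientation (M : mfd)
    (o : forall p : M, detelt (tangent p) 'rV[R]_0) : Prop :=
  smooth_top o /\ forall p, det_nonzero 0 (o p).

(* (M, o) is an oriented cobordism from Z false to Z true: a compact oriented
   manifold whose boundary is identified by j with (- Z false) + (Z true), where
   boundaries are oriented by outward normal first. *)
Definition oriented_cobordism (M : mfd) (o : forall p : M, detelt (tangent p) 'rV[R]_0)
    (Z : bool -> mfd) (oZ : forall a (q : Z a), detelt (tangent q) 'rV[R]_0)
    (j : forall a, Z a -> M) : Prop :=
  [/\ is_manifold M /\ compact [set: M], is_orientation o,
      forall a, embedding setT (j a),
      mboundary M = range (j false) `|` range (j true) /\
        range (j false) `&` range (j true) = set0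
    & forall a (q : Z a) k (b : k.-tuple (tangent q)) (v : tangent (j a q)),
        basis_of fullv b -> outward v ->
        0 < (-1) ^+ (~~ a) * oZ a q k 0%N b [tuple] *
            o (j a q) k.+1 0%N
              [tuple of v :: map_tuple (mdiff setT (j a) q) b] [tuple]].

End Manifolds.

Arguments mboundary {R} M.

(* Charts are indexed by all subsets of the labels 0, .., N-1, but only those
   with index in [kidx] below matter; at other indices the data is arbitrary.
   Partially defined maps are total functions of which only the values on the
   domain matter. *)
Record katlas (R : realType) (T : topologicalType) (N : nat) := Katlas {
  kU : {set 'I_N} -> mfd R;
  kE : {set 'I_N} -> vectType R;
  ks : forall I, kU I -> kE I;
  kpsi : forall I, kU I -> T;
  kF1 : 'I_N -> set T;
  kdom : forall I J : {set 'I_N}, set (kU I);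
  kphi : forall I J : {set 'I_N}, kU I -> kU J;
  khat : forall I J : {set 'I_N}, 'Hom(kE I, kE J) }.

Arguments kU {R T N} K I : rename.
Arguments kE {R T N} K I : rename.
Arguments ks {R T N K I} _ : rename.
Arguments kpsi {R T N K I} _ : rename.
Arguments kF1 {R T N} K i : rename.
Arguments kdom {R T N} K I J _ : rename.
Arguments kphi {R T N} K I J _ : rename.
Arguments khat {R T N} K I J : rename.

Section Atlases.
Variable R : realType.

Section Data.
Variables (T : topologicalType) (N : nat).

Variable K : katlas R T N.

Definition kF (I : {set 'I_N}) : set T :=
  [set p | forall i, i \in I -> kF1 K i p].

Definition kidx (I : {set 'I_N}) : Prop := (0 < #|I|)%N /\ kF I !=set0.

Definition kds (I : {set 'I_N}) (x : kU K I) : 'Hom(tangent x, kE K I) :=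
  vdiff setT (@ks R T N K I) x.

(* X is a subspace of the ambient space T. *)
Definition is_chart (X : set T) (I : {set 'I_N}) : Prop :=
  [/\ is_manifold (kU K I) /\ mboundary (kU K I) = set0,
      vsmooth_on setT (@ks R T N K I),
      open_in X (kF I), kF I !=set0
    & homeo_onto [set x | @ks R T N K I x = 0] (kF I) (@kpsi R T N K I)].

Definition index_condition (I J : {set 'I_N}) : Prop :=
  forall u, kdom K I J u ->
    let v := kphi K I J u in
    (mdiff (kdom K I J) (kphi K I J) u @: lker (kds u))%VS = lker (kds v) /\
    forall C : {vspace kE K I},
      (limg (kds u) + C)%VS = fullv -> (limg (kds u) :&: C)%VS = 0%VS ->
      (limg (kds v) + khat K I J @: C)%VS = fullv /\
      (limg (kds v) :&: khat K I J @: C)%VS = 0%VS.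

Definition coord_change (I J : {set 'I_N}) : Prop :=
  [/\ open (kdom K I J) /\
        (forall x, @ks R T N K I x = 0 -> kdom K I J x <-> (kF I `&` kF J) (kpsi x)),
      embedding (kdom K I J) (kphi K I J) /\ lker (khat K I J) = 0%VS,
      forall x, kdom K I J x -> ks (kphi K I J x) = khat K I J (ks x),
      forall x, kdom K I J x -> @ks R T N K I x = 0 -> kpsi (kphi K I J x) = kpsi x
    & index_condition I J].

Definition cocycle : Prop :=
  forall I J L : {set 'I_N}, kidx I -> kidx J -> kidx L ->
    I \proper J -> J \proper L ->
    (khat K J L \o khat K I J)%VF = khat K I L /\
    forall x, kdom K I J x -> kdom K J L (kphi K I J x) ->
      kdom K I L x /\ kphi K J L (kphi K I J x) = kphi K I L x.

Definition conventions : Prop :=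
  forall I, kidx I ->
    [/\ kdom K I I = setT, forall x, kphi K I I x = x, khat K I I = \1%VF
      & forall H, ~ kidx H -> kdom K I H = set0].

(* The basic charts are those with label i such that kF1 i is nonempty (for
   atlases of boundary restrictions, some labels may be unused). *)
Definition is_atlas (X : set T) (d : int) : Prop :=
  [/\ (forall i, open_in X (kF1 K i)) /\ X `<=` \bigcup_i kF1 K i,
      forall I, kidx I ->
        is_chart X I /\ (mdim (kU K I))%:Z - (\dim {:kE K I})%:Z = d,
      forall I J, kidx I -> kidx J -> I \proper J -> coord_change I J,
      cocycle
    & conventions].

Definition additive_atlas : Prop :=
  forall I, kidx I ->
    let sum (e : forall i : 'I_N, kE K [set i]%SET) :=
      \sum_(i in I) khat K [set i]%SET I (e i) in
    (forall w : kE K I, exists e, sum e = w) /\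
    (forall e e', sum e = sum e' -> forall i, i \in I -> e i = e' i).

Definition tame : Prop :=
  [/\ additive_atlas,
      forall I J L, kidx I -> kidx J -> kidx L -> I \subset J -> I \subset L ->
        kdom K I J `&` kdom K I L = kdom K I (J :|: L)%SET
    & forall I J L, kidx I -> kidx J -> kidx L -> I \subset J -> J \subset L ->
        kphi K I J @` kdom K I L =
        kdom K J L `&` [set y | ks y \in limg (khat K I J)]].

Definition kpt : topologicalType := {I : {set 'I_N} & kU K I}.

Definition krel (p q : kpt) : Prop :=
  [/\ kidx (projT1 p), kidx (projT1 q), projT1 p \proper projT1 q,
      kdom K (projT1 p) (projT1 q) (projT2 p)
    & kphi K (projT1 p) (projT1 q) (projT2 p) = projT2 q].

Definition kreal := gen_quot krel.

Definition kpi (I : {set 'I_N}) (x : kU K I) : kreal :=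
  gen_proj krel (existT (fun I => kU K I : Type) I x).

(* The image of X under iota: p in X lies in some kF I, and
   iota p = [I, psi_I^-1 p]. *)
Definition iota_image : set kreal :=
  [set q | exists I (x : kU K I), [/\ kidx I, ks x = 0 & q = kpi x]].

Definition kpi_image (V : forall I, set (kU K I)) : set kreal :=
  [set q | exists I (x : kU K I), [/\ kidx I, V I x & q = kpi x]].

Definition is_reduction (V : forall I, set (kU K I)) : Prop :=
  [/\ forall I, kidx I ->
        [/\ open (V I), precompact_in (V I) setT
          & V I !=set0 -> V I `&` [set x | ks x = 0] !=set0],
      forall I, ~ kidx I -> V I = set0,
      forall I J, kidx I -> kidx J ->
        (@kpi I @` closure (V I)) `&` (@kpi J @` closure (V J)) !=set0 ->
        I \subset J \/ J \subset I
    & iota_image `<=` kpi_image V].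

Definition precompact_red (C V : forall I, set (kU K I)) : Prop :=
  forall I, kidx I -> precompact_in (C I) (V I).

Unset Implicit Arguments.
Variables (V : forall I, set (kU K I)) (nu : forall I, kU K I -> kE K I).
Set Implicit Arguments.

Definition is_perturbation : Prop :=
  (forall I, kidx I -> vsmooth_on (V I) (nu I)) /\
  forall I J, kidx I -> kidx J -> I \proper J ->
    forall x, V I x -> kdom K I J x -> V J (kphi K I J x) ->
      nu J (kphi K I J x) = khat K I J (nu I x).

Definition admissible : Prop :=
  forall I J, kidx I -> kidx J -> I \proper J ->
    forall y, V J y -> (kphi K I J @` (V I `&` kdom K I J)) y ->
      (limg (vdiff (V J) (nu J) y) <= limg (khat K I J))%VS.

Definition kZ (I : {set 'I_N}) : set (kU K I) :=
  [set x | [/\ kidx I, V I x & ks x + nu I x = 0]].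
Arguments kZ I : clear implicits.

Definition kdsnu (I : {set 'I_N}) (x : kU K I) : 'Hom(tangent x, kE K I) :=
  vdiff (V I) (fun y => ks y + nu I y) x.

Definition transverse : Prop :=
  forall I (z : kU K I), kZ I z -> ~ mboundary (kU K I) z -> limg (kdsnu z) = fullv.

Definition zpt : topologicalType := {I : {set 'I_N} & set_type (kZ I)}.

Definition zrel (p q : zpt) : Prop :=
  [/\ projT1 p \proper projT1 q,
      kdom K (projT1 p) (projT1 q) (val (projT2 p))
    & kphi K (projT1 p) (projT1 q) (val (projT2 p)) = val (projT2 q)].

Definition zset := gen_quot zrel.

Definition zproj (I : {set 'I_N}) (z : kZ I) : zset :=
  gen_proj zrel (existT (fun I => set_type (kZ I) : Type) I z).

Definition zincl n I (AI : charts R n (set_type (kZ I))) (z : Mfd AI) : kU K I :=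
  val z.

Definition zquot n (A : charts R n zset) I (AI : charts R n (set_type (kZ I)))
    (z : Mfd AI) : Mfd A :=
  zproj z.

(* A makes |Z| a manifold, and AI makes every Z_I a submanifold of U_I such
   that Z_I -> |Z| is a diffeomorphism onto an open subset. *)
Definition zero_structure n (A : charts R n zset)
    (AI : forall I, charts R n (set_type (kZ I))) : Prop :=
  is_manifold (Mfd A) /\
  forall I,
    [/\ is_manifold (Mfd (AI I)),
        embedding setT (@zincl n I (AI I)),
        open (range (@zquot n A I (AI I)))
      & diffeo setT (range (@zquot n A I (AI I))) (@zquot n A I (AI I))].

Definition ksection : Type :=
  forall I (x : kU K I), detelt (tangent x) (kE K I).

(* o restricts on Z_I to C_{d(s_I + nu_I)} o C_{ds_I}^{-1} o sigma_I, a section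
   of det(d(s_I + nu_I)) = Lambda^max T Z_I; the tangent space of Z_I is
   identified with ker d(s_I + nu_I) by the differential of the inclusion. *)
Definition zero_orientation (sigma : ksection) n (A : charts R n zset)
    (AI : forall I, charts R n (set_type (kZ I)))
    (o : forall q : Mfd A, detelt (tangent q) 'rV[R]_0) : Prop :=
  is_orientation o /\
  forall I (z : Mfd (AI I)), exists lam c,
    [/\ is_contraction (kds (zincl z)) lam (sigma I (zincl z)),
        is_contraction (kdsnu (zincl z)) lam c
      & forall k (v : k.-tuple (tangent z)), basis_of fullv v ->
          o (zquot A z) k 0%N (map_tuple (mdiff setT (@zquot n A I (AI I)) z) v) [tuple]
          = c k 0%N (map_tuple (mdiff setT (@zincl n I (AI I)) z) v) [tuple]].

Definition orientation (sigma : ksection) : Prop :=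
  (forall I, kidx I ->
    [/\ exists2 lam, smooth_top lam
          & forall x, is_contraction (kds x) (lam x) (@sigma I x)
      & forall x, det_nonzero (kds x) (@sigma I x)]) /\
  forall I J, kidx I -> kidx J -> I \proper J ->
    forall x, kdom K I J x ->
      forall k l (v : k.-tuple (tangent x)) (w : l.-tuple (kE K I)),
        basis_of (lker (kds x)) v -> coker_basis (kds x) w ->
        sigma J (kphi K I J x) k l
          (map_tuple (mdiff (kdom K I J) (kphi K I J) x) v)
          (map_tuple (khat K I J) w)
        = sigma I x k l v w.

(* |Z| with the structure (A, AI, o) is an oriented closed d-manifold. *)
Definition oriented_closed_zero_set (d : int) (sigma : ksection) n
    (A : charts R n zset) (AI : forall I, charts R n (set_type (kZ I)))
    (o : forall q : Mfd A, detelt (tangent q) 'rV[R]_0) : Prop :=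
  [/\ [set: zset] !=set0 -> n%:Z = d,
      zero_structure A AI,
      compact [set: zset],
      mboundary (Mfd A) = set0
    & zero_orientation sigma AI o].

End Data.

Arguments kZ {T N K} V nu I.

Definition precompact_pert (T : topologicalType) (N : nat) (K : katlas R T N)
    (V : forall I, set (kU K I)) (nu : forall I, kU K I -> kE K I) : Prop :=
  exists C : forall I, set (kU K I),
    [/\ is_reduction C, precompact_red C V
      & kpi_image (kZ V nu) `<=` kpi_image C].

(* A^0_delta = [0, delta) and A^1_delta = (1 - delta, 1]; the end alpha in
   {0, 1} is encoded as a boolean, coerced to R by %:R. *)
Definition collar_int (a : bool) (delta : R) : set R :=
  if a then [set t | 1 - delta < t <= 1] else [set t | 0 <= t < delta].

Section Cobordisms.
Variables (Y : topologicalType) (N : nat).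

(* The collar maps are only meaningful on A^alpha_eps x bd^alpha. *)
Record collared := Collared {
  cbd : bool -> set Y;
  ccol : bool -> R * Y -> Y;
  ceps : R }.

Variable c : collared.

Definition is_collared : Prop :=
  [/\ 0 < ceps c,
      (forall a, closed (cbd c a)) /\ cbd c false `&` cbd c true = set0,
      forall a y, cbd c a y -> ccol c a (a%:R, y) = y,
      forall a, let D := collar_int a (ceps c) `*` cbd c a in
        homeo_onto D (ccol c a @` D) (ccol c a) /\ open (ccol c a @` D)
    & (ccol c false @` (collar_int false (ceps c) `*` cbd c false)) `&`
      (ccol c true @` (collar_int true (ceps c) `*` cbd c true)) = set0].

Definition collared_subset (F : set Y) : Prop :=
  open F /\
  forall a,
    (exists2 delta, 0 < delta <= ceps c
      & F `&` ccol c a @` (collar_int a delta `*` cbd c a) =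
        ccol c a @` (collar_int a delta `*` (F `&` cbd c a))) /\
    (F `&` cbd c a = set0 ->
     F `&` ccol c a @` (collar_int a (ceps c) `*` cbd c a) = set0).

(* [cobU a I] is the boundary piece of U_I at the end a, a manifold identified
   with a subset of U_I by x |-> [cobcol a I (a, x)]; it is meaningful only for
   I in the index set of the boundary atlas. *)
Record kcob := Kcob {
  cobK : katlas R Y N;
  cobU : bool -> {set 'I_N} -> mfd R;
  cobcol : forall a I, R * cobU a I -> kU cobK I;
  cobphi : forall a (I J : {set 'I_N}), cobU a I -> cobU a J }.

Variable K : kcob.

Definition cobincl a I (x : cobU K a I) : kU (cobK K) I := cobcol (a%:R, x).

Definition bdy_atlas (a : bool) : katlas R Y N :=
  @Katlas R Y N (cobU K a) (kE (cobK K))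
    (fun I x => ks (cobincl x))
    (fun I x => kpsi (cobincl x))
    (fun i => kF1 (cobK K) i `&` cbd c a)
    (fun I J => [set x | kdom (cobK K) I J (cobincl x)])
    (@cobphi K a)
    (khat (cobK K)).

Definition is_bchart (I : {set 'I_N}) : Prop :=
  let U := kU (cobK K) I in
  [/\ [/\ is_manifold U, vsmooth_on setT (@ks R Y N (cobK K) I)
        & homeo_onto [set x | @ks R Y N (cobK K) I x = 0] (kF (cobK K) I)
            (@kpsi R Y N (cobK K) I)],
      collared_subset (kF (cobK K) I) /\ (exists a, kidx (bdy_atlas a) I),
      mboundary U =
        \bigcup_(a in [set a | kidx (bdy_atlas a) I]) range (@cobincl a I),
      (kidx (bdy_atlas false) I -> kidx (bdy_atlas true) I ->
        range (@cobincl false I) `&` range (@cobincl true I) = set0)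
    & forall a, kidx (bdy_atlas a) I ->
      [/\ mdim U = (mdim (cobU K a I)).+1,
          is_chart (bdy_atlas a) (cbd c a) I
        & exists2 eps, 0 < eps <= ceps c
          & let D := collar_int a eps `*` [set: cobU K a I] in
            [/\ open (@cobcol K a I @` D),
                diffeo (M := cylinder (cobU K a I)) D (@cobcol K a I @` D)
                  (@cobcol K a I)
              & forall t x, collar_int a eps t ->
                  ks (cobcol (t, x)) = ks (@cobincl a I x) /\
                  (ks (cobcol (t, x)) = 0 ->
                   kpsi (cobcol (t, x)) =
                     ccol c a (t, kpsi (@cobincl a I x)))]]].

Definition is_ichart (I : {set 'I_N}) : Prop :=
  is_chart (cobK K) setT I /\
  precompact_in (kF (cobK K) I) (~` (cbd c false `|` cbd c true)).

Definition cob_coord_change (I J : {set 'I_N}) : Prop :=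
  coord_change (cobK K) I J /\
  forall a,
    (kidx (bdy_atlas a) J ->
      coord_change (bdy_atlas a) I J /\
      exists2 eps, 0 < eps & forall t, collar_int a eps t ->
        [/\ forall x : cobU K a I, kdom (cobK K) I J (cobcol (t, x)) <->
              kdom (bdy_atlas a) I J x,
            forall x : cobU K a I, kdom (bdy_atlas a) I J x ->
              kphi (cobK K) I J (cobcol (t, x)) = cobcol (t, cobphi J x)
          & forall y : cobU K a J,
              (kphi (cobK K) I J @` kdom (cobK K) I J) (cobcol (t, y)) <->
              (@cobphi K a I J @` kdom (bdy_atlas a) I J) y]) /\
    (kidx (bdy_atlas a) I -> ~ kidx (bdy_atlas a) J ->
      exists2 eps, 0 < eps & forall t (x : cobU K a I), collar_int a eps t ->
        ~ kdom (cobK K) I J (cobcol (t, x))).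

Definition is_cobordism (d : int) : Prop :=
  [/\ is_collared,
      (forall i, open (kF1 (cobK K) i)) /\ [set: Y] `<=` \bigcup_i kF1 (cobK K) i,
      forall I, kidx (cobK K) I ->
        (is_bchart I \/ is_ichart I) /\
        (mdim (kU (cobK K) I))%:Z - (\dim {:kE (cobK K) I})%:Z = d,
      forall I J, kidx (cobK K) I -> kidx (cobK K) J -> I \proper J ->
        cob_coord_change I J
    & [/\ cocycle (cobK K), conventions (cobK K)
        & forall a, conventions (bdy_atlas a)]].

Definition bdy_red (V : forall I, set (kU (cobK K) I)) (a : bool) :
    forall I, set (kU (bdy_atlas a) I) :=
  fun I => [set x | kidx (bdy_atlas a) I /\ V I (cobincl x)].
Arguments bdy_red V a I : clear implicits.

Definition is_cob_reduction (V : forall I, set (kU (cobK K) I)) : Prop :=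
  is_reduction V /\
  forall a I, kidx (bdy_atlas a) I ->
    (exists2 eps, 0 < eps & forall t (x : cobU K a I), collar_int a eps t ->
       V I (cobcol (t, x)) <-> bdy_red V a I x) /\
    (bdy_red V a I !=set0 <->
     V I `&` [set x | ks x = 0 /\ (kF (cobK K) I `&` cbd c a) (kpsi x)] !=set0).

Definition bdy_pert (nu : forall I, kU (cobK K) I -> kE (cobK K) I) (a : bool) :
    forall I, kU (bdy_atlas a) I -> kE (bdy_atlas a) I :=
  fun I x => nu I (cobincl x).
Arguments bdy_pert nu a I : clear implicits.

Definition is_cob_perturbation (V : forall I, set (kU (cobK K) I))
    (nu : forall I, kU (cobK K) I -> kE (cobK K) I) : Prop :=
  is_perturbation V nu /\
  forall a I, kidx (bdy_atlas a) I ->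
    exists2 eps, 0 < eps & forall t (x : cobU K a I), collar_int a eps t ->
      bdy_red V a I x -> nu I (cobcol (t, x)) = nu I (cobincl x).

Definition cob_precompact_pert (V : forall I, set (kU (cobK K) I))
    (nu : forall I, kU (cobK K) I -> kE (cobK K) I) : Prop :=
  exists C : forall I, set (kU (cobK K) I),
    [/\ is_cob_reduction C, precompact_red C V
      & kpi_image (kZ V nu) `<=` kpi_image C].

(* bsigma a is the family (sigma^a_I), determined by sigma through
   sigma_I(iota(t, x)) = (d iota(1) /\ d iota(eta)) (x) zeta
   for sigma^a_I(x) = eta (x) zeta. *)
Definition cob_orientation (sigma : ksection (cobK K))
    (bsigma : forall a, ksection (bdy_atlas a)) : Prop :=
  orientation sigma /\
  forall a I, kidx (bdy_atlas a) I ->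
    (forall x : kU (bdy_atlas a) I, is_detelt (kds x) (bsigma a I x)) /\
    exists2 eps, 0 < eps & forall t (x : kU (bdy_atlas a) I), collar_int a eps t ->
      let q : cylinder (cobU K a I) := (t, x) in
      let dcol := mdiff (M := cylinder (cobU K a I)) (collar_int a eps `*` setT)
                    (@cobcol K a I) q in
      forall k l (v : k.-tuple (tangent x)) (w : l.-tuple (kE (cobK K) I)),
        basis_of (lker (kds x)) v -> coker_basis (kds x) w ->
        sigma I (cobcol (t, x)) k.+1 l
          [tuple of dcol (cyl_dt q) ::
             map_tuple (fun u => dcol (cyl_tangent (p := q) u)) v] w
        = bsigma a I x k l v w.

End Cobordisms.
End Atlases.

Arguments bdy_red {R Y N} c {K} V a I.
Arguments bdy_pert {R Y N} c {K} nu a I.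
Arguments kZ {R T N K} V nu I.

(* Main.v *)
(** Tameness collapses the relation generated by the coordinate changes to a single step:
    points of Z_I and Z_J have the same image in |Z| only if I and J are comparable and one
    point is the image of the other under phi_IJ. Transversality makes every Z_I a submanifold
    of U_I, and the coordinate changes restrict to open embeddings between the Z_I, which have
    equal dimension; so the Z_I glue to |Z|, while precompactness of the perturbation makes |Z|
    compact and Hausdorff. Admissibility says that d nu_J vanishes modulo the image of hat phi_IJ,
    so that the quotients of d s_J and d(s_J + nu_J) by the linearised coordinate change agree and
    the contractions of sigma_I and sigma_J match on overlaps. In a collar all data are products,
    so the section sigma^a is obtained by inserting the collar vector in the first slot of sigma,
    and the sign of an outward vector against the collar vector gives the boundary orientations. *)

From HB Require Import structures.
From Stdlib Require Import Relations.
Require Import Defs.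
From mathcomp Require Import all_boot all_order all_algebra.
From mathcomp Require Import all_classical all_reals all_analysis.
From mathcomp Require Import ring lra zify.

Set Implicit Arguments.
Unset Strict Implicit.
Unset Printing Implicit Defensive.

Import Order.TTheory GRing.Theory Num.Theory.
Import numFieldNormedType.Exports.

Local Open Scope classical_set_scope.
Local Open Scope ring_scope.

(** * Differential calculus in coordinates *)

(** Differentials are obtained by choosing smooth extensions of chart expressions, so they are
    meaningful only where all extensions agree to first order; this governs the treatment of
    boundary points and of half-open collars. Transversality is assumed only in the interior of a
    cobordism. It reaches the boundary because a boundary zero continues into the collar as a
    constant line of zeros: surjectivity holds there and, [s + nu] being constant along the collar,
    passes to the boundary piece. The collar vector itself lies in the kernel of d(s + nu) and is
    transverse to the boundary, so level sets have half-space charts; the transition maps must then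
    be shown open at boundary points too, where the inverse function theorem alone does not suffice.
    Points of |Z| are separated because phi_IJ(U_IJ) equals s_J^{-1}(E_I) by tameness and hence is
    closed in U_J: limits of pairs related by one step are again related. Determinant elements are
    compared by completing bases and tracking block-triangular changes of basis. *)

Section CkTheory.
Variable R : realType.
Implicit Types V W X : normedModType R.

(** The differential is determined by the little-o expansion at [x], which only sees the germ of the
    function there. *)
Lemma diff_near_eq V W (f g : V -> W) x :
  (\near x, f x = g x) -> differentiable f x ->
  differentiable g x /\ 'd g x = 'd f x :> (V -> W).
Proof.
move=> fg df.
have fgx : f x = g x by exact: nbhs_singleton fg.
have /diff_locallyP [dc H] := df.
have G : g \o shift x = cst (g x) + 'd f x +o_ 0 id.
  apply/eqaddoP => _/posnumP[e].
  have /eqaddoP/(_ e%:num) := H.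
  move=> /(_ (gt0 e)) H1.
  have fg' : \forall y \near (0:V), f (y + x) = g (y + x).
    by move: fg; rewrite (near_shift 0 x) /=; apply: filterS => y /=; rewrite subr0.
  near=> y.
  have E : f (y + x) = g (y + x) by near: y.
  have : `|(f \o shift x - (cst (f x) + 'd f x)) y| <= e%:num * `|id y| by near: y.
  by rewrite /= !fctE /= E fgx.
have E := diff_unique dc G.

split; last exact: E.
by apply/diff_locallyP; rewrite E; split; [exact: dc|exact: G].
Unshelve. all: by end_near. Qed.

Lemma Ck_sub V W k (O O' : set V) (f : V -> W) : O' `<=` O -> Ck k O f -> Ck k O' f.
Proof.
move=> OO; elim: k f => [|k IH] f /=; first by move=> H x /OO; apply: H.
by move=> [H1 H2]; split=> [x /OO|v]; [apply: H1|apply: IH].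
Qed.

Lemma Ck_cont V W k (O : set V) (f : V -> W) x : Ck k O f -> O x -> {for x, continuous f}.
Proof.
case: k => [|k] /=; first by apply.
by move=> [H _] /H; apply: differentiable_continuous.
Qed.

Lemma CkW V W k (O : set V) (f : V -> W) : Ck k.+1 O f -> Ck k O f.
Proof.
elim: k f => [|k IH] f.
  by move=> H x; apply: Ck_cont H.
by move=> [H1 H2]; split => // v; apply: IH.
Qed.

(** Needed because [Ck] recurses through ['d]: the sum, product, chain and inverse rules express the
    differential by a formula valid only on [O], and this congruence carries regularity from the
    formula back to ['d]. *)
Lemma Ck_eq V W k (O : set V) (f g : V -> W) :
  open O -> (forall x, O x -> f x = g x) -> Ck k O f -> Ck k O g.
Proof.
move=> oO; have nO x : O x -> nbhs x O by move=> Ox; apply: open_nbhs_nbhs.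
elim: k f g => [|k IH] f g fg.
  move=> H x Ox; rewrite /prop_for /continuous_at -(fg _ Ox).
  apply: cvg_trans (H x Ox); apply: near_eq_cvg; apply: filterS (nO x Ox) => y Oy.
  by rewrite fg.
move=> [H1 H2]; have D x (Ox : O x) := diff_near_eq (filterS fg (nO x Ox)) (H1 x Ox).
split=> [x /D[]//|v].
by apply: IH (H2 v) => x /D[_ ->].
Qed.

Lemma Ck_cst V W k (O : set V) (a : W) : Ck k O (cst a).
Proof.
elim: k a => [|k IH] a; first by move=> x _; apply: cst_continuous.
split=> [x _|v]; first exact: differentiable_cst.
by rewrite (_ : (fun x => _) = cst 0) // funeqE => x; rewrite diff_cst.
Qed.

Lemma Ck_lin_comp V W X k (O : set V) (L : {linear W -> X}) (f : V -> W) :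
  open O -> continuous L -> Ck k O f -> Ck k O (L \o f).
Proof.
move=> oO cL; elim: k f => [|k IH] f.
  by move=> H x Ox; apply: continuous_comp; [exact: H|exact: cL].
have dL y : differentiable L y by apply: linear_differentiable.
move=> [H1 H2]; split=> [x Ox|v].
  by apply: differentiable_comp; [exact: H1|exact: dL].
apply: (@Ck_eq _ _ _ _ (L \o (fun x => 'd f x v))) => //; last exact: (IH _ (H2 v)).
move=> x Ox /=; rewrite (diff_comp (H1 _ Ox) (dL _)).
by rewrite diff_lin.
Qed.

Lemma Ck_linear V W k (O : set V) (L : {linear V -> W}) :
  continuous L -> Ck k O L.
Proof.
move=> cL; case: k => [|k]; first by move=> x _; apply: cL.
split=> [x _|v]; first exact: linear_differentiable.
rewrite (_ : (fun x => _) = cst (L v)); first exact: Ck_cst.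
by rewrite funeqE => x; rewrite diff_lin.
Qed.

Lemma Ck_add V W k (O : set V) (f g : V -> W) :
  open O -> Ck k O f -> Ck k O g -> Ck k O (fun x => f x + g x).
Proof.
move=> oO; elim: k f g => [|k IH] f g.
  by move=> H1 H2 x Ox; apply: continuousD; [exact: H1|exact: H2].
move=> [F1 F2] [G1 G2]; split=> [x Ox|v].
  by apply: (@differentiableD _ _ _ f g); [exact: F1|exact: G1].
apply: (@Ck_eq _ _ _ _ (fun x => 'd f x v + 'd g x v)) => //; last exact: (IH _ _ (F2 v) (G2 v)).
move=> x Ox; rewrite -[fun y => f y + g y]/(f + g).
by rewrite (@diffD _ _ _ f g); [|exact: F1|exact: G1].
Qed.

Lemma Ck_sum V W k (O : set V) (I : finType) (P : pred I) (f : I -> V -> W) :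
  open O -> (forall i, P i -> Ck k O (f i)) ->
  Ck k O (fun x => \sum_(i | P i) f i x).
Proof.
move=> oO H; rewrite (_ : (fun x => _) = \sum_(i | P i) f i); last first.
  by apply/funext => x; rewrite fct_sumE.
elim/big_rec : _ => [|i g Pi IH]; first exact: Ck_cst.
by apply: Ck_add => //; apply: H.
Qed.

Lemma Ck_mul V k (O : set V) (f g : V -> R) :
  open O -> Ck k O f -> Ck k O g -> Ck k O (fun x => f x * g x).
Proof.
move=> oO; elim: k f g => [|k IH] f g.
  by move=> H1 H2 x Ox; apply: continuousM; [exact: H1|exact: H2].
move=> Ff Gg; have [F1 F2] := Ff; have [G1 G2] := Gg; split=> [x Ox|v].
  by apply: (@differentiableM _ _ f g); [exact: F1|exact: G1].
apply: (@Ck_eq _ _ _ _ (fun x => f x * 'd g x v + g x * 'd f x v)) => //.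
  move=> x Ox; rewrite -[fun y => f y * g y]/(f * g).
  by rewrite (@diffM _ _ f g); [|exact: F1|exact: G1].
by apply: Ck_add => //; [apply: IH (CkW Ff) (G2 v)|apply: IH (CkW Gg) (F2 v)].
Qed.

Lemma Ck_prod V k (O : set V) (I : finType) (P : pred I) (f : I -> V -> R) :
  open O -> (forall i, P i -> Ck k O (f i)) ->
  Ck k O (fun x => \prod_(i | P i) f i x).
Proof.
move=> oO H; rewrite (_ : (fun x => _) = \prod_(i | P i) f i); last first.
  by apply/funext => x; rewrite fct_prodE.
elim/big_rec : _ => [|i g Pi IH]; first exact: Ck_cst.
by apply: Ck_mul => //; apply: H.
Qed.

Lemma Ck_inv V k (O : set V) (f : V -> R) :
  open O -> (forall x, O x -> f x != 0) -> Ck k O f -> Ck k O (fun x => (f x)^-1).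
Proof.
move=> oO f0; elim: k => [|k IH].
  by move=> H x Ox; apply: continuousV; [exact: f0|exact: H].
move=> Ff; have [F1 F2] := Ff; split=> [x Ox|v].
  by apply: (@differentiableV _ _ f); [exact: F1|exact: f0].
have I := IH (CkW Ff).
apply: (@Ck_eq _ _ _ _ (fun x => (-1) * (((f x)^-1 * (f x)^-1) * 'd f x v))) => //.
  move=> x Ox; rewrite (@diffV _ _ f); [|exact: F1|exact: f0].
  rewrite /= -[RHS]/(- (f x) ^- 2 * 'd f x v).
  by rewrite mulN1r mulNr expr2 invfM.
by apply: Ck_mul => //; [exact: Ck_cst|apply: Ck_mul (F2 v) => //; apply: Ck_mul].
Qed.

Definition coordl m n i j (M : 'M[R]_(m, n)) : R := M i j.
Lemma coordl_linear m n i j : linear (@coordl m n i j).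
Proof. by move=> a x y; rewrite /coordl !mxE. Qed.
HB.instance Definition _ m n i j :=
  GRing.isLinear.Build _ _ _ _ _ (@coordl_linear m n i j).

Definition scalel V (v : V) (a : R) : V := a *: v.
Lemma scalel_linear V v : linear (@scalel V v).
Proof. by move=> a x y; rewrite /scalel scalerDl scalerA. Qed.
HB.instance Definition _ V (v : V) :=
  GRing.isLinear.Build _ _ _ _ _ (@scalel_linear V v).

Lemma Ck_coord V m n k (O : set V) (f : V -> 'M[R]_(m, n)) i j :
  open O -> Ck k O f -> Ck k O (fun x => f x i j).
Proof.
by move=> oO; apply: (@Ck_lin_comp _ _ _ _ _ (@coordl m n i j)) => //; exact: coord_continuous.
Qed.

Lemma Ck_mx V m n k (O : set V) (f : V -> 'M[R]_(m, n)) :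
  open O -> (forall i j, Ck k O (fun x => f x i j)) -> Ck k O f.
Proof.
move=> oO H.
rewrite (_ : f = fun x => \sum_i \sum_j f x i j *: delta_mx i j); last first.
  by apply/funext => x; exact: matrix_sum_delta.
apply: Ck_sum => // i _; apply: Ck_sum => // j _.
by apply: (@Ck_lin_comp _ _ _ _ _ (scalel (delta_mx i j))) => //; exact: scalel_continuous.
Qed.

(** The inner map lands in row vectors so that the chain rule can be expanded over [delta_mx]: a
    directional derivative of the composite is a sum of products, and the induction hypothesis
    applies to the partial derivatives of [g]. *)
Lemma Ck_comp V m k (O : set V) (O' : set 'rV[R]_m) (f : V -> 'rV[R]_m) (g : 'rV[R]_m -> R) :
  open O -> open O' -> (forall x, O x -> O' (f x)) ->
  Ck k O f -> Ck k O' g -> Ck k O (g \o f).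
Proof.
move=> oO oO' fO; elim: k g => [|k IH] g.
  by move=> H1 H2 x Ox; apply: continuous_comp; [exact: H1|exact: H2 (fO _ Ox)].
move=> Ff [G1 G2]; have [F1 F2] := Ff; split=> [x Ox|v].
  by apply: differentiable_comp; [exact: F1|exact: G1 (fO _ Ox)].
apply: (@Ck_eq _ _ _ _ (fun x => \sum_i ('d f x v) ord0 i * 'd g (f x) (delta_mx ord0 i))) => //.
  move=> x Ox; rewrite (diff_comp (F1 _ Ox) (G1 _ (fO _ Ox))).
  rewrite /= {2}['d f x v]row_sum_delta linear_sum.
  by apply: eq_bigr => i _; rewrite linearZ.
apply: Ck_sum => // i _; apply: Ck_mul => //; first exact: (Ck_coord _ _ oO (F2 v)).
exact: (IH (fun y => 'd g y (delta_mx ord0 i)) (CkW Ff) (G2 _)).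
Qed.

Lemma smooth_comp V m n p (O : set V) (O' : set 'rV[R]_m) (f : V -> 'rV[R]_m)
    (g : 'rV[R]_m -> 'M[R]_(n, p)) :
  open O -> open O' -> (forall x, O x -> O' (f x)) ->
  smooth_open O f -> smooth_open O' g -> smooth_open O (g \o f).
Proof.
move=> oO oO' fO F G k; apply: Ck_mx => // i j.
by apply: (@Ck_comp _ _ _ _ O' f (fun y => g y i j)) => //; apply: Ck_coord.
Qed.

Lemma Ck_det V n k (O : set V) (f : V -> 'M[R]_n) :
  open O -> (forall i j, Ck k O (fun x => f x i j)) -> Ck k O (fun x => \det (f x)).
Proof.
move=> oO H; apply: Ck_sum => // s _; apply: Ck_mul => //; first exact: Ck_cst.
by apply: Ck_prod.
Qed.

(** Cramer's rule: the entries of the inverse are cofactors divided by the determinant. *)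
Lemma Ck_invmx V n k (O : set V) (f : V -> 'M[R]_n) i j :
  open O -> (forall x, O x -> f x \in unitmx) ->
  (forall i j, Ck k O (fun x => f x i j)) -> Ck k O (fun x => invmx (f x) i j).
Proof.
move=> oO u H.
apply: (@Ck_eq _ _ _ _ (fun x => (\det (f x))^-1 * cofactor (f x) j i)) => //.
  by move=> x Ox; rewrite /invmx u // !mxE.
apply: Ck_mul => //.
  apply: Ck_inv => //; last exact: Ck_det.
  by move=> x /u; rewrite unitmxE unitfE.
apply: Ck_mul => //; first exact: Ck_cst.
apply: Ck_det => // i' j'.
by under eq_fun do rewrite !mxE.
Qed.

Lemma Ck_id V k (O : set V) : Ck k O (fun x => x).
Proof. by apply: (@Ck_linear _ _ _ _ idfun) => x. Qed.

Lemma Ck_mulmxr V m n p k (O : set V) (f : V -> 'M[R]_(m, n)) (B : 'M[R]_(n, p)) :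
  open O -> Ck k O f -> Ck k O (fun x => f x *m B).
Proof.
move=> oO F; apply: Ck_mx => // i j; under eq_fun do rewrite mxE.
apply: Ck_sum => // l _; apply: Ck_mul => //; last exact: Ck_cst.
exact: Ck_coord.
Qed.

Lemma mulmxr_continuous m n p (B : 'M[R]_(n, p)) :
  continuous (fun x : 'M[R]_(m, n) => x *m B).
Proof.
move=> x; exact: (@Ck_cont _ _ 0%N setT (fun y => y *m B) x (Ck_mulmxr B openT (@Ck_id _ 0 setT)) I).
Qed.

Lemma diff_mulmxr m n p (B : 'M[R]_(n, p)) (x v : 'M[R]_(m, n)) :
  'd (fun x : 'M[R]_(m, n) => x *m B) x v = v *m B.
Proof.
by rewrite -[fun x => _]/(mulmxr B : _ -> _) diff_lin //; exact: mulmxr_continuous.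
Qed.

End CkTheory.

(* Locked: comparing differentials at two points by unfolding is prohibitive. *)
HB.lock Definition jac (R : realType) p q (f : 'rV[R]_p -> 'rV[R]_q) (x : 'rV[R]_p) :
    'M[R]_(p, q) :=
  \matrix_(i, j) 'd f x (delta_mx ord0 i) ord0 j.

(** * The inverse function theorem *)

Section InverseFunction.
Variable R : realType.

Lemma mx_norm_ge m n (M : 'M[R]_(m, n)) i j : `|M i j| <= `|M|.
Proof.
rewrite [leRHS]/Num.norm /= mx_normrE.
exact: (le_bigmax _ (fun ij => `|M ij.1 ij.2|) (i, j)).
Qed.

Lemma mx_norm_le m n (M : 'M[R]_(m, n)) (e : R) : 0 <= e ->
  (forall i j, `|M i j| <= e) -> `|M| <= e.
Proof.
move=> e0 H; rewrite [leLHS]/Num.norm /= mx_normrE; apply/bigmax_leP; by split=> // ij _; exact: H.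
Qed.

Lemma mulmxr_bound n p (B : 'M[R]_(n, p)) :
  exists2 k : R, 0 < k & forall m (y : 'M[R]_(m, n)), `|y *m B| <= k * `|y|.
Proof.
exists (1 + \sum_i \sum_j `|B i j|).
  by rewrite ltr_pwDl // sumr_ge0 // => i _; rewrite sumr_ge0.
move=> m y; apply: mx_norm_le => [|i j].
  by rewrite mulr_ge0 // addr_ge0 // sumr_ge0 // => i _; rewrite sumr_ge0.
rewrite mxE (le_trans (ler_norm_sum _ _ _)) //.
rewrite mulrDl mul1r -[leLHS]add0r lerD // mulr_suml ler_sum // => l _.
rewrite normrM mulrC ler_pM //; last exact: mx_norm_ge.
by rewrite (bigD1 j) //= lerDl sumr_ge0.
Qed.

Lemma norm_rV_sum n (y : 'rV[R]_n) (a : 'I_n -> R) (e : R) : 0 <= e ->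
  (forall i, `|a i| <= e) -> `|\sum_i y ord0 i * a i| <= n%:R * e * `|y|.
Proof.
move=> e0 H; rewrite (le_trans (ler_norm_sum _ _ _)) //.
rewrite (@le_trans _ _ (\sum_(i < n) e * `|y|)) //.
  by apply: ler_sum => i _; rewrite normrM mulrC ler_pM // mx_norm_ge.
by rewrite sumr_const card_ord -[_ *+ n]mulr_natl mulrA.
Qed.

Lemma jac_coord p q (f : 'rV[R]_p -> 'rV[R]_q) x i j :
  jac f x i j = 'd f x (delta_mx ord0 i) ord0 j.
Proof. by rewrite jac.unlock mxE. Qed.

Lemma jacE p q (f : 'rV[R]_p -> 'rV[R]_q) x v : 'd f x v = v *m jac f x.
Proof.
rewrite {1}[v]row_sum_delta linear_sum /=; apply/matrixP => i j; rewrite (ord1 i).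
rewrite summxE mxE; apply: eq_bigr => l _; by rewrite linearZ /= mxE jac_coord.
Qed.

Lemma diff_coordE p q (f : 'rV[R]_p -> 'rV[R]_q) x v j :
  'd f x v ord0 j = \sum_i v ord0 i * 'd f x (delta_mx ord0 i) ord0 j.
Proof. by rewrite jacE mxE; apply: eq_bigr => i _; rewrite jac_coord. Qed.

Lemma diff_coordB_le p q (f : 'rV[R]_p -> 'rV[R]_q) a b v j (e : R) : 0 <= e ->
  (forall i, `|'d f a (delta_mx ord0 i) ord0 j - 'd f b (delta_mx ord0 i) ord0 j| <= e) ->
  `|'d f a v ord0 j - 'd f b v ord0 j| <= p%:R * e * `|v|.
Proof.
move=> e0.
have K (A B : R) (F G : 'I_p -> R) : A = \sum_i v ord0 i * F i -> B = \sum_i v ord0 i * G i ->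
   (forall i, `|F i - G i| <= e) -> `|A - B| <= p%:R * e * `|v|.
  move=> -> -> H; rewrite -sumrB; under eq_bigr do rewrite -mulrBr.
  exact: norm_rV_sum.
exact: K (diff_coordE f a v j) (diff_coordE f b v j).
Qed.

Lemma lipschitz_continuous_at (V W : normedModType R) (g : V -> W) w A (k : R) :
  0 < k -> nbhs w A -> (forall w', A w' -> `|g w - g w'| <= k * `|w - w'|) ->
  {for w, continuous g}.
Proof.
move=> k0 nA lip; apply/cvgrPdist_le => e e0.
near=> w'; have Aw' : A w' by near: w'.
rewrite (le_trans (lip _ Aw')) // -ler_pdivlMl //; near: w'.
by apply: cvgr_dist_le; [exact: cvg_id|rewrite mulr_gt0 // invr_gt0].
Unshelve. all: by end_near. Qed.

Lemma differentiable_est (V W : normedModType R) (g : V -> W) w (L : {linear V -> W}) :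
  continuous L ->
  (forall e : R, 0 < e -> exists2 d : R, 0 < d & forall h, `|h| < d ->
    `|g (h + w) - g w - L h| <= e * `|h|) ->
  differentiable g w /\ 'd g w = L :> (V -> W).
Proof.
move=> cL est.
have H : g \o shift w = cst (g w) + L +o_ 0 id.
  apply/eqaddoP => e e0; have [d d0 Hd] := est e e0.
  near=> h; have hd : `|h| < d by near: h; exact: nbhs0_lt.
  by have := Hd h hd; rewrite /= !fctE /= opprD addrA.
have E := diff_unique cL H.
split; last exact: E.
by apply/diff_locallyP; rewrite E; split; [exact: cL|exact: H].
Unshelve. all: by end_near. Qed.

Lemma diff_line (V W : normedModType R) (f : V -> W) (y v : V) (t : R) :
  differentiable f (y + t *: v) ->
  differentiable (fun s : R => f (y + s *: v)) t /\
  forall h : R, 'd (fun s : R => f (y + s *: v)) t h = 'd f (y + t *: v) (h *: v).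
Proof.
move=> D.
have cv : continuous (scalel v : R -> V) by exact: scalel_continuous.
have D1 : differentiable (cst y : R -> V) t by exact: differentiable_cst.
have D2 : differentiable (scalel v : R -> V) t by exact: linear_differentiable.
have D3 := differentiableD D1 D2.
have E h : 'd (cst y + (scalel v : R -> V)) t h = h *: v.
  by rewrite (diffD D1 D2) /= diff_cst (diff_lin t cv) /= add0r.
have D' : differentiable f ((cst y + (scalel v : R -> V)) t) by exact: D.
have D4 := differentiable_comp D3 D'.
have -> : (fun s : R => f (y + s *: v)) = f \o (cst y + (scalel v : R -> V)) by [].
split; first exact: D4.
move=> h; rewrite (diff_comp D3 D') /=.
by rewrite E.
Qed.

(** Each coordinate of [f] along the segment from [y] to [x] obeys the mean value theorem, so the
    error is controlled by the oscillation of the partial derivatives near [x0], which is small by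
    continuity. *)
Lemma strict_diff p q (O : set 'rV[R]_p) (f : 'rV[R]_p -> 'rV[R]_q) x0 (e : R) :
  open O -> O x0 -> Ck 1 O f -> 0 < e ->
  exists2 r : R, 0 < r & ball x0 r `<=` O /\
    forall x y, ball x0 r x -> ball x0 r y ->
      `|f x - f y - 'd f x0 (x - y)| <= e * `|x - y|.
Proof.
move=> oO Ox0 [F1 F2] e0.
(* The errors of [p] partial derivatives add up, and [p * e'] is at most [e]; the added 1 covers
   [p = 0]. *)
have e1 : 0 < e / (p%:R + 1) by rewrite divr_gt0 // ltr_wpDl.
set e' := e / (p%:R + 1) in e1.
have nb (i : 'I_p) (j : 'I_q) : \forall x \near x0,
    `|'d f x (delta_mx ord0 i) ord0 j - 'd f x0 (delta_mx ord0 i) ord0 j| <= e'.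
  have C : {for x0, continuous (fun x => 'd f x (delta_mx ord0 i) ord0 j)}.
    apply: (@continuous_comp _ _ _ (fun x => 'd f x (delta_mx ord0 i)) (fun M => M ord0 j)).
      exact: (F2 (delta_mx ord0 i)).
    exact: coord_continuous.
  exact: (@cvgr_distC_le _ _ _ _ _ _ _ C _ e1).
have : \forall x \near x0, O x /\ forall i j,
    `|'d f x (delta_mx ord0 i) ord0 j - 'd f x0 (delta_mx ord0 i) ord0 j| <= e'.
  apply: filterI; first exact: open_nbhs_nbhs.
  apply: filterS (@filter_forall _ _ (fun i => [set x | forall j : 'I_q,
    `|'d f x (delta_mx ord0 i) ord0 j - 'd f x0 (delta_mx ord0 i) ord0 j| <= e']) (nbhs x0) _ _) => [x|i]; first by [].
  by apply: (@filter_forall _ _ (fun j => [set x | `|'d f x (delta_mx ord0 i) ord0 j - 'd f x0 (delta_mx ord0 i) ord0 j| <= e'])) => j; exact: nb.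
move=> /nbhs_ballP[r /= r0 H]; exists r => //; split=> [x /H[]//|x y bx by_].
apply: mx_norm_le => [|i j]; first by rewrite mulr_ge0 // ltW.
rewrite (ord1 i) {i}.
pose c (t : R) := y + t *: (x - y).
have bc t : t \in `[0, 1] -> ball x0 r (c t).
  rewrite in_itv /= => /andP[t0 t1].
  move: bx by_; rewrite -!ball_normE /= => bx by_.
  have -> : x0 - c t = t *: (x0 - x) + (1 - t) *: (x0 - y).
    by apply/matrixP => a b; rewrite !mxE; ring.
  rewrite (le_lt_trans (ler_normD _ _)) // !normrZ !ger0_norm ?subr_ge0 //.
  have [->|t0'] := eqVneq t 0; first by rewrite mul0r add0r subr0 mul1r.
  have {}t0' : 0 < t by rewrite lt_def t0'.
  rewrite [ltRHS](_ : r = t * r + (1 - t) * r); last by ring.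
  by rewrite ltr_leD // ?ltr_pM2l // ler_wpM2l ?subr_ge0 // ltW.
pose g (t : R) := f (c t) ord0 j.
pose dg (t : R) := 'd f (c t) (x - y) ord0 j.
have dgP (t : R) : t \in `[0, 1] -> is_derive t 1 g (dg t).
  move=> /bc/H[/F1 D _].
  have [Df E] := diff_line D.
  have DC M : differentiable (@coordl R 1 q ord0 j) M by exact: differentiable_coord.
  have Dj := @differentiable_comp _ _ _ _ _ (@coordl R 1 q ord0 j) _ Df (DC _).
  have -> : g = (coordl ord0 j \o (fun s : R => f (y + s *: (x - y)))) by [].
  apply: DeriveDef; first exact: diff_derivable Dj.
  rewrite (deriveE _ Dj) (diff_comp Df (DC _)) /= E.
  by rewrite (@diff_lin _ _ _ (coordl ord0 j) _ (@coord_continuous _ _ _ ord0 j)) scale1r.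
have cg : {within `[0, 1], continuous g}.
  apply: continuous_in_subspaceT => t /set_mem h.
  have [D _] := dgP t h.
  by apply: differentiable_continuous; apply/derivable1_diffP.
have [z z01] := @MVT_segment R g dg 0 1 ler01 (fun t h => dgP t (subset_itv_oo_cc h)) cg.
have c1 : c 1 = x by rewrite /c scale1r addrC subrK.
have c0 : c 0 = y by rewrite /c scale0r addr0.
rewrite subr0 mulr1 /dg /g c1 c0 => E; rewrite !mxE E.
have [_ /(_ _ j) Hz] := H _ (bc _ z01).
apply: le_trans (@diff_coordB_le _ _ f (c z) x0 (x - y) j e' (ltW e1) Hz) _.
rewrite ler_wpM2r // /e' mulrCA ler_piMr ?ltW //.
by rewrite ltr_pdivrMr ?ltr_wpDl // mul1r ltrDl.
Qed.

Section Square.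
Variables (n : nat) (O : set 'rV[R]_n) (f : 'rV[R]_n -> 'rV[R]_n).
Hypotheses (oO : open O) (sf : smooth_open O f).

Lemma jac_Ck i j k : Ck k O (fun x => jac f x i j).
Proof.
have [_ H] := sf k.+1.
rewrite (_ : (fun x => _) = fun x => 'd f x (delta_mx ord0 i) ord0 j); last first.
  by apply/funext => x; rewrite jac_coord.
by apply: Ck_coord => //; exact: (H (delta_mx ord0 i)).
Qed.

(** The Newton map [T w x = x + (w - f x) A^-1], with [A] the Jacobian at [x0], contracts by 1/2
    near [x0], and its fixed points solve [f x = w]. Contraction gives the lower Lipschitz bound.
    When [w] is close to [f x0], [T w] also maps a closed ball into itself, where a fixed point is
    found by compactness. *)
Lemma local_inverse x0 : O x0 -> jac f x0 \in unitmx ->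
  exists r k : R, [/\ 0 < r, 0 < k, ball x0 r `<=` O,
    forall x y, ball x0 r x -> ball x0 r y -> `|x - y| <= k * `|f x - f y|
  & forall s w, 0 < s < r -> `|w - f x0| * k <= s ->
      exists2 x, `|x - x0| <= s & f x = w].
Proof.
move=> Ox0 uJ; set A := jac f x0; set B := invmx A.
have [k k0 kB] := mulmxr_bound B.
(* With [k] bounding multiplication by [A^-1], an error of this size in the strict differential
   yields the contraction factor 1/2. *)
have e0 : 0 < (2 * k)^-1 by rewrite invr_gt0 mulr_gt0.
have [r r0 [rO H]] := strict_diff oO Ox0 (sf 1) e0.
pose T w x := x + (w - f x) *m B.
have TT w x y : ball x0 r x -> ball x0 r y -> `|T w x - T w y| <= 2^-1 * `|x - y|.
  move=> bx by_.
  have -> : T w x - T w y = - ((f x - f y - (x - y) *m A) *m B).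
    rewrite mulmxBl mulmxK // /T mulmxBl -[w - f y]opprB mulNmx !mulmxBl.
    by apply/matrixP => a b; rewrite !mxE; ring.
  rewrite normrN (le_trans (kB _ _)) // -jacE.
  rewrite (le_trans (ler_wpM2l (ltW k0) (H _ _ bx by_))) //.
  by rewrite mulrA invfM mulrCA mulfV ?gt_eqF // mulr1.
exists r, (2 * k); split=> // [|x y bx by_|s w /andP[s0 sr] ws].
  by rewrite mulr_gt0.
  have : `|x - y| <= 2^-1 * `|x - y| + k * `|f x - f y|.
    have E : x - y = (T 0 x - T 0 y) + (f x - f y) *m B.
      rewrite /T !sub0r !mulNmx mulmxBl.
      by apply/matrixP => a b; rewrite !mxE; ring.
    rewrite {1}E (le_trans (ler_normD _ _)) // lerD //; first exact: TT.
  have := normr_ge0 (x - y); have := normr_ge0 (f x - f y); lra.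
pose D := [set x : 'rV[R]_n | `|x - x0| <= s].
have DB x : D x -> ball x0 r x.
  by rewrite /D -ball_normE /= distrC => h; exact: le_lt_trans h sr.
have DT x : D x -> D (T w x).
  rewrite /D /= => Dx.
  have -> : T w x - x0 = (T w x - T w x0) + (w - f x0) *m B.
    by rewrite /T; apply/matrixP => a b; rewrite !mxE; ring.
  rewrite (le_trans (ler_normD _ _)) //.
  have h1 := TT w x x0 (DB x Dx) (ballxx _ r0).
  have h2 := kB _ (w - f x0).
  move: h1 h2 ws Dx; set a := `|_|; set b := `|_ *m B|; set c := `|w - f x0|.
  set d := `|x - x0|; lra.
have cD : compact D.
  apply: bounded_closed_compact.
    exists (`|x0| + s); split; first exact: num_real.
    move=> M sM x; rewrite /D /= => Dx.
    rewrite -[x](subrK x0) (le_trans (ler_normD _ _)) //.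
    by apply: ltW; apply: le_lt_trans sM; rewrite addrC lerD2l.
  rewrite (_ : D = closed_ball x0 s); first exact: closed_ball_closed.
  by rewrite closed_ballE //; apply/seteqP; split=> x; rewrite /D /closed_ball_ /= distrC.
have cf x : D x -> {for x, continuous f}.
  by move=> /DB/rO Ox; apply: Ck_cont (sf 0) Ox.
have cT x : D x -> {for x, continuous (fun x => `|T w x - x|)}.
  move=> Dx; apply: continuous_comp; last exact: norm_continuous.
  have -> : (fun y => T w y - y) = (fun y => (w - f y) *m B).
    by apply/funext => y; rewrite /T addrAC subrr add0r.
  apply: (@continuous_comp _ _ _ (fun y => w - f y) (fun z => z *m B)); last exact: mulmxr_continuous.
  by apply: continuousB; [exact: cst_continuous|exact: cf].
have Dx0 : D x0 by rewrite /D /= subrr normr0 ltW.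
have cTD : {within D, continuous (fun x => `|T w x - x|)}.
  by apply: continuous_in_subspaceT => x /set_mem; exact: cT.
(* The displacement [|T w x - x|] attains its minimum on the compact ball. Applying [T w] at least
   halves it, so the minimum is 0. *)
have [c /set_mem Dc Hc] := EVT_min_rV (ex_intro _ x0 Dx0) cD cTD.
exists c; first exact: Dc.
have Tc : T w c = c.
  apply/eqP; rewrite -subr_eq0 -normr_eq0; apply/eqP.
  have := Hc (T w c) (mem_set (DT _ Dc)).
  have := TT w _ _ (DB _ (DT _ Dc)) (DB _ Dc).
  have := normr_ge0 (T w c - c); lra.
have : (w - f c) *m B = 0 by rewrite -[LHS](addKr c) -/(T w c) Tc addNr.
move=> /(congr1 (mulmx^~ A)); rewrite mulmxKV // mul0mx => /eqP.
by rewrite subr_eq0 => /eqP.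
Qed.

End Square.

Lemma eqdim p q (A : 'M[R]_(p, q)) (B : 'M[R]_(q, p)) :
  A *m B = 1%:M -> B *m A = 1%:M -> p = q.
Proof. by move=> /mulmx1_min h1 /mulmx1_min h2; apply/eqP; rewrite eqn_leq h1 h2. Qed.

(** Stated with two dimensions [p] and [q] and a two-sided inverse [B], because in the applications
    the dimensions are only propositionally equal; the equality is derived here so that users need
    no casts. *)
Theorem inverse_function p q (O : set 'rV[R]_p) (f : 'rV[R]_p -> 'rV[R]_q) x0
    (B : 'M[R]_(q, p)) :
  open O -> O x0 -> smooth_open O f ->
  jac f x0 *m B = 1%:M -> B *m jac f x0 = 1%:M ->
  exists (U : set 'rV[R]_p) (g : 'rV[R]_q -> 'rV[R]_p),
    [/\ open U, U x0 /\ U `<=` O, open (f @` U), smooth_open (f @` U) g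
      & forall x, U x -> g (f x) = x].
Proof.
move=> oO Ox0 sf AB BA; have E := eqdim AB BA.
move: f sf B AB BA; rewrite -{q}E => f sf B AB _.
have uJ : jac f x0 \in unitmx by have [] := mulmx1_unit AB.
have [r [k [r0 k0 rO inj _]]] := local_inverse oO sf Ox0 uJ.
pose O1 := [set x | O x /\ jac f x \in unitmx].
have oO1 : open O1.
  rewrite openE => x [Ox Jx]; apply: filterI; first exact: open_nbhs_nbhs.
  have C : {for x, continuous (fun x => \det (jac f x))}.
    apply: (@Ck_cont _ _ _ 0%N O) => //; apply: Ck_det => // i j; exact: jac_Ck.
  have : \forall y \near \det (jac f x), y != 0.
    by apply: open_nbhs_nbhs; split; [exact: open_neq|rewrite -unitfE -unitmxE].
  move=> /C; rewrite nbhs_simpl /= /nbhs_filter /=; apply: filterS => y /=.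
  by rewrite unitmxE unitfE.
pose U := ball x0 r `&` O1.
have oU : open U by apply: openI => //; exact: ball_open.
have UO x : U x -> O x by case=> _ [].
pose g w := xget x0 [set x | U x /\ f x = w].
have gP x : U x -> g (f x) = x.
  move=> Ux; rewrite /g; case: xgetP => [y _ [Uy fy]|/(_ x)]; last by case.
  apply/eqP; rewrite -subr_eq0 -normr_le0.
  by rewrite (le_trans (inj _ _ Uy.1 Ux.1)) // fy subrr normr0 mulr0.
have oW : open (f @` U).
  rewrite openE => _ [x Ux <-].
  have [r1 [k1 [r10 k10 _ _ sur]]] := local_inverse oO sf (UO _ Ux) Ux.2.2.
  have /nbhs_ballP[r2 /= r20 r2U] : nbhs x U by exact: open_nbhs_nbhs.
  pose s := Num.min r1 r2 / 2.
  have m0 : 0 < Num.min r1 r2 by rewrite lt_min r10.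
  have s0 : 0 < s by rewrite divr_gt0.
  have sm : s < Num.min r1 r2 by rewrite /s ltr_pdivrMr // ltr_pMr // ltr1n.
  have [sr1 sr2] : s < r1 /\ s < r2 by apply/andP; rewrite -lt_min.
  apply/nbhs_ballP; exists (s / k1) => /=; first by rewrite divr_gt0.
  move=> w; rewrite -ball_normE /= distrC => wb.
  have [||y yx <-] := sur s w; first by rewrite s0.
    by rewrite -ler_pdivlMr // ltW.
  exists y; last by [].
  apply: r2U; rewrite -ball_normE /= distrC.
  exact: le_lt_trans yx sr2.
have gU w : (f @` U) w -> U (g w) /\ f (g w) = w by move=> [x Ux <-]; rewrite gP.
have lip w w' : (f @` U) w -> (f @` U) w' -> `|g w - g w'| <= k * `|w - w'|.
  move=> /gU[Uw fw] /gU[Uw' fw']; rewrite -{2}fw -{2}fw'; exact: inj Uw.1 Uw'.1.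
have cg w : (f @` U) w -> {for w, continuous g}.
  move=> Ww; apply: (lipschitz_continuous_at k0 (open_nbhs_nbhs (conj oW Ww))) => w' Ww'.
  exact: lip.
have dg w : (f @` U) w -> differentiable g w /\
    forall v, 'd g w v = v *m invmx (jac f (g w)).
  move=> Ww; have [Ug fg] := gU w Ww; set J := jac f (g w); have uJ' : J \in unitmx := Ug.2.2.
  have cL : continuous (mulmxr (invmx J) : 'rV[R]_p -> 'rV[R]_p) by exact: mulmxr_continuous.
  suff [D E] : differentiable g w /\ 'd g w = mulmxr (invmx J) :> ('rV[R]_p -> 'rV[R]_p).
    by split; [exact: D|move=> v; rewrite E].
  apply: differentiable_est cL _ => e e0.
    have [k' k'0 kJ] := mulmxr_bound (invmx J).
    (* The strict-differential error is multiplied by at most [k'] through [invmx J], and the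
       displacement of [g] is at most [k] times that of its argument; the three factors multiply to
       [e]. *)
    have ee0 : 0 < e / (k' * k) by rewrite divr_gt0 // mulr_gt0.
    have [s s0 [sO Hs]] := strict_diff oO (UO _ Ug) (sf 1%N) ee0.
    have /nbhs_ballP[d0 /= d00 d0W] : nbhs w (f @` U) by exact: open_nbhs_nbhs.
    exists (Num.min d0 (s / k)); first by rewrite lt_min d00 divr_gt0.
    move=> h; rewrite lt_min => /andP[hd hs].
    have Wh : (f @` U) (h + w).
      by apply: d0W; rewrite -ball_normE /= opprD addrCA subrr addr0 normrN.
    have gb : ball (g w) s (g (h + w)).
      rewrite -ball_normE /= (le_lt_trans (lip _ _ Ww Wh)) //.
      by rewrite opprD addrCA subrr addr0 normrN mulrC -ltr_pdivlMr.
    have [Uh fh] := gU _ Wh.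
    have -> : g (h + w) - g w - mulmxr (invmx J) h =
        - ((f (g (h + w)) - f (g w) - 'd f (g w) (g (h + w) - g w)) *m invmx J).
      rewrite /= fh fg addrK jacE mulmxBl mulmxK //.
      by apply/matrixP => a b; rewrite !mxE; ring.
    rewrite normrN (le_trans (kJ _ _)) //.
    have := Hs _ _ gb (ballxx _ s0) => /(ler_wpM2l (ltW k'0))/le_trans; apply.
    have := lip _ _ Wh Ww; rewrite addrK => hl.
    rewrite mulrA -[leRHS](_ : k' * (e / (k' * k)) * (k * `|h|) = _); last first.
      by field; rewrite !gt_eqF.
    by rewrite ler_wpM2l // mulr_ge0 // ltW.
exists U, g; split=> //; first by split=> //; split; [exact: ballxx|].
(* Bootstrapping: the differential of [g] at [w] is the inverse Jacobian of [f] at [g w], so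
   regularity of order [m] of [g] gives order [m + 1]. *)
elim=> [|m IH]; first exact: cg.
split=> [w /dg[]//|v].
apply: (@Ck_eq _ _ _ _ _ (fun w => v *m invmx (jac f (g w)))) => //.
  by move=> w /dg[].
apply: Ck_mx => // i j; under eq_fun do rewrite mxE.
apply: Ck_sum => // l _; apply: Ck_mul => //; first exact: Ck_cst.
have gO1 w : (f @` U) w -> O1 (g w) by move=> /gU[] [].
have H : Ck m O1 (fun y => invmx (jac f y) l j).
  apply: Ck_invmx; [exact: oO1|by move=> x []|move=> a b].
  by apply: Ck_sub (jac_Ck oO sf a b m) => x [].
exact: (Ck_comp oW oO1 gO1 IH H).
Qed.

End InverseFunction.

(** * Jacobian matrices and sets that determine them *)

Section Jacobians.
Variable R : realType.

Lemma smooth_diff p q (O : set 'rV[R]_p) (f : 'rV[R]_p -> 'rV[R]_q) x :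
  smooth_open O f -> O x -> differentiable f x.
Proof. by move=> sf Ox; have [H _] := sf 1%N; exact: H. Qed.

Lemma smooth_cont p q (O : set 'rV[R]_p) (f : 'rV[R]_p -> 'rV[R]_q) x :
  smooth_open O f -> O x -> {for x, continuous f}.
Proof. by move=> sf Ox; exact: Ck_cont (sf 0%N) Ox. Qed.

Lemma smooth_sub p q (O O' : set 'rV[R]_p) (f : 'rV[R]_p -> 'rV[R]_q) :
  O' `<=` O -> smooth_open O f -> smooth_open O' f.
Proof. by move=> OO sf k; exact: Ck_sub OO (sf k). Qed.

Lemma open_preim p q (O : set 'rV[R]_p) (O' : set 'rV[R]_q) (f : 'rV[R]_p -> 'rV[R]_q) :
  open O -> open O' -> smooth_open O f -> open (O `&` f @^-1` O').
Proof.
move=> oO oO' sf; rewrite openE => x [Ox O'fx].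
apply: filterI; first exact: open_nbhs_nbhs.
by apply: (smooth_cont sf Ox); exact: open_nbhs_nbhs.
Qed.

Lemma jac_comp p q r (f : 'rV[R]_p -> 'rV[R]_q) (g : 'rV[R]_q -> 'rV[R]_r) x :
  differentiable f x -> differentiable g (f x) ->
  jac (g \o f) x = jac f x *m jac g (f x).
Proof.
move=> df dg; apply/row_matrixP => i; rewrite !rowE -jacE (diff_comp df dg) /=.
by rewrite !jacE mulmxA.
Qed.

Lemma jac_near_eq p q (f g : 'rV[R]_p -> 'rV[R]_q) x :
  (\near x, f x = g x) -> differentiable f x -> jac g x = jac f x.
Proof.
move=> fg df; have [_ E] := diff_near_eq fg df.
apply/matrixP => i j; rewrite !jac_coord.
have := congr1 (fun F : 'rV[R]_p -> 'rV[R]_q => F (delta_mx ord0 i) ord0 j) E.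
by apply.
Qed.

Lemma jac_eq p q O (f g : 'rV[R]_p -> 'rV[R]_q) x :
  open O -> O x -> (forall y, O y -> f y = g y) -> smooth_open O f ->
  jac g x = jac f x.
Proof.
move=> oO Ox fg sf; apply: jac_near_eq; last exact: smooth_diff sf Ox.
by apply: filterS fg _; exact: open_nbhs_nbhs.
Qed.

Lemma jac_mulmxr p q (B : 'M[R]_(p, q)) x : jac (fun y => y *m B) x = B.
Proof. by apply/row_matrixP => i; rewrite !rowE -jacE diff_mulmxr. Qed.

Lemma smooth_mulmxr p q (O : set 'rV[R]_p) (B : 'M[R]_(p, q)) :
  open O -> smooth_open O (fun y => y *m B).
Proof. by move=> oO k; apply: Ck_mulmxr oO (Ck_id _ _). Qed.

Lemma jac_id p x : jac (fun y : 'rV[R]_p => y) x = 1%:M.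
Proof. by rewrite -(jac_mulmxr 1%:M x); congr jac; apply/funext => y; rewrite mulmx1. Qed.

Lemma smooth_id p (O : set 'rV[R]_p) : smooth_open O (fun y => y).
Proof. by move=> k; exact: Ck_id. Qed.

Lemma smooth_row_mx p q r (O : set 'rV[R]_p) (f : 'rV[R]_p -> 'rV[R]_q)
    (g : 'rV[R]_p -> 'rV[R]_r) : open O ->
  smooth_open O f -> smooth_open O g -> smooth_open O (fun x => row_mx (f x) (g x)).
Proof.
move=> oO sf sg k; apply: Ck_mx => // i j.
case: (split_ordP j) => j' ->.
  by under eq_fun do rewrite row_mxEl; apply: Ck_coord oO (sf k).
by under eq_fun do rewrite row_mxEr; apply: Ck_coord oO (sg k).
Qed.

Lemma jac_row_mx p q r (O : set 'rV[R]_p) (f : 'rV[R]_p -> 'rV[R]_q)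
    (g : 'rV[R]_p -> 'rV[R]_r) x : open O -> O x ->
  smooth_open O f -> smooth_open O g ->
  jac (fun x => row_mx (f x) (g x)) x = row_mx (jac f x) (jac g x).
Proof.
move=> oO Ox sf sg; set h := fun x => _.
have dh := smooth_diff (smooth_row_mx oO sf sg) Ox.
have E1 : jac f x = jac h x *m col_mx 1%:M 0.
  rewrite -[X in _ *m X](jac_mulmxr _ (h x)) -jac_comp //; last first.
    exact: (smooth_diff (smooth_mulmxr _ openT)).
  by congr jac; apply/funext => y /=; rewrite mul_row_col mulmx1 mulmx0 addr0.
have E2 : jac g x = jac h x *m col_mx 0 1%:M.
  rewrite -[X in _ *m X](jac_mulmxr _ (h x)) -jac_comp //; last first.
    exact: (smooth_diff (smooth_mulmxr _ openT)).
  by congr jac; apply/funext => y /=; rewrite mul_row_col mulmx1 mulmx0 add0r.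
rewrite E1 E2 -mul_mx_row -[LHS]mulmx1; congr (_ *m _).
by rewrite scalar_mx_block block_mxEh.
Qed.

Lemma smooth_jac p q (O : set 'rV[R]_p) (f : 'rV[R]_p -> 'rV[R]_q) i j k :
  open O -> smooth_open O f -> Ck k O (fun x => jac f x i j).
Proof.
move=> oO sf; have [_ H] := sf k.+1.
rewrite (_ : (fun x => _) = fun x => 'd f x (delta_mx ord0 i) ord0 j); last first.
  by apply/funext => x; rewrite jac_coord.
by apply: Ck_coord => //; exact: (H (delta_mx ord0 i)).
Qed.

Lemma jac_dir p q (f : 'rV[R]_p -> 'rV[R]_q) x v (e : R) : differentiable f x -> 0 < e ->
  exists2 d : R, 0 < d & forall t : R, 0 < t < d ->
    `|f (x + t *: v) - f x - t *: (v *m jac f x)| <= e * t.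
Proof.
move=> df e0.
have /diff_locallyP [_ /eqaddoP H] := df.
have e1 : 0 < e / (`|v| + 1) by rewrite divr_gt0 // ltr_wpDl.
have /nbhs_ballP[d /= d0 Hd] := H _ e1.
exists (d / (`|v| + 1)); first by rewrite divr_gt0 // ltr_wpDl.
move=> t /andP[t0 td].
have nt : `|t *: v| <= t * (`|v| + 1).
  by rewrite normrZ (ger0_norm (ltW t0)) (ler_wpM2l (ltW t0)) // lerDl.
have B : ball (0 : 'rV[R]_p) d (t *: v).
  rewrite -ball_normE /= sub0r normrN (le_lt_trans nt) //.
  by rewrite -ltr_pdivlMr // ltr_wpDl.
have := Hd _ B; rewrite /= !fctE /= [t *: v + x]addrC opprD addrA.
rewrite [in X in X -> _]jacE -scalemxAl => /le_trans; apply.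
by rewrite -mulrA ler_pM2l // ler_pdivrMl ?ltr_wpDl // mulrC.
Qed.

(* [A] determines differentials at [a]: it meets every initial segment of enough rays. *)
Definition thick n (A : set 'rV[R]_n) (a : 'rV[R]_n) : Prop :=
  A a /\ exists2 B : 'M[R]_n, B \in unitmx &
    forall i (e : R), 0 < e -> exists2 t : R, 0 < t < e & A (a + t *: row i B).

(** Difference quotients along the rays spanned by the rows of [B] can be taken inside [A]; since
    these rows form a basis, the corresponding directional derivatives determine the Jacobian. *)
Lemma thick_jac p q (A : set 'rV[R]_p) (f g : 'rV[R]_p -> 'rV[R]_q) a :
  thick A a -> differentiable f a -> differentiable g a ->
  (forall x, A x -> f x = g x) -> jac f a = jac g a.
Proof.
move=> [Aa [B uB HB]] df dg fg.
suff E : B *m jac f a = B *m jac g a.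
  by rewrite -[LHS](mulKmx uB) E mulKmx.
apply/row_matrixP => i; rewrite !row_mul.
apply/eqP; rewrite -subr_eq0 -normr_le0; apply/ler_addgt0Pl => e e0; rewrite addr0.
have e20 : 0 < e / 2 by rewrite divr_gt0.
have [d1 d10 H1] := jac_dir (row i B) df e20.
have [d2 d20 H2] := jac_dir (row i B) dg e20.
have [|t /andP[t0 td] At] := HB i (Num.min d1 d2); first by rewrite lt_min d10.
move: td; rewrite lt_min => /andP[td1 td2].
have h1 := H1 t; rewrite t0 td1 in h1; have {}h1 := h1 isT.
have h2 := H2 t; rewrite t0 td2 in h2; have {}h2 := h2 isT.
rewrite (fg _ At) (fg _ Aa) in h1.
rewrite -(ler_pM2l t0) -{1}(ger0_norm (ltW t0)) -normrZ scalerBr.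
set u := t *: (row i B *m jac f a) in h1 *; set w := t *: (row i B *m jac g a) in h2 *.
set z := g (a + t *: row i B) - g a in h1 h2.
rewrite -(subrKA z u (- w)) (le_trans (ler_normD _ _)) // distrC.
by rewrite (le_trans (lerD h1 h2)) // -mulrDl -splitr mulrC.
Qed.

Lemma thick_sub n (A B : set 'rV[R]_n) a O : thick A a -> nbhs a O ->
  A `&` O `<=` B -> thick B a.
Proof.
move=> [Aa [M uM HM]] nO AB; split.
  by apply: AB; split=> //; exact: nbhs_singleton nO.
exists M => // i e e0.
have /nbhs_ballP[r /= r0 rO] := nO.
have n0 : 0 < `|row i M| + 1 by rewrite ltr_wpDl.
have [|t /andP[t0 td] At] := HM i (Num.min e (r / (`|row i M| + 1))).
  by rewrite lt_min e0 divr_gt0.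
move: td; rewrite lt_min => /andP[te tr]; exists t; first by rewrite t0.
apply: AB; split=> //; apply: rO; rewrite -ball_normE /= opprD addrA subrr sub0r normrN.
rewrite normrZ ger0_norm ?ltW //; apply: le_lt_trans (_ : _ <= t * (`|row i M| + 1)) _.
  by rewrite ler_wpM2l ?ltW // ltrDl.
by rewrite -ltr_pdivlMr.
Qed.

Lemma thick_half n a : @half_space R n a -> thick (@half_space R n) a.
Proof.
move=> Ha; split=> //; exists 1%:M; first exact: unitmx1.
move=> i e e0; exists (e / 2); first by rewrite divr_gt0 //= ltr_pdivrMr // ltr_pMr // ltr1n.
move=> j j0; by rewrite !mxE addr_ge0 ?Ha // mulr_ge0 ?ler0n // divr_ge0 // ltW.
Qed.

Lemma thickT n a : thick (setT : set 'rV[R]_n) a.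
Proof.
split=> //; exists 1%:M; first exact: unitmx1.
move=> i e e0; exists (e / 2) => //.
by rewrite divr_gt0 //= ltr_pdivrMr // ltr_pMr // ltr1n.
Qed.

End Jacobians.

Lemma cvg_withinP (S T : topologicalType) (A : set S) (f : S -> T) (p : S) (l : T) :
  (f x @[x --> within A (nbhs p)] --> l) <->
  forall W, nbhs l W -> nbhs p [set q | A q -> W (f q)].
Proof. by []. Qed.

Lemma within_contP (S T : topologicalType) (A : set S) (f : S -> T) :
  {within A, continuous f} <->
  forall p, A p -> f x @[x --> within A (nbhs p)] --> f p.
Proof.
split; first by move=> /subspace_continuousP H p Ap; exact: H.
by move=> H; apply/subspace_continuousP => p Ap; exact: H.
Qed.

(** Replaces the setwise openness clause by a condition at each point; the open set of the original
    form is recovered as the union of all suitable neighbourhoods. *)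
Lemma homeo_ontoP (S T : topologicalType) (A : set S) (B : set T) (f : S -> T) :
  homeo_onto A B f <->
  [/\ set_bij A B f, forall p, A p -> f x @[x --> within A (nbhs p)] --> f p
    & forall p W, A p -> nbhs p W ->
        exists N, [/\ open N, N (f p) & forall q, A q -> N (f q) -> W q]].
Proof.
split=> [[bij cf op]|[bij cf op]].
  split=> //; first by apply/within_contP.
  move=> p W Ap; rewrite nbhsE => -[W' [oW' W'p] W'W].
  have [N oN E] := op W' oW'; exists N; split=> //.
    have : (f @` (A `&` W')) (f p) by exists p.
    by rewrite E => -[].
  move=> q Aq Nq; apply: W'W.
  have : (f @` (A `&` W')) (f q).
    by rewrite E; split=> //; have [fAB _ _] := bij; exact: fAB.
  move=> [q' [Aq' W'q'] fqq']; have [_ inj _] := bij.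
  by rewrite -(inj q' q) ?inE.
split=> //; first exact/within_contP.
move=> W oW; exists (\bigcup_(N in [set N | open N /\ forall q, A q -> N (f q) -> W q]) N).
  by apply: bigcup_open => N [].
have [fAB inj sur] := bij.
apply/seteqP; split=> y.
  move=> [x [Ax Wx] <-]; split; first exact: fAB.
  by have [N [oN Nx H]] := op x W Ax (open_nbhs_nbhs (conj oW Wx)); exists N.
move=> [By [N [oN H] Ny]]; have [x Ax fx] := sur _ By; exists x => //; split=> //.
by apply: H => //; rewrite fx.
Qed.

(** * Maps between manifolds with boundary *)

Section Germs.
Variable R : realType.
Implicit Types M N L : mfd R.

(** Weakens [is_manifold] to what the calculus needs: chart images are thick at their points instead
    of open in a half space. Cylinders satisfy this although their coordinates need not be
    half-space coordinates. *)
Definition charted M : Prop := forall x : M,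
  [/\ open (mdom x), mdom x x,
      homeo_onto (mdom x) (mmap x @` mdom x) (mmap x),
      forall p, mdom x p -> thick (mmap x @` mdom x) (mmap x p)
    & forall y p : M, mdom x p -> mdom y p ->
        exists Q g, coord_rep x (mdom x `&` mdom y) (mmap y) p Q g].

Lemma manifold_charted M : is_manifold M -> charted M.
Proof.
move=> [_ _ H] x; have [oD Dx hm im tr] := H x; split=> //.
move=> p Dp; case: im => [oI|[Q oO E]].
  apply: (thick_sub (thickT _) (open_nbhs_nbhs (conj oI _))); first by exists p.
  by move=> y [].
have [Hp Qp] : (@half_space R (mdim M) `&` Q) (mmap x p) by rewrite -E; exists p.
rewrite E; apply: (thick_sub (thick_half Hp) (open_nbhs_nbhs (conj oO Qp))).
by [].
Qed.

Section SingleManifold.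
Variables (M : mfd R) (cM : charted M).

Lemma mdom_refl (x : M) : mdom x x.
Proof. by have [] := cM x. Qed.

Lemma mdom_open (x : M) : open (mdom x).
Proof. by have [] := cM x. Qed.

Lemma mdom_nbhs (x p : M) : mdom x p -> nbhs p (mdom x).
Proof. by move=> Dp; apply: open_nbhs_nbhs; split=> //; exact: mdom_open. Qed.

Lemma mmap_inj (x p q : M) : mdom x p -> mdom x q -> mmap x p = mmap x q -> p = q.
Proof.
move=> Dp Dq; have [_ _ [[_ inj _] _ _] _ _] := cM x.
by apply: inj; rewrite inE.
Qed.

Lemma mmap_cont (x p : M) : mdom x p -> {for p, continuous (mmap x)}.
Proof.
move=> Dp; have [_ _ /homeo_ontoP[_ H _] _ _] := cM x.
have := H p Dp; rewrite /prop_for /continuous_at => C.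
apply: cvg_trans C => P /=; rewrite /within /= !nbhs_simpl /= => H1.
near=> q; suff : mdom x q -> P (mmap x q) by apply; near: q; exact: mdom_nbhs.
by near: q.
Unshelve. all: by end_near. Qed.

Lemma chart_nbhs (x p : M) W : mdom x p -> nbhs p W ->
  exists Q, [/\ open Q, Q (mmap x p) & forall q, mdom x q -> Q (mmap x q) -> W q].
Proof. by move=> Dp nW; have [_ _ /homeo_ontoP[_ _ H] _ _] := cM x; exact: H. Qed.

Definition thickS (S : set M) (x p : M) := thick (mmap x @` (S `&` mdom x)) (mmap x p).

Lemma thickS_sub (S S' : set M) (x p : M) W : mdom x p -> thickS S x p -> nbhs p W ->
  S `&` W `<=` S' -> thickS S' x p.
Proof.
move=> Dp tS nW SW; have [Q [oO Qp QW]] := chart_nbhs Dp nW.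
apply: (thick_sub tS (open_nbhs_nbhs (conj oO Qp))) => _ [[q [Sq Dq] <-] Qq].
by exists q => //; split=> //; apply: SW; split=> //; exact: QW.
Qed.

Lemma thickS_mem (S : set M) (x p : M) : mdom x p -> thickS S x p -> S p.
Proof.
by move=> Dp [[q [Sq Dq] E] _]; rewrite -(mmap_inj Dq Dp E).
Qed.

Lemma thickST (x p : M) : mdom x p -> thickS setT x p.
Proof. by move=> Dp; rewrite /thickS setTI; have [_ _ _ H _] := cM x; exact: H. Qed.

Lemma thickS_nbhs (x p : M) W : mdom x p -> nbhs p W -> thickS W x p.
Proof. by move=> Dp nW; apply: thickS_sub (thickST Dp) nW _ => // q []. Qed.

Section CoordRep.
Variable n : nat.
Implicit Types (h : M -> 'rV[R]_n) (S : set M).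

Lemma crep_sub x S S' h p Q g : S' `<=` S -> coord_rep x S h p Q g ->
  coord_rep x S' h p Q g.
Proof. by move=> SS [oO Qp sg H]; split=> // q /SS; exact: H. Qed.

Lemma crep_shrink x S h p Q g Q' : open Q' -> Q' (mmap x p) -> coord_rep x S h p Q g ->
  coord_rep x S h p (Q `&` Q') g.
Proof.
move=> oO' Q'p [oO Qp sg H]; split=> //; first exact: openI.
  by apply: smooth_sub sg => y [].
by move=> q Sq Dq [Qq _]; exact: H.
Qed.

Lemma crep_eq x S h h' p Q g : (forall q, S q -> mdom x q -> h q = h' q) ->
  coord_rep x S h p Q g -> coord_rep x S h' p Q g.
Proof. by move=> hh [oO Qp sg H]; split=> // q Sq Dq Qq; rewrite H // hh. Qed.

Lemma crep_local x S S' h p Q g W : mdom x p -> nbhs p W -> S `&` W `<=` S' ->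
  coord_rep x S' h p Q g ->
  exists Q', [/\ Q' `<=` Q, coord_rep x S h p Q' g &
    forall q, mdom x q -> Q' (mmap x q) -> W q].
Proof.
move=> Dp nW SW cr; have [Q1 [oO1 Q1p Q1W]] := chart_nbhs Dp nW.
exists (Q `&` Q1); split; first by move=> y [].
  have [oO Qp sg H] := crep_shrink oO1 Q1p cr; split=> // q Sq Dq [Qq Q1q].
  by apply: H => //; apply: SW; split=> //; exact: Q1W.
by move=> q Dq [_ Q1q]; exact: Q1W.
Qed.

(** Precomposition with the transition map turns an extension in the chart around [y] into one in
    the chart around [x], so smoothness at [p] may be tested in any chart containing [p]. *)
Lemma crep_chart x y S h p Q g : mdom x p -> mdom y p -> coord_rep y S h p Q g ->
  exists Q' g', coord_rep x S h p Q' g'.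
Proof.
move=> Dx Dy [oO Qp sg H].
have [_ _ _ _ tr] := cM x; have [Q1 [k [oO1 Q1p sk Hk]]] := tr y p Dx Dy.
have E := Hk p (conj Dx Dy) Dx Q1p.
have cr : coord_rep x (S `&` mdom y) h p (Q1 `&` k @^-1` Q) (g \o k).
  split; first exact: open_preim.
    by split=> //=; rewrite E.
    have oP := open_preim oO1 oO sk.
    by apply: smooth_comp oP oO _ (smooth_sub _ sk) sg => z [].
    move=> q [Sq yq] xq [Q1q]; rewrite /= (Hk q (conj xq yq)) // => Qq; exact: H.
have [Q' [_ cr' _]] := crep_local Dx (mdom_nbhs Dy) (@subset_refl _ _) cr.
by exists Q', (g \o k).
Qed.

(** [rdiff] chooses one linear map among those given by extensions. On a thick set all extensions
    have the same Jacobian at the point, so any representative computes it. *)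
Lemma rdiffP S h p Q g : thickS S p p -> coord_rep p S h p Q g ->
  forall v, rdiff S h p v = v *m jac g (mmap p p).
Proof.
move=> tS cr v; rewrite /rdiff; case: xgetP => [L _ [Q' [g' [cr' E]]]|/(_ (linfun (mulmxr (jac g (mmap p p))))) []].
  rewrite -E jacE; congr (_ *m _).
  have [oO Qp sg H] := cr; have [oO' Qp' sg' H'] := cr'.
  have nO : nbhs (mmap p p) (Q `&` Q') by apply: open_nbhs_nbhs; split; [exact: openI|].
  apply: (@thick_jac _ _ _ (mmap p @` (S `&` mdom p) `&` (Q `&` Q'))).
    by apply: thick_sub tS nO _.
    exact: smooth_diff sg' Qp'.
    exact: smooth_diff sg Qp.
    by move=> _ [[q [Sq Dq] <-] [Qq Q'q]]; rewrite H // H'.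
by exists Q, g; split=> // w; rewrite jacE lfunE.
Qed.

(** Both sides are computed by one extension, that of [h'], restricted to a coordinate neighbourhood
    whose points lie in [W]. *)
Lemma rdiff_ext S S' h h' p : thickS S p p -> thickS S' p p ->
  (exists2 W, nbhs p W & forall q, W q -> S q -> S' q /\ h q = h' q) ->
  rsmooth_at S' h' p -> rdiff S h p = rdiff S' h' p.
Proof.
move=> tS tS' [W nW HW] [Q [g cr]].
have [Q' [sO [oO' Q'p sg H] Q'W]] := crep_local (S := S `&` W) (mdom_refl p) nW
  (fun q (Hq : ((S `&` W) `&` W) q) => (HW q Hq.2 Hq.1.1).1) cr.
have cr1 : coord_rep p S h p Q' g.
  split=> // q Sq Dq Qq; have Wq := Q'W q Dq Qq.
  by rewrite H //; have [_ ->] := HW q Wq Sq.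
apply/lfunP => v; rewrite (rdiffP tS cr1) (rdiffP tS' cr) //.
Qed.

End CoordRep.
End SingleManifold.

Lemma rsmooth_sub M n (S S' : set M) (h : M -> 'rV[R]_n) p :
  S' `<=` S -> rsmooth_at S h p -> rsmooth_at S' h p.
Proof. by move=> SS [Q [g cr]]; exists Q, g; exact: crep_sub cr. Qed.

Lemma rsmooth_local M n (S S' : set M) (h h' : M -> 'rV[R]_n) p : charted M ->
  (exists2 W, nbhs p W & forall q, W q -> S q -> S' q /\ h q = h' q) ->
  rsmooth_at S' h' p -> rsmooth_at S h p.
Proof.
move=> cM [W nW HW] [Q [g cr]].
have [Q' [sO [oO' Q'p sg H] Q'W]] := crep_local cM (S := S `&` W) (mdom_refl cM p) nW
  (fun q (Hq : ((S `&` W) `&` W) q) => (HW q Hq.2 Hq.1.1).1) cr.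
exists Q', g; split=> // q Sq Dq Qq; have Wq := Q'W q Dq Qq.
by rewrite H //; have [_ ->] := HW q Wq Sq.
Qed.

Lemma crep_comp M N n (S : set M) (S' : set N) (f : M -> N) (h : N -> 'rV[R]_n)
    x y p Q g Q' g' :
  S p -> mdom x p -> (forall q, S q -> mdom x q -> S' (f q) /\ mdom y (f q)) ->
  coord_rep x S (mmap y \o f) p Q g -> coord_rep y S' h (f p) Q' g' ->
  coord_rep x S (h \o f) p (Q `&` g @^-1` Q') (g' \o g).
Proof.
move=> Sp Dp Sf [oO Qp sg H] [oO' Q'p sg' H'].
have E := H p Sp Dp Qp.
split; first exact: open_preim.
  by split=> //=; rewrite E.
  by apply: smooth_comp (open_preim oO oO' sg) oO' _ (smooth_sub _ sg) sg' => z [].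
  move=> q Sq Dq [Qq]; rewrite /= H // => Q'q.
  by have [S'q yq] := Sf q Sq Dq; exact: H'.
Qed.

(** Pointwise form of [smooth_on]: the latter is, by conversion, [smooth_at] at every point of the
    set. *)
Definition smooth_at M N (S : set M) (f : M -> N) (p : M) :=
  (f x @[x --> within S (nbhs p)] --> f p) /\
  rsmooth_at (S `&` f @^-1` mdom (f p)) (mmap (f p) \o f) p.

Lemma within_near (T : topologicalType) (S : set T) (p : T) (U : topologicalType) (f : T -> U) W :
  f x @[x --> within S (nbhs p)] --> f p -> nbhs (f p) W ->
  exists2 W', nbhs p W' & forall q, W' q -> S q -> W (f q).
Proof. by move=> cf nW; have := cf W nW; rewrite /= /within /= => H; exists (fun q => S q -> W (f q)). Qed.

Lemma smooth_at_sub M N (S S' : set M) (f : M -> N) p :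
  S' `<=` S -> smooth_at S f p -> smooth_at S' f p.
Proof.
move=> SS [cf sf]; split; last by apply: rsmooth_sub sf => q [/SS].
by apply: cvg_trans cf; apply: cvg_app; apply: within_subset.
Qed.

Lemma smooth_at_local M N (S S' : set M) (f f' : M -> N) p : charted M -> charted N -> S p ->
  (exists2 W, nbhs p W & forall q, W q -> S q -> S' q /\ f q = f' q) ->
  smooth_at S' f' p -> smooth_at S f p.
Proof.
move=> cM cN Sp [W nW HW] [cf sf]; have [S'p fp] := HW p (nbhs_singleton nW) Sp.
split.
  apply/cvg_withinP; rewrite fp => A nA; have /cvg_withinP/(_ A nA) H := cf.
  apply: filterS (filterI nW H) => q [Wq Hq] Sq.
  by have [S'q ->] := HW q Wq Sq; exact: Hq.
apply: (rsmooth_local cM _ (h' := mmap (f' p) \o f') (S' := S' `&` f' @^-1` mdom (f' p))).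
  exists W => // q Wq [Sq fq]; have [S'q E] := HW q Wq Sq.
  by split; [split=> //=; rewrite -E -fp|rewrite /= fp E].
exact: sf.
Qed.

Section Chain.
Variables (M N : mfd R) (cM : charted M) (cN : charted N).

Lemma rsmooth_comp n (S : set M) (S' : set N) (f : M -> N) (h : N -> 'rV[R]_n) p :
  S p -> (forall q, S q -> S' (f q)) -> smooth_at S f p -> rsmooth_at S' h (f p) ->
  rsmooth_at S (h \o f) p.
Proof.
move=> Sp Sf [cf [Q [g cr]]] [Q' [g' cr']].
have [W nW HW] := within_near cf (mdom_nbhs cN (mdom_refl cN (f p))).
have cr2 := crep_comp (conj Sp (mdom_refl cN (f p))) (mdom_refl cM p)
  (fun q (Hq : (S `&` f @^-1` mdom (f p)) q) _ => conj (Sf q Hq.1) Hq.2) cr cr'.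
apply: (rsmooth_local cM (S' := S `&` f @^-1` mdom (f p)) (h' := h \o f)).
  by exists W => // q Wq Sq; split=> //; split=> //; exact: HW.
by eexists _, _; exact: cr2.
Qed.

(** The coordinate expressions compose only where [f] lands in the chart around [f p]. By continuity
    this is a relative neighbourhood of [p], so cutting [S] down to it changes no differential. *)
Lemma rdiff_comp n (S : set M) (S' : set N) (f : M -> N) (h : N -> 'rV[R]_n) p :
  thickS S p p -> thickS S' (f p) (f p) ->
  (forall q, S q -> S' (f q)) -> smooth_at S f p -> rsmooth_at S' h (f p) ->
  rdiff S (h \o f) p = (rdiff S' h (f p) \o mdiff S f p)%VF.
Proof.
move=> tS tS' Sf sf rh; have Sp := thickS_mem cM (mdom_refl cM p) tS.
have [cf [Q [g cr]]] := sf; have [Q' [g' cr']] := rh.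
have [W nW HW] := within_near cf (mdom_nbhs cN (mdom_refl cN (f p))).
have cr2 := crep_comp (conj Sp (mdom_refl cN (f p))) (mdom_refl cM p)
  (fun q (Hq : (S `&` f @^-1` mdom (f p)) q) _ => conj (Sf q Hq.1) Hq.2) cr cr'.
have tS1 : thickS (S `&` f @^-1` mdom (f p)) p p.
  by apply: thickS_sub (mdom_refl cM p) tS nW _ => // q [Sq Wq]; split=> //; exact: HW.
rewrite (rdiff_ext cM tS tS1 (h' := h \o f)).
  have [oO Qp sg H] := cr; have [oO' Qp' sg' H'] := cr'.
  have E : g (mmap p p) = mmap (f p) (f p).
    by apply: (H p) => //; [split=> //; exact: mdom_refl|exact: mdom_refl].
  apply/lfunP => v; rewrite comp_lfunE /= (rdiffP tS1 cr2) (rdiffP tS' cr').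
  rewrite /mdiff (rdiffP tS1 cr) -mulmxA jac_comp ?E //.
    exact: smooth_diff sg Qp.
    exact: smooth_diff sg' Qp'.
  by exists W => // q Wq Sq; split=> //; split=> //; exact: HW.
  by eexists _, _; exact: cr2.
Qed.

End Chain.

Lemma smooth_at_comp M N L (S : set M) (S' : set N) (f : M -> N) (k : N -> L) p :
  charted M -> charted N -> charted L ->
  S p -> (forall q, S q -> S' (f q)) -> smooth_at S f p -> smooth_at S' k (f p) ->
  smooth_at S (k \o f) p.
Proof.
move=> cM cN cL Sp Sf sf [ck rk]; split.
  have [/cvg_withinP cf _] := sf; apply/cvg_withinP => W nW.
  have /cvg_withinP/(_ W nW) nW' := ck.
  by apply: filterS (cf _ nW') => q Hq Sq; apply: Hq => //; exact: Sf.
have [W nW HW] := within_near ck (mdom_nbhs cL (mdom_refl cL (k (f p)))).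
have := rsmooth_comp cM cN (S := S `&` (k \o f) @^-1` mdom (k (f p)))
  (S' := S' `&` k @^-1` mdom (k (f p))) (f := f) (h := mmap (k (f p)) \o k) (p := p).
apply => //; last by apply: smooth_at_sub sf => q [].
  by split=> //; exact: mdom_refl.
by move=> q [/Sf].
Qed.

Lemma mdiff_comp M N L (S : set M) (S' : set N) (f : M -> N) (k : N -> L) p :
  charted M -> charted N -> charted L ->
  thickS S p p -> thickS S' (f p) (f p) ->
  (forall q, S q -> S' (f q)) -> smooth_at S f p -> smooth_at S' k (f p) ->
  mdiff S (k \o f) p = (mdiff S' k (f p) \o mdiff S f p)%VF.
Proof.
move=> cM cN cL tS tS' Sf sf sk; have [cf _] := sf; have [ck rk] := sk.
have [W nW HW] := within_near ck (mdom_nbhs cL (mdom_refl cL (k (f p)))).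
have [W1 nW1 HW1] := within_near cf nW.
have tS1 : thickS (S `&` (k \o f) @^-1` mdom (k (f p))) p p.
  apply: thickS_sub (mdom_refl cM p) tS nW1 _ => // q [Sq Wq]; split=> //.
  by apply: HW; [exact: HW1|exact: Sf].
have tS'1 : thickS (S' `&` k @^-1` mdom (k (f p))) (f p) (f p).
  by apply: thickS_sub (mdom_refl cN (f p)) tS' nW _ => // q [Sq Wq]; split=> //; exact: HW.
have sf1 : smooth_at (S `&` (k \o f) @^-1` mdom (k (f p))) f p.
  by apply: smooth_at_sub sf => q [].
have := rdiff_comp cM cN tS1 tS'1 _ sf1 rk => H.
rewrite {1}/mdiff -[mmap _ \o (k \o f)]/((mmap (k (f p)) \o k) \o f) H; last first.
  by move=> q [/Sf].
congr (_ \o _)%VF; rewrite /mdiff.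
have [W2 nW2 HW2] := within_near cf (mdom_nbhs cN (mdom_refl cN (f p))).
apply: (rdiff_ext cM).
  by apply: thickS_sub (mdom_refl cM p) tS1 nW2 _ => // q [[Sq kq] Wq]; do !split=> //; exact: HW2.
  by apply: thickS_sub (mdom_refl cM p) tS nW2 _ => // q [Sq Wq]; split=> //; exact: HW2.
  by exists setT; [exact: filterT|move=> q _ [[Sq _] fq]; split].
by have [] := sf.
Qed.

End Germs.

Import passmx.

(** * Maps into vector spaces *)

Section VectorValued.
Variable R : realType.
Implicit Types M N L : mfd R.
Implicit Types E F : vectType R.

(** Named copies of the coordinate maps of [vbasis], to which linear structures can be attached. *)
Definition rv E (v : E) : 'rV[R]_(\dim {:E}) := passmx.rVof (vbasis {:E}) v.
Definition vec E (v : 'rV[R]_(\dim {:E})) : E := passmx.vecof (vbasis {:E}) v.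

Lemma rvK E : cancel (@rv E) (@vec E).
Proof. by apply: passmx.rVofK; exact: vbasisP. Qed.

Lemma vecK E : cancel (@vec E) (@rv E).
Proof. by apply: passmx.vecofK; exact: vbasisP. Qed.

Lemma rv_linear E : linear (@rv E).
Proof. exact: passmx.rVof_linear. Qed.
HB.instance Definition _ E := GRing.isLinear.Build _ _ _ _ _ (@rv_linear E).

Lemma vec_linear E : linear (@vec E).
Proof. exact: passmx.vecof_linear. Qed.
HB.instance Definition _ E := GRing.isLinear.Build _ _ _ _ _ (@vec_linear E).

Definition vsmooth_at M E (S : set M) (s : M -> E) p := rsmooth_at S (@rv E \o s) p.

Lemma vdiffE M E (S : set M) (s : M -> E) p v :
  vdiff S s p v = vec (rdiff S (@rv E \o s) p v).
Proof. by rewrite /vdiff comp_lfunE lfunE. Qed.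

Definition linmx E F (L : 'Hom(E, F)) : 'M[R]_(\dim {:E}, \dim {:F}) :=
  lin1_mx (fun x => rv (L (vec x))).

Lemma linmxE E F (L : 'Hom(E, F)) v : rv (L v) = rv v *m linmx L.
Proof.
pose f (x : 'rV[R]_(\dim {:E})) := rv (L (vec x)).
have lf : linear f by move=> a x y; rewrite /f !linearP.
pose fM := GRing.isLinear.Build _ _ _ _ _ lf.
pose fL : {linear 'rV[R]_(\dim {:E}) -> 'rV[R]_(\dim {:F})} := HB.pack f fM.
by rewrite (mul_rV_lin1 fL) /= /f rvK.
Qed.

Section Maps.
Variables (M N : mfd R) (cM : charted M) (cN : charted N).

Lemma vsmooth_comp E (S : set M) (S' : set N) (f : M -> N) (s : N -> E) p :
  S p -> (forall q, S q -> S' (f q)) -> smooth_at S f p -> vsmooth_at S' s (f p) ->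
  vsmooth_at S (s \o f) p.
Proof. exact: rsmooth_comp. Qed.

Lemma vdiff_comp E (S : set M) (S' : set N) (f : M -> N) (s : N -> E) p :
  thickS S p p -> thickS S' (f p) (f p) ->
  (forall q, S q -> S' (f q)) -> smooth_at S f p -> vsmooth_at S' s (f p) ->
  vdiff S (s \o f) p = (vdiff S' s (f p) \o mdiff S f p)%VF.
Proof.
move=> tS tS' Sf sf ss; rewrite /vdiff (rdiff_comp cM cN tS tS' Sf sf ss).
by rewrite comp_lfunA.
Qed.

Lemma vsmooth_local E (S S' : set M) (s s' : M -> E) p :
  (exists2 W, nbhs p W & forall q, W q -> S q -> S' q /\ s q = s' q) ->
  vsmooth_at S' s' p -> vsmooth_at S s p.
Proof.
move=> [W nW HW]; apply: rsmooth_local => //; exists W => // q Wq Sq.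
by have [S'q /= ->] := HW q Wq Sq.
Qed.

Lemma vdiff_ext E (S S' : set M) (s s' : M -> E) p : thickS S p p -> thickS S' p p ->
  (exists2 W, nbhs p W & forall q, W q -> S q -> S' q /\ s q = s' q) ->
  vsmooth_at S' s' p -> vdiff S s p = vdiff S' s' p.
Proof.
move=> tS tS' [W nW HW] ss; rewrite /vdiff; congr (_ \o _)%VF.
apply: (rdiff_ext cM tS tS') ss; exists W => // q Wq Sq.
by have [S'q /= ->] := HW q Wq Sq.
Qed.

Lemma vdiff_jac E (S : set M) (s : M -> E) p Q g : thickS S p p ->
  coord_rep p S (@rv E \o s) p Q g ->
  forall v, rv (vdiff S s p v) = v *m jac g (mmap p p).
Proof. by move=> tS cr v; rewrite vdiffE vecK (rdiffP tS cr). Qed.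

Lemma vsmooth_lin E F (L : 'Hom(E, F)) (S : set M) (s : M -> E) p :
  vsmooth_at S s p -> vsmooth_at S (L \o s) p.
Proof.
move=> [Q [g [oQ Qp sg H]]]; exists Q, (fun y => g y *m linmx L); split=> //.
  by move=> k; apply: Ck_mulmxr.
by move=> q Sq Dq Qq; rewrite H //= linmxE.
Qed.

Lemma vdiff_lin E F (L : 'Hom(E, F)) (S : set M) (s : M -> E) p : thickS S p p ->
  vsmooth_at S s p -> vdiff S (L \o s) p = (L \o vdiff S s p)%VF.
Proof.
move=> tS [Q [g cr]]; have [oQ Qp sg H] := cr.
have cr' : coord_rep p S (@rv F \o (L \o s)) p Q ((fun y => y *m linmx L) \o g).
  split=> //; first by move=> k; apply: Ck_mulmxr.
  by move=> q Sq Dq Qq; rewrite /= H //= linmxE.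
apply/lfunP => v; apply: (can_inj (@rvK F)).
rewrite (vdiff_jac tS cr') comp_lfunE linmxE (vdiff_jac tS cr) -mulmxA.
rewrite jac_comp ?jac_mulmxr //; first exact: smooth_diff sg Qp.
exact: (smooth_diff (smooth_mulmxr _ openT)).
Qed.

Lemma smooth_add p q (Q : set 'rV[R]_p) (f g : 'rV[R]_p -> 'rV[R]_q) : open Q ->
  smooth_open Q f -> smooth_open Q g -> smooth_open Q (fun x => f x + g x).
Proof. by move=> oQ sf sg k; apply: Ck_add. Qed.

Lemma jac_add p q (Q : set 'rV[R]_p) (f g : 'rV[R]_p -> 'rV[R]_q) x : open Q -> Q x ->
  smooth_open Q f -> smooth_open Q g -> jac (fun x => f x + g x) x = jac f x + jac g x.
Proof.
move=> oQ Qx sf sg.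
have df := smooth_diff sf Qx; have dg := smooth_diff sg Qx.
have ds : smooth_open setT (fun y : 'rV[R]_(q + q) => y *m col_mx 1%:M 1%:M).
  by apply: smooth_mulmxr; exact: openT.
rewrite (_ : (fun x => f x + g x) = (fun y => y *m col_mx 1%:M 1%:M) \o (fun x => row_mx (f x) (g x))).
  rewrite jac_comp; last 2 first.
    exact: smooth_diff (smooth_row_mx oQ sf sg) Qx.
    exact: (smooth_diff ds).
  by rewrite (jac_row_mx oQ Qx sf sg) jac_mulmxr mul_row_col !mulmx1.
by apply/funext => y /=; rewrite mul_row_col !mulmx1.
Qed.

Lemma crep_add n (S : set M) (s t : M -> 'rV[R]_n) x p Q g Q' g' :
  coord_rep x S s p Q g -> coord_rep x S t p Q' g' ->
  coord_rep x S (fun q => s q + t q) p (Q `&` Q') (fun y => g y + g' y).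
Proof.
move=> [oQ Qp sg H] [oQ' Qp' sg' H']; have oI := openI oQ oQ'; split=> //.
  by apply: smooth_add => //; [apply: smooth_sub sg|apply: smooth_sub sg'] => y [].
by move=> q Sq Dq [Qq Qq']; rewrite H // H'.
Qed.

Lemma vsmooth_add E (S : set M) (s t : M -> E) p :
  vsmooth_at S s p -> vsmooth_at S t p -> vsmooth_at S (fun q => s q + t q) p.
Proof.
move=> [Q [g cr]] [Q' [g' cr']]; have cr2 := crep_add cr cr'.
eexists _, _; apply: crep_eq cr2 => q _ _; by rewrite /= linearD.
Qed.

Lemma vdiff_add E (S : set M) (s t : M -> E) p : thickS S p p ->
  vsmooth_at S s p -> vsmooth_at S t p ->
  vdiff S (fun q => s q + t q) p = vdiff S s p + vdiff S t p.
Proof.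
move=> tS [Q [g cr]] [Q' [g' cr']]; have cr2 := crep_add cr cr'.
have cr3 : coord_rep p S (@rv E \o (fun q => s q + t q)) p (Q `&` Q') (fun y => g y + g' y).
  by apply: crep_eq cr2 => q _ _; rewrite /= linearD.
have [oI Ip _ _] := cr3; have [_ _ sg _] := cr; have [_ _ sg' _] := cr'.
apply/lfunP => v; apply: (can_inj (@rvK E)).
rewrite (vdiff_jac tS cr3) add_lfunE linearD /= (vdiff_jac tS cr) (vdiff_jac tS cr').
rewrite (jac_add oI Ip) ?mulmxDr //; first by apply: smooth_sub sg => y [].
by apply: smooth_sub sg' => y [].
Qed.

End Maps.
End VectorValued.

(** * Invariance of the boundary *)

Section Boundary.
Variable R : realType.
Implicit Types M N L : mfd R.

(** The composite of the two extended transition maps is the identity only on the image of the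
    chart, but that set is thick, so the Jacobians are inverse to each other also at boundary
    points. *)
Lemma trans_jac M (x y p : M) Q k Q' k' : charted M -> mdom x p -> mdom y p ->
  coord_rep x (mdom x `&` mdom y) (mmap y) p Q k ->
  coord_rep y (mdom x `&` mdom y) (mmap x) p Q' k' ->
  jac k (mmap x p) *m jac k' (mmap y p) = 1%:M.
Proof.
move=> cM Dx Dy [oQ Qp sk H] [oQ' Qp' sk' H'].
have E := H p (conj Dx Dy) Dx Qp.
have nI : nbhs p (mdom x `&` mdom y).
  by apply: filterI; exact: mdom_nbhs.
have tS := thickS_nbhs cM Dx nI.
have oP := open_preim oQ oQ' sk.
have sc : smooth_open (Q `&` k @^-1` Q') (k' \o k).
  by apply: smooth_comp oP oQ' _ (smooth_sub _ sk) sk' => z [].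
have Pp : (Q `&` k @^-1` Q') (mmap x p) by split=> //=; rewrite E.
rewrite -E -jac_comp; last 2 first.
  exact: smooth_diff sk Qp.
  by rewrite E; exact: smooth_diff sk' Qp'.
rewrite -[RHS](jac_id (mmap x p)).
apply: (@thick_jac _ _ _ (mmap x @` ((mdom x `&` mdom y) `&` mdom x) `&` (Q `&` k @^-1` Q'))).
- apply: thick_sub tS (open_nbhs_nbhs (conj oP Pp)) _; exact: subset_refl.
- exact: smooth_diff sc Pp.
- exact: (smooth_diff (smooth_id setT)).
move=> _ [[q [[Dq Eq] _] <-] [Qq /=]].
by rewrite (H q (conj Dq Eq)) // => Qq'; rewrite (H' q (conj Dq Eq)).
Qed.

(** An injective Jacobian between equal dimensions is invertible, so the inverse function theorem
    applies to the extension [g]. At an interior point, all coordinates near [mmap x p] come from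
    points of [M], hence their images come from points of [N]. *)
Lemma interior_image M N (S : set M) (x p : M) (y : N) (f : M -> N) Q
    (g : 'rV[R]_(mdim M) -> 'rV[R]_(mdim N)) :
  charted M -> charted N -> mdim M = mdim N ->
  mdom x p -> nbhs p S -> (forall q, S q -> mdom x q -> mdom y (f q)) ->
  coord_rep x S (mmap y \o f) p Q g -> 
  (forall v : 'rV[R]_(mdim M), v *m jac g (mmap x p) = 0 -> v = 0) ->
  nbhs (mmap x p) (mmap x @` mdom x) -> nbhs (mmap y (f p)) (mmap y @` (mdom y `&` f @` S)).
Proof.
move=> cM cN dMN Dx nS Sf [oQ Qp sg H] inj int.
have Sp := nbhs_singleton nS.
have [Q1 [oQ1 Q1p Q1S]] := chart_nbhs cM Dx nS.
have [Q2 [oQ2 Q2p] Q2I] : exists2 Q2, open_nbhs (mmap x p) Q2 & Q2 `<=` mmap x @` mdom x.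
  by move: int; rewrite nbhsE => -[Q2 ? ?]; exists Q2.
pose W := Q `&` (Q1 `&` Q2).
have oW : open W by do 2!apply: openI => //.
have sW : smooth_open W g by apply: smooth_sub sg => z [].
have rf : row_free (jac g (mmap x p)).
  by apply/inj_row_free => v; exact: inj.
have ru : row_full (jac g (mmap x p)).
  by rewrite /row_full -[X in _ == X]dMN; move: rf; rewrite /row_free.
have [B AB] := row_freeP rf; have [B' BA] := row_fullP ru.
have EB : B = B'.
  by rewrite -[LHS]mul1mx -BA -mulmxA AB mulmx1.
have BA' : B *m jac g (mmap x p) = 1%:M by rewrite EB.
have Wp : W (mmap x p) by [].
have [U [k [oU [Up UW] oV _ _]]] := inverse_function oW Wp sW AB BA'.
rewrite nbhsE; exists (g @` U).
  split=> //; exists (mmap x p) => //.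
  exact: H.
move=> _ [z Uz <-].
have [Qz [Q1z Q2z]] := UW z Uz.
have [q Dq Eq] := Q2I z Q2z; rewrite -Eq in Qz Q1z Uz *.
have Sq := Q1S q Dq Q1z.
exists (f q); last by rewrite H.
split; last by exists q.
exact: Sf.
Qed.

Lemma interior_chart M (x y p : M) : charted M -> mdom x p -> mdom y p ->
  nbhs (mmap x p) (mmap x @` mdom x) -> nbhs (mmap y p) (mmap y @` mdom y).
Proof.
move=> cM Dx Dy int.
have [_ _ _ _ tr] := cM x; have [Q [k cr]] := tr y p Dx Dy.
have [_ _ _ _ tr'] := cM y; have [Q' [k' cr']] := tr' x p Dy Dx.
rewrite setIC in cr'.
have J := trans_jac cM Dx Dy cr cr'.
have nI : nbhs p (mdom x `&` mdom y) by apply: filterI; exact: mdom_nbhs.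
have : nbhs (mmap y p) (mmap y @` (mdom y `&` id @` (mdom x `&` mdom y))).
  apply: (interior_image (f := id) (x := x) (Q := Q) (g := k)) => //.
    by move=> q [].
  by move=> v vk; rewrite -[v]mulmx1 -J mulmxA vk mul0mx.
by apply: filterS => _ [q [Dq _] <-]; exists q.
Qed.

(** The boundary is defined through the chart around the point itself; transition maps preserve
    interior points, so any chart containing the point detects it. *)
Lemma bdryE M (x p : M) : charted M -> mdom x p ->
  mboundary M p <-> ~ nbhs (mmap x p) (mmap x @` mdom x).
Proof.
move=> cM Dx; split=> H; apply: contra_not H => H; apply: interior_chart H => //;
  exact: mdom_refl.
Qed.

Lemma bdry_chart M (x p : M) : is_manifold M -> mdom x p ->
  mboundary M p <-> exists i0 : 'I_(mdim M), [/\ i0 = 0%N :> nat,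
    exists2 Q, open Q & mmap x @` mdom x = @half_space R (mdim M) `&` Q
    & mmap x p ord0 i0 = 0].
Proof.
move=> mM Dx; have cM := manifold_charted mM; rewrite (bdryE cM Dx).
have [_ _ /(_ x) [_ _ _ im _]] := mM.
split=> [nb|[i0 [i00 [Q oQ E] p0]] nb].
  case: im => [oI|[Q oQ E]].
    by exfalso; apply: nb; apply: open_nbhs_nbhs; split=> //; exists p.
  have [Hp Qp] : (@half_space R (mdim M) `&` Q) (mmap x p) by rewrite -E; exists p.
  (* In dimension 0 the half space imposes no condition, so there are no boundary points. *)
  have [m0|m0] := posnP (mdim M).
    exfalso; apply: nb; rewrite E; apply: filterI; last exact: open_nbhs_nbhs.
    by apply: filterE => v i; have := ltn_ord i; rewrite {2}m0.
  pose i0 := Ordinal m0; exists i0; split=> //; first by exists Q.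
  apply/eqP/negP => p0; apply: nb; rewrite E; apply: filterI; last exact: open_nbhs_nbhs.
  have pp : 0 < mmap x p ord0 i0 by rewrite lt_def Hp // andbT; apply/negP.
  have : nbhs (mmap x p) ((fun v : 'rV[R]_(mdim M) => v ord0 i0) @^-1` [set t : R | 0 < t]).
    apply: (@coord_continuous _ _ _ ord0 i0 (mmap x p)).
    by apply: open_nbhs_nbhs; split=> //; exact: open_gt.
  by apply: filterS => v /= v0 i i00; rewrite (_ : i = i0) ?ltW //; exact: val_inj.
move: nb => /nbhs_ballP[e /= e0 be].
have e20 : 0 < e / 2 by rewrite divr_gt0.
(* A point with vanishing first coordinate is moved out of the half space by an arbitrarily small
   step against that coordinate. *)
have : ball (mmap x p) e (mmap x p - (e / 2) *: delta_mx ord0 i0).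
  rewrite -ball_normE /= opprB addrC subrK.
  apply: le_lt_trans (_ : _ <= e / 2) _; last by rewrite ltr_pdivrMr // ltr_pMr // ltr1n.
  apply: mx_norm_le => [|i j]; first exact: ltW.
  rewrite !mxE; case: (_ && _); last by rewrite mulr0 normr0 ltW.
  by rewrite mulr1 gtr0_norm.
move=> /be; rewrite E => -[/(_ i0 i00)].
by rewrite !mxE !eqxx p0 mulr1 sub0r oppr_ge0 leNgt e20.
Qed.

End Boundary.

(** * Cylinders *)

Section Cylinder.
Variables (R : realType) (B : mfd R).
Hypothesis cB : charted B.

Lemma cyl_row m (t s : R) (v w : 'rV[R]_m) :
  row_mx (const_mx t : 'rV_1) v = row_mx (const_mx s) w -> t = s /\ v = w.
Proof.
move=> /eq_row_mx [/matrixP/(_ ord0 ord0)]; rewrite !mxE => -> ->.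
by [].
Qed.

Lemma row_mx_continuous_at (T : topologicalType) m n (f : T -> 'rV[R]_m) (g : T -> 'rV[R]_n) p :
  {for p, continuous f} -> {for p, continuous g} ->
  {for p, continuous (fun q => row_mx (f q) (g q))}.
Proof.
move=> cf cg.
have -> : (fun q => row_mx (f q) (g q)) =
    (fun q => f q *m row_mx 1%:M 0 + g q *m row_mx 0 1%:M).
  apply/funext => q; rewrite !mul_mx_row !mulmx1 !mulmx0 add_row_mx addr0 add0r.
  by [].
apply: continuousD.
  apply: (@continuous_comp _ _ _ f (fun z => z *m row_mx 1%:M 0) p cf).
  exact: mulmxr_continuous.
apply: (@continuous_comp _ _ _ g (fun z => z *m row_mx 0 1%:M) p cg).
exact: mulmxr_continuous.
Qed.

(** The rays are spanned by a block-diagonal matrix. At the end of a half-open interval only one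
    direction stays inside, and the sign of [c] selects it. *)
Lemma thick_prod n (I : set R) (A : set 'rV[R]_n) (t c : R) a :
  I t -> c != 0 -> (forall e : R, 0 < e -> exists2 s : R, 0 < s < e & I (t + s * c)) ->
  thick A a ->
  thick [set v : 'rV[R]_(1 + n) | I (v ord0 (lshift n ord0)) /\ A (rsubmx v)]
    (row_mx (const_mx t) a).
Proof.
move=> It c0 HI [Aa [M uM HM]]; split.
  by rewrite /= row_mxEl mxE row_mxKr.
exists (block_mx (const_mx c : 'M[R]_1) 0 0 M).
  rewrite unitmxE det_ublock unitrM -[in X in _ && X]unitmxE uM andbT.
  by rewrite det_mx11 mxE unitfE.
move=> i e e0; case: (split_ordP i) => j ->.
  have [s se Is] := HI e e0; exists s => //=.
  rewrite block_mxEv rowKu row_row_mx row_const row0 scale_row_mx add_row_mx scaler0 addr0.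
  by rewrite row_mxKr row_mxEl !mxE.
have [s se As] := HM j e e0; exists s => //=.
rewrite block_mxEv rowKd row_row_mx row0 scale_row_mx add_row_mx scaler0 addr0.
by rewrite row_mxKr row_mxEl !mxE.
Qed.

Lemma const_mx_continuous m n : continuous (fun t : R => const_mx t : 'M[R]_(m, n)).
Proof.
rewrite (_ : (fun t => _) = scalel (const_mx 1)); first exact: scalel_continuous.
by apply/funext => t; apply/matrixP => i j; rewrite !mxE mulr1.
Qed.

Lemma rsubmx_mul m n (v : 'rV[R]_(m + n)) : rsubmx v = v *m col_mx 0 1%:M.
Proof. by rewrite -{2}[v]hsubmxK mul_row_col mulmx0 mulmx1 add0r. Qed.

Lemma lsubmx_mul m n (v : 'rV[R]_(m + n)) : lsubmx v = v *m col_mx 1%:M 0.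
Proof. by rewrite -{2}[v]hsubmxK mul_row_col mulmx0 mulmx1 addr0. Qed.

Lemma open_row_mx n (I : set R) (A : set 'rV[R]_n) : open I -> open A ->
  open [set v : 'rV[R]_(1 + n) | I (v ord0 (lshift n ord0)) /\ A (rsubmx v)].
Proof.
move=> oI oA; apply: (@openI _ ((fun v : 'rV[R]_(1 + n) => v ord0 (lshift n ord0)) @^-1` I)
  (rsubmx @^-1` A)).
  by apply: open_comp oI => v _; exact: coord_continuous.
rewrite (_ : rsubmx = fun v => v *m col_mx 0 1%:M); last first.
  by apply/funext => v; exact: rsubmx_mul.
by apply: open_comp oA => v _; exact: mulmxr_continuous.
Qed.

Lemma cyl_mmapE (p q : cylinder B) : mmap p q = row_mx (const_mx q.1 : 'rV_1) (mmap p.2 q.2).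
Proof. by []. Qed.

Lemma cyl_continuous (p q : cylinder B) : mdom p q -> {for q, continuous (mmap p)}.
Proof.
move=> [_ Dq].
apply: (@row_mx_continuous_at _ 1 (mdim B) (fun q : R * B => const_mx q.1) (fun q : R * B => mmap p.2 q.2)).
  exact: (continuous_comp (@cvg_fst _ _ _ _ _) (const_mx_continuous (x := q.1))).
exact: (continuous_comp (@cvg_snd _ _ _ _ _) (mmap_cont cB Dq)).
Qed.

Lemma cylinder_charted : charted (cylinder B).
Proof.
move=> p; split.
- rewrite openE => q [_ Dq]; exists (setT, mdom p.2) => //; split=> /=; first exact: filterT.
  exact (mdom_nbhs cB Dq).
- by split=> //; exact: mdom_refl.
- apply/homeo_ontoP; split.
  + split; first by move=> q Dq; exists q.
      move=> [t q] [s q'] /set_mem[_ Dq] /set_mem[_ Dq'] /=; rewrite !cyl_mmapE /= => /cyl_row[-> E].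
      by congr pair; exact: (mmap_inj cB Dq Dq' E).
    by move=> _ [q Dq <-]; exists q.
  + move=> q Dq; apply: cvg_within_filter; exact: cyl_continuous.
  + move=> [t q] W [_ Dq] [[A C] /= [nA nC] AC].
    have [Q [oQ Qq QC]] := chart_nbhs cB Dq nC.
    exists [set v : 'rV[R]_(1 + mdim B) | A^° (v ord0 (lshift _ ord0)) /\ Q (rsubmx v)]; split.
    * by apply: open_row_mx => //; exact: open_interior.
    * by rewrite /= cyl_mmapE row_mxKr row_mxEl mxE.
    * move=> [s q'] [_ Dq'] /=; rewrite cyl_mmapE row_mxKr row_mxEl mxE /= => -[As Qq'].
      apply: AC; split; first exact: interior_subset.
      exact: QC.
- move=> [t q] [_ Dq].
  have [_ _ _ th _] := cB p.2.
  have := @thick_prod _ setT _ t 1 _ I (oner_neq0 _) _ (th q Dq) => H.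
  rewrite (_ : mmap p @` mdom p = [set v : 'rV[R]_(1 + mdim B) | setT (v ord0 (lshift _ ord0)) /\ (mmap p.2 @` mdom p.2) (rsubmx v)]).
    apply: H => e e0; exists (e / 2) => //.
    by rewrite divr_gt0 //= ltr_pdivrMr // ltr_pMr // ltr1n.
  apply/seteqP; split=> v /=.
    by move=> [q' [_ Dq'] <-]; split=> //; rewrite cyl_mmapE row_mxKr; exists q'.2.
  move=> [_ [q' Dq' E]]; exists (v ord0 (lshift _ ord0), q') => //.
  rewrite cyl_mmapE /= E -[RHS]hsubmxK; congr row_mx.
  by apply/matrixP => i j; rewrite !mxE !ord1.
- move=> p' q Dq Dq'.
  have [_ _ _ _ tr] := cB p.2; have [Q [k [oQ Qq sk H]]] := tr p'.2 q.2 Dq.2 Dq'.2.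
  pose k' (v : 'rV[R]_(1 + mdim B)) := row_mx (v *m col_mx 1%:M 0) (k (v *m col_mx 0 1%:M)).
  exists (setT `&` (fun v => v *m col_mx 0 1%:M) @^-1` Q), k'.
  have oP : open (setT `&` (fun v : 'rV[R]_(1 + mdim B) => v *m col_mx 0 1%:M) @^-1` Q).
    exact: (open_preim openT oQ (smooth_mulmxr _ openT)).
  split=> //.
  + by split=> //=; rewrite -rsubmx_mul cyl_mmapE row_mxKr.
  + apply: smooth_row_mx => //; first exact: smooth_mulmxr.
    apply: (@smooth_comp _ _ _ _ _ _ Q (fun v => v *m col_mx 0 1%:M) k) => //; first by move=> x [].
    exact: smooth_mulmxr.
  + move=> q' [Eq' Eq''] Fq' [_]; rewrite /= /k' -rsubmx_mul -lsubmx_mul !cyl_mmapE row_mxKr row_mxKl => Qq'.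
    by rewrite H //; [split; [exact: Eq'.2|exact: Eq''.2]|exact: Eq'.2].
Qed.

End Cylinder.

(** * Regular level sets and gluing *)

Section LinearComplement.
Variable F : fieldType.

Lemma complement_rows k n m (X : 'M[F]_(k, m)) : row_free X -> (n + k = m)%N ->
  exists Y : 'M[F]_(n, m), row_full (Y + X)%MS.
Proof.
move=> fX nk; have E : \rank (X^C)%MS = n.
  by rewrite mxrank_compl (eqP fX) -nk addnK.
exists (castmx (E, erefl) (row_base X^C%MS)).
rewrite -sub1mx; have : (1%:M <= X + X^C)%MS by rewrite sub1mx addsmx_compl_full.
move/submx_trans; apply; rewrite addsmx_sub addsmxSr /=.
by apply: submx_trans (addsmxSl _ _); rewrite eqmx_cast eq_row_base.
Qed.

Lemma full_inverse p q (A : 'M[F]_(p, q)) : p = q -> row_full A ->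
  exists B : 'M[F]_(q, p), A *m B = 1%:M /\ B *m A = 1%:M.
Proof.
move=> pq fA; have rA : row_free A by rewrite /row_free (eqP fA) pq.
have [B AB] := row_freeP rA; have [B' BA] := row_fullP fA.
by exists B; split=> //; rewrite -[B]mul1mx -{1}BA -(mulmxA B') AB mulmx1.
Qed.

(** Completes a surjective linear map to an isomorphism by adding [n] linear coordinates [P]. *)
Lemma complement_cols m e n (A : 'M[F]_(m, e)) : row_full A -> (n + e = m)%N ->
  exists (P : 'M[F]_(m, n)) (B : 'M[F]_(n + e, m)),
    row_mx P A *m B = 1%:M /\ B *m row_mx P A = 1%:M.
Proof.
move=> fA nem; have fT : row_free A^T by rewrite /row_free mxrank_tr.
have [Y fY] := complement_rows fT nem.
have [|B [AB BA]] := @full_inverse _ _ (col_mx Y A^T) nem.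
  by rewrite /row_full -addsmxE.
exists Y^T, B^T.
have -> : row_mx Y^T A = (col_mx Y A^T)^T by rewrite tr_col_mx trmxK.
by rewrite -!trmx_mul AB BA !trmx1.
Qed.

(** The first added coordinate can be the [i0]-th ambient one, because the kernel vector [v] shows
    it to be independent of the columns of [A]. At boundary points this makes slice coordinates
    inherit the half-space coordinate. *)
Lemma complement_cols_coord m e n (A : 'M[F]_(m, e)) (i0 : 'I_m) (v : 'rV[F]_m) :
  row_full A -> (n + e = m)%N -> v *m A = 0 -> v ord0 i0 != 0 ->
  exists (P : 'M[F]_(m, n)) (B : 'M[F]_(n + e, m)),
    [/\ row_mx P A *m B = 1%:M, B *m row_mx P A = 1%:M, (0 < n)%N
      & forall (u : 'rV[F]_m) (j0 : 'I_n), j0 = 0%N :> nat -> (u *m P) ord0 j0 = u ord0 i0].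
Proof.
move=> fA nem vA v0.
have fT : row_free A^T by rewrite /row_free mxrank_tr.
pose e0 : 'rV[F]_m := delta_mx ord0 i0.
have ev : e0 *m v^T = (v ord0 i0)%:M.
  by rewrite /e0 -rowE; apply/matrixP => i j; rewrite !mxE !ord1 eqxx mulr1n.
have fX : row_free (col_mx e0 A^T).
  apply/inj_row_free => w; rewrite -[w]hsubmxK mul_row_col => H.
  (* Pairing a linear relation with [v] kills the columns of [A] and isolates the coefficient of
     [e0]. *)
  have : (lsubmx w *m e0 + rsubmx w *m A^T) *m v^T = 0 by rewrite H mul0mx.
  rewrite mulmxDl -!mulmxA ev -trmx_mul vA trmx0 mulmx0 addr0 mul_mx_scalar.
  move/eqP; rewrite scaler_eq0 (negPf v0) /= => /eqP l0.
  move: H; rewrite l0 mul0mx add0r => /eqP; rewrite mulmx_free_eq0 // => /eqP ->.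
  by rewrite row_mx0.
have n0 : (0 < n)%N.
  have := rank_leq_col (col_mx e0 A^T); rewrite (eqP fX) -nem.
  by rewrite leq_add2r.
case: n nem n0 => // n nem _.
have [|Y fY] := @complement_rows _ n _ (col_mx e0 A^T) fX.
  by rewrite -nem addnCA add1n addSn.
have [|B [AB BA]] := @full_inverse _ _ (col_mx (col_mx e0 Y : 'M[F]_(1 + n, m)) A^T) nem.
  rewrite -sub1mx; move: fY; rewrite -sub1mx => /submx_trans; apply.
  have sT : (A^T <= col_mx (col_mx e0 Y : 'M[F]_(1 + n, m)) A^T)%MS by rewrite -addsmxE addsmxSr.
  have s0 : (col_mx e0 Y <= col_mx (col_mx e0 Y : 'M[F]_(1 + n, m)) A^T)%MS.
    by rewrite -(addsmxE (col_mx e0 Y : 'M[F]_(1 + n, m)) A^T) addsmxSl.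
  rewrite addsmx_sub (submx_trans _ s0) /=; last by rewrite -addsmxE addsmxSr.
  by rewrite -addsmxE addsmx_sub sT (submx_trans _ s0) // -addsmxE addsmxSl.
exists (col_mx e0 Y : 'M[F]_(1 + n, m))^T, B^T.
have -> : row_mx (col_mx e0 Y : 'M[F]_(1 + n, m))^T A = (col_mx (col_mx e0 Y : 'M[F]_(1 + n, m)) A^T)^T.
  by rewrite [RHS]tr_col_mx trmxK.
split; rewrite -?trmx_mul ?AB ?BA ?trmx1 // => u j0 j00.
have -> : j0 = lshift n (@ord0 0) by apply: val_inj; rewrite /= j00.
have E k : (col_mx e0 Y : 'M[F]_(1 + n, m))^T k (lshift n (@ord0 0)) = (k == i0)%:R.
  by rewrite mxE col_mxEu /e0 mxE.
rewrite mxE (bigD1 i0) //= E eqxx mulr1 big1 ?addr0 // => k /negPf ki.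
by rewrite E ki mulr0.
Qed.
End LinearComplement.

Section Slices.
Variable R : realType.

Lemma rv0 (E : vectType R) : rv (0 : E) = 0.
Proof. exact: (raddf0 (@rv R E)). Qed.

(** A submanifold chart for [Z] at [z]: multiplication by [P] gives the slice coordinates, and [psi]
    recovers the ambient coordinates from them. At a boundary point [P] keeps the first coordinate,
    so the slice coordinates range over part of a half space. *)
Definition slice (M : mfd R) (Z : set M) n (z : M) (Q : set 'rV[R]_(mdim M))
    (P : 'M[R]_(mdim M, n)) (W : set 'rV[R]_n) (psi : 'rV[R]_n -> 'rV[R]_(mdim M)) : Prop :=
  [/\ open Q /\ Q (mmap z z), open W /\ smooth_open W psi,
      forall q, Z q -> mdom z q -> Q (mmap z q) ->
        W (mmap z q *m P) /\ psi (mmap z q *m P) = mmap z q,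
      forall y, W y -> psi y *m P = y
    & (forall y, W y -> (mboundary M z -> @half_space R n y) ->
        exists q, [/\ Z q, mdom z q, Q (mmap z q) & mmap z q = psi y]) /\
      (mboundary M z -> (0 < n)%N /\ forall (u : 'rV[R]_(mdim M)) (i0 : 'I_(mdim M)) (j0 : 'I_n),
         i0 = 0%N :> nat -> j0 = 0%N :> nat -> (u *m P) ord0 j0 = u ord0 i0)].

(** Regular value theorem: with [F] the coordinate form of [f], the map [u |-> (u P, F u)] is a
    local diffeomorphism, and the level set is where its second component vanishes. The last
    hypothesis says that at a boundary point the kernel is not tangent to the boundary. *)
Lemma slice_exists (M : mfd R) (E : vectType R) (V : set M) (f : M -> E) n z :
  is_manifold M -> open V -> vsmooth_on V f -> V z -> f z = 0 ->
  limg (vdiff V f z) = fullv -> (n + \dim {:E})%N = mdim M ->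
  (mboundary M z -> exists (v : tangent z) (i0 : 'I_(mdim M)),
     [/\ vdiff V f z v = 0, i0 = 0%N :> nat & (v : 'rV[R]_(mdim M)) ord0 i0 != 0]) ->
  exists Q P W psi, @slice M [set x | V x /\ f x = 0] n z Q P W psi.
Proof.
move=> mM oV sf Vz fz sur dims bd; have cM := manifold_charted mM.
have nV : nbhs z V by exact: open_nbhs_nbhs.
have zz := mdom_refl cM z.
have tV := thickS_nbhs cM zz nV.
have [Q0 [F cr0]] : vsmooth_at V f z := sf z Vz.
have [Q1 [_ cr1 Q1V]] := crep_local cM zz nV (fun q H => H.1) cr0.
(* [F] lives on a full open set of coordinates; [Q2] records which of these are coordinates of
   points of [M], namely all of them at an interior point and those in the half space at a boundary
   point. *)
have [Q2 [oQ2 Q2z] HQ2] : exists2 Q2 : set 'rV[R]_(mdim M), open Q2 /\ Q2 (mmap z z) &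
   forall u, Q2 u -> (mboundary M z -> @half_space R _ u) -> (mmap z @` mdom z) u.
  have [b|nb] := pselect (mboundary M z).
    have [i0 [_ [Qh oQh Eh] _]] := (bdry_chart mM zz).1 b.
    exists Qh.
      split=> //; have : (mmap z @` mdom z) (mmap z z) by exists z.
      by rewrite Eh => -[].
    by move=> u Qu hu; rewrite Eh; split=> //; exact: hu.
  have : nbhs (mmap z z) (mmap z @` mdom z) by apply: contrapT => H; apply: nb; apply/(bdryE cM zz).
  by rewrite nbhsE => -[Q2 ? Q2I]; exists Q2 => // u /Q2I.
have cr := crep_shrink oQ2 Q2z cr1; have [oQ Qz sF HF] := cr.
set A := jac F (mmap z z).
have AE v : rv (vdiff V f z v) = v *m A by exact: vdiff_jac cr v.
have fA : row_full A.
  apply/row_fullP.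
  have H (i : 'I_(\dim {:E})) : exists v : 'rV[R]_(mdim M), v *m A = delta_mx ord0 i.
    have : vec (delta_mx ord0 i) \in limg (vdiff V f z) by rewrite sur memvf.
    by move=> /memv_imgP[v _ Ev]; exists v; rewrite -AE -Ev vecK.
  have [B HB] := choice H; exists (\matrix_i B i).
  by apply/row_matrixP => i; rewrite row_mul rowK HB rowE mulmx1.
have [P [B [AB BA pres]]] : exists (P : 'M[R]_(mdim M, n)) (B : 'M[R]_(n + \dim {:E}, mdim M)),
    [/\ row_mx P A *m B = 1%:M, B *m row_mx P A = 1%:M
      & mboundary M z -> (0 < n)%N /\ forall (u : 'rV[R]_(mdim M)) (i0 : 'I_(mdim M)) (j0 : 'I_n),
         i0 = 0%N :> nat -> j0 = 0%N :> nat -> (u *m P) ord0 j0 = u ord0 i0].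
  have [b|nb] := pselect (mboundary M z).
    have [v [i0 [dv i00 v0]]] := bd b.
    have vA : (v : 'rV[R]_(mdim M)) *m A = 0 by rewrite -AE dv linear0.
    have [P [B [AB BA n0 pr]]] := complement_cols_coord fA dims vA v0.
    exists P, B; split=> // _; split=> // u i j i_0 j_0.
    by rewrite (pr u j j_0); congr (u _ _); apply: val_inj; rewrite /= i00 i_0.
  by have [P [B [AB BA]]] := complement_cols fA dims; exists P, B; split.
pose Phi u := row_mx (u *m P) (F u).
have sP : smooth_open (Q1 `&` Q2) (fun u => u *m P) by exact: smooth_mulmxr.
have sPhi : smooth_open (Q1 `&` Q2) Phi by exact: smooth_row_mx.
have JPhi : jac Phi (mmap z z) = row_mx P A.
  by rewrite (jac_row_mx oQ Qz sP sF) jac_mulmxr.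
rewrite -JPhi in AB BA.
have [U [g [oU [Uz UQ] oPU sg gK]]] := inverse_function oQ Qz sPhi AB BA.
pose W := [set y : 'rV[R]_n | (Phi @` U) (row_mx y 0)].
have rowE0 (y : 'rV[R]_n) : row_mx y (0 : 'rV[R]_(\dim {:E})) = y *m row_mx 1%:M 0.
  by rewrite mul_mx_row mulmx1 mulmx0.
have oW : open W.
  rewrite (_ : W = setT `&` (fun y : 'rV[R]_n => y *m row_mx 1%:M 0) @^-1` (Phi @` U)).
    exact: (open_preim openT oPU (smooth_mulmxr _ openT)).
  by apply/seteqP; split=> y /=; rewrite /W /= rowE0 // => -[].
exists U, P, W, (fun y => g (row_mx y 0)); split.
- by [].
- split=> //; rewrite (_ : (fun y => _) = g \o (fun y : 'rV[R]_n => y *m row_mx 1%:M 0)); last first.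
    by apply/funext => y /=; rewrite rowE0.
  apply: (smooth_comp oW oPU) (sg); last exact: smooth_mulmxr.
  by move=> y; rewrite /W /= rowE0.
- move=> q [Vq fq] Dq Uq.
  have E1 : Phi (mmap z q) = row_mx (mmap z q *m P) 0.
    have HFq : F (mmap z q) = 0 by rewrite (HF q Vq Dq (UQ _ Uq)) /= fq rv0.
    by rewrite /Phi HFq.
  by split; [exists (mmap z q)|rewrite -E1 gK].
- move=> y [u Uu Ey]; rewrite -Ey gK //.
  by move: Ey => /eq_row_mx[].
- split=> // y [u Uu Ey] hy; have [uP Fu] := eq_row_mx Ey.
  have [Q1u Q2u] := UQ u Uu.
  have [|q Dq Eq] := HQ2 u Q2u.
    move=> b i i0; have [n0 pr] := pres b.
    by rewrite -(pr u i (Ordinal n0) i0 erefl) uP; apply: (hy b).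
  have gE : g (row_mx y 0) = u by rewrite -Ey gK.
  exists q; rewrite gE Eq; split=> //.
  have Vq : V q by apply: Q1V => //; rewrite Eq.
  split=> //; apply: (can_inj (@rvK R E)); rewrite rv0 -Fu -Eq HF //=.
  by rewrite Eq.
Qed.

End Slices.

Section Subtypes.
Variables (T : topologicalType) (Z : set T).

Lemma subtype_nbhsP (p : set_type Z) A :
  nbhs p A <-> exists2 B, nbhs (val p) B & forall q : set_type Z, B (val q) -> A q.
Proof.
split.
  move=> [_ [[B oB <-] Bp BA]]; exists B; first exact (open_nbhs_nbhs (conj oB Bp)).
  by move=> q Bq; exact: BA.
move=> [B nB BA]; have C : {for p, continuous (val : set_type Z -> T)} by exact: initial_continuous.
have nC : nbhs p ((val : set_type Z -> T) @^-1` B) := C B nB.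
by apply: filterS nC => q Bq; exact: BA.
Qed.

Lemma subtype_cont (p : set_type Z) : {for p, continuous (val : set_type Z -> T)}.
Proof. exact: initial_continuous. Qed.

Lemma subtype_hausdorff : hausdorff_space T -> hausdorff_space (set_type Z).
Proof.
move=> H p q cl; apply: val_inj; apply: H => A B nA nB.
have nA' : nbhs p (val @^-1` A) by apply/subtype_nbhsP; exists A.
have nB' : nbhs q (val @^-1` B) by apply/subtype_nbhsP; exists B.
by have [r [Ar Br]] := cl _ _ nA' nB'; exists (val r).
Qed.

Lemma subtype_second_countable : @second_countable T -> @second_countable (set_type Z).
Proof.
move=> [B cB [oB bB]]; exists [set (val : set_type Z -> T) @^-1` b | b in B].
  exact: (card_le_trans (card_image_le _ _)).
split=> [_ [b Bb <-]|p A]; first by exists b => //; exact: oB.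
move=> /subtype_nbhsP[C nC CA]; have [b [Bb bp] bC] := bB (val p) C nC.
by exists (val @^-1` b); [split=> //; exists b|move=> q /bC/CA].
Qed.

End Subtypes.

Section SliceCharts.
Variables (R : realType) (M : mfd R) (Z : set M) (n : nat).
Hypothesis mM : is_manifold M.
Hypothesis HS : forall z, Z z -> exists Q P W psi, @slice R M Z n z Q P W psi.

(** Charts of [Z] are ambient charts followed by [P]. Their transition maps are smooth because [psi]
    returns to ambient coordinates, and the half-space clause of [slice] makes the boundary of [Z]
    its intersection with that of [M]. *)
Lemma slice_charts : exists AI : charts R n (set_type Z),
  [/\ is_manifold (Mfd AI), embedding setT (val : Mfd AI -> M)
    & forall z : Mfd AI, mboundary (Mfd AI) z <-> mboundary M (val z)].
Proof.
have cM := manifold_charted mM.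
pose D := ((set 'rV[R]_(mdim M) * 'M[R]_(mdim M, n)) * (set 'rV[R]_n * ('rV[R]_n -> 'rV[R]_(mdim M))))%type.
have HS' (z : set_type Z) : exists d : D, @slice R M Z n (val z) d.1.1 d.1.2 d.2.1 d.2.2.
  have [Q [P [W [psi H]]]] := HS (set_valP z).
  by exists ((Q, P), (W, psi)).
have [d Hd] := choice HS'.
pose AI : charts R n (set_type Z) := Charts
  (fun z : set_type Z => [set q : set_type Z | mdom (val z) (val q) /\ (d z).1.1 (mmap (val z) (val q))])
  (fun z q : set_type Z => mmap (val z) (val q) *m (d z).1.2).
have domE (z q : Mfd AI) : mdom z q = (mdom (val z) (val q) /\ (d z).1.1 (mmap (val z) (val q))) by [].
have mapE (z q : Mfd AI) : mmap z q = mmap (val z) (val q) *m (d z).1.2 by [].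
have domN (z q : Mfd AI) : mdom z q -> nbhs q (mdom z).
  rewrite domE => -[Dq Qq]; have [[oQ _] _ _ _ _] := Hd z.
  apply/subtype_nbhsP; exists (mdom (val z) `&` mmap (val z) @^-1` (d z).1.1).
    apply: filterI; first exact (mdom_nbhs cM Dq).
    by apply: (mmap_cont cM Dq); exact: open_nbhs_nbhs.
  by [].
have psiE (z q : Mfd AI) : mdom z q -> (d z).2.1 (mmap z q) /\ (d z).2.2 (mmap z q) = mmap (val z) (val q).
  rewrite domE => -[Dq Qq]; have [_ _ H _ _] := Hd z.
  by have [] := H (val q) (set_valP q) Dq Qq.
have im (z : Mfd AI) y : (mmap z @` mdom z) y <->
    (d z).2.1 y /\ (mboundary M (val z) -> @half_space R n y).
  have [[oQ Qz] _ H1 H2 [H3 H4]] := Hd z; split.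
    move=> [q Dq <-]; have [Wq pq] := psiE z q Dq; split=> // b.
    have [_ pres] := H4 b; have [i0 [i00 [Qh _ Eh] _]] := (bdry_chart mM (mdom_refl cM (val z))).1 b.
    have [hq _] : (@half_space R (mdim M) `&` Qh) (mmap (val z) (val q)).
      by rewrite -Eh; exists (val q) => //; have [] := Dq.
    by move=> j j0; rewrite mapE (pres _ i0 j i00 j0); exact: hq.
  move=> [Wy hy]; have [q [Zq Dq Qq Eq]] := H3 y Wy hy.
  exists (@exist _ _ q (mem_set Zq) : set_type Z); first by split.
  by rewrite mapE /= Eq H2.
exists AI.
have mAI : is_manifold (Mfd AI).
  have [hM scM _] := mM; split.
  - exact: subtype_hausdorff.
  - exact: subtype_second_countable.
  move=> z; have [[oQ Qz] [oW spsi] H1 H2 [H3 H4]] := Hd z; split.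
  - by rewrite openE => q Dq; exact: domN.
  - by split=> //; exact: mdom_refl.
  - apply/homeo_ontoP; split.
    + split; first by move=> q Dq; exists q.
        move=> q q' /set_mem Dq /set_mem Dq' E; apply: val_inj.
        apply: (mmap_inj cM Dq.1 Dq'.1).
        by rewrite -(psiE z q Dq).2 -(psiE z q' Dq').2 E.
      by move=> _ [q Dq <-]; exists q.
    + move=> q Dq; apply: cvg_within_filter.
      apply: (@continuous_comp _ _ _ (fun q : set_type Z => mmap (val z) (val q)) (fun u => u *m (d z).1.2)); last exact: mulmxr_continuous.
      apply: (@continuous_comp _ _ _ (val : set_type Z -> M) (mmap (val z))); first exact: subtype_cont.
      exact (mmap_cont cM Dq.1).
    + move=> q A Dq /subtype_nbhsP[B nB BA].
      have [Q' [oQ' Q'q Q'B]] := chart_nbhs cM Dq.1 nB.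
      exists ((d z).2.1 `&` (d z).2.2 @^-1` Q'); split.
      * exact: open_preim.
      * by have [Wq pq] := psiE z q Dq; split=> //=; rewrite pq.
      * move=> q' Dq' [_ /=]; have [Wq' ->] := psiE z q' Dq' => Q'q'.
        by apply: BA; apply: Q'B => //; exact: Dq'.1.
  - have [b|nb] := pselect (mboundary M (val z)).
      right; exists (d z).2.1 => //.
      apply/seteqP; split=> y; first by move=> /im[Wy /(_ b)].
      by move=> [hy Wy]; apply/im; split.
    left; rewrite (_ : mmap z @` mdom z = (d z).2.1) //.
    by apply/seteqP; split=> y; [move=> /im[]|move=> Wy; apply/im].
  - move=> z' q Dq Dq'.
    have [_ _ _ _ tr] := cM (val z); have [Q' [k [oQ' Q'q sk Hk]]] := tr (val z') (val q) Dq.1 Dq'.1.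
    exists ((d z).2.1 `&` (d z).2.2 @^-1` Q'), (fun y => k ((d z).2.2 y) *m (d z').1.2).
    have oP := open_preim oW oQ' spsi.
    split=> //.
    + by have [Wq pq] := psiE z q Dq; split=> //=; rewrite pq.
    + move=> kk; apply: Ck_mulmxr => //; move: kk.
      apply: (smooth_comp oP oQ') sk; first by move=> y [].
      by apply: smooth_sub spsi => y [].
    + move=> q' [Eq' Fq'] _ [_ /=]; have [_ ->] := psiE z q' Eq' => Q'q'.
      by rewrite Hk //; [split; [exact: Eq'.1|exact: Fq'.1]|exact: Eq'.1].
have cAI := manifold_charted mAI.
split=> //.
- have cr (z : Mfd AI) : coord_rep z (setT `&` (val : Mfd AI -> M) @^-1` mdom (val z))
      (mmap (val z) \o (val : Mfd AI -> M)) z (d z).2.1 (d z).2.2.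
    have [[oQ Qz] [oW spsi] _ _ _] := Hd z.
    have zz : mdom z z by split=> //; exact: mdom_refl.
    split=> //; first by have [] := psiE z z zz.
    by move=> q _ Dq _; have [] := psiE z q Dq.
  split.
  + move=> z _; split; first by apply: cvg_within_filter; exact: subtype_cont.
    by exists (d z).2.1, (d z).2.2; exact: cr.
  + apply/homeo_ontoP; split.
    * split; [by move=> q _; exists q|by move=> q q' _ _; exact: val_inj|by move=> _ [q _ <-]; exists q].
    * by move=> q _; apply: cvg_within_filter; exact: subtype_cont.
    * move=> q A _ /subtype_nbhsP[B]; rewrite nbhsE => -[B' [oB' B'q] B'B] BA.
      by exists B'; split=> // q' _ /B'B/BA.
  + move=> z _; apply/eqP; rewrite -subv0; apply/subvP => v; rewrite memv_ker memv0 => /eqP dv.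
    have [[oQ Qz] [oW spsi] H1 H2 [H3 H4]] := Hd z.
    have zz : mdom z z by split=> //; exact: mdom_refl.
    have tS : thickS (setT `&` (val : Mfd AI -> M) @^-1` mdom (val z)) z z.
      apply: thickS_nbhs => //; rewrite setTI; apply: subtype_cont.
      exact (mdom_nbhs cM (mdom_refl cM _)).
    move: dv; rewrite /mdiff (rdiffP tS (cr z)) => dv.
    have [Wz pz] := psiE z z zz.
    have : jac (fun y : 'rV[R]_n => y) (mmap z z) = jac (d z).2.2 (mmap z z) *m (d z).1.2.
      rewrite -[X in _ *m X](jac_mulmxr _ ((d z).2.2 (mmap z z))) -jac_comp.
      + apply: esym; apply: (jac_eq oW Wz); last exact: smooth_id.
        by move=> y Wy /=; rewrite H2.
      + exact: smooth_diff spsi Wz.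
      + exact: (smooth_diff (smooth_mulmxr _ openT) I).
    rewrite jac_id => E; apply/eqP.
    by rewrite -[LHS]mulmx1 E mulmxA dv mul0mx.
- move=> z; have zz : mdom z z by split; [exact: mdom_refl|have [[]] := Hd z].
  have [b|nb] := pselect (mboundary M (val z)).
    split=> // _; apply/(bdry_chart mAI zz).
    have [i0 [i00 _ z0]] := (bdry_chart mM (mdom_refl cM (val z))).1 b.
    have [_ [oW _] _ _ [_ H4]] := Hd z; have [n0 pres] := H4 b.
    exists (Ordinal n0); split=> //; last by rewrite mapE (pres _ i0 (Ordinal n0) i00 erefl).
    exists (d z).2.1 => //; apply/seteqP; split=> y; first by move=> /im[Wy /(_ b)].
    by move=> [hy Wy]; apply/im; split.
  split=> // bz; exfalso; apply: bz.
  have [_ [oW _] _ _ _] := Hd z.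
  rewrite (_ : mmap z @` mdom z = (d z).2.1).
    by apply: open_nbhs_nbhs; split=> //; have [] := psiE z z zz.
  by apply/seteqP; split=> y; [move=> /im[]|move=> Wy; apply/im].
Qed.

End SliceCharts.

(** * Immersions and local diffeomorphisms *)

Section LocalDiffeos.
Variable R : realType.
Implicit Types M N L : mfd R.

Lemma lker0_inj (aT rT : vectType R) (f : 'Hom(aT, rT)) v : lker f = 0%VS -> f v = 0 -> v = 0.
Proof. by move=> lk fv; apply/eqP; rewrite -memv0 -lk memv_ker fv. Qed.

Lemma lker0_intro (aT rT : vectType R) (f : 'Hom(aT, rT)) :
  (forall v, f v = 0 -> v = 0) -> lker f = 0%VS.
Proof.
move=> H; apply/eqP; rewrite -subv0; apply/subvP => v; rewrite memv_ker memv0 => /eqP fv.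
by apply/eqP; exact: H.
Qed.

Lemma smooth_at_charts M N (S : set M) (f : M -> N) p x y : charted M -> charted N ->
  S p -> smooth_at S f p -> mdom x p -> mdom y (f p) ->
  exists Q g, coord_rep x (S `&` f @^-1` mdom y) (mmap y \o f) p Q g.
Proof.
move=> cM cN Sp [cf [Q [g cr]]] Dx Dy.
have fp := mdom_refl cN (f p).
have [_ _ _ _ tr] := cN (f p); have [Q' [k crk]] := tr y (f p) fp Dy.
have [W nW HW] := within_near cf (filterI (mdom_nbhs cN fp) (mdom_nbhs cN Dy)).
have cr1 : coord_rep p ((S `&` f @^-1` mdom (f p)) `&` f @^-1` mdom y) (mmap (f p) \o f) p Q g.
  by apply: crep_sub cr => q [].
have cr2 := crep_comp (conj (conj Sp fp) Dy) (mdom_refl cM p)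
  (fun q (Hq : ((S `&` f @^-1` mdom (f p)) `&` f @^-1` mdom y) q) _ => conj (conj Hq.1.2 Hq.2) Hq.1.2) cr1 crk.
have [Q3 [_ cr3 _]] := crep_local (S := S `&` f @^-1` mdom y) cM (mdom_refl cM p) nW
  (fun q H => conj (conj H.1.1 (HW q H.2 H.1.1).1) H.1.2) cr2.
exact: (crep_chart cM Dx (mdom_refl cM p) cr3).
Qed.

Lemma mdiff_jac M N (S : set M) (f : M -> N) p Q g : charted M -> charted N ->
  thickS S p p -> f x @[x --> within S (nbhs p)] --> f p ->
  coord_rep p (S `&` f @^-1` mdom (f p)) (mmap (f p) \o f) p Q g ->
  forall v, mdiff S f p v = v *m jac g (mmap p p).
Proof.
move=> cM cN tS cf cr; have [W nW HW] := within_near cf (mdom_nbhs cN (mdom_refl cN (f p))).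
apply: rdiffP cr; apply: (thickS_sub cM (mdom_refl cM p) tS nW) => q [Sq Wq].
by split=> //; exact: HW.
Qed.

(** At an interior point an immersion between equal dimensions covers a full coordinate
    neighbourhood of its image, which is therefore interior. *)
Lemma interior_map M N (S : set M) (f : M -> N) p : charted M -> charted N ->
  mdim M = mdim N -> nbhs p S -> smooth_at S f p -> lker (mdiff S f p) = 0%VS ->
  ~ mboundary M p -> ~ mboundary N (f p).
Proof.
move=> cM cN dMN nS [cf [Q [g cr]]] lk /contrapT int; apply.
have pp := mdom_refl cM p; have fp := mdom_refl cN (f p).
have [W nW HW] := within_near cf (mdom_nbhs cN fp).
have nS' : nbhs p (S `&` f @^-1` mdom (f p)).
  apply: filterS (filterI nS nW) => q [Sq Wq]; split=> //; exact: HW.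
have E := mdiff_jac cM cN (thickS_nbhs cM pp nS) cf cr.
have : nbhs (mmap (f p) (f p)) (mmap (f p) @` (mdom (f p) `&` f @` (S `&` f @^-1` mdom (f p)))).
  apply: interior_image cr _ int => //; first by move=> q [].
  by move=> v; rewrite -E; exact: lker0_inj.
by apply: filterS => _ [q [Dq _] <-]; exists q.
Qed.

(** The differential of the identity with [mdiff] unfolded, the shape in which it appears after
    rewriting a base point. *)
Lemma mdiff_id M (S : set M) p v : charted M -> thickS S p p ->
  rdiff (S `&` mdom p) (mmap p) p v = v.
Proof.
move=> cM tS.
have cr : coord_rep p (S `&` mdom p) (mmap p) p setT (fun y => y).
  by split=> //; [exact: openT|exact: smooth_id].
rewrite (rdiffP _ cr) ?jac_id ?mulmx1 //.
apply: (thickS_sub cM (mdom_refl cM p) tS (mdom_nbhs cM (mdom_refl cM p))) => q.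
exact: id.
Qed.

Lemma mdiff_cancel M N (S : set M) (S' : set N) (f : M -> N) (g : N -> M) p :
  charted M -> charted N -> thickS S p p -> thickS S' (f p) (f p) ->
  (forall q, S q -> S' (f q)) -> (forall q, S q -> g (f q) = q) ->
  smooth_at S f p -> smooth_at S' g (f p) ->
  forall v : tangent p, (mdiff S' g (f p) (mdiff S f p v) : 'rV[R]_(mdim M)) = v.
Proof.
move=> cM cN tS tS' Sf gf sf sg v.
have Sp := thickS_mem cM (mdom_refl cM p) tS.
have H := mdiff_comp cM cN cM tS tS' Sf sf sg.
have -> : mdiff S' g (f p) (mdiff S f p v) = mdiff S (g \o f) p v by rewrite H comp_lfunE.
rewrite /mdiff [(g \o f) p](gf p Sp).
rewrite -[RHS](mdiff_id v cM tS); congr (fun_of_lfun _ _).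
apply: (rdiff_ext cM).
- have [cf _] := smooth_at_comp cM cN cM Sp Sf sf sg.
  have [W nW HW] := within_near cf (mdom_nbhs cM (mdom_refl cM _)).
  apply: (thickS_sub cM (mdom_refl cM p) tS nW) => q [Sq Wq]; split=> //=.
  by rewrite -[p](gf p Sp); exact: HW.
- apply: (thickS_sub cM (mdom_refl cM p) tS (mdom_nbhs cM (mdom_refl cM p))) => q; exact: id.
- exists setT; first exact: filterT.
  by move=> q _ [Sq /=]; rewrite gf.
exists setT, (fun y => y); split=> //; [exact: openT|exact: smooth_id].
Qed.

(** A right inverse [C] of the Jacobian of [i] (acting on row vectors) turns the coordinate form [g]
    of [i] into a local diffeomorphism [y |-> g y C]. Its inverse [k] recovers [f] from the
    coordinates of the composite of [i] with [f]. Continuity of [f] is needed beforehand to keep [f]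
    inside the chart. *)
Lemma immersion_lift L M N (S : set L) (S' : set N) (f : L -> N) (i : N -> M) p :
  charted L -> charted M -> charted N -> S p ->
  f x @[x --> within S (nbhs p)] --> f p ->
  nbhs (f p) S' -> smooth_at S' i (f p) -> lker (mdiff S' i (f p)) = 0%VS ->
  smooth_at S (i \o f) p -> smooth_at S f p.
Proof.
move=> cL cM cN Sp cf nS' [ci [Q [g cr]]] lk sif; split=> //.
have ff := mdom_refl cN (f p); have S'f := nbhs_singleton nS'.
have E := mdiff_jac cN cM (thickS_nbhs cN ff nS') ci cr.
have rf : row_free (jac g (mmap (f p) (f p))).
  by apply/inj_row_free => v; rewrite -E; exact: lker0_inj.
have [C gC] := row_freeP rf.
have [oQ Qf sg Hg] := cr.
have sh : smooth_open Q (fun y => g y *m C) by move=> k; apply: Ck_mulmxr.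
have Jh : jac (fun y => g y *m C) (mmap (f p) (f p)) = 1%:M.
  rewrite -[LHS]/(jac ((fun y => y *m C) \o g) _) jac_comp ?jac_mulmxr //.
    exact: smooth_diff sg Qf.
  exact: (smooth_diff (smooth_mulmxr C openT) I).
have [U [k [oU [Uf UQ] oV sk kK]]] := inverse_function (B := 1%:M) oQ Qf sh
  (etrans (congr1 (mulmx^~ _) Jh) (mulmx1 _)) (etrans (congr1 (mulmx _) Jh) (mulmx1 _)).
have if_ := mdom_refl cM (i (f p)).
have [Q1 [G crG]] := smooth_at_charts cL cM Sp sif (mdom_refl cL p) if_.
have [oQ1 Q1p sG HG] := crG.
have [W2 nW2 HW2] := within_near ci (mdom_nbhs cM if_).
pose W1 := (S' `&` mdom (f p)) `&` (mmap (f p) @^-1` U `&` W2).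
have nW1 : nbhs (f p) W1.
  apply: filterI; first by apply: filterI => //; exact (mdom_nbhs cN ff).
  apply: filterI => //; apply: (mmap_cont cN ff).
  by apply: open_nbhs_nbhs; split.
have [W nW HW] := within_near cf nW1.
have sGC : smooth_open Q1 (fun y => G y *m C) by move=> j; apply: Ck_mulmxr.
pose V := [set g y *m C | y in U].
have oV1 := open_preim oQ1 oV sGC.
have key q : S q -> W1 (f q) -> mdom p q -> Q1 (mmap p q) ->
    V (G (mmap p q) *m C) /\ k (G (mmap p q) *m C) = mmap (f p) (f q).
  move=> Sq [[S'q Dq] [Uq W2q]] Dpq Q1q.
  have iq : mdom (i (f p)) (i (f q)) by exact: HW2.
  have E1 : G (mmap p q) = g (mmap (f p) (f q)).
    by rewrite (HG q (conj Sq iq) Dpq Q1q) (Hg (f q) (conj S'q iq) Dq (UQ _ Uq)).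
  by rewrite E1; split; [exists (mmap (f p) (f q))|exact: kK].
have cr1 : coord_rep p ((S `&` f @^-1` mdom (f p)) `&` f @^-1` W1) (mmap (f p) \o f) p
    (Q1 `&` (fun y => G y *m C) @^-1` V) (k \o (fun y => G y *m C)).
  split=> //.
  - by split=> //; have [] := key p Sp (nbhs_singleton nW1) (mdom_refl cL p) Q1p.
  - by apply: (smooth_comp oV1 oV) sk; [move=> y []|apply: smooth_sub sGC => y []].
  - by move=> q [[Sq _] W1q] Dq [Q1q _]; have [] := key q Sq W1q Dq Q1q.
have [Q3 [_ cr3 _]] := crep_local (S := S `&` f @^-1` mdom (f p)) cL (mdom_refl cL p) nW
  (fun q H => conj H.1 (HW q H.2 H.1.1)) cr1.
by exists Q3, (k \o (fun y => G y *m C)).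
Qed.

(* Near a boundary point, the intermediate value theorem along a segment shows
   that the local inverse maps the half space into the half space. *)
Lemma local_diffeo_image M N (S : set M) (f : M -> N) p :
  is_manifold M -> is_manifold N -> mdim M = mdim N -> nbhs p S ->
  smooth_at S f p -> lker (mdiff S f p) = 0%VS ->
  (forall q, S q -> mboundary M q <-> mboundary N (f q)) ->
  nbhs (f p) (f @` S).
Proof.
move=> mM mN dMN nS [cf [Q0 [g cr0]]] lk bdry.
have cM := manifold_charted mM; have cN := manifold_charted mN.
have pp := mdom_refl cM p; have fp := mdom_refl cN (f p).
have Sp := nbhs_singleton nS.
have [W nW HW] := within_near cf (mdom_nbhs cN fp).
pose S1 := S `&` f @^-1` mdom (f p).
have nS1 : nbhs p S1 by apply: filterS (filterI nS nW) => q [Sq Wq]; split=> //; exact: HW.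
have E := mdiff_jac cM cN (thickS_nbhs cM pp nS) cf cr0.
suff [Qo Of OS] : exists2 Qo : set 'rV[R]_(mdim N), open_nbhs (mmap (f p) (f p)) Qo &
    forall w, mdom (f p) w -> Qo (mmap (f p) w) -> (f @` S) w.
  apply: filterS (filterI (mdom_nbhs cN fp) (mmap_cont cN fp (open_nbhs_nbhs Of))).
  by move=> w [Dw Qw]; exact: OS.
have [b|nb] := pselect (mboundary M p); last first.
  have int : nbhs (mmap p p) (mmap p @` mdom p) by exact: contrapT.
  have : nbhs (mmap (f p) (f p)) (mmap (f p) @` (mdom (f p) `&` f @` S1)).
    apply: interior_image cr0 _ int => //; first by move=> q [].
    by move=> v; rewrite -E; exact: lker0_inj.
  rewrite nbhsE => -[Qo oQo OI]; exists Qo => // w Dw /OI[w' [Dw' [q [Sq _] Eq]] Ew].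
  by rewrite -(mmap_inj cN Dw' Dw Ew); exists q.
have [i0 [i00 [Qh oQh Eh] p0]] := (bdry_chart mM pp).1 b.
have [j0 [j00 [Qh' oQh' Eh'] fp0]] := (bdry_chart mN fp).1 ((bdry p Sp).1 b).
have [Q1 [_ cr1 Q1S]] := crep_local cM pp nS1 (fun q H => H.1) cr0.
have Qhp : Qh (mmap p p).
  by have : (mmap p @` mdom p) (mmap p p) by [exists p]; rewrite Eh => -[].
have cr := crep_shrink oQh Qhp cr1; have [oQ Qp sg Hg] := cr.
have rf : row_free (jac g (mmap p p)).
  by apply/inj_row_free => v; rewrite -E; exact: lker0_inj.
have [|B [AB BA]] := full_inverse dMN (A := jac g (mmap p p)).
  by rewrite /row_full (eqP rf) dMN.
have [U [k [oU [Up UQ] oV sk kK]]] := inverse_function oQ Qp sg AB BA.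
have Gp : g (mmap p p) = mmap (f p) (f p) by exact: Hg.
have nV : nbhs (mmap (f p) (f p)) (g @` U).
  by apply: open_nbhs_nbhs; split=> //; exists (mmap p p).
have /nbhs_ballP[r /= r0 rV] := nV.
exists (ball (mmap (f p) (f p)) r); first by split; [exact: ball_open|exact: ballxx].
have chartU u : U u -> 0 <= u ord0 i0 -> exists q, [/\ mdom p q, S1 q, mmap p q = u & g u = mmap (f p) (f q)].
  move=> Uu u0; have [Q1u Qhu] := UQ u Uu.
  have : (mmap p @` mdom p) u.
    by rewrite Eh; split=> // i i_0; rewrite (_ : i = i0) //; apply: val_inj; rewrite /= i00.
  move=> [q Dq Eq]; rewrite -Eq in Uu u0 Q1u Qhu *; have S1q : S1 q by exact: Q1S.
  by exists q; split=> //; rewrite Hg.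
have bchart u q : mdom p q -> mmap p q = u -> mboundary M q <-> u ord0 i0 = 0.
  move=> Dq <-; rewrite (bdry_chart mM Dq); split.
    by move=> [i [i_0 _ <-]]; congr (mmap p q _ _); apply: val_inj; rewrite /= i00.
  by move=> u0; exists i0; split=> //; exists Qh.
have bchart' w : mdom (f p) w -> mboundary N w <-> mmap (f p) w ord0 j0 = 0.
  move=> Dw; rewrite (bdry_chart mN Dw); split.
    by move=> [i [i_0 _ <-]]; congr (mmap (f p) w _ _); apply: val_inj; rewrite /= j00.
  by move=> u0; exists j0; split=> //; exists Qh'.
have half' w : mdom (f p) w -> 0 <= mmap (f p) w ord0 j0.
  move=> Dw; have : (mmap (f p) @` mdom (f p)) (mmap (f p) w) by exists w.
  by rewrite Eh' => -[H _]; exact: H.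
move=> w Dw bw; set y' := mmap (f p) w.
have [u Uu gu] := rV y' bw.
have [u0|u0] := leP 0 (u ord0 i0).
  have [q [Dq [Sq fq] Eq Egu]] := chartU u Uu u0; exists q => //.
  by apply: (mmap_inj cN fq Dw); rewrite -Egu gu.
(* The preimage [u] of [y'] has negative first coordinate. The segment from [g u1], with [u1] in the
   open half space, to [y'] pulls back to a path that meets the zero level at some [u2], a boundary
   point. So the first coordinate of [g u2], a convex combination of a positive and a nonnegative
   number, is 0; this forces [s = 1], that is [u2 = u], against the sign of [u]. *)
exfalso.
have [u1 [Uu1 u10 bu1]] : exists u1, [/\ U u1, 0 < u1 ord0 i0 & ball (mmap (f p) (f p)) r (g u1)].
  have cg : {for mmap p p, continuous g} by exact: smooth_cont sg Qp.
  have : nbhs (mmap p p) (U `&` g @^-1` ball (mmap (f p) (f p)) r).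
    apply: filterI; first exact: open_nbhs_nbhs.
    by apply: cg; rewrite Gp; exact: nbhsx_ballx.
  move=> /nbhs_ballP[e /= e0 eU].
  have e20 : 0 < e / 2 by rewrite divr_gt0.
  have be : ball (mmap p p) e (mmap p p + (e / 2) *: delta_mx ord0 i0).
    rewrite -ball_normE /= opprD addrA subrr sub0r normrN.
    apply: le_lt_trans (_ : _ <= e / 2) _; last by rewrite ltr_pdivrMr // ltr_pMr // ltr1n.
    apply: mx_norm_le => [|i j]; first exact: ltW.
    rewrite !mxE; case: (_ && _); last by rewrite mulr0 normr0 ltW.
    by rewrite mulr1 gtr0_norm.
  have [Ue ge] := eU _ be; exists (mmap p p + (e / 2) *: delta_mx ord0 i0); split=> //.
  by rewrite !mxE !eqxx p0 mulr1 add0r.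
have g1pos : 0 < g u1 ord0 j0.
  have [q [Dq [Sq fq] Eq Egu]] := chartU u1 Uu1 (ltW u10).
  rewrite lt_def Egu half' // andbT; apply/eqP => H.
  have := (bchart u1 q Dq Eq).1 ((bdry q Sq).2 ((bchart' _ fq).2 H)).
  by move=> H1; rewrite H1 ltxx in u10.
pose c (s : R) := g u1 + s *: (y' - g u1).
have bc (s : R) : s \in `[0, 1] -> (g @` U) (c s).
  rewrite in_itv /= => /andP[s0 s1]; apply: rV.
  move: bw bu1; rewrite -!ball_normE /= => bw bu1.
  have -> : mmap (f p) (f p) - c s = s *: (mmap (f p) (f p) - y') + (1 - s) *: (mmap (f p) (f p) - g u1).
    by apply/matrixP => a a'; rewrite !mxE; ring.
  rewrite (le_lt_trans (ler_normD _ _)) // !normrZ !ger0_norm ?subr_ge0 //.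
  have [->|s0'] := eqVneq s 0; first by rewrite mul0r add0r subr0 mul1r.
  have {}s0' : 0 < s by rewrite lt_def s0'.
  rewrite [ltRHS](_ : r = s * r + (1 - s) * r); last by ring.
  by rewrite ltr_leD // ?ltr_pM2l // ler_wpM2l ?subr_ge0 // ltW.
pose h (s : R) := k (c s) ord0 i0.
have ch : {within `[0, 1], continuous h}.
  apply: continuous_in_subspaceT => s /set_mem hs.
  have kc : {for c s, continuous k} by exact: smooth_cont sk (bc s hs).
  have cc : {for s, continuous c}.
    apply: continuousD; first exact: cst_continuous.
    exact: scalel_continuous.
  apply: (@continuous_comp _ _ _ (fun s => k (c s)) (fun M : 'rV[R]_(mdim M) => M ord0 i0)); last exact: coord_continuous.
  exact: (@continuous_comp _ _ _ c k).
have h0 : h 0 = u1 ord0 i0 by rewrite /h /c scale0r addr0 kK.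
have h1 : h 1 = u ord0 i0 by rewrite /h /c scale1r addrC subrK -gu kK.
have hr : Num.min (h 0) (h 1) <= 0 <= Num.max (h 0) (h 1).
  by rewrite h0 h1 ge_min (ltW u0) orbT le_max (ltW u10).
have [s s01 hs] := IVT ler01 ch hr.
have [u2 Uu2 gu2] := bc s s01.
have u20 : u2 ord0 i0 = 0 by rewrite -(kK u2 Uu2) gu2.
have [|q [Dq [Sq fq] Eq Egu]] := chartU u2 Uu2; first by rewrite u20.
have := (bchart' _ fq).1 ((bdry q Sq).1 ((bchart u2 q Dq Eq).2 u20)).
rewrite -Egu gu2 /c !mxE => H.
have y0 : 0 <= y' ord0 j0 by exact: half'.
move: s01; rewrite in_itv /= => /andP[s0 s1].
have s_1 : s = 1.
  apply/eqP; rewrite eq_le s1 /= leNgt; apply/negP => ls1.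
  have : 0 < (1 - s) * g u1 ord0 j0 by rewrite mulr_gt0 // subr_gt0.
  have : 0 <= s * y' ord0 j0 by rewrite mulr_ge0.
  move: H; lra.
by move: u0; rewrite -h1 -s_1 hs ltxx.
Qed.

End LocalDiffeos.

(** * Gluing along open embeddings *)

Section Gluing.
Variables (R : realType) (n : nat) (T : topologicalType) (I : finType).
Variables (X : I -> topologicalType) (AI : forall i, charts R n (X i)).
Variable f : forall i, X i -> T.
Hypothesis mI : forall i, is_manifold (Mfd (AI i)).
Hypothesis hT : hausdorff_space T.
Hypothesis f_inj : forall i, injective (@f i).
Hypothesis f_cont : forall i, continuous (@f i).
Hypothesis f_open : forall i A, open A -> open (@f i @` A).
Hypothesis f_cov : forall q, exists s : {i & X i}, @f (projT1 s) (projT2 s) = q.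
Hypothesis f_trans : forall i j (x : X i) (y : X j), f x = f y ->
  exists (S : set (X i)) (tau : X i -> X j), [/\ nbhs x S,
    forall q, S q -> f (tau q) = f q & @smooth_at R (Mfd (AI i)) (Mfd (AI j)) S tau x].

(** The chart around [q] is the chart around a chosen preimage of [q], transported by [f].
    Transition maps between different pieces are coordinate forms of the maps [tau] of [f_trans];
    second countability survives because the index type is finite. *)
Lemma glue_charts : exists A : charts R n T, is_manifold (Mfd A) /\
  forall i, open (range (@f i)) /\
    @diffeo R (Mfd (AI i)) (Mfd A) setT (range (@f i)) (@f i).
Proof.
have cI i := manifold_charted (mI i).
have [r rP] := choice f_cov.
pose ix q := projT1 (r q); pose xx q : X (ix q) := projT2 (r q).
have fxx q : f (xx q) = q by exact: rP.
pose inv i (x0 : X i) q : X i := xget x0 [set x | f x = q].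
have invE i (x0 x : X i) : inv i x0 (f x) = x.
  by rewrite /inv; case: xgetP => [y _ /f_inj//|/(_ x)]; case.
pose dom q := @f (ix q) @` @mdom R (Mfd (AI (ix q))) (xx q).
pose map q q' := @mmap R (Mfd (AI (ix q))) (xx q) (inv _ (xx q) q').
pose A : charts R n T := Charts dom map.
have domP q (x : X (ix q)) : dom q (f x) <-> @mdom R (Mfd (AI (ix q))) (xx q) x.
  by split=> [[y Dy /f_inj <-]//|Dx]; exists x.
have mapP q (x : X (ix q)) : map q (f x) = @mmap R (Mfd (AI (ix q))) (xx q) x.
  by rewrite /map invE.
(* Each [f i] has a smooth expression from any chart of its source into any glued chart: near [a] it
   coincides with [tau] followed by the chart of the chosen preimage. *)
have G i (a x : X i) q2 : dom q2 (f a) -> @mdom R (Mfd (AI i)) x a ->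
    exists Q g, @coord_rep R (Mfd (AI i)) n x (@f i @^-1` dom q2) (map q2 \o @f i) a Q g.
  move=> [b Db fb] Da; have [S [tau [nS ftau stau]]] := f_trans (esym fb).
  have tab : tau a = b by apply: f_inj; rewrite ftau //; exact: nbhs_singleton nS.
  have Dta : @mdom R (Mfd (AI (ix q2))) (xx q2) (tau a) by rewrite tab.
  have [Q [g cr]] := smooth_at_charts (cI i) (cI (ix q2)) (nbhs_singleton nS) stau Da Dta.
  have [Q' [_ [oQ' Q'a sg H] Q'S]] := crep_local (S := S `&` @f i @^-1` dom q2) (cI i) Da nS
    (fun q (Hq : ((S `&` @f i @^-1` dom q2) `&` S) q) =>
      conj Hq.1.1 ((domP q2 (tau q)).1 (eq_ind_r (dom q2) Hq.1.2 (ftau q Hq.1.1)))) cr.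
  exists Q', g; split=> // q Dq Dxq Qq; have Sq := Q'S q Dxq Qq.
  by rewrite H //= -mapP ftau.
have TR q (S : set T) m (h : T -> 'rV[R]_m) b Q g : @mdom R (Mfd (AI (ix q))) (xx q) b ->
    @coord_rep R (Mfd (AI (ix q))) m (xx q) (@f (ix q) @^-1` S) (h \o @f (ix q)) b Q g ->
    @coord_rep R (Mfd A) m q S h (f b) Q g.
  move=> Db [oQ Qb sg H]; split=> //; first by rewrite /mmap /= mapP.
  move=> q0 Sq [q' Dq' E0]; rewrite -E0 in Sq *.
  by rewrite /mmap /= mapP => Qq; exact: H.
have dom_open q : open (dom q) by apply: f_open; exact: (mdom_open (cI (ix q))).
have domx q : dom q q.
  by exists (xx q) => //; exact: (mdom_refl (cI (ix q))).
have im q : map q @` dom q = @mmap R (Mfd (AI (ix q))) (xx q) @` @mdom R (Mfd (AI (ix q))) (xx q).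
  apply/seteqP; split=> y.
    by move=> [_ [x Dx <-] <-]; exists x => //; rewrite mapP.
  by move=> [x Dx <-]; exists (f x); [exists x|rewrite mapP].
exists A; split; last first.
  move=> i; split; first by apply: f_open; exact: openT.
  split.
  - by split=> [x _|x y _ _ /f_inj|_ [x _ <-]]; [exists x| |exists x].
  - move=> a _; split; first by apply: cvg_within_filter; exact: f_cont.
    have [Q [g cr]] := G i a a (f a) (domx _) (mdom_refl (cI i) a).
    by exists Q, g; apply: crep_sub cr => q [].
  - move=> [_ [x0 _ _]]; exists (inv i x0); split; first by move=> x _; exact: invE.
    move=> p [a _ fa]; have ga : inv i x0 p = a by rewrite -fa invE.
    split.
      apply/cvg_withinP => W; rewrite ga nbhsE => -[W' [oW' W'a] W'W].
      have : nbhs p (@f i @` W') by apply: open_nbhs_nbhs; split; [exact: f_open|exists a].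
      by apply: filterS => _ [w W'w <-] _; rewrite /= invE; exact: W'W.
    have [S [tau [nS ftau stau]]] := f_trans (etrans (fxx p) (esym fa)).
    have ta : tau (xx p) = a by apply: f_inj; rewrite ftau ?fxx //; exact: nbhs_singleton nS.
    have Dta : @mdom R (Mfd (AI i)) a (tau (xx p)) by rewrite ta; exact: (mdom_refl (cI i)).
    have Dxx : @mdom R (Mfd (AI (ix p))) (xx p) (xx p) by exact: (mdom_refl (cI (ix p))).
    have [Q [g cr]] := smooth_at_charts (cI (ix p)) (cI i) (nbhs_singleton nS) stau Dxx Dta.
    have tg q : S q -> inv i x0 (f q) = tau q by move=> Sq; rewrite -ftau // invE.
    have [Q' [_ [oQ' Q'a sg H] Q'S]] := crep_local
      (S := S `&` @f (ix p) @^-1` (inv i x0 @^-1` @mdom R (Mfd (AI i)) a)) (cI (ix p)) Dxx nS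
      (fun q (Hq : ((S `&` @f (ix p) @^-1` (inv i x0 @^-1` @mdom R (Mfd (AI i)) a)) `&` S) q) =>
        conj Hq.1.1 (eq_ind (inv i x0 (f q)) (@mdom R (Mfd (AI i)) a) Hq.1.2 (tau q) (tg q Hq.1.1))) cr.
    exists Q', g; rewrite ga -{2}(fxx p); apply: TR => //.
    split=> // q [_ Dq] Dxq Qq; have Sq := Q'S q Dxq Qq.
    by rewrite H //= ?tg // -[tau q]tg.
split=> //.
- have scI i : @second_countable (X i) by have [] := mI i.
  have scI' i : exists B : set (set T), [/\ countable B, forall b, B b -> open b
      & forall (x : X i) W, nbhs (f x) W -> exists b, [/\ B b, b (f x) & b `<=` W]].
    have [B cB [oB bB]] := scI i; exists [set @f i @` b | b in B]; split.
    - exact: (card_le_trans (card_image_le _ _)).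
    - by move=> _ [b Bb <-]; apply: f_open; exact: oB.
    - move=> x W nW; have [b [Bb bx] bW] := bB x _ (f_cont nW).
      exists (@f i @` b); split; [by exists b|by exists x|].
      by move=> _ [y /bW Wy <-].
  have [B HB] := choice scI'.
  exists (\bigcup_(i in setT) B i).
    by apply: bigcup_countable => [|i _]; [exact: countableP|have [] := HB i].
  split; first by move=> b [i _ Bb]; have [_ oB _] := HB i; exact: oB.
  move=> q W nW; have [_ _ bB] := HB (ix q); rewrite -(fxx q) in nW *.
  by have [b [Bb bx bW]] := bB _ _ nW; exists b => //; split=> //; exists (ix q).
move=> q; split.
- exact: dom_open.
- exact: domx.
- apply/homeo_ontoP; split.
  + split; first by move=> q' Dq'; exists q'.
      move=> _ _ /set_mem[x Dx <-] /set_mem[y Dy <-]; rewrite /mmap /= !mapP => E.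
      by rewrite (mmap_inj (cI (ix q)) Dx Dy E).
    by move=> _ [q' Dq' <-]; exists q'.
  + move=> _ [x Dx <-]; apply/cvg_withinP => W; rewrite /mmap /= mapP => nW.
    have nx : nbhs (x : X (ix q)) (@mmap R (Mfd (AI (ix q))) (xx q) @^-1` W) := mmap_cont (cI (ix q)) Dx nW.
    move: nx; rewrite nbhsE => -[W' [oW' W'x] W'W].
    have : nbhs (f x) (@f (ix q) @` W') by apply: open_nbhs_nbhs; split; [exact: f_open|exists x].
    by apply: filterS => _ [y W'y <-] _; rewrite /= mapP; exact: W'W.
  + move=> _ W [x Dx <-] nW.
    have nW' : nbhs x (@f (ix q) @^-1` W) by exact: f_cont.
    have [Q [oQ Qx QW]] := chart_nbhs (cI (ix q)) Dx nW'.
    exists Q; split=> //; first by rewrite /mmap /= mapP.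
    by move=> _ [y Dy <-]; rewrite /mmap /= mapP => Qy; exact: QW.
- rewrite -[mmap q @` mdom q]/(map q @` dom q) im.
  by have [_ _ /(_ (xx q)) []] := mI (ix q).
- move=> q2 _ [x Dx <-] D2.
  have [Q [g cr]] := G (ix q) x (xx q) q2 D2 Dx.
  by exists Q, g; apply: TR => //; apply: crep_sub cr => y [].
Qed.

End Gluing.

Section DiffeoFacts.
Variables (R : realType) (M N : mfd R) (S : set M) (S' : set N) (f : M -> N).
Hypotheses (cM : charted M) (cN : charted N).
Hypothesis df : diffeo S S' f.

Lemma diffeo_inverse : S !=set0 -> exists g : N -> M,
  [/\ forall x, S x -> g (f x) = x, forall y, S' y -> S (g y) /\ f (g y) = y,
      smooth_on S f & smooth_on S' g].
Proof.
move=> [x Sx]; have [[fS inj sur] sf H] := df.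
have [|g [gf sg]] := H; first by exists (f x); exact: fS.
exists g; split=> // y S'y; have [z Sz <-] := sur y S'y.
by rewrite gf.
Qed.

Lemma diffeo_lker p : thickS S p p -> thickS S' (f p) (f p) -> lker (mdiff S f p) = 0%VS.
Proof.
move=> tS tS'; have Sp := thickS_mem cM (mdom_refl cM p) tS.
have [g [gf fg sf sg]] := diffeo_inverse (ex_intro _ p Sp).
have [[fS _ _] _ _] := df.
apply: lker0_intro => v fv.
by rewrite -(mdiff_cancel cM cN tS tS' fS gf (sf p Sp) (sg (f p) (fS _ Sp)) v) fv linear0.
Qed.

(** Both [f] and its inverse are immersions between equal dimensions, so each maps interior points
    to interior points. *)
Lemma diffeo_bdry p : mdim M = mdim N -> nbhs p S -> nbhs (f p) S' ->
  mboundary M p <-> mboundary N (f p).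
Proof.
move=> dMN nS nS'; have Sp := nbhs_singleton nS.
have [g [gf fg sf sg]] := diffeo_inverse (ex_intro _ p Sp).
have [[fS _ _] _ _] := df; have S'p := fS _ Sp.
have tS := thickS_nbhs cM (mdom_refl cM p) nS.
have tS' := thickS_nbhs cN (mdom_refl cN (f p)) nS'.
split; apply: contraPP => nb.
  rewrite -[p](gf p Sp); apply: (interior_map cN cM (esym dMN) nS') => //; first exact: sg.
  apply: lker0_intro => v gv.
  have tSg : thickS S (g (f p)) (g (f p)) by rewrite gf.
  have := mdiff_cancel cN cM tS' tSg (fun y H => (fg y H).1) (fun y H => (fg y H).2)
    (sg _ S'p) (sf _ (fg _ S'p).1) v.
  by rewrite gv linear0 => <-.
by apply: (interior_map cM cN dMN nS (sf p Sp)) => //; exact: diffeo_lker.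
Qed.

End DiffeoFacts.

(** * The zero set and its manifold structure *)

Section GenQuot.
Variables (T : topologicalType) (r : T -> T -> Prop).

Lemma gen_proj_eq (x y : T) : gen_proj r x = gen_proj r y <-> clos_refl_sym_trans T r x y.
Proof.
split; first by move=> /eqmodP /asboolP.
by move=> H; apply/eqmodP/asboolP.
Qed.

Lemma gen_proj_surj (q : gen_quot r) : exists x, gen_proj r x = q.
Proof. by exists (repr q); exact: reprK. Qed.

Lemma gen_proj_cont : continuous (gen_proj r).
Proof. exact: pi_continuous. Qed.

Lemma gen_open (A : set (gen_quot r)) : open A <-> open (gen_proj r @^-1` A).
Proof. by []. Qed.

Lemma rst_mono (T' : Type) (s : T' -> T' -> Prop) (f : T -> T') :
  (forall x y, r x y -> clos_refl_sym_trans T' s (f x) (f y)) ->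
  forall x y, clos_refl_sym_trans T r x y -> clos_refl_sym_trans T' s (f x) (f y).
Proof.
move=> rs x y; elim=> [a b /rs //|a|a b _ IH|a b c _ IH1 _ IH2].
- exact: rst_refl.
- exact: rst_sym.
- exact: rst_trans IH1 IH2.
Qed.
End GenQuot.

Lemma subtype_compact (T : topologicalType) (Z : set T) (A : set (set_type Z)) :
  compact (set_val @` A) -> compact A.
Proof.
move=> cA F PF FA.
have [|_ [[z Az <-] cz]] := cA (set_val @ F) _; first exact: (filterS (fun b Ab => ex_intro2 _ _ b Ab erefl) FA).
exists z; split=> [//|] B W FB /subtype_nbhsP [W' W'z WW'].
have [_ [[b Bb <-] W'b]] := cz (set_val @` B) W' (filterS (fun b Bb => ex_intro2 _ _ b Bb erefl) FB) W'z.
by exists b; split=> //; exact: WW'.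
Qed.

(** [E] carries no topology, so continuity of [s] is used through its coordinate extension [g]. *)
Lemma vsmooth_nonzero (R : realType) (M : mfd R) (E : vectType R) (S : set M) (s : M -> E) p :
  charted M -> nbhs p S -> vsmooth_at S s p -> s p != 0 -> nbhs p [set q | s q != 0].
Proof.
move=> cM Sp [Q [g [oQ Qp sg Hg]]] sp0.
have Dp := mdom_nbhs cM (mdom_refl cM p).
have gc : {for p, continuous (g \o mmap p)}.
  by apply: continuous_comp; [exact (mmap_cont cM (mdom_refl cM p))|exact: smooth_cont sg Qp].
have E0 : (g \o mmap p) p != 0.
  rewrite /= Hg //; [|exact: nbhs_singleton|exact (mdom_refl cM p)].
  by apply: contra sp0 => /eqP /(congr1 (@vec R E)); rewrite rvK => ->; rewrite -(rvK 0) rv0.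
have N0 : nbhs p ((g \o mmap p) @^-1` [set v | v != 0]).
  by apply: gc; apply: open_nbhs_nbhs; split=> //; rewrite (_ : [set v | _] = ~` [set 0]); [apply/closed_openC/accessible_closed_set1/hausdorff_accessible/norm_hausdorff|apply/seteqP; split=> v /= /eqP].
have NQ : nbhs p (mmap p @^-1` Q).
  by apply: (mmap_cont cM (mdom_refl cM p)); exact: open_nbhs_nbhs.
apply: filterS (filterI (filterI Dp Sp) (filterI N0 NQ)) => q [[Dq Sq] [g0 Qq]].
apply: contra g0 => /eqP s0; rewrite /= Hg //= s0; exact: (introT eqP (rv0 E)).
Qed.

(** * The one-step equivalence relation and compactness *)

Section Core.
Variables (R : realType) (T : topologicalType) (N : nat) (K : katlas R T N).
Unset Implicit Arguments.
Variables (V : forall I, set (kU K I)) (nu : forall I, kU K I -> kE K I) (n : nat).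
Set Implicit Arguments.
Implicit Types I J L : {set 'I_N}.

(* What the zero set of an atlas, of a cobordism and of its boundary pieces have in common. *)
Record core_data : Prop := CoreData {
  cd_man : forall I, kidx K I -> is_manifold (kU K I);
  cd_s : forall I, kidx K I -> vsmooth_on setT (@ks R T N K I);
  cd_dim : forall I, kidx K I -> kZ V nu I !=set0 -> (n + \dim {:kE K I})%N = mdim (kU K I);
  cd_cc : forall I J, kidx K I -> kidx K J -> I \proper J ->
    [/\ open (kdom K I J), embedding (kdom K I J) (kphi K I J), lker (khat K I J) = 0%VS
      & forall x, kdom K I J x -> ks (kphi K I J x) = khat K I J (ks x)];
  cd_coc : cocycle K;
  cd_conv : conventions K;
  cd_tame2 : forall I J L, kidx K I -> kidx K J -> kidx K L -> I \subset J -> I \subset L ->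
        kdom K I J `&` kdom K I L = kdom K I (J :|: L)%SET;
  cd_tame3 : forall I J L, kidx K I -> kidx K J -> kidx K L -> I \subset J -> J \subset L ->
        kphi K I J @` kdom K I L =
        kdom K J L `&` [set y | ks y \in limg (khat K I J)];
  cd_V : forall I, kidx K I -> open (V I);
  cd_Vc : forall I J (x : kU K I) (y : kU K J), kidx K I -> kidx K J -> V I x -> V J y ->
    kpi x = kpi y -> I \subset J \/ J \subset I;
  cd_pert : is_perturbation V nu;
  cd_C : exists C : forall I, set (kU K I),
    (forall I, kidx K I -> compact (closure (C I)) /\ closure (C I) `<=` V I) /\
    kpi_image (kZ V nu) `<=` kpi_image C;
  cd_trans : forall I z, kZ V nu I z -> limg (kdsnu V nu z) = fullv;
  cd_bdry : forall I z, kZ V nu I z -> mboundary (kU K I) z ->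
    exists (v : tangent z) (i0 : 'I_(mdim (kU K I))),
     [/\ kdsnu V nu z v = 0, i0 = 0%N :> nat & (v : 'rV[R]_(mdim (kU K I))) ord0 i0 != 0];
  cd_phib : forall I J x, kidx K I -> kidx K J -> I \proper J -> kdom K I J x ->
    mboundary (kU K I) x <-> mboundary (kU K J) (kphi K I J x)
}.

Hypothesis cd : core_data.

Lemma proper_or_eq I J : I \subset J -> I = J \/ I \proper J.
Proof. by rewrite subEproper => /orP[/eqP|]; [left|right]. Qed.

Lemma kdomII I x : kidx K I -> kdom K I I x.
Proof. by move=> kI; have [-> _ _ _] := cd_conv cd kI. Qed.

Lemma kphiII I x : kidx K I -> kphi K I I x = x.
Proof. by move=> kI; have [_ -> _ _] := cd_conv cd kI. Qed.

Lemma kdom_idx I L x : kidx K I -> kdom K I L x -> kidx K L.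
Proof.
move=> kI; have [_ _ _ H] := cd_conv cd kI; move=> D; apply: contrapT => nL.
by move: D; rewrite (H L nL).
Qed.

Lemma kcoc I J L x : kidx K I -> kidx K J -> kidx K L -> I \subset J -> J \subset L ->
  kdom K I J x -> kdom K J L (kphi K I J x) ->
  kdom K I L x /\ kphi K J L (kphi K I J x) = kphi K I L x.
Proof.
move=> kI kJ kL /proper_or_eq[<-|IJ] /proper_or_eq[<-|JL].
- by move=> _; rewrite !kphiII.
- by move=> _; rewrite !kphiII.
- by move=> DIJ _; rewrite kphiII.
by have [_ H] := cd_coc cd kI kJ kL IJ JL; exact: H.
Qed.

(** Both halves are tameness: U_IJ meets U_IL in the domain indexed by the union of J and L, which
    is L, and phi_IJ maps U_IL into U_JL. *)
Lemma kdom_mono I J L x : kidx K I -> kidx K J -> kidx K L -> I \subset J -> J \subset L ->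
  kdom K I L x -> kdom K I J x /\ kdom K J L (kphi K I J x).
Proof.
move=> kI kJ kL IJ JL D.
have H := cd_tame2 cd kI kJ kL IJ (fintype.subset_trans IJ JL).
have DIJ : kdom K I J x.
  have : (kdom K I J `&` kdom K I L) x by rewrite H (elimT finset.setUidPr JL).
  by case.
split=> //; have : (kphi K I J @` kdom K I L) (kphi K I J x) by exists x.
by rewrite (cd_tame3 cd kI kJ kL IJ JL) => -[].
Qed.

Lemma kphi_inj I J x y : kidx K I -> kidx K J -> I \subset J ->
  kdom K I J x -> kdom K I J y -> kphi K I J x = kphi K I J y -> x = y.
Proof.
move=> kI kJ /proper_or_eq[E|IJ]; first by subst J; rewrite !kphiII.
have [_ [_ [[_ inj _] _ _] _] _ _] := cd_cc cd kI kJ IJ.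
by move=> Dx Dy; apply: inj; rewrite inE.
Qed.

(* By tameness, equivalent points have a common image in some U_L. *)
Definition kstrong (p q : kpt K) : Prop :=
  p = q \/ exists L, [/\ kidx K (projT1 p), kidx K (projT1 q),
    (projT1 p \subset L) && (projT1 q \subset L),
    kdom K (projT1 p) L (projT2 p) /\ kdom K (projT1 q) L (projT2 q)
    & kphi K (projT1 p) L (projT2 p) = kphi K (projT1 q) L (projT2 q)].

(** The middle point has images in U_L1 and in U_L2, hence by tameness in the chart indexed by the
    union of L1 and L2. The cocycle condition carries the two common images into that chart, where
    they coincide. *)
Lemma kstrong_trans p q s : kstrong p q -> kstrong q s -> kstrong p s.
Proof.
move=> [->//|[L1 [kI kJ /andP[I1 J1] [DI DJ] E1]]].
move=> [<-|[L2 [_ kL /andP[J2 M2] [DJ2 DM] E2]]].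
  by right; exists L1; rewrite I1 J1.
have k1 := kdom_idx kI DI; have k2 := kdom_idx kJ DJ2.
have DJ12 : kdom K (projT1 q) (L1 :|: L2)%SET (projT2 q).
  by rewrite -(cd_tame2 cd kJ k1 k2 J1 J2).
have k12 := kdom_idx kJ DJ12.
have s1 : L1 \subset (L1 :|: L2)%SET by exact: finset.subsetUl.
have s2 : L2 \subset (L1 :|: L2)%SET by exact: finset.subsetUr.
have [_ D1] := kdom_mono kJ k1 k12 J1 s1 DJ12.
have [_ D2] := kdom_mono kJ k2 k12 J2 s2 DJ12.
have [_ F1] := kcoc kJ k1 k12 J1 s1 DJ D1.
have [_ F2] := kcoc kJ k2 k12 J2 s2 DJ2 D2.
have [A1 A2] := kcoc kI k1 k12 I1 s1 DI (eq_ind_r (kdom K L1 _) D1 E1).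
have [B1 B2] := kcoc kL k2 k12 M2 s2 DM (eq_ind (kphi K _ L2 _) (kdom K L2 _) D2 _ E2).
right; exists (L1 :|: L2)%SET; split=> //.
  by rewrite (fintype.subset_trans I1 s1) (fintype.subset_trans M2 s2).
by rewrite -A2 -B2 E1 -E2 F1 F2.
Qed.

Lemma kstrongP p q : clos_refl_sym_trans _ (@krel R T N K) p q -> kstrong p q.
Proof.
elim=> [a b [ka kb ab D E]|a|a b _ IH|a b c _ IH1 _ IH2].
- right; exists (projT1 b); split=> //; first by rewrite proper_sub //= subxx.
    by split=> //; exact: kdomII.
  by rewrite kphiII.
- by left.
- case: IH => [->|[L [ka kb /andP[aL bL] [Da Db] E]]]; first by left.
  by right; exists L; rewrite aL bL.
- exact: kstrong_trans IH1 IH2.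
Qed.

(** The two points share an image in some U_L. By [kdom_mono] the map of the first to U_L passes
    through U_J, J being the larger index, and injectivity of phi_JL identifies the intermediate
    point with the second. *)
Lemma kpi_eq (p q : kpt K) : kidx K (projT1 p) -> kidx K (projT1 q) -> projT1 p \subset projT1 q ->
  kpi (projT2 p) = kpi (projT2 q) ->
  kdom K (projT1 p) (projT1 q) (projT2 p) /\
  kphi K (projT1 p) (projT1 q) (projT2 p) = projT2 q.
Proof.
move=> kp kq pq /gen_proj_eq/kstrongP.
have E (x : kpt K) : existT (fun I => kU K I : Type) (projT1 x) (projT2 x) = x by case: x.
rewrite !E => -[->|[L [_ _ /andP[pL qL] [Dp Dq] F]]].
  by rewrite kphiII //; split=> //; exact: kdomII.
have kL := kdom_idx kp Dp.
have [D1 D2] := kdom_mono kp kq kL pq qL Dp; split=> //.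
apply: (kphi_inj kq kL qL D2 Dq).
by have [_ ->] := kcoc kp kq kL pq qL D1 D2.
Qed.

Definition zp I (x : kU K I) (Zx : kZ V nu I x) : set_type (kZ V nu I) := exist _ x (mem_set Zx).

Lemma zP I (z : set_type (kZ V nu I)) : kZ V nu I (val z).
Proof. exact: set_valP. Qed.

Lemma zidx I (z : set_type (kZ V nu I)) : kidx K I.
Proof. by have [] := zP z. Qed.

Lemma kZ_push I J x : I \subset J -> kZ V nu I x -> kdom K I J x -> V J (kphi K I J x) ->
  kZ V nu J (kphi K I J x).
Proof.
move=> IJ [kI Vx Zx] D VJ; have kJ := kdom_idx kI D; split=> //.
case/proper_or_eq: IJ => [E|IJ]; first by subst J; rewrite kphiII.
have [_ _ _ H] := cd_cc cd kI kJ IJ; have [_ Hnu] := cd_pert cd.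
by rewrite H // (Hnu I J) // -linearD Zx linear0.
Qed.

(** The converse of [kZ_push], by injectivity of the linear map [khat]. *)
Lemma kZ_pull I J x : kidx K I -> I \subset J -> V I x -> kdom K I J x -> kZ V nu J (kphi K I J x) ->
  kZ V nu I x.
Proof.
move=> kI IJ Vx D [kJ VJ Z]; split=> //.
case/proper_or_eq: IJ => [E|IJ]; first by subst J; rewrite kphiII in Z.
have [_ _ inj H] := cd_cc cd kI kJ IJ; have [_ Hnu] := cd_pert cd.
apply: (lker0_inj inj); move: Z; rewrite H // (Hnu I J) //.
by rewrite linearD.
Qed.

Lemma zproj_kpi I J (z : kZ V nu I) (w : kZ V nu J) : zproj z = zproj w -> kpi (val z) = kpi (val w).
Proof.
move=> /gen_proj_eq H; apply/gen_proj_eq.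
pose f (p : zpt V nu) : kpt K := existT (fun I => kU K I : Type) (projT1 p) (val (projT2 p)).
apply: (@rst_mono _ _ _ _ f _ (existT _ I z) (existT _ J w) H) => p q [pq D E].
by apply: rst_step; split=> //=; [exact: zidx (projT2 p)|exact: zidx (projT2 q)].
Qed.

Definition zlink I J (z : kZ V nu I) (w : kZ V nu J) : Prop :=
  [/\ I \subset J, kdom K I J (val z) & kphi K I J (val z) = val w].

(** Comparability of [I] and [J] is supplied by the reduction through [cd_Vc]; tameness then gives
    the single step. *)
Lemma zproj_eq I J (z : kZ V nu I) (w : kZ V nu J) : zproj z = zproj w -> zlink z w \/ zlink w z.
Proof.
move=> /zproj_kpi H; have [kI Vz _] := zP z; have [kJ Vw _] := zP w.
have [IJ|JI] := cd_Vc cd kI kJ Vz Vw H.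
  by left; have [D E] := @kpi_eq (existT _ I (val z)) (existT _ J (val w)) kI kJ IJ H.
by right; have [D E] := @kpi_eq (existT _ J (val w)) (existT _ I (val z)) kJ kI JI (esym H).
Qed.

Lemma zlink_proj I J (z : kZ V nu I) (w : kZ V nu J) : zlink z w -> zproj z = zproj w.
Proof.
move=> [/proper_or_eq[E|IJ] D P].
  subst J; congr zproj; apply: val_inj; rewrite -P kphiII //; exact: zidx z.
by apply/gen_proj_eq; apply: rst_step; split.
Qed.

Lemma zproj_inj I : injective (@zproj R T N K V nu I).
Proof.
move=> z w /zproj_eq[[_ _ E]|[_ _ E]]; apply: val_inj; rewrite -E kphiII //; exact: zidx z.
Qed.

Lemma zproj_surj (q : zset V nu) : exists p : zpt V nu, zproj (projT2 p) = q.
Proof. by have [[I z] <-] := gen_proj_surj q; exists (existT _ I z). Qed.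

Lemma zproj_cont I : continuous (@zproj R T N K V nu I).
Proof.
move=> z; apply: (@continuous_comp _ _ _ (fun z => existT (fun I => set_type (kZ V nu I) : topologicalType) I z : zpt V nu) (gen_proj (@zrel R T N K V nu))).
  exact: existT_continuous.
exact: gen_proj_cont.
Qed.

Lemma zset_open (A : set (zset V nu)) : (forall I, open (@zproj R T N K V nu I @^-1` A)) -> open A.
Proof. by move=> H; apply/gen_open/sigT_openP. Qed.

(** |Z| is the finite union of the images of the zeros lying in the closures of the C_I: a zero
    equivalent to a point of C_J can be pushed or pulled to that point, which is then a zero itself.
    Each of these sets is closed in the compact closure of C_I, because this closure lies in V_I,
    where [s + nu] is defined and continuous. *)
Lemma zset_compact : compact [set: zset V nu].
Proof.
have [C [HC CZ]] := cd_C cd.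
pose A I : set (set_type (kZ V nu I)) := [set z | closure (C I) (val z)].
have -> : [set: zset V nu] = \bigcup_(I in [set: {set 'I_N}]) (@zproj R T N K V nu I @` A I).
  apply/seteqP; split=> // q _; have [[I z] <-] := zproj_surj q.
  have [kI Vz Zz] := zP z.
  have [|J [x [kJ Cx E]]] := CZ (kpi (val z)); first by exists I, (val z); split=> //; exact: zP.
  have Vx : V J x by have [_ CV] := HC J kJ; apply: CV; exact: subset_closure.
  have ZJ : kZ V nu J x.
    have [IJ|JI] := cd_Vc cd kI kJ Vz Vx E.
      have [D P] := @kpi_eq (existT _ I (val z)) (existT _ J x) kI kJ IJ E.
      by have := kZ_push IJ (zP z) D; rewrite /= in P; rewrite P; apply.
    have [D P] := @kpi_eq (existT _ J x) (existT _ I (val z)) kJ kI JI (esym E).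
    by apply: (kZ_pull kJ JI Vx D); rewrite /= in P; rewrite P; exact: zP.
  exists J => //; exists (zp ZJ); first exact: subset_closure.
  have [IJ|JI] := cd_Vc cd kI kJ Vz Vx E.
    by apply: esym; apply: zlink_proj; have [D P] := @kpi_eq (existT _ I (val z)) (existT _ J x) kI kJ IJ E.
  by apply: zlink_proj; have [D P] := @kpi_eq (existT _ J x) (existT _ I (val z)) kJ kI JI (esym E).
rewrite -fsbig_setU; last exact: finite_finset.
apply: big_rec; first exact: compact0.
move=> I X _ cX; apply: compactU => //.
apply: continuous_compact; first by apply: continuous_subspaceT; exact: zproj_cont.
have [kI|nkI] := pselect (kidx K I); last first.
  rewrite (_ : A I = set0); first exact: compact0.
  by apply/seteqP; split=> // z _; apply: nkI; exact: zidx z.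
have [cC CV] := HC I kI.
have mI := cd_man cd kI; have cI := manifold_charted mI.
apply: subtype_compact.
have sZ : vsmooth_on (V I) (fun x => ks x + nu I x).
  move=> x Vx; have [sn _] := cd_pert cd.
  by apply: vsmooth_add; [apply: (rsmooth_sub _ (cd_s cd kI _))|exact: sn].
apply: (subclosed_compact _ cC); last by move=> _ [z Az <-].
move=> x clx; have Cx : closure (C I) x.
  apply: closed_closure; apply: closureS clx => _ [z Az <-] //.
have Vx := CV _ Cx.
have [x0|x0] := eqVneq (ks x + nu I x) 0.
  by have Zx : kZ V nu I x by []; exists (zp Zx).
have Vn : nbhs x (V I) by apply: open_nbhs_nbhs; split=> //; exact: cd_V.
have [_ [[z _ <-] /=]] := clx _ (vsmooth_nonzero cI Vn (sZ _ Vx) x0).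
by have [_ _ ->] := zP z; rewrite eqxx.
Qed.

End Core.

Section MoreLocal.
Variable R : realType.
Implicit Types M N : mfd R.

Lemma thickS_preim M N (S : set M) (f : M -> N) p : charted M -> charted N ->
  thickS S p p -> f x @[x --> within S (nbhs p)] --> f p ->
  thickS (S `&` f @^-1` mdom (f p)) p p.
Proof.
move=> cM cN tS cf; have pp := mdom_refl cM p.
have [W nW HW] := within_near cf (mdom_nbhs cN (mdom_refl cN (f p))).
by apply: (thickS_sub cM pp tS nW) => q [Sq Wq]; split=> //; exact: HW.
Qed.

Lemma mdiff_ext M N (S S' : set M) (f f' : M -> N) p : charted M -> charted N ->
  thickS S p p -> thickS S' p p ->
  (exists2 W, nbhs p W & forall q, W q -> S q -> S' q /\ f q = f' q) ->
  smooth_at S' f' p ->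
  forall v, (mdiff S f p v : 'rV[R]_(mdim N)) = mdiff S' f' p v.
Proof.
move=> cM cN tS tS' [W nW HW] sf; have pp := mdom_refl cM p.
have [_ E] := HW p (nbhs_singleton nW) (thickS_mem cM pp tS).
have sf2 : smooth_at S f p.
  by apply: (smooth_at_local cM cN (thickS_mem cM pp tS) _ sf); exists W.
move=> v; rewrite /mdiff.
have t1 := thickS_preim cM cN tS sf2.1; have t2 := thickS_preim cM cN tS' sf.1.
move: t1; rewrite E => t1.
congr (fun_of_lfun _ v); apply: (rdiff_ext cM t1 t2 _ sf.2).
exists W => // q Wq [Sq Dq]; have [S'q Eq] := HW q Wq Sq.
by rewrite /= -Eq; split.
Qed.

Lemma empty_manifold n (T : topologicalType) (A : charts R n T) :
  (forall x : T, False) -> is_manifold (Mfd A).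
Proof.
move=> H; split=> [p|| x]; [by case: (H p)| |by case: (H x)].
exists set0; first exact: countable0.
by split=> [A0 []|p]; case: (H p).
Qed.

(** Composition with [\1 - projv L], whose kernel is [L], reduces the claim to openness of
    nonvanishing. *)
Lemma vsmooth_closed M (E : vectType R) (s : M -> E) (L : {vspace E}) : charted M ->
  vsmooth_on setT s -> closed [set x | s x \in L].
Proof.
move=> cM ss; rewrite -[X in closed X]setCK; apply: open_closedC.
rewrite openE => x /negP xL.
pose P : 'End(E) := (\1 - projv L)%VF.
have PL w : (P w == 0) = (w \in L).
  rewrite add_lfunE opp_lfunE id_lfunE subr_eq0; apply/eqP/idP => [->|/projv_id ->//].
  exact: memv_proj.
have Px : P (s x) != 0 by rewrite PL.
have sP := vsmooth_lin P (ss x I).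
apply: filterS (vsmooth_nonzero cM filterT sP Px) => q /=; rewrite PL => /negP; exact.
Qed.
End MoreLocal.

(** * Charts on the zero sets, transition maps and separation *)

Section Structure.
Variables (R : realType) (T : topologicalType) (N : nat) (K : katlas R T N).
Unset Implicit Arguments.
Variables (V : forall I, set (kU K I)) (nu : forall I, kU K I -> kE K I) (n : nat).
Set Implicit Arguments.
Implicit Types I J L : {set 'I_N}.
Hypothesis cd : core_data V nu n.

Lemma vsmooth_snu I : kidx K I -> vsmooth_on (V I) (fun x => ks x + nu I x).
Proof.
move=> kI x Vx; have [sn _] := cd_pert cd.
apply: vsmooth_add; last exact: sn.
exact (rsmooth_sub (@subsetT _ _) (cd_s cd kI (p:=x) Logic.I)).
Qed.

Lemma zcharts I : exists AI : charts R n (set_type (kZ V nu I)),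
  [/\ is_manifold (Mfd AI), embedding setT (@zincl R T N K V nu n I AI)
    & forall z : Mfd AI, mboundary (Mfd AI) z <-> mboundary (kU K I) (val z)].
Proof.
(* Outside the index set [kZ] is empty by definition, and arbitrary chart data will do. *)
have [kI|nkI] := pselect (kidx K I); last first.
  have E (z : set_type (kZ V nu I)) : False by apply: nkI; exact: zidx z.
  exists (Charts (fun _ => setT) (fun _ _ => 0)); split; first exact: empty_manifold.
    split; [by move=> z; case: (E z)| |by move=> z; case: (E z)].
    apply/homeo_ontoP; split=> [|z|z]; try by case: (E z).
    by split=> [z|z w|y [z]]; move=> *; case: (E z).
  by move=> z; case: (E z).
have mI := cd_man cd kI.
apply: slice_charts => // z Zz; have [_ Vz z0] := Zz.
have -> : kZ V nu I = [set x | V I x /\ ks x + nu I x = 0].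
  by apply/seteqP; split=> x [] //.
apply: (slice_exists mI (cd_V cd kI) (vsmooth_snu kI) Vz z0).
- exact (cd_trans cd Zz).
- by apply: (cd_dim cd kI); exists z.
- exact (cd_bdry cd Zz).
Qed.

Lemma zlink_refl I (z : set_type (kZ V nu I)) : zlink z z.
Proof. by have kI := zidx z; split=> //; [exact (kdomII cd _ kI)|exact (kphiII cd _ kI)]. Qed.

Variable AI : forall I, charts R n (set_type (kZ V nu I)).
Hypothesis mAI : forall I, is_manifold (Mfd (AI I)).
Hypothesis eAI : forall I, embedding setT (@zincl R T N K V nu n I (AI I)).
Hypothesis bAI : forall I (z : Mfd (AI I)),
  mboundary (Mfd (AI I)) z <-> mboundary (kU K I) (val z).

Lemma cAI I : charted (Mfd (AI I)).
Proof. exact: manifold_charted. Qed.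

Lemma cKU I : kidx K I -> charted (kU K I).
Proof. by move=> kI; exact (manifold_charted (cd_man cd kI)). Qed.

Lemma thickM (M : mfd R) (p : M) : charted M -> thickS setT p p.
Proof. by move=> cM; apply: thickST => //; exact (mdom_refl cM p). Qed.

Lemma zincl_smooth I (z : Mfd (AI I)) : smooth_at setT (@zincl R T N K V nu n I (AI I)) z.
Proof. by have [H _ _] := eAI I; exact: H. Qed.

(** Smoothness into Z_J is tested in U_J: the inclusion is an immersion, and continuity is free
    because Z_J has the subspace topology. *)
Lemma zlift (M : mfd R) (S : set M) (J : {set 'I_N}) (g : M -> Mfd (AI J)) p : charted M -> S p ->
  smooth_at S (@zincl R T N K V nu n J (AI J) \o g) p -> smooth_at S g p.
Proof.
move=> cM Sp sg; have kJ := zidx (g p).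
apply: (immersion_lift cM (cKU kJ) (cAI (I := J)) Sp _ filterT (zincl_smooth (g p)) _ sg).
  apply/cvg_withinP => W /subtype_nbhsP[B nB BW].
  by have := (cvg_withinP _ _ _ _).1 sg.1 B nB; apply: filterS => q Hq /Hq; exact: BW.
by have [_ _ H] := eAI J; exact: H.
Qed.

Section Push.
Variables (I J : {set 'I_N}) (IJ : I \proper J) (w : Mfd (AI J)).

Definition zdom : set (Mfd (AI I)) := [set q | kdom K I J (val q) /\ V J (kphi K I J (val q))].

(** The restriction of phi_IJ to the zero sets, made total; [w] is the value where the image is not
    a zero in V_J. *)
Definition zpush (q : Mfd (AI I)) : Mfd (AI J) :=
  if pselect (kZ V nu J (kphi K I J (val q))) is left H then zp H else w.

Lemma zpush_val q : zdom q -> val (zpush q) = kphi K I J (val q).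
Proof.
move=> [D VJ]; rewrite /zpush; case: pselect => // -[].
exact (kZ_push cd (proper_sub IJ) (zP q) D VJ).
Qed.

Lemma zpush_link q : zdom q -> zlink q (zpush q).
Proof. by move=> Dq; split; [exact: proper_sub|case: Dq|rewrite zpush_val]. Qed.

Lemma zpush_proj q : zdom q -> zproj (zpush q) = zproj q.
Proof. by move=> /zpush_link/(zlink_proj cd). Qed.

Lemma zpush_inj q q' : zdom q -> zdom q' -> zpush q = zpush q' -> q = q'.
Proof. by move=> Dq Dq' E; apply: (zproj_inj cd); rewrite -(zpush_proj Dq) E zpush_proj. Qed.

Lemma zphi_smooth (q : Mfd (AI I)) : kdom K I J (val q) ->
  smooth_at (kdom K I J) (kphi K I J) (val q).
Proof.
move=> Dq; have kI := zidx q; have kJ := kdom_idx cd kI Dq.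
by have [_ [H _ _] _ _] := cd_cc cd kI kJ IJ; exact: H.
Qed.

Lemma zdom_open : open zdom.
Proof.
rewrite openE => q [Dq Vq]; have kI := zidx q; have kJ := kdom_idx cd kI Dq.
have [oD _ _ _] := cd_cc cd kI kJ IJ.
have nV : nbhs (kphi K I J (val q)) (V J) by apply: open_nbhs_nbhs; split=> //; exact (cd_V cd kJ).
have H := (cvg_withinP _ _ _ _).1 (zphi_smooth Dq).1 _ nV.
have nD : nbhs (val q) (kdom K I J) by exact: open_nbhs_nbhs.
apply/subtype_nbhsP; exists (kdom K I J `&` [set x | kdom K I J x -> V J (kphi K I J x)]).
  exact: filterI.
by move=> q' [D' /(_ D') V'].
Qed.

Lemma zpush_comp_smooth q : zdom q ->
  smooth_at zdom (kphi K I J \o @zincl R T N K V nu n I (AI I)) q.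
Proof.
move=> Dq; have kI := zidx q; have kJ := kdom_idx cd kI Dq.1.
apply: (smooth_at_comp (cAI (I := I)) (cKU kI) (cKU kJ) (S' := kdom K I J)) => //.
- by move=> q' [].
- exact: smooth_at_sub (zincl_smooth q).
- exact (zphi_smooth Dq.1).
Qed.

Lemma zpush_incl_smooth q : zdom q ->
  smooth_at zdom (@zincl R T N K V nu n J (AI J) \o zpush) q.
Proof.
move=> Dq; have kI := zidx q; have kJ := kdom_idx cd kI Dq.1.
apply: (smooth_at_local (cAI (I := I)) (cKU kJ) Dq _ (zpush_comp_smooth Dq)).
by exists setT; [exact: filterT|move=> q' _ Dq'; split=> //; exact: zpush_val].
Qed.

Lemma zpush_smooth q : zdom q -> smooth_at zdom zpush q.
Proof. by move=> Dq; apply: zlift => //; [exact: cAI|exact: zpush_incl_smooth]. Qed.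

Lemma thick_zdom q : zdom q -> thickS zdom q q.
Proof.
move=> Dq; have c := cAI (I := I).
by apply: (thickS_nbhs c (mdom_refl c q)); apply: open_nbhs_nbhs; split=> //; exact: zdom_open.
Qed.

Lemma zpush_diff q v : zdom q ->
  (mdiff setT (@zincl R T N K V nu n J (AI J)) (zpush q) (mdiff zdom zpush q v) : 'rV[R]_(mdim (kU K J))) =
  mdiff (kdom K I J) (kphi K I J) (val q) (mdiff setT (@zincl R T N K V nu n I (AI I)) q v).
Proof.
move=> Dq; have kI := zidx q; have kJ := kdom_idx cd kI Dq.1.
have cI := cAI (I := I); have cJ := cAI (I := J).
have [oD _ _ _] := cd_cc cd kI kJ IJ.
have tq := thick_zdom Dq.
have tk : thickS (kdom K I J) (val q) (val q).
  by apply: (thickS_nbhs (cKU kI) (mdom_refl (cKU kI) (val q))); apply: open_nbhs_nbhs; split=> //; case: Dq.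
have E1 := mdiff_comp cI cJ (cKU kJ) tq (thickM (zpush q) cJ) (fun _ _ => Logic.I)
  (zpush_smooth Dq) (zincl_smooth (zpush q)).
have E2 := mdiff_comp cI (cKU kI) (cKU kJ) tq tk (fun q' (D : zdom q') => D.1)
  (smooth_at_sub (fun _ _ => Logic.I) (zincl_smooth q)) (zphi_smooth Dq.1).
have E3 := mdiff_ext cI (cKU kJ) tq tq
  (ex_intro2 _ _ setT (@filterT _ (nbhs q) _) (fun q' _ Dq' => conj Dq' (zpush_val Dq'))) (zpush_comp_smooth Dq) v.
have E4 := mdiff_ext cI (cKU kI) tq (thickM q cI)
  (ex_intro2 _ _ setT (@filterT _ (nbhs q) _) (fun q' _ Dq' => conj Logic.I erefl)) (zincl_smooth q) v.
move/lfunP: E1 => /(_ v) F1; move/lfunP: E2 => /(_ v) F2.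
rewrite /= comp_lfunE in F1; rewrite /= comp_lfunE in F2.
by rewrite -F1 E3 F2 E4.
Qed.

Lemma zpush_lker q : zdom q -> lker (mdiff zdom zpush q) = 0%VS.
Proof.
move=> Dq; have kI := zidx q; have kJ := kdom_idx cd kI Dq.1.
apply: lker0_intro => v v0; have := zpush_diff v Dq; rewrite v0 linear0 => /esym H.
have [_ [_ _ lk] _ _] := cd_cc cd kI kJ IJ.
have H1 := lker0_inj (lk _ Dq.1) H.
by have [_ _ lz] := eAI I; exact (lker0_inj (lz q Logic.I) H1).
Qed.

Lemma zpush_bdry q : zdom q -> mboundary (Mfd (AI I)) q <-> mboundary (Mfd (AI J)) (zpush q).
Proof.
move=> Dq; have kI := zidx q; have kJ := kdom_idx cd kI Dq.1.
by rewrite !bAI zpush_val //; exact (cd_phib cd kI kJ IJ Dq.1).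
Qed.

(** Z_I and Z_J have the same dimension and [zpush] is an immersion matching their boundaries, so
    [local_diffeo_image] applies at interior and boundary points alike. *)
Lemma zpush_image q W : zdom q -> nbhs q W -> nbhs (zpush q) (zpush @` (zdom `&` W)).
Proof.
move=> Dq nW; have cI := cAI (I := I); have cJ := cAI (I := J).
have nD : nbhs q (zdom `&` W) by apply: filterI => //; apply: open_nbhs_nbhs; split=> //; exact: zdom_open.
have sub : zdom `&` W `<=` zdom by move=> ? [].
apply: local_diffeo_image => //.
- exact: smooth_at_sub sub (zpush_smooth Dq).
- apply: lker0_intro => v v0; apply: (lker0_inj (zpush_lker Dq)).
  have := mdiff_ext cI cJ (thickS_nbhs cI (mdom_refl cI q) nD) (thick_zdom Dq)
    (ex_intro2 _ _ setT (@filterT _ (nbhs q) _) (fun q' _ Dq' => conj (sub _ Dq') erefl)) (zpush_smooth Dq) v.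
  by rewrite v0 => <-.
- by move=> q' /sub; exact: zpush_bdry.
Qed.
End Push.

(** Depending on the direction of the link, the transition is [zpush] itself or a local inverse of
    it. The inverse is smooth by [immersion_lift], since its composite with the immersion [zpush] is
    the identity. *)
Lemma ztrans I J (z : Mfd (AI I)) (w : Mfd (AI J)) : zproj z = zproj w ->
  exists (S : set (Mfd (AI I))) (tau : Mfd (AI I) -> Mfd (AI J)),
    [/\ nbhs z S, forall q, S q -> zproj (tau q) = zproj q & smooth_at S tau z].
Proof.
have id_case I' (z' : Mfd (AI I')) : exists (S : set (Mfd (AI I'))) (tau : Mfd (AI I') -> Mfd (AI I')),
    [/\ nbhs z' S, forall q, S q -> zproj (tau q) = zproj q & smooth_at S tau z'].
  exists setT, id; split=> //; first exact: filterT.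
  by apply: zlift => //; [exact: cAI|exact: zincl_smooth].
move=> /(zproj_eq cd)[] [/proper_or_eq[E|IJ] D P]; try by subst J; exact: id_case.
  have Dz : zdom J z by split=> //; rewrite P; have [] := zP w.
  exists (zdom J), (zpush w); split; last exact: zpush_smooth.
    by apply: open_nbhs_nbhs; split=> //; exact: zdom_open.
  by move=> q; exact: zpush_proj.
have Dw : zdom I w by split=> //; rewrite P; have [] := zP z.
have zw : zpush z w = z by apply: val_inj; rewrite zpush_val.
have cI := cAI (I := I); have cJ := cAI (I := J).
have im W : nbhs w W -> nbhs z (zpush z @` (zdom I `&` W)).
  by move=> /(zpush_image IJ z Dw); rewrite zw.
(* By [zpush_image] this image is a neighbourhood of [z]; [tau] picks the preimage, unique by
   injectivity of [zpush], and takes the irrelevant value [w] off [S]. *)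
pose S : set (Mfd (AI I)) := zpush z @` zdom (I := J) I.
have nS : nbhs z S by apply: filterS (im setT filterT) => q [w' [Dw' _] <-]; exists w'.
pose tau (q : Mfd (AI I)) : Mfd (AI J) :=
  if pselect (S q) is left H then projT1 (cid2 H) else w.
have tauP q : S q -> zdom I (tau q) /\ zpush z (tau q) = q.
  by rewrite /tau; case: pselect => // H _; case: cid2.
have tauK w' : zdom I w' -> tau (zpush z w') = w'.
  move=> Dw'; have [|D1 E1] := tauP (zpush z w'); first by exists w'.
  exact: (zpush_inj IJ D1 Dw' E1).
have tz : tau z = w by rewrite -zw tauK.
have Sz := nbhs_singleton nS.
exists S, tau; split=> //.
  by move=> q /tauP[Dq {2}<-]; rewrite zpush_proj.
apply: (immersion_lift (S' := zdom I) (i := zpush z) cI cI cJ Sz); rewrite ?tz.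
- apply/cvg_withinP => W nW; apply: filterS (im W nW) => _ [w' [Dw' Ww'] <-] _.
  by rewrite tauK.
- by apply: open_nbhs_nbhs; split=> //; exact: zdom_open.
- exact: zpush_smooth.
- exact: zpush_lker.
have H : smooth_at setT (id : Mfd (AI I) -> Mfd (AI I)) z.
  by apply: zlift => //; exact: zincl_smooth.
by apply: (smooth_at_local cI cI Sz _ H); exists setT; [exact: filterT|move=> q _ /tauP[]].
Qed.

(** Near a point [w] of Z_J whose class is represented in [A], the points that [tau] sends into [A]
    have their classes represented in [A]; continuity of [tau] makes them a neighbourhood of [w]. *)
Lemma zproj_open I (A : set (set_type (kZ V nu I))) : open A -> open (@zproj R T N K V nu I @` A).
Proof.
move=> oA; apply: zset_open => J; rewrite openE => w [z Az E].
have [S [tau [nS tS [ct _]]]] := @ztrans J I w z (esym E).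
have tw : tau w = z by apply: (zproj_inj cd); rewrite tS //; exact: nbhs_singleton.
have nA : nbhs (tau w) A by rewrite tw; exact: open_nbhs_nbhs.
apply: filterS (filterI nS ((cvg_withinP _ _ _ _).1 ct A nA)) => q [Sq /(_ Sq) Aq].
by exists (tau q) => //; exact: tS.
Qed.

Lemma zlink_closed I J (z : Mfd (AI I)) (w : Mfd (AI J)) : I \subset J ->
  (forall W W', nbhs z W -> nbhs w W' -> exists z' w', [/\ W z', W' w' & zlink z' w']) -> zlink z w.
Proof.
move=> IJ H; have kI := zidx z; have kJ := zidx w.
have [hI _ _] := cd_man cd kI.
case/proper_or_eq: (IJ) => [E|pIJ].
  subst J; suff -> : z = w by exact: zlink_refl.
  have [hA _ _] := mAI I; apply: hA => W W' nW nW'.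
  have [z' [w' [Wz Ww [_ _ P]]]] := H W W' nW nW'.
  exists z'; split=> //; suff -> : z' = w' by [].
  by apply: val_inj; rewrite -P (kphiII cd).
have [oD [_ he _] _ cs] := cd_cc cd kI kJ pIJ.
have ckJ := cKU kJ.
have cl := vsmooth_closed (L := limg (khat K I J)) ckJ (cd_s cd kJ).
have lw : ks (val w) \in limg (khat K I J).
  apply: cl => B nB.
  have [z' [w' [_ Bw' [_ D P]]]] : exists (z' : Mfd (AI I)) (w' : Mfd (AI J)), [/\ setT z', (val @^-1` B) w' & zlink z' w'].
    apply: H; first exact: filterT.
    by apply/subtype_nbhsP; exists B.
  by exists (val w'); split=> //=; rewrite -P cs // memv_img ?memvf.
have : (kdom K J J `&` [set y | ks y \in limg (khat K I J)]) (val w) by split=> //; exact: (kdomII cd).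
rewrite -(cd_tame3 cd kI kJ kJ IJ (subxx J)) => -[x0 Dx0 Ex0].
suff E : val z = x0 by split; rewrite ?E.
apply: hI => B B' nB nB'.
have [_ _ inv] := (homeo_ontoP _ _ _).1 he.
have [N' [oN' N'x NB]] := inv x0 B' Dx0 nB'.
have [z' [w' [Bz N'w [_ D P]]]] : exists (z' : Mfd (AI I)) (w' : Mfd (AI J)), [/\ (val @^-1` B) z', (val @^-1` N') w' & zlink z' w'].
  apply: H; first by apply/subtype_nbhsP; exists B.
  by apply/subtype_nbhsP; exists N' => //; apply: open_nbhs_nbhs; split=> //; rewrite -Ex0.
by exists (val z'); split=> //; apply: NB => //; rewrite P.
Qed.

(** The maps [zproj] are open, so points that cannot be separated are approached by equivalent,
    hence linked, pairs. The order of [I] and [J] fixes the direction of all these links, except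
    when [I = J], where links are equalities; [zlink_closed] then links the points themselves. *)
Lemma zset_hausdorff : hausdorff_space (zset V nu).
Proof.
move=> a b H; have [[I z] /= Ea] := zproj_surj a; have [[J w] /= Eb] := zproj_surj b.
rewrite -{}Ea -{}Eb in H *.
have G (W : set (Mfd (AI I))) (W' : set (Mfd (AI J))) : nbhs z W -> nbhs w W' -> exists z' w', [/\ W z', W' w' & zlink z' w' \/ zlink w' z'].
  rewrite !nbhsE => -[B [oB Bz] BW] [B' [oB' B'w] BW'].
  have [||q [[z' Bz' Ez] [w' Bw' Ew]]] := H (@zproj R T N K V nu I @` B) (@zproj R T N K V nu J @` B').
  - by apply: open_nbhs_nbhs; split; [exact: zproj_open|exists z].
  - by apply: open_nbhs_nbhs; split; [exact: zproj_open|exists w].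
  exists z', w'; split; [exact: BW|exact: BW'|].
  by apply: (zproj_eq cd); rewrite Ez Ew.
have [z0 [w0 [_ _ L0]]] := G setT setT filterT filterT.
have eqcase (E : I = J) (z' : Mfd (AI I)) (w' : Mfd (AI J)) : zlink w' z' -> zlink z' w'.
  subst J => -[_ _ P]; have kI := zidx w'.
  suff -> : z' = w' by exact: zlink_refl.
  by apply: val_inj; rewrite -P (kphiII cd).
have eqcase' (E : I = J) (z' : Mfd (AI I)) (w' : Mfd (AI J)) : zlink z' w' -> zlink w' z'.
  subst J => -[_ _ P]; have kI := zidx w'.
  suff -> : z' = w' by exact: zlink_refl.
  by apply: val_inj; rewrite -P (kphiII cd).
case: L0 => -[IJ _ _].
  apply: (zlink_proj cd); apply: (zlink_closed IJ) => W W' nW nW'.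
  have [z' [w' [Wz Ww L]]] := G W W' nW nW'; exists z', w'; split=> //.
  case: L => // L; apply: eqcase => //; case: L => JI _ _.
  by apply/eqP; rewrite finset.eqEsubset IJ.
apply: esym; apply: (zlink_proj cd); apply: (zlink_closed IJ) => W W' nW nW'.
have [z' [w' [Wz Ww L]]] := G W' W nW' nW; exists w', z'; split=> //.
case: L => // L; apply: eqcase' => //; case: L => JI _ _.
by apply/eqP; rewrite finset.eqEsubset IJ JI.
Qed.

Lemma zglue : exists A : charts R n (zset V nu),
  zero_structure A AI /\
  forall I (z : set_type (kZ V nu I)), mboundary (Mfd A) (zproj z) <-> mboundary (kU K I) (val z).
Proof.
have [|||||||A [mA HA]] := @glue_charts R n (zset V nu) {set 'I_N} (fun I => set_type (kZ V nu I)) AI (fun I => @zproj R T N K V nu I).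
- exact: mAI.
- exact: zset_hausdorff.
- by move=> I; exact: (zproj_inj cd).
- by move=> I; exact: zproj_cont.
- by move=> I B; exact: zproj_open.
- by move=> q; have [[I z] E] := zproj_surj q; exists (existT _ I z).
- by move=> I J z w; exact: ztrans.
exists A; split; first by split=> // I; have [] := HA I.
move=> I z; rewrite -(@bAI I z); apply: iff_sym.
have [oR df] := HA I.
apply: (diffeo_bdry (cAI (I:=I)) (manifold_charted mA) df) => //; first exact: filterT.
by apply: open_nbhs_nbhs; split=> //; exists z.
Qed.
End Structure.

(** * Orientations *)

Section BasisChange.
Variables (R : realType).
Implicit Types U V W : vectType R.

(** The rows of [T] expand the new vectors in the old ones, the convention of [is_detelt]. *)
Definition chg V k (T : 'M[R]_k) (v v' : k.-tuple V) : Prop :=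
  forall i, tnth v' i = \sum_j T i j *: tnth v j.

Lemma chg_comp V k (T S : 'M[R]_k) (v v' v'' : k.-tuple V) :
  chg T v v' -> chg S v' v'' -> chg (S *m T) v v''.
Proof.
move=> H H' i; rewrite H'; under eq_bigr do rewrite H scaler_sumr.
rewrite exchange_big; apply: eq_bigr => j _; rewrite mxE scaler_suml.
by apply: eq_bigr => l _; rewrite scalerA.
Qed.

Lemma chg1 V k (v : k.-tuple V) : chg 1%:M v v.
Proof.
move=> i; rewrite (bigD1 i) //= mxE eqxx scale1r big1 ?addr0 // => j ji.
by rewrite mxE eq_sym (negbTE ji) scale0r.
Qed.

Lemma chg_free V k (T : 'M[R]_k) (v : k.-tuple V) : free v -> chg T v v -> T = 1%:M.
Proof.
move=> /freeP fv H; apply/matrixP => i j.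
have : \sum_j (T i j - 1%:M i j) *: v`_j = 0.
  have := chg1 v i; rewrite {1}H => /eqP; rewrite -subr_eq0 -sumrB => /eqP E.
  by rewrite -[RHS]E; apply: eq_bigr => l _; rewrite scalerBl (tnth_nth 0).
by move=> /fv /(_ j) /eqP; rewrite subr_eq0 => /eqP.
Qed.

Lemma chg_exists V k (v v' : k.-tuple V) : (forall i, tnth v' i \in <<v>>%VS) ->
  exists T, chg T v v'.
Proof.
move=> H; exists (\matrix_(i, j) coord v j (tnth v' i)) => i.
rewrite {1}(coord_span (H i)); apply: eq_bigr => j _.
by rewrite mxE -tnth_nth.
Qed.

Lemma chg_unit V (U : {vspace V}) k (T : 'M[R]_k) (v v' : k.-tuple V) :
  basis_of U v -> basis_of U v' -> chg T v v' -> T \in unitmx.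
Proof.
move=> bv bv' H; have [|S HS] := @chg_exists _ k v' v.
  by move=> i; rewrite (span_basis bv') (basis_mem bv) // mem_tnth.
have := chg_free (basis_free bv) (chg_comp H HS).
by move=> /mulmx1_unit [].
Qed.

Lemma chg_inv V k (T : 'M[R]_k) (v v' : k.-tuple V) : T \in unitmx ->
  chg T v v' -> chg (invmx T) v' v.
Proof.
move=> uT H i.
have -> : \sum_j invmx T i j *: tnth v' j = \sum_j (invmx T *m T) i j *: tnth v j.
  under eq_bigr do rewrite H scaler_sumr.
  rewrite exchange_big; apply: eq_bigr => j _; rewrite mxE scaler_suml.
  by apply: eq_bigr => l _; rewrite scalerA.
by rewrite mulVmx //; exact: chg1.
Qed.

Lemma chg_basis V (U : {vspace V}) k (T : 'M[R]_k) (v v' : k.-tuple V) :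
  basis_of U v -> T \in unitmx -> chg T v v' -> basis_of U v'.
Proof.
move=> bv uT H.
have sub w w' S : chg S w w' -> (<<w' : k.-tuple V>> <= <<w : k.-tuple V>>)%VS.
  move=> HS; apply/span_subvP => x /tnthP[i ->]; rewrite HS.
  by apply: memv_suml => j _; rewrite memvZ // memv_span // mem_tnth.
rewrite basisEdim -(span_basis bv) (sub _ _ _ (chg_inv uT H)) size_tuple /=.
by rewrite (span_basis bv) -(size_basis bv).
Qed.

Lemma chg_cat V k r (a : 'M[R]_k) (b : 'M[R]_(k, r)) (c : 'M[R]_(r, k)) (d : 'M[R]_r) (v1 v1' : k.-tuple V) (v2 v2' : r.-tuple V) :
  (forall i, tnth v1' i = \sum_j a i j *: tnth v1 j + \sum_j b i j *: tnth v2 j) ->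
  (forall i, tnth v2' i = \sum_j c i j *: tnth v1 j + \sum_j d i j *: tnth v2 j) ->
  chg (block_mx a b c d) [tuple of v1 ++ v2] [tuple of v1' ++ v2'].
Proof.
move=> H1 H2 i; rewrite big_split_ord /=.
under eq_bigr do rewrite tnth_lshift; under [X in _ = _ + X]eq_bigr do rewrite tnth_rshift.
case: (split_ordP i) => i' ->; rewrite ?tnth_lshift ?tnth_rshift ?H1 ?H2; congr (_ + _);
  apply: eq_bigr => j _; by rewrite ?block_mxEul ?block_mxEur ?block_mxEdl ?block_mxEdr.
Qed.

Lemma cat_span V (x : V) k r (v : k.-tuple V) (w : r.-tuple V) : x \in <<v ++ w>>%VS ->
  exists (a : 'I_k -> R) (b : 'I_r -> R), x = \sum_j a j *: tnth v j + \sum_j b j *: tnth w j.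
Proof.
rewrite span_cat => /memv_addP[y /coord_span -> [z /coord_span -> ->]].
exists (fun j => coord v j y), (fun j => coord w j z).
by congr (_ + _); apply: eq_bigr => j _; rewrite (tnth_nth 0).
Qed.

Lemma ext_basis V k (v : k.-tuple V) : free v ->
  exists r (w : r.-tuple V), basis_of fullv (v ++ w).
Proof.
move=> fv; exists (\dim <<v>>^C), (vbasis <<v>>^C).
rewrite -(addv_complf <<v>>); apply: cat_basis.
- by apply/directv_addP; rewrite capv_compl.
- by rewrite /basis_of eqxx.
- exact: vbasisP.
Qed.

Lemma img_basis V W (D : 'Hom(V, W)) k r (v : k.-tuple V) (w : r.-tuple V) :
  basis_of (lker D) v -> basis_of fullv (v ++ w) -> basis_of (limg D) (map D w).
Proof.
move=> bv bvw; rewrite basisEdim size_map size_tuple; apply/andP; split.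
  rewrite -(span_basis bvw) span_cat limgD -!limg_span (span_basis bv).
  by rewrite subv_add subvv andbT; apply/subvP => _ /memv_imgP[x /[1!memv_ker] /eqP H ->]; rewrite H mem0v.
have := limg_ker_dim D fullv; rewrite capfv => E.
by rewrite -(leq_add2l (\dim (lker D))) E (size_basis (X := [tuple of v ++ w]) bvw) (size_basis bv) leqnn.
Qed.

Lemma lker0f V W : lker (0 : 'Hom(V, W)) = fullv.
Proof. by apply/eqP; rewrite eqEsubv subvf; apply/subvP => x _; rewrite memv_ker lfunE. Qed.

Lemma coker0 V W l (w : l.-tuple W) : coker_basis (0 : 'Hom(V, W)) w = basis_of fullv w.
Proof.
have L0 : limg (0 : 'Hom(V, W)) = 0%VS.
  by apply/eqP; rewrite -subv0; apply/subvP => _ /memv_imgP[x _ ->]; rewrite lfunE mem0v.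
by rewrite /coker_basis L0 add0v cap0v eqxx andbT /basis_of andbC.
Qed.
End BasisChange.

(** * The contraction isomorphism *)

Section Contraction.
Variables (R : realType).
Implicit Types U V W : vectType R.

(** Evaluation on sequences: lengths that agree only propositionally can then be rewritten by
    [map_cat] or [catA] without casting tuples. *)
Definition sq V W (c : detelt V W) (s : seq V) (t : seq W) : R :=
  c (size s) (size t) (in_tuple s) (in_tuple t).

Lemma sqE V W (c : detelt V W) k l (v : k.-tuple V) (w : l.-tuple W) : c k l v w = sq c v w.
Proof.
case: v w => s /= ss [t /= ts]; move: (ss) (ts); rewrite -(eqP ss) -(eqP ts) => ss' ts'.
by rewrite /sq; congr c; apply: val_inj.
Qed.

Lemma detelt_chg V W (lam : detelt V W) k l (P : 'M[R]_k) (Q : 'M[R]_l)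
    (v v' : k.-tuple V) (w w' : l.-tuple W) :
  is_detelt 0 lam -> basis_of fullv v -> basis_of fullv w -> P \in unitmx -> Q \in unitmx ->
  chg P v v' -> chg Q w w' -> \det P * lam k l v' w' = \det Q * lam k l v w.
Proof.
move=> H bv bw uP uQ cP cQ; apply: H; rewrite ?lker0f ?coker0 //.
- exact: chg_basis cP.
- exact: chg_basis cQ.
- by move=> i; rewrite cQ subrr mem0v.
Qed.

Lemma coker_cat V W (D : 'Hom(V, W)) l r (w : l.-tuple W) (u : r.-tuple W) :
  coker_basis D w -> basis_of (limg D) u -> basis_of fullv (w ++ u).
Proof.
move=> /and3P[fw /eqP Ew /eqP Cw] bu; rewrite -Ew addvC; apply: cat_basis => //.
  by apply/directv_addP; rewrite capvC.
by rewrite /basis_of eqxx.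
Qed.

Lemma cat_coker V W (D : 'Hom(V, W)) l r (w : l.-tuple W) (u : r.-tuple W) :
  basis_of (limg D) u -> basis_of fullv (w ++ u) -> coker_basis D w.
Proof.
move=> bu bwu; have := basis_free bwu; rewrite cat_free => /and3P[fw _ /directv_addP dwu].
rewrite /coker_basis fw -(span_basis bu) addvC -span_cat (span_basis bwu) eqxx /=.
by rewrite capvC dwu.
Qed.

(** The value at [v], [w] is that of [lam] after completing [v] by some [v2] and [w] by [D v2]. Two
    completions differ by block-triangular matrices with the same corner [T] on both sides, so their
    determinants cancel. The transformation law follows in the same way, with corners [A] and
    [B]. *)
Lemma contraction_exists V W (D : 'Hom(V, W)) (lam : detelt V W) :
  is_detelt 0 lam -> exists c : detelt V W, Defs.is_contraction D lam c.
Proof.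
move=> lam0.
pose val k l (v : k.-tuple V) (w : l.-tuple W) x := exists r (v2 : r.-tuple V),
  [/\ basis_of fullv (v ++ v2), basis_of fullv (w ++ map D v2)
    & x = lam _ _ [tuple of v ++ v2] [tuple of w ++ map_tuple D v2]].
(* The default 0 is taken only where no completion exists. *)
pose c : detelt V W := fun k l v w => xget 0 [set x | val k l v w x].
have un k l (v : k.-tuple V) (w : l.-tuple W) x y : basis_of (lker D) v ->
    val k l v w x -> val k l v w y -> x = y.
  move=> bv [r [v2 [bv2 bw2 ->]]] [r' [v2' [bv2' bw2' ->]]].
  have Er : r = r'.
    have := size_basis (X := [tuple of v ++ v2]) bv2.
    by rewrite (size_basis (X := [tuple of v ++ v2']) bv2') => /addnI.
  subst r'.
  have H i : exists ab : ('I_k -> R) * ('I_r -> R),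
      tnth v2' i = \sum_j ab.1 j *: tnth v j + \sum_j ab.2 j *: tnth v2 j.
    have [|a [b E]] := @cat_span _ _ (tnth v2' i) _ _ v v2; first by rewrite (span_basis bv2) memvf.
    by exists (a, b).
  have [ab Hab] := choice H.
  pose T : 'M[R]_r := \matrix_(i, j) (ab i).2 j.
  have c1 : chg (block_mx 1%:M 0 (\matrix_(i, j) (ab i).1 j) T) [tuple of v ++ v2] [tuple of v ++ v2'].
    apply: chg_cat => i.
      rewrite {1}(chg1 v i); apply: esym; rewrite [X in _ + X]big1 ?addr0 // => j _.
      by rewrite mxE scale0r.
    by rewrite Hab; congr (_ + _); apply: eq_bigr => j _; rewrite mxE.
  have c2 : chg (block_mx 1%:M 0 0 T) [tuple of w ++ map_tuple D v2] [tuple of w ++ map_tuple D v2'].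
    apply: chg_cat => i.
      rewrite {1}(chg1 w i); apply: esym; rewrite [X in _ + X]big1 ?addr0 // => j _.
      by rewrite mxE scale0r.
    rewrite [X in _ = X + _]big1 => [|j _]; last by rewrite mxE scale0r.
    rewrite add0r tnth_map Hab linearD !linear_sum /= big1 ?add0r => [|j _].
      by apply: eq_bigr => j _; rewrite mxE linearZ tnth_map.
    have : tnth v j \in lker D by rewrite -(span_basis bv) memv_span // mem_tnth.
    by rewrite linearZ /= memv_ker => /eqP ->; rewrite scaler0.
  have u1 := chg_unit (v := [tuple of v ++ v2]) (v' := [tuple of v ++ v2']) bv2 bv2' c1.
  have u2 := chg_unit (v := [tuple of w ++ map_tuple D v2]) (v' := [tuple of w ++ map_tuple D v2']) bw2 bw2' c2.
  have := detelt_chg (v := [tuple of v ++ v2]) (w := [tuple of w ++ map_tuple D v2]) lam0 bv2 bw2 u1 u2 c1 c2.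
  rewrite !det_lblock !det1 !mul1r => E.
  move: u2; rewrite unitmxE det_ublock det1 mul1r unitfE => nz.
  by apply: esym; exact: (mulfI nz).
have valc k l (v : k.-tuple V) (w : l.-tuple W) r (v2 : r.-tuple V) :
    basis_of (lker D) v -> basis_of fullv (v ++ v2) -> basis_of fullv (w ++ map D v2) ->
    c k l v w = lam _ _ [tuple of v ++ v2] [tuple of w ++ map_tuple D v2].
  move=> bv b1 b2; have H : val k l v w (lam _ _ [tuple of v ++ v2] [tuple of w ++ map_tuple D v2]) by exists r, v2.
  by rewrite /c; case: xgetP => [x _ Hx|/(_ _ H)//]; exact: un Hx H.
exists c; split=> //; last by move=> k l r v1 v2 w1 bv b1 b2; rewrite (valc _ _ _ _ _ v2).
move=> k l v v' w w' A B bv bv' bw bw' HA HB.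
have [r [v2 b1]] := ext_basis (basis_free bv).
have bi := img_basis bv b1; have b2 := coker_cat (u := map_tuple D v2) bw bi.
have b2' := coker_cat (u := map_tuple D v2) bw' bi.
have c1 : chg (block_mx A 0 0 1%:M) [tuple of v ++ v2] [tuple of v' ++ v2].
  apply: chg_cat => i.
    by rewrite HA [X in _ = _ + X]big1 ?addr0 // => j _; rewrite mxE scale0r.
  by rewrite {1}(chg1 v2 i) [X in _ = X + _]big1 ?add0r // => j _; rewrite mxE scale0r.
have uA := chg_unit bv bv' HA.
have u1 : block_mx A 0 0 1%:M \in unitmx.
  by move=> *; rewrite unitmxE det_ublock det1 mulr1 -unitmxE.
have b1' := chg_basis (v := [tuple of v ++ v2]) b1 (u1 r) c1.
have H i : exists b : 'I_r -> R, tnth w' i = \sum_j B i j *: tnth w j + \sum_j b j *: D (tnth v2 j).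
  have := HB i; rewrite -(span_basis bi) => /(@coord_span _ _ _ (map_tuple D v2)) E.
  exists (fun j => coord (map_tuple D v2) j (tnth w' i - \sum_(j0 < l) B i j0 *: tnth w j0)).
  rewrite -{1}(subrK (\sum_j B i j *: tnth w j) (tnth w' i)) {1}E addrC; congr (_ + _).
  by apply: eq_bigr => j _; rewrite -(tnth_nth 0) tnth_map.
have [b Hb] := choice H.
have c2 : chg (block_mx B (\matrix_(i, j) b i j) 0 1%:M) [tuple of w ++ map_tuple D v2] [tuple of w' ++ map_tuple D v2].
  apply: chg_cat => i.
    by rewrite Hb; congr (_ + _); apply: eq_bigr => j _; rewrite mxE tnth_map.
  by rewrite {1}(chg1 (map_tuple D v2) i) [X in _ = X + _]big1 ?add0r // => j _; rewrite mxE scale0r.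
have u2 := chg_unit (v := [tuple of w ++ map_tuple D v2]) (v' := [tuple of w' ++ map_tuple D v2]) b2 b2' c2.
rewrite (valc _ _ _ _ _ v2 bv' b1' b2') (valc _ _ _ _ _ v2 bv b1 b2).
have := detelt_chg (v := [tuple of v ++ v2]) (w := [tuple of w ++ map_tuple D v2]) lam0 b1 b2 (u1 r) u2 c1 c2.
by rewrite !det_ublock det1 !mulr1.
Qed.

Lemma chg_map V W (A : 'Hom(V, W)) k (T : 'M[R]_k) (v v' : k.-tuple V) :
  chg T v v' -> chg T (map_tuple A v) (map_tuple A v').
Proof.
move=> H i; rewrite tnth_map H linear_sum; apply: eq_bigr => j _.
by rewrite linearZ tnth_map.
Qed.

Lemma chg_catl V k r (T : 'M[R]_k) (v v' : k.-tuple V) (n : r.-tuple V) :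
  chg T v v' -> chg (block_mx T 0 0 1%:M) [tuple of v ++ n] [tuple of v' ++ n].
Proof.
move=> H; apply: chg_cat => i.
  by rewrite H [X in _ = _ + X]big1 ?addr0 // => j _; rewrite mxE scale0r.
by rewrite {1}(chg1 n i) [X in _ = X + _]big1 ?add0r // => j _; rewrite mxE scale0r.
Qed.

Lemma block1_unit k r (T : 'M[R]_k) :
  (block_mx T 0 0 (1%:M : 'M[R]_r) \in unitmx) = (T \in unitmx).
Proof. by rewrite !unitmxE det_ublock det1 mulr1. Qed.

Lemma map_basis V W (A : 'Hom(V, W)) (U : {vspace V}) (s : seq V) : lker A = 0%VS ->
  basis_of U s -> basis_of (A @: U) (map A s).
Proof. by move=> A0; apply: limg_basis_of; rewrite A0 capv0. Qed.

Section Compat.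
Variables (V W V' W' : vectType R) (A : 'Hom(V, V')) (B : 'Hom(W, W')).
Variables (D : 'Hom(V, W)) (D1 : 'Hom(V', W')).
Variables (lam sg : detelt V W) (lam1 sg1 : detelt V' W').
Hypotheses (A0 : lker A = 0%VS) (B0 : lker B = 0%VS).
Hypothesis DAB : forall v, D1 (A v) = B (D v).
Hypothesis kerA : (A @: lker D)%VS = lker D1.
Hypothesis con : Defs.is_contraction D lam sg.
Hypothesis con1 : Defs.is_contraction D1 lam1 sg1.
Hypothesis sgE : forall k l (v : k.-tuple V) (w : l.-tuple W),
  basis_of (lker D) v -> coker_basis D w -> sg1 (map_tuple A v) (map_tuple B w) = sg v w.

(** For bases adapted to [D] the identity is [sgE] read through the two contractions. Passing to
    arbitrary [x] and [w] multiplies both sides by the same ratio of determinants, since [n] and its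
    image under [D1] are kept. *)
Lemma top_compat p q s (x : p.-tuple V) (w : q.-tuple W) (n : s.-tuple V') :
  basis_of fullv x -> basis_of fullv w -> basis_of fullv (map A x ++ n) ->
  basis_of fullv (map B w ++ map D1 n) ->
  sq lam1 (map A x ++ n) (map B w ++ map D1 n) = sq lam x w.
Proof.
move=> bx bw bxn bwn.
have [lam0 _ conE] := con; have [lam10 _ con1E] := con1.
have by1 := vbasisP (lker D); set y1 := vbasis (lker D) in by1.
have [r [y2 byy]] := ext_basis (basis_free by1).
have biy := img_basis by1 byy.
have [cw Hcw] : exists l, exists w1 : l.-tuple W, coker_basis D w1.
  exists (\dim (limg D)^C), (vbasis (limg D)^C).
  rewrite /coker_basis (basis_free (vbasisP _)) (span_basis (vbasisP _)).
  by rewrite addv_complf capv_compl !eqxx.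
have [w1 cbw1] := Hcw => {Hcw}.
have bwy := coker_cat (u := map_tuple D y2) cbw1 biy.
have Ep : p = (\dim (lker D) + r)%N.
  by rewrite -(size_basis bx) (size_basis (X := [tuple of y1 ++ y2]) byy).
have Eq : q = (cw + r)%N.
  by rewrite -(size_basis bw) (size_basis (X := [tuple of w1 ++ map_tuple D y2]) bwy).
subst p q.
pose y : (\dim (lker D) + r).-tuple V := [tuple of y1 ++ y2].
pose u : (cw + r).-tuple W := [tuple of w1 ++ map_tuple D y2].
have [|T cT] := @chg_exists _ _ _ y x; first by move=> i; rewrite (span_basis (X := y) byy) memvf.
have [|Q cQ] := @chg_exists _ _ _ u w; first by move=> i; rewrite (span_basis (X := u) bwy) memvf.
have uT := chg_unit (v := y) byy bx cT; have uQ := chg_unit (v := u) bwy bw cQ.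
have cT1 := chg_catl n (chg_map A cT); have cQ1 := chg_catl (map_tuple D1 n) (chg_map B cQ).
have uT1 : block_mx T 0 0 (1%:M : 'M[R]_s) \in unitmx by rewrite block1_unit.
have uQ1 : block_mx Q 0 0 (1%:M : 'M[R]_s) \in unitmx by rewrite block1_unit.
have byn := chg_basis (v := [tuple of map_tuple A x ++ n]) (v' := [tuple of map_tuple A y ++ n]) bxn _ (chg_inv uT1 cT1).
have bun := chg_basis (v := [tuple of map_tuple B w ++ map_tuple D1 n])
  (v' := [tuple of map_tuple B u ++ map_tuple D1 n]) bwn _ (chg_inv uQ1 cQ1).
have {byn} := byn (eq_ind_r is_true uT1 (unitmx_inv _)).
have {bun} := bun (eq_ind_r is_true uQ1 (unitmx_inv _)).
move=> bun byn.
have E1 := detelt_chg lam10 byn bun uT1 uQ1 cT1 cQ1.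
have E2 := detelt_chg (v := y) (w := u) lam0 byy bwy uT uQ cT cQ.
suff E : sq lam1 (map A y ++ n) (map B u ++ map D1 n) = sq lam y u.
  move: E1 E2; rewrite !det_ublock !det1 !mulr1 !sqE /= => E1 E2.
  have nz : \det T != 0 by move: uT; rewrite unitmxE unitfE.
  by apply: (mulfI nz); rewrite E1 E2 E.
have Ey : map A y ++ n = map_tuple A y1 ++ [tuple of map_tuple A y2 ++ n] by rewrite /= map_cat catA.
have Eu : map B u ++ map D1 n = map_tuple B w1 ++ map_tuple D1 [tuple of map_tuple A y2 ++ n].
  rewrite /= !map_cat -!map_comp -catA; congr (_ ++ (_ ++ _)).
  by apply: eq_map => z /=; rewrite DAB.
have H1 := con1E _ _ _ (map_tuple A y1) [tuple of map_tuple A y2 ++ n] (map_tuple B w1).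
rewrite Ey Eu -[LHS](sqE lam1 [tuple of map_tuple A y1 ++ [tuple of map_tuple A y2 ++ n]]
  [tuple of map_tuple B w1 ++ map_tuple D1 [tuple of map_tuple A y2 ++ n]]) H1.
- rewrite sgE // -(sqE lam y u); apply: esym; exact: conE.
- by rewrite -kerA; exact: map_basis.
- by move: byn; rewrite /= map_cat catA.
- by rewrite -[X in basis_of _ X]Eu.
Qed.

Variables (D' : 'Hom(V, W)) (D1' : 'Hom(V', W')) (c : detelt V W) (c1 : detelt V' W').
Hypothesis DAB' : forall v, D1' (A v) = B (D' v).
Hypotheses (surj : limg D' = fullv) (surj1 : limg D1' = fullv).
Hypothesis dims : (\dim {:V} + \dim {:W'} = \dim {:V'} + \dim {:W})%N.
Hypothesis adm : forall v, D1' v - D1 v \in limg B.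
Hypothesis conc : Defs.is_contraction D' lam c.
Hypothesis conc1 : Defs.is_contraction D1' lam1 c1.

(** After completing by vectors [n] transverse to the image of [A], the perturbed contraction
    evaluates [lam1] with [D1' n] in the target, whereas [top_compat] needs [D1 n]. By [adm] the two
    differ by elements of the image of [B], spanned by the vectors [B w] already present, so the
    change of basis is unipotent and [lam1] is unaffected. *)
Lemma contraction_compat k (v : k.-tuple V) : basis_of (lker D') v ->
  c1 (map_tuple A v) [tuple] = c v [tuple].
Proof.
move=> bv; have [lam10 _ _] := con1.
have [_ _ concE] := conc; have [_ _ conc1E] := conc1.
have [r [v2 b1]] := ext_basis (basis_free bv).
have bi := img_basis bv b1; rewrite surj in bi.
pose x : (k + r).-tuple V := [tuple of v ++ v2].
have fAx : free (map A x).
  exact: basis_free (map_basis A0 b1).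
have [s [n bn]] := @ext_basis _ _ _ (map_tuple A x) fAx.
have bAv : basis_of (lker D1') (map A v).
  have bA := map_basis A0 bv; rewrite basisEfree (basis_free bA) (span_basis bA) /=.
  apply/andP; split.
    apply/subvP => _ /memv_imgP[z /[1!memv_ker] /eqP z0 ->].
    by rewrite memv_ker DAB' z0 linear0.
  have := limg_ker_dim D1' fullv; have := limg_ker_dim D' fullv.
  rewrite !capfv surj surj1 size_map size_tuple (size_basis bv) => e1 e2.
  by move: dims; rewrite -e1 -e2; lia.
have bxn : basis_of fullv (map A v ++ (map A v2 ++ n)) by move: bn; rewrite /= map_cat catA.
have biD := img_basis (v := map_tuple A v) (w := [tuple of map_tuple A v2 ++ n]) bAv bxn.
rewrite surj1 in biD.
have ED : map D1' (map A v2 ++ n) = map B (map D' v2) ++ map D1' n.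
  by rewrite map_cat -!map_comp; congr (_ ++ _); apply: eq_map => z /=; rewrite DAB'.
pose w : r.-tuple W := map_tuple D' v2.
have bwn' : basis_of fullv [tuple of map_tuple B w ++ map_tuple D1' n] by rewrite /= -ED.
(* Admissibility enters here: the two images of each vector of [n] differ by a combination of
   [map_tuple B w]. *)
have /choice[a Ha] : forall i, exists a : 'I_r -> R, tnth (map_tuple D1 n) i = \sum_j a j *: tnth (map_tuple B w) j + tnth (map_tuple D1' n) i.
  move=> i; rewrite !tnth_map.
  have /memv_imgP[z _ Ez] := adm (tnth n i).
  have zw : z \in <<w>>%VS by rewrite (span_basis (X := w) bi) memvf.
  exists (fun j => - coord w j z).
  rewrite -[D1 _](subKr (D1' (tnth n i))) Ez addrC; congr (_ + _).
  rewrite {1}(coord_span zw) linear_sum -sumrN; apply: eq_bigr => j _.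
  by rewrite linearZ tnth_map -tnth_nth scaleNr.
have cQ : chg (block_mx 1%:M 0 (\matrix_(i, j) a i j) 1%:M) [tuple of map_tuple B w ++ map_tuple D1' n]
    [tuple of map_tuple B w ++ map_tuple D1 n].
  apply: chg_cat => i.
    by rewrite {1}(chg1 (map_tuple B w) i) [X in _ = _ + X]big1 ?addr0 // => j _; rewrite mxE scale0r.
  rewrite Ha; congr (_ + _); last exact: chg1.
  by apply: eq_bigr => j _; rewrite mxE.
have uQ : block_mx (1%:M : 'M[R]_r) 0 (\matrix_(i, j) a i j) (1%:M : 'M[R]_s) \in unitmx.
  by rewrite unitmxE det_lblock !det1 mulr1 unitr1.
have bwn := chg_basis bwn' uQ cQ.
have E1 := detelt_chg (v := [tuple of map_tuple A x ++ n]) lam10 bn bwn' (unitmx1 _ _) uQ (chg1 _) cQ.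
move: E1; rewrite det1 det_lblock !det1 !mul1r !sqE /= => E1.
have E2 := top_compat (x := x) (w := w) (n := n) b1 bi bn bwn.
have H1 := conc1E _ _ _ (map_tuple A v) [tuple of map_tuple A v2 ++ n] [tuple] bAv bxn biD.
have H2 := concE _ _ _ v v2 [tuple] bv b1 bi.
rewrite !sqE /= in H1 H2; rewrite -H1 -H2 ED.
by move: E1 E2; rewrite /= map_cat -catA => <- ->.
Qed.
End Compat.
End Contraction.

(** * Coordinate frames and smoothness of determinant sections *)

Section Frames.
Variable R : realType.
Implicit Types M N : mfd R.

Lemma rdiff_chart N n (S : set N) (h : N -> 'rV[R]_n) (x0 q : N) Q g : charted N ->
  mdom x0 q -> thickS S q q -> coord_rep x0 S h q Q g ->
  forall v, rdiff S h q v = rdiff (mdom x0) (mmap x0) q v *m jac g (mmap x0 q).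
Proof.
move=> cN xq tS cr v; have qq := mdom_refl cN q.
have [oQ Qq sg Hg] := cr.
have [_ _ _ _ tr] := cN q; have [Q1 [k [oQ1 Q1q sk Hk]]] := tr x0 q qq xq.
have cr1 : coord_rep q (mdom x0) (mmap x0) q Q1 k by split=> // p xp qp Qp; exact: Hk.
have E := Hk q (conj qq xq) qq Q1q.
have nx := mdom_nbhs cN xq.
have t1 : thickS (mdom x0) q q by exact: thickS_nbhs.
have t2 : thickS (S `&` mdom x0) q q by exact: (thickS_sub cN qq tS nx).
have oP := open_preim oQ1 oQ sk.
have cr2 : coord_rep q (S `&` mdom x0) h q (Q1 `&` k @^-1` Q) (g \o k).
  split=> //; first by split=> //=; rewrite E.
    by apply: smooth_comp oP oQ _ (smooth_sub _ sk) sg => z [].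
  by move=> p [Sp xp] qp [Q1p]; rewrite /= (Hk p (conj qp xp)) // => Qp; exact: Hg.
have -> : rdiff S h q = rdiff (S `&` mdom x0) h q.
  apply: (rdiff_ext cN tS t2); last by exists (Q1 `&` k @^-1` Q), (g \o k).
  by exists (mdom x0).
rewrite (rdiffP t2 cr2) (rdiffP t1 cr1) jac_comp ?mulmxA ?E //.
  exact: smooth_diff sk Q1q.
exact: smooth_diff sg Qq.
Qed.

Lemma mdiff_chart N M (S : set N) (f : N -> M) x0 u0 p Q G : charted N -> charted M ->
  thickS S p p -> smooth_at S f p -> mdom x0 p -> (forall q, S q -> mdom u0 (f q)) ->
  coord_rep x0 S (mmap u0 \o f) p Q G ->
  forall v, rdiff (mdom u0) (mmap u0) (f p) (mdiff S f p v) =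
    rdiff (mdom x0) (mmap x0) p v *m jac G (mmap x0 p).
Proof.
move=> cN cM tS sf xp Su cr v.
have Sp := thickS_mem cN (mdom_refl cN p) tS.
have uq := Su p Sp.
rewrite -(rdiff_chart cN xp tS cr).
have [_ _ _ _ tr] := cM (f p).
have su : rsmooth_at (mdom u0) (mmap u0) (f p).
  have [Q1 [k [oQ1 Q1q sk Hk]]] := tr u0 (f p) (mdom_refl cM _) uq.
  by exists Q1, k; split=> // q xp' qp Qp'; exact: Hk.
have tu : thickS (mdom u0) (f p) (f p).
  by apply: (thickS_nbhs cM (mdom_refl cM _)); exact: mdom_nbhs.
by rewrite (rdiff_comp cN cM tS tu Su sf su) comp_lfunE.
Qed.

(** The Jacobian at [q] of the transition from the chart around [q], in which tangent vectors are
    read, to the chart around [x0]. *)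
Definition chartmx N (x0 q : N) : 'M[R]_(mdim N) := lin1_mx (rdiff (mdom x0) (mmap x0) q).

Lemma chartmxE N (x0 q : N) v : rdiff (mdom x0) (mmap x0) q v = v *m chartmx x0 q.
Proof. by rewrite mul_rV_lin1. Qed.

Lemma chartmx_unit N (x0 q : N) : charted N -> mdom x0 q -> chartmx x0 q \in unitmx.
Proof.
move=> cN xq; have qq := mdom_refl cN q.
have [_ _ _ _ tr] := cN q; have [Q1 [k cr]] := tr x0 q qq xq.
have [_ _ _ _ tr'] := cN x0; have [Q2 [k' cr']] := tr' q q xq qq.
have cr1 : coord_rep q (mdom x0) (mmap x0) q Q1 k.
  by have [? ? ? H] := cr; split=> // p xp qp Qp; exact: H.
have cr2 : coord_rep x0 (mdom q `&` mdom x0) (mmap q) q Q2 k' by rewrite setIC.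
have -> : chartmx x0 q = jac k (mmap q q).
  apply/row_matrixP => i; rewrite !rowE -chartmxE; apply: (rdiffP _ cr1).
  by apply: (thickS_nbhs cN qq); exact: mdom_nbhs.
by have /mulmx1_unit[] := trans_jac cN qq xq cr cr2.
Qed.

(** The coordinate frame of the chart around [x0]; its vectors are rows of an inverse matrix because
    tangent vectors at [q] are written in the chart around [q]. *)
Definition frame N (x0 q : N) : (mdim N).-tuple (tangent q) :=
  [tuple row i (invmx (chartmx x0 q)) | i < mdim N].

Lemma frame_delta N (x0 q : N) i : charted N -> mdom x0 q ->
  rdiff (mdom x0) (mmap x0) q (tnth (frame x0 q) i) = delta_mx ord0 i.
Proof.
by move=> cN xq; rewrite chartmxE tnth_mktuple -row_mul mulVmx ?chartmx_unit // row1.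
Qed.

Lemma frame_uniq N (x0 q : N) (v : (mdim N).-tuple (tangent q)) : charted N -> mdom x0 q ->
  (forall i, rdiff (mdom x0) (mmap x0) q (tnth v i) = delta_mx ord0 i) -> v = frame x0 q.
Proof.
move=> cN xq H; apply: eq_from_tnth => i.
rewrite -[LHS](mulmxK (chartmx_unit cN xq)) -chartmxE H -(frame_delta i cN xq) chartmxE.
by rewrite mulmxK // chartmx_unit.
Qed.

Lemma rows_basis m (L : 'M[R]_m) : L \in unitmx ->
  basis_of fullv ([tuple row i L | i < m] : m.-tuple 'rV[R]_m).
Proof.
move=> uL; set t : m.-tuple 'rV[R]_m := [tuple _ | i < m].
suff ft : free t by rewrite basisEfree ft subvf size_tuple dimvf /= dim_matrix mul1r leqnn.
apply/freeP => c c0 i; have : (\row_j c j) *m L = 0.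
  by rewrite -[RHS]c0 mulmx_sum_row; apply: eq_bigr => j _; rewrite mxE -tnth_nth tnth_mktuple.
move=> /(congr1 (mulmx^~ (invmx L))); rewrite mulmxK // mul0mx => /rowP/(_ i).
by rewrite !mxE.
Qed.

Lemma frame_basis N (x0 q : N) : charted N -> mdom x0 q -> basis_of fullv (frame x0 q).
Proof. by move=> cN xq; apply: rows_basis; rewrite unitmx_inv chartmx_unit. Qed.

Lemma chg_frame N (x0 q : N) (T : 'M[R]_(mdim N)) (v : (mdim N).-tuple (tangent q)) :
  charted N -> mdom x0 q ->
  (forall i, rdiff (mdom x0) (mmap x0) q (tnth v i) = row i T) -> chg T (frame x0 q) v.
Proof.
move=> cN xq H i; rewrite -[LHS](mulmxK (chartmx_unit cN xq)) -chartmxE H mulmx_sum_row.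
by apply: eq_bigr => j _; rewrite mxE tnth_mktuple.
Qed.

Lemma vec_sum (E : vectType R) (v : 'rV[R]_(\dim {:E})) :
  vec v = \sum_j v ord0 j *: tnth (vbasis {:E}) j.
Proof. by apply: eq_bigr => j _; rewrite -tnth_nth. Qed.

Lemma chg_vbasis (E : vectType R) (T : 'M[R]_(\dim {:E})) (w : (\dim {:E}).-tuple E) :
  (forall i, rv (tnth w i) = row i T) -> chg T (vbasis {:E}) w.
Proof.
by move=> H i; rewrite -[LHS]rvK H vec_sum; apply: eq_bigr => j _; rewrite mxE.
Qed.

Lemma vsmooth_of_Ck N (S : set N) (h : N -> R^o) x0 p Q (phi : 'rV[R]_(mdim N) -> R) :
  charted N -> mdom x0 p -> open Q -> Q (mmap x0 p) -> (forall k, Ck k Q phi) ->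
  (forall q, S q -> mdom x0 q -> Q (mmap x0 q) -> h q = phi (mmap x0 q)) ->
  vsmooth_at S h p.
Proof.
move=> cN xp oQ Qp sphi H; apply: (crep_chart cN (mdom_refl cN p) xp (Q := Q)
   (g := fun y => rv (phi y : R^o))).
split=> //; last by move=> q Sq xq Qq /=; rewrite H.
move=> k; apply: Ck_mx => // i j.
apply: (@Ck_eq _ _ _ _ _ (fun y => phi y * rv (1 : R^o) i j)) => //.
  move=> y _; have L : rv (phi y : R^o) = phi y *: rv (1 : R^o).
    transitivity (rv (phi y *: (1 : R^o))); first by rewrite [_ *: _]mulr1.
    by have := rv_linear (phi y) (1 : R^o) 0; rewrite rv0 !addr0.
  have Lij : rv (phi y : R^o) i j = phi y * rv (1 : R^o) i j by rewrite L mxE.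
  exact: esym Lij.
by apply: Ck_mul => //; exact: Ck_cst.
Qed.

Lemma Ck_of_vsmooth N (S : set N) (h : N -> R^o) x0 p : charted N -> mdom x0 p ->
  vsmooth_at S h p -> exists Q (phi : 'rV[R]_(mdim N) -> R),
    [/\ open Q, Q (mmap x0 p), forall k, Ck k Q phi
      & forall q, S q -> mdom x0 q -> Q (mmap x0 q) -> h q = phi (mmap x0 q)].
Proof.
move=> cN xp [Q0 [g0 cr0]].
have [Q [g [oQ Qp sg Hg]]] := crep_chart cN xp (mdom_refl cN p) cr0.
exists Q, (fun y => \sum_j g y ord0 j * (tnth (vbasis {:R^o}) j : R^o)); split=> //.
  move=> k; apply: Ck_sum => // j _; apply: Ck_mul => //; last exact: Ck_cst.
  by apply: Ck_coord => //; exact: sg.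
move=> q Sq xq Qq; rewrite Hg // -[LHS](rvK (h q)) vec_sum; exact: eq_bigr.
Qed.

(** [Mat] and [Bm] express the bases [X] and [w] in the coordinate frame of [M] and in [vbasis]. The
    value of [lam] on them is its smooth frame coefficient times [\det Bm / \det Mat], a smooth
    function where [\det Mat] does not vanish. *)
Lemma top_eval N M (E : vectType R) (lam : forall p : M, detelt (tangent p) E)
    (S : set N) (i : N -> M) x0 p0 u0 Q G
    (Mat : 'rV[R]_(mdim N) -> 'M[R]_(mdim M)) (Bm : 'rV[R]_(mdim N) -> 'M[R]_(\dim {:E})) 
    (X : forall q, (mdim M).-tuple (tangent (i q))) (w : N -> (\dim {:E}).-tuple E) :
  charted N -> charted M -> smooth_top lam -> S p0 -> S `<=` mdom x0 ->
  (forall q, S q -> mdom u0 (i q)) ->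
  coord_rep x0 S (mmap u0 \o i) p0 Q G ->
  (forall k a b, Ck k Q (fun y => Mat y a b)) -> (forall k a b, Ck k Q (fun y => Bm y a b)) ->
  \det (Mat (mmap x0 p0)) != 0 ->
  (forall q, S q -> Q (mmap x0 q) ->
    forall a, rdiff (mdom u0) (mmap u0) (i q) (tnth (X q) a) = row a (Mat (mmap x0 q))) ->
  (forall q, S q -> Q (mmap x0 q) -> \det (Mat (mmap x0 q)) != 0 ->
    (forall a, rv (tnth (w q) a) = row a (Bm (mmap x0 q))) /\ basis_of fullv (w q)) ->
  exists Q' phi, [/\ open Q', Q' (mmap x0 p0), forall k, Ck k Q' phi
    & forall q, S q -> Q' (mmap x0 q) ->
      [/\ Q (mmap x0 q), \det (Mat (mmap x0 q)) != 0 & lam (i q) _ _ (X q) (w q) = phi (mmap x0 q)]].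
Proof.
move=> cN cM [lam0 Hlam] Sp Sx Su [oQ Qp sG HG] sMat sBm det0 HX Hw.
have [h sh Hh] := Hlam u0 _ (vbasis {:E}) (vbasisP _).
have [Q1 [phi1 [oQ1 Q1p sphi1 Hphi1]]] := Ck_of_vsmooth cM (Su _ Sp) (sh _ (Su _ Sp)).
have sdet k : Ck k Q (fun y => \det (Mat y)) by exact: Ck_det.
have oQ2 : open (Q `&` [set y | \det (Mat y) != 0]).
  rewrite openE => y [Qy dy]; apply: filterI; first exact: open_nbhs_nbhs.
  have c : {for y, continuous (fun y => \det (Mat y))} by exact: Ck_cont (sdet 0%N) Qy.
  apply: (c [set r | r != 0]); apply: open_nbhs_nbhs; split=> //.
pose Q' := (Q `&` [set y | \det (Mat y) != 0]) `&` (Q `&` G @^-1` Q1).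
have oQ' : open Q' by apply: openI => //; exact: open_preim.
exists Q', (fun y => phi1 (G y) * \det (Bm y) * (\det (Mat y))^-1); split=> //.
- by split; split=> //=; rewrite HG //; exact: Sx.
- move=> k; apply: Ck_mul => //; first apply: Ck_mul => //.
  + by apply: (Ck_comp oQ' oQ1) (sphi1 k) => [y [_ []]//|]; apply: Ck_sub (sG k) => y [[]].
  + by apply: Ck_sub (Ck_det oQ (sBm k)) => y [[]].
  + apply: Ck_inv => //; first by move=> y [[]].
    by apply: Ck_sub (sdet k) => y [[]].
move=> q Sq [[Qq dq] [_ /= Q1q]].
have Eq : G (mmap x0 q) = mmap u0 (i q) by apply: HG => //; exact: Sx.
have [Hw1 bw] := Hw q Sq Qq dq.
have uq := Su q Sq.
have c1 := chg_frame cM uq (HX q Sq Qq).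
have u1 : Mat (mmap x0 q) \in unitmx by rewrite unitmxE unitfE.
have c2 := chg_vbasis Hw1.
have u2 := chg_unit (vbasisP _) bw c2.
have := detelt_chg (lam0 (i q)) (frame_basis cM uq) (vbasisP _) u1 u2 c1 c2.
rewrite (Hh (i q) (frame u0 (i q)) uq) => [|a]; last exact: frame_delta.
rewrite Hphi1 -?Eq // => H; split=> //.
by apply: (mulfI dq); rewrite H [RHS]mulrC mulfVK // mulrC.
Qed.

Lemma ker_basis (V1 V W : vectType R) (A : 'Hom(V1, V)) (D : 'Hom(V, W)) (b : seq V1) :
  lker A = 0%VS -> basis_of fullv b -> (forall v, D (A v) = 0) -> limg D = fullv ->
  (\dim {:V1} + \dim {:W} = \dim {:V})%N -> basis_of (lker D) (map A b).
Proof.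
move=> A0 bb DA sD dims.
have bA := map_basis A0 bb; rewrite basisEfree (basis_free bA) (span_basis bA) /=.
apply/andP; split; first by apply/subvP => _ /memv_imgP[z _ ->]; rewrite memv_ker DA.
have := limg_ker_dim D fullv; rewrite capfv sD size_map -(size_basis (X := in_tuple b) bb).
by rewrite -dims => /addIn ->.
Qed.

Lemma dim_tangent M (p : M) : \dim {:tangent p} = mdim M.
Proof. by rewrite dimvf /= dim_matrix mul1r. Qed.

(** The frame of [N], pushed by [i] onto the kernel, is completed by vector fields [Yt] with
    constant coordinates. The contraction is then by definition the value of [lam] on this basis and
    on the images of [Yt], which [top_eval] handles. *)
Lemma contraction_smooth : forall (N M : mfd R) (E : vectType R)
    (lam : forall p : M, detelt (tangent p) E) (V : set M) (f : M -> E)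
    (S : set N) (i : N -> M) (o : forall p : N, detelt (tangent p) 'rV[R]_0) (x0 p0 : N),
  charted N -> charted M -> smooth_top lam -> open S -> S p0 -> mdom x0 p0 ->
  smooth_on S i -> (forall q, S q -> V (i q)) -> open V -> vsmooth_on V f ->
  (mdim N + \dim {:E})%N = mdim M ->
  (forall q, S q -> lker (mdiff S i q) = 0%VS) ->
  (forall q, S q -> limg (vdiff V f (i q)) = fullv) ->
  (forall q v, S q -> vdiff V f (i q) (mdiff S i q v) = 0) ->
  (forall q, S q -> exists c, Defs.is_contraction (vdiff V f (i q)) (lam (i q)) c /\
    forall k (b : k.-tuple (tangent q)), basis_of fullv b ->
      o q k 0%N b [tuple] = c k 0%N (map_tuple (mdiff S i q) b) [tuple]) ->
  exists W Q phi, [/\ nbhs p0 W, open Q /\ Q (mmap x0 p0), forall k, Ck k Q phi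
    & forall q, W q -> mdom x0 q -> Q (mmap x0 q) ->
        o q _ 0%N (frame x0 q) [tuple] = phi (mmap x0 q)].
Proof.
(* [M] is taken apart so that its dimension can be replaced by a sum, which lets matrices on its
   tangent spaces be written in blocks. *)
move=> N [T m ch] E; set M := Mfd ch => lam V f S i o x0 p0 cN cM slam oS Sp xp si SV oV sf dims.
move=> lk surj kil Ho; rewrite /= in dims; subst m.
set u0 := i p0.
pose S1 : set N := [set q | [/\ S q, mdom x0 q & mdom u0 (i q)]].
have S1p : S1 p0 by split=> //; exact: (mdom_refl cM).
have S1n q : S1 q -> nbhs q S1.
  move=> [Sq xq uq]; have nS : nbhs q S by exact: open_nbhs_nbhs.
  have [W nW HW] := within_near (si q Sq).1 (mdom_nbhs cM uq).
  by apply: filterS (filterI (filterI nS nW) (mdom_nbhs cN xq)) => z [[Sz Wz] xz]; split=> //; exact: HW.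
have S1S : S1 `<=` S by move=> q [].
have th1 q : S1 q -> thickS S1 q q by move=> H; apply: (thickS_nbhs cN (mdom_refl cN q)); exact: S1n.
have thS q : S q -> thickS S q q.
  by move=> H; apply: (thickS_nbhs cN (mdom_refl cN q)); exact: open_nbhs_nbhs.
have thV u : V u -> thickS V u u.
  by move=> H; apply: (thickS_nbhs cM (mdom_refl cM u)); exact: open_nbhs_nbhs.
have si1 q : S1 q -> smooth_at S1 i q by move=> H; apply: (smooth_at_sub S1S); apply: si; exact: S1S.
have [Q0 [G cr0']] := smooth_at_charts cN cM S1p (si1 p0 S1p) xp (mdom_refl cM u0).
have cr0 : coord_rep x0 S1 (mmap u0 \o i) p0 Q0 G.
  by apply: crep_sub cr0' => q H; split=> //; case: H.
have [Qf [F crF]] := sf u0 (SV _ Sp).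
have [oQ0 Q0p sG HG] := cr0; have [oQf Qfp sF HF] := crF.
have Gp : G (mmap x0 p0) = mmap u0 u0 by exact: HG.
have oP := open_preim oQ0 oQf sG.
have cr : coord_rep x0 S1 (mmap u0 \o i) p0 (Q0 `&` (Q0 `&` G @^-1` Qf)) G.
  by apply: crep_shrink cr0 => //; split=> //=; rewrite Gp.
set Q := Q0 `&` _ in cr.
have QQf y : Q y -> Qf (G y) by move=> [_ []].
have GE q : S1 q -> Q (mmap x0 q) -> G (mmap x0 q) = mmap u0 (i q).
  by move=> S1q [Qq _]; apply: HG => //; case: S1q.
have [oQ Qp sGQ HGQ] := cr.
have key1 q v : S1 q -> Q (mmap x0 q) ->
    (mdiff S i q v : 'rV[R]__) *m chartmx u0 (i q) = v *m chartmx x0 q *m jac G (mmap x0 q).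
  move=> S1q Qq; have [Sq xq uq] := S1q.
  have crq : coord_rep x0 S1 (mmap u0 \o i) q Q G by [].
  have E0 := mdiff_chart cN cM (th1 q S1q) (si1 q S1q) xq (fun z Sz => let: And3 _ _ h := Sz in h) crq v.
  have E1 : (mdiff S1 i q v : 'rV[R]__) = mdiff S i q v.
    apply: (mdiff_ext cN cM (th1 q S1q) (thS q Sq) _ (si q Sq)).
    by exists setT; [exact: filterT|move=> z _ /S1S].
  rewrite -(chartmxE u0 (mdiff S i q v)) -(chartmxE x0 v).
  exact (etrans (congr1 (rdiff (mdom u0) (mmap u0) (i q)) (esym E1)) E0).
have key2 u v : V u -> mdom u0 u -> Qf (mmap u0 u) ->
    rv (vdiff V f u v) = (v : 'rV[R]__) *m chartmx u0 u *m jac F (mmap u0 u).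
  move=> Vu uu Qu; rewrite vdiffE vecK -chartmxE.
  have crq : coord_rep u0 V (@rv R E \o f) u Qf F by [].
  by rewrite -(rdiff_chart cM uu (thV u Vu) crq).
have rf : row_free (jac G (mmap x0 p0)).
  apply/inj_row_free => v v0.
  have H := key1 p0 (v *m invmx (chartmx x0 p0)) S1p Qp.
  move: H; rewrite mulmxKV ?chartmx_unit // v0 => /(congr1 (mulmx^~ (invmx (chartmx u0 (i p0))))).
  rewrite mulmxK ?(chartmx_unit cM (mdom_refl cM _)) // mul0mx => /(lker0_inj (lk p0 Sp)).
  move=> /(congr1 (mulmx^~ (chartmx x0 p0))); rewrite mulmxKV ?chartmx_unit // mul0mx; exact.
(* The complement is chosen at [p0] and kept constant; it remains a complement wherever the
   determinant of [Mat] does not vanish. *)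
have [Yc HY] := complement_rows rf (addnC _ _).
pose Mat y : 'M[R]_(mdim N + \dim {:E}) := col_mx (jac G y) Yc.
pose Bm y : 'M[R]_(\dim {:E}) := Yc *m jac F (G y).
pose Yt (q : N) : (\dim {:E}).-tuple (tangent (i q)) :=
  [tuple row j Yc *m invmx (chartmx u0 (i q)) | j < \dim {:E}].
pose X (q : N) : (mdim N + \dim {:E}).-tuple (tangent (i q)) :=
  [tuple of map_tuple (mdiff S i q) (frame x0 q) ++ Yt q].
pose w (q : N) : (\dim {:E}).-tuple E := map_tuple (vdiff V f (i q)) (Yt q).
have HX q : S1 q -> Q (mmap x0 q) ->
    forall a, rdiff (mdom u0) (mmap u0) (i q) (tnth (X q) a) = row a (Mat (mmap x0 q)).
  move=> S1q Qq a; have [Sq xq uq] := S1q; rewrite chartmxE.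
  case: (split_ordP a) => a' ->; rewrite ?tnth_lshift ?tnth_rshift.
    rewrite tnth_map key1 // -chartmxE frame_delta // -rowE.
    by apply/rowP => b; rewrite [LHS]mxE [RHS]mxE /Mat col_mxEu.
  rewrite tnth_mktuple mulmxKV ?(chartmx_unit cM uq) //.
  by apply/rowP => b; rewrite [LHS]mxE [RHS]mxE /Mat col_mxEd.
have bX q : S1 q -> Q (mmap x0 q) -> \det (Mat (mmap x0 q)) != 0 -> basis_of fullv (X q).
  move=> S1q Qq dq; have [Sq xq uq] := S1q.
  apply: (chg_basis (frame_basis cM uq) (T := Mat (mmap x0 q))); first by rewrite unitmxE unitfE.
  by apply: (chg_frame cM uq); exact: HX.
have bK q : S1 q -> basis_of (lker (vdiff V f (i q))) (map_tuple (mdiff S i q) (frame x0 q)).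
  move=> [Sq xq uq]; apply: ker_basis; first exact: lk.
  - exact: frame_basis.
  - by move=> v; exact: kil.
  - exact: surj.
  - by rewrite !dim_tangent.
have bw q : S1 q -> Q (mmap x0 q) -> \det (Mat (mmap x0 q)) != 0 -> basis_of fullv (w q).
  move=> S1q Qq dq; have := img_basis (bK q S1q) (bX q S1q Qq dq).
  by rewrite surj //; case: S1q.
have sMat k a b : Ck k Q (fun y => Mat y a b).
  case: (split_ordP a) => a' ->.
    apply: (@Ck_eq _ _ _ _ _ (fun y => jac G y a' b)) => //; first by move=> y _; rewrite col_mxEu.
    exact: smooth_jac.
  apply: (@Ck_eq _ _ _ _ _ (cst (Yc a' b))) => //; first by move=> y _; rewrite col_mxEd.
  exact: Ck_cst.
have sBm k a b : Ck k Q (fun y => Bm y a b).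
  apply: (@Ck_eq _ _ _ _ _ (fun y => \sum_j Yc a j * jac F (G y) j b)) => //.
    by move=> y _; rewrite mxE.
  apply: Ck_sum => // j _; apply: Ck_mul => //; first exact: Ck_cst.
  exact: (Ck_comp oQ oQf QQf (sGQ k) (smooth_jac j b k oQf sF)).
have det0 : \det (Mat (mmap x0 p0)) != 0.
  rewrite -unitfE -unitmxE -row_full_unit /row_full /Mat -addsmxE addsmxC.
  exact: HY.
have Hw q : S1 q -> Q (mmap x0 q) -> \det (Mat (mmap x0 q)) != 0 ->
    (forall a, rv (tnth (w q) a) = row a (Bm (mmap x0 q))) /\ basis_of fullv (w q).
  move=> S1q Qq dq; split; last exact: bw.
  move=> a; have [Sq xq uq] := S1q; rewrite tnth_map tnth_mktuple.
  rewrite key2; [|exact: SV|by []|by rewrite -GE //; exact: QQf].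
  by rewrite mulmxKV ?(chartmx_unit cM uq) // /Bm GE // row_mul.
have [||Q' [phi [oQ' Q'p sphi Hphi]]] := top_eval cN cM slam S1p _ _ cr sMat sBm det0 HX Hw.
- by move=> q [].
- by move=> q [].
exists S1, Q', phi; split=> //; first exact: S1n.
move=> q S1q xq Q'q; have [Sq _ uq] := S1q; have [Qq dq <-] := Hphi q S1q Q'q.
have [c [[_ _ cE] Eo]] := Ho q Sq.
rewrite Eo; last exact: frame_basis.
rewrite -(cE _ _ _ _ (Yt q)) ?sqE //; [exact: bK|exact: bX|exact: bw].
Qed.

Lemma orientation_of N (o : forall p : N, detelt (tangent p) 'rV[R]_0) : charted N ->
  (forall p, is_detelt 0 (o p)) -> (forall p, det_nonzero 0 (o p)) ->
  (forall x0 p0, mdom x0 p0 ->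
    exists W Q phi, [/\ nbhs p0 W, open Q /\ Q (mmap x0 p0), forall k, Ck k Q phi
      & forall q, W q -> mdom x0 q -> Q (mmap x0 q) ->
        o q _ 0%N (frame x0 q) [tuple] = phi (mmap x0 q)]) ->
  is_orientation o.
Proof.
move=> cN o0 onz H; split=> //; split=> // x0 l w bw.
have l0 : l = 0%N by rewrite -(size_basis bw) dimvf /= dim_matrix mulr0.
subst l; have -> : w = [tuple] by exact: tuple0.
exists (fun q => o q _ 0%N (frame x0 q) [tuple]); last first.
  by move=> p v xp Hv; rewrite (frame_uniq cN xp Hv).
move=> p0 xp; have [W [Q [phi [nW [oQ Qp] sphi Hphi]]]] := H x0 p0 xp.
apply: (vsmooth_local cN (S' := W)) (vsmooth_of_Ck cN xp oQ Qp sphi _); last first.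
  by move=> q Wq xq Qq; exact: Hphi.
by exists W.
Qed.
End Frames.

(** The differentiated form of an intertwining relation. It serves for [s] and [s + nu] under
    coordinate changes, for the vanishing of [s + nu] along the zero set, and for [nu] along the
    boundary inclusion. *)
Lemma vdiff_push (R : realType) (M N : mfd R) (E F : vectType R) (Dm SM : set M) (SN : set N)
    (phi : M -> N) (s : M -> E) (t : N -> F) (B : 'Hom(E, F)) p :
  charted M -> charted N -> thickS Dm p p -> thickS SM p p -> thickS SN (phi p) (phi p) ->
  smooth_at Dm phi p -> vsmooth_at SM s p -> vsmooth_at SN t (phi p) ->
  (exists2 W, nbhs p W & forall q, W q -> Dm q -> [/\ SM q, SN (phi q) & t (phi q) = B (s q)]) ->
  forall v, vdiff SN t (phi p) (mdiff Dm phi p v) = B (vdiff SM s p v).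
Proof.
move=> cM cN tD tM tN sphi ss st [W nW HW] v; have pp := mdom_refl cM p.
have tS : thickS (Dm `&` W) p p by exact: (thickS_sub cM pp tD nW).
have sS : Dm `&` W `<=` Dm by move=> q [].
have -> : mdiff Dm phi p v = mdiff (Dm `&` W) phi p v :> 'rV[R]_(mdim N).
  have := mdiff_ext cM cN tS tD
    (ex_intro2 _ _ setT (@filterT _ (nbhs p) _) (fun z _ Sz => conj (sS z Sz) erefl)) sphi v.
  by move=> ->.
have H := vdiff_comp cM cN tS tN _ (smooth_at_sub sS sphi) st.
have DS : forall q, (Dm `&` W) q -> SN (phi q) by move=> q [Dq Wq]; have [] := HW q Wq Dq.
have /lfunP/(_ v) := H DS; rewrite comp_lfunE => <-.
have /lfunP/(_ v) := vdiff_lin B tM ss; rewrite comp_lfunE => <-.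
congr (fun_of_lfun _ v); apply: (vdiff_ext cM tS tM); last exact: vsmooth_lin.
by exists W => // q Wq [Dq _]; have [] := HW q Wq Dq.
Qed.

Lemma mdiff_point (R : realType) (M N : mfd R) (S : set M) (f : M -> N) p p' (v : 'rV[R]_(mdim M)) :
  p = p' -> (mdiff S f p v : 'rV[R]_(mdim N)) = mdiff S f p' v.
Proof. by move=> ->. Qed.

(** [P] is the differential of [g], retyped between row-vector spaces so that later equations do not
    depend on the base point [g q]. *)
Lemma lift_inverse (R : realType) (M N U : mfd R) (f : M -> N) (i : M -> U) (g : N -> M) :
  charted M -> charted N -> charted U -> open (range f) -> smooth_on setT f -> smooth_on setT i ->
  smooth_on (range f) g -> (forall x, g (f x) = x) -> 
  smooth_on (range f) (i \o g) /\
  forall q, range f q -> exists P : 'Hom('rV[R]_(mdim N), 'rV[R]_(mdim M)),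
    [/\ lker P = 0%VS,
       forall v, (mdiff (range f) (i \o g) q v : 'rV[R]_(mdim U)) = mdiff setT i (g q) (P v)
     & forall v, (mdiff setT f (g q) (P v) : 'rV[R]_(mdim N)) = v].
Proof.
move=> cM cN cU oR sf si sg gK; split.
  move=> q Rq; apply: (smooth_at_comp cN cM cU Rq (S' := setT)) => //; [exact: sg|exact: si].
move=> q Rq; have [x _ Ex] := Rq; exists (mdiff (range f) g q).
have tR q' : range f q' -> thickS (range f) q' q'.
  by move=> Rq'; apply: (thickS_nbhs cN (mdom_refl cN q')); exact: open_nbhs_nbhs.
have tM (x' : M) : thickS setT x' x' by exact (thickM x' cM).
have fg q' : range f q' -> f (g q') = q' by move=> [y _ <-]; rewrite gK.
have inv (v : 'rV[R]_(mdim N)) : (mdiff setT f (g q) (mdiff (range f) g q v) : 'rV[R]_(mdim N)) = v.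
  apply: (mdiff_cancel cN cM (tR q Rq) (tM (g q)) (fun _ _ => Logic.I) fg (sg q Rq)).
  exact: sf.
split=> //.
  apply: lker0_intro => v v0.
  exact (etrans (esym (inv v)) (etrans (congr1 (mdiff setT f (g q)) v0) (linear0 _))).
move=> v; have := mdiff_comp cN cM cU (tR q Rq) (tM (g q)) (fun _ _ => Logic.I) (sg q Rq) (si (g q) Logic.I).
by move/lfunP => /(_ v); rewrite comp_lfunE.
Qed.

Lemma map_map_eq (S T U : Type) (f : T -> U) (g : S -> T) (h : S -> U) :
  (forall x, f (g x) = h x) -> forall s, map f (map g s) = map h s.
Proof. by move=> H; elim=> //= x s ->; rewrite H. Qed.

(** Both contractions are values of [lam] on full bases, which differ by a ratio of nonzero
    determinants. *)
Lemma contraction_nonzero (R : realType) (V W : vectType R) (D D' : 'Hom(V, W)) (lam c c' : detelt V W) :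
  Defs.is_contraction D lam c -> Defs.is_contraction D' lam c' ->
  det_nonzero D c -> det_nonzero D' c'.
Proof.
move=> [lam0 _ cE] [_ _ cE'] nz k l v w bv cw.
have [r [v2 b1]] := ext_basis (basis_free bv).
have b2 := coker_cat (u := map_tuple D' v2) cw (img_basis bv b1).
have by1 := vbasisP (lker D); set y1 := vbasis (lker D) in by1.
have [r' [y2 byy]] := ext_basis (basis_free by1).
have biy := img_basis by1 byy.
have [l' [w1 cbw1]] : exists l', exists w1 : l'.-tuple W, coker_basis D w1.
  exists (\dim (limg D)^C), (vbasis (limg D)^C).
  rewrite /coker_basis (basis_free (vbasisP _)) (span_basis (vbasisP _)).
  by rewrite addv_complf capv_compl !eqxx.
have bwy := coker_cat (u := map_tuple D y2) cbw1 biy.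
have := nz _ _ y1 w1 by1 cbw1; rewrite -(cE _ _ _ y1 y2 w1 by1 byy bwy).
rewrite -(cE' _ _ _ v v2 w bv b1 b2).
move: ([tuple of y1 ++ y2]) ([tuple of w1 ++ map_tuple D y2])
  (byy : basis_of _ [tuple of y1 ++ y2]) (bwy : basis_of _ [tuple of w1 ++ map_tuple D y2]).
have Ek : (\dim (lker D) + r')%N = (k + r)%N.
  by rewrite -(size_basis (X := [tuple of y1 ++ y2]) byy) (size_basis (X := [tuple of v ++ v2]) b1).
have El : (l' + r')%N = (l + r)%N.
  by rewrite -(size_basis (X := [tuple of w1 ++ map_tuple D y2]) bwy) (size_basis (X := [tuple of w ++ map_tuple D' v2]) b2).
rewrite Ek El => y u by_ bu nz0.
have [|T cT] := @chg_exists _ _ _ y [tuple of v ++ v2]; first by move=> i; rewrite (span_basis by_) memvf.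
have [|Q cQ] := @chg_exists _ _ _ u [tuple of w ++ map_tuple D' v2]; first by move=> i; rewrite (span_basis bu) memvf.
have uT := chg_unit (v' := [tuple of v ++ v2]) by_ b1 cT.
have uQ := chg_unit (v' := [tuple of w ++ map_tuple D' v2]) bu b2 cQ.
have E1 := detelt_chg lam0 by_ bu uT uQ cT cQ.
move: uQ; rewrite unitmxE unitfE => dQ.
have : \det Q * lam _ _ y u != 0 by rewrite mulf_neq0.
by rewrite -E1 mulf_eq0 negb_or => /andP[].
Qed.

(** * The orientation of the zero set *)

Section CoreOrientation.
Variables (R : realType) (T : topologicalType) (N : nat) (K : katlas R T N).
Unset Implicit Arguments.
Variables (V : forall I, set (kU K I)) (nu : forall I, kU K I -> kE K I) (n : nat).
Set Implicit Arguments.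
Implicit Types I J L : {set 'I_N}.
Hypothesis cd : core_data V nu n.
Unset Implicit Arguments.
Variable sigma : ksection K.
Set Implicit Arguments.
Hypothesis hidx : forall I J, kidx K I -> kidx K J -> I \proper J -> index_condition K I J.
Hypothesis hor : orientation sigma.
Hypothesis hadm : admissible V nu.

Variable AI : forall I, charts R n (set_type (kZ V nu I)).
Hypothesis mAI : forall I, is_manifold (Mfd (AI I)).
Hypothesis eAI : forall I, embedding setT (@zincl R T N K V nu n I (AI I)).
Hypothesis bAI : forall I (z : Mfd (AI I)),
  mboundary (Mfd (AI I)) z <-> mboundary (kU K I) (val z).
Variable A : charts R n (zset V nu).
Hypothesis zA : zero_structure A AI.

Let dincl I (z : Mfd (AI I)) := mdiff setT (@zincl R T N K V nu n I (AI I)) z.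
Let dquot I (z : Mfd (AI I)) := mdiff setT (@zquot R T N K V nu n A I (AI I)) z.
Let D I (z : Mfd (AI I)) := kdsnu V nu (zincl z).

Let cAJ I : charted (Mfd (AI I)).
Proof. exact: manifold_charted. Qed.

Lemma cA : charted (Mfd A).
Proof. by apply: manifold_charted; case: zA. Qed.

Lemma thickV I (z : kU K I) : kidx K I -> V I z -> thickS (V I) z z.
Proof.
move=> kI Vz; have c := cKU cd kI; apply: (thickS_nbhs c (mdom_refl c z)).
by apply: open_nbhs_nbhs; split=> //; exact (cd_V cd kI).
Qed.

(** A choice of the inverse contraction of [sigma I] along [ds_I], as provided by [orientation]; it
    is 0 outside the index set. *)
Definition lamI I : forall x : kU K I, detelt (tangent x) (kE K I) :=
  if pselect (kidx K I) is left H then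
    projT1 (cid2 (let: conj h _ := hor in let: conj a _ := h I H in a))
  else fun _ _ _ _ _ => 0.

Arguments lamI I x [k l] v w.

Lemma lamIP I : kidx K I -> smooth_top (lamI I) /\
  forall x, Defs.is_contraction (kds x) (lamI I x) (sigma I x).
Proof. by rewrite /lamI => kI; case: pselect => // H; case: cid2. Qed.

Lemma lam0 I (x : kU K I) : is_detelt 0 (lamI I x).
Proof.
have [kI|nk] := pselect (kidx K I); first by have [[]] := lamIP kI.
by rewrite /lamI; case: pselect => // H k l v v' w w' P Q *; rewrite !mulr0.
Qed.

(** The contraction of [lamI] along d(s_I + nu_I): the orientation of Z_I, still living on the
    kernel inside the tangent space of U_I. *)
Definition cc I (z : Mfd (AI I)) : detelt (tangent (zincl z)) (kE K I) :=
  projT1 (cid (contraction_exists (D z) (@lam0 I (zincl z)))).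

Arguments cc [I] z [k l] v w.

Lemma ccP I (z : Mfd (AI I)) : Defs.is_contraction (D z) (lamI I (zincl z)) (cc z).
Proof. by rewrite /cc; case: cid. Qed.

Lemma D_surj I (z : Mfd (AI I)) : limg (D z) = fullv.
Proof. exact (cd_trans cd (zP z)). Qed.

Lemma dincl_lker I (z : Mfd (AI I)) : lker (dincl z) = 0%VS.
Proof. by have [_ _ H] := eAI I; exact (H z Logic.I). Qed.

Lemma dims I (z : Mfd (AI I)) : (n + \dim {:kE K I})%N = mdim (kU K I).
Proof. by apply: (cd_dim cd (zidx z)); exists (val z); exact: zP. Qed.

Lemma D_dincl I (z : Mfd (AI I)) v : D z (dincl z v) = 0.
Proof.
have kI := zidx z; have cI := @cAJ I; have [_ Vz _] := zP z.
pose B : 'Hom('rV[R]_1, kE K I) := 0.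
pose s (q : Mfd (AI I)) : 'rV[R]_1 := 0.
have ss : vsmooth_at setT s z.
  exists setT, (fun _ => rv (0 : 'rV[R]_1)); split=> //; first exact: openT.
  by move=> k; exact: Ck_cst.
have tz := thickM z cI; have ti := thickV kI Vz.
have si := vsmooth_snu cd kI Vz.
have H := vdiff_push cI (cKU cd kI) tz tz ti (zincl_smooth eAI z) ss si _ v (B := B).
rewrite /D /kdsnu H; first by rewrite lfunE.
exists setT; [exact: filterT|move=> q _ _; split=> //; first by have [] := zP q].
by rewrite lfunE; have [] := zP q.
Qed.

Lemma dincl_basis I (z : Mfd (AI I)) (b : seq (tangent z)) :
  basis_of fullv b -> basis_of (lker (D z)) (map (dincl z) b).
Proof.
move=> bb; apply: ker_basis bb _ (D_surj z) _; first exact: dincl_lker.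
  exact: D_dincl.
by rewrite !dim_tangent; exact: dims z.
Qed.

Lemma phi_ds I J (u : kU K I) v : kidx K I -> kidx K J -> I \proper J -> kdom K I J u ->
  kds (kphi K I J u) (mdiff (kdom K I J) (kphi K I J) u v) = khat K I J (kds u v).
Proof.
move=> kI kJ IJ Du; have [oD [sphi _ _] _ Hs] := cd_cc cd kI kJ IJ.
have cI := cKU cd kI; have cJ := cKU cd kJ.
have tD : thickS (kdom K I J) u u.
  by apply: (thickS_nbhs cI (mdom_refl cI u)); exact: open_nbhs_nbhs.
apply: (vdiff_push cI cJ tD (thickM u cI) (thickM _ cJ) (sphi u Du)
  (cd_s cd kI (p := u) Logic.I) (cd_s cd kJ (p := kphi K I J u) Logic.I)).
by exists setT; [exact: filterT|move=> q _ Dq; split=> //; exact: Hs].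
Qed.

Lemma phi_dsnu I J (u : kU K I) v : kidx K I -> kidx K J -> I \proper J -> kdom K I J u ->
  V I u -> V J (kphi K I J u) ->
  kdsnu V nu (kphi K I J u) (mdiff (kdom K I J) (kphi K I J) u v) = khat K I J (kdsnu V nu u v).
Proof.
move=> kI kJ IJ Du Vu VJ; have [oD [sphi _ _] _ Hs] := cd_cc cd kI kJ IJ.
have cI := cKU cd kI; have cJ := cKU cd kJ.
have tD : thickS (kdom K I J) u u.
  by apply: (thickS_nbhs cI (mdom_refl cI u)); exact: open_nbhs_nbhs.
apply: (vdiff_push cI cJ tD (thickV kI Vu) (thickV kJ VJ) (sphi u Du)
  (vsmooth_snu cd kI Vu) (vsmooth_snu cd kJ VJ)).
have nVJ : nbhs (kphi K I J u) (V J) by apply: open_nbhs_nbhs; split=> //; exact (cd_V cd kJ).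
have [W nW HW] := within_near (sphi u Du).1 nVJ.
exists (W `&` V I).
  by apply: filterI => //; apply: open_nbhs_nbhs; split=> //; exact (cd_V cd kI).
move=> q [Wq Vq] Dq; have Vq' := HW q Wq Dq; split=> //.
by have [_ Hnu] := cd_pert cd; rewrite Hs // (Hnu I J) // -linearD.
Qed.

Lemma kdsnuE I (u : kU K I) : kidx K I -> V I u ->
  kdsnu V nu u = kds u + vdiff (V I) (nu I) u.
Proof.
move=> kI Vu; have cI := cKU cd kI; have tV := thickV kI Vu.
have sV : vsmooth_at (V I) (@ks R T N K I) u.
  exact (rsmooth_sub (@subsetT _ _) (cd_s cd kI (p := u) Logic.I)).
have [sn _] := cd_pert cd.
rewrite /kdsnu (vdiff_add tV sV (sn I kI u Vu)); congr (_ + _).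
apply: (vdiff_ext cI tV (thickM u cI)); last exact (cd_s cd kI (p := u) Logic.I).
by exists setT; first exact: filterT.
Qed.

(** An instance of [contraction_compat]: the index condition matches the kernels, compatibility of
    [sigma] is [sgE], and admissibility provides [adm], since d(s_J + nu_J) and ds_J differ by d
    nu_J. *)
Lemma cc_compat I J (z : Mfd (AI I)) (w : Mfd (AI J)) k (v : k.-tuple (tangent (zincl z))) :
  I \proper J -> zlink z w -> basis_of (lker (D z)) v ->
  cc w (map_tuple (mdiff (kdom K I J) (kphi K I J) (val z)) v : k.-tuple 'rV[R]_(mdim (kU K J))) [tuple]
  = cc z v [tuple].
Proof.
move=> IJ [_ Dz E] bv; have kI := zidx z; have kJ := zidx w.
have [_ VJ _] := zP w; have [_ VI _] := zP z.
have Zw : kZ V nu J (kphi K I J (val z)) by rewrite E; exact: zP.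
have Ew : w = zp Zw by apply: val_inj; rewrite -E.
move: Dz E VJ; rewrite {}Ew => Dz _ VJ {w}.
have [oD [sphi _ lkphi] lkhat Hs] := cd_cc cd kI kJ IJ.
have [sI cI] := lamIP kI; have [sJ cJ] := lamIP kJ.
have [horI horIJ] := hor.
refine (@contraction_compat _ _ _ _ _ (mdiff (kdom K I J) (kphi K I J) (val z)) (khat K I J)
  (kds (zincl z)) (kds (kphi K I J (val z))) (lamI I (zincl z)) (sigma I (zincl z))
  (lamI J (kphi K I J (val z))) (sigma J (kphi K I J (val z))) _ _ _ _ _ _
  (D z) (D (zp Zw : Mfd (AI J))) (cc z) (cc (zp Zw : Mfd (AI J))) _ _ _ _ _ _ _ k v bv).
- exact: lkphi.
- by move=> u; exact: phi_ds.
- by have [] := hidx kI kJ IJ Dz.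
- exact: cI.
- exact: cJ.
- by move=> k' l v' w' bv' bw'; exact: (horIJ I J kI kJ IJ).
- by move=> u; exact: phi_dsnu.
- exact: D_surj.
- exact: D_surj.
- rewrite !dim_tangent -(dims z) -(dims (zp Zw : Mfd (AI J))).
  by rewrite -!addnA [(\dim {:kE K J} + _)%N]addnC.
- move=> u; rewrite /D kdsnuE // add_lfunE addrAC subrr add0r.
  apply: (subvP (hadm kI kJ IJ VJ _)); first by exists (val z).
  exact: memv_img (memvf u).
- exact: ccP.
- exact: ccP.
Qed.

Lemma zquot_smooth I (z : Mfd (AI I)) : smooth_at setT (@zquot R T N K V nu n A I (AI I)) z.
Proof. by have [_ H] := zA; have [_ _ _ [_ sq _]] := H I; exact: sq. Qed.

Lemma zrange_nbhs I (z : Mfd (AI I)) : nbhs (zquot A z : Mfd A) (range (@zquot R T N K V nu n A I (AI I))).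
Proof. by have [_ H] := zA; have [_ _ oR _] := H I; apply: open_nbhs_nbhs; split=> //; exists z. Qed.

Lemma dquot_lker I (z : Mfd (AI I)) : lker (dquot z) = 0%VS.
Proof.
have [_ H] := zA; have [_ _ oR df] := H I.
exact (diffeo_lker (@cAJ I) cA df (thickM z (@cAJ I))
  (thickS_nbhs cA (mdom_refl cA (zquot A z)) (zrange_nbhs z))).
Qed.

Lemma hom_bij (f : 'Hom('rV[R]_n, 'rV[R]_n)) : lker f = 0%VS ->
  [/\ cancel f^-1%VF f, cancel f f^-1%VF & lker f^-1%VF = 0%VS].
Proof.
move=> /eqP f0; split; [exact: lker0_lfunVK|exact: lker0_lfunK|].
by apply: lker0_intro => v v0; rewrite -(lker0_lfunVK f0 v) v0 linear0.
Qed.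

Lemma bij_basis (f : 'Hom('rV[R]_n, 'rV[R]_n)) (b : seq 'rV[R]_n) : lker f = 0%VS ->
  basis_of fullv b -> basis_of fullv (map f b).
Proof. by move=> f0 /(map_basis f0); rewrite lker0_limgf // f0. Qed.

Lemma zpush_link_cc I J (IJ : I \proper J) (z : Mfd (AI I)) (w : Mfd (AI J)) (L : zlink z w) :
  exists2 P : 'Hom('rV[R]_n, 'rV[R]_n), lker P = 0%VS & forall v : 'rV[R]_n,
    (dquot w (P v) : 'rV[R]_n) = dquot z v /\
    (dincl w (P v) : 'rV[R]_(mdim (kU K J))) = mdiff (kdom K I J) (kphi K I J) (val z) (dincl z v).
Proof.
have [_ Dz E] := L; have [kJ VJ _] := zP w.
have Dq : zdom J z by split; rewrite ?E.
have Ew : zpush w z = w by apply: val_inj; rewrite zpush_val.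
have lk := zpush_lker cd mAI eAI IJ w Dq.
exists (mdiff (zdom J) (zpush w) z); first exact: lk.
move=> v; have cI := @cAJ I; have cJ := @cAJ J.
have H1 := zpush_diff cd mAI eAI IJ w v Dq.
have F (w' : Mfd (AI J)) (u : 'rV[R]_n) : w' = w ->
  (dincl w' u : 'rV[R]_(mdim (kU K J))) = dincl w u /\ (dquot w' u : 'rV[R]_n) = dquot w u by move=> ->.
have [F1 F2] := F _ (mdiff (zdom J) (zpush w) z v) Ew.
split; last by rewrite -[LHS]F1; exact: H1.
have tz := thick_zdom cd mAI IJ Dq.
have sp := zpush_smooth cd mAI eAI IJ w Dq.
have C1 := mdiff_comp cI cJ cA tz (thickM (zpush w z) cJ) (fun _ _ => Logic.I) sp (zquot_smooth (zpush w z)).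
have C2 := mdiff_ext cI cA tz (thickM z cI)
  (ex_intro2 _ _ setT (@filterT _ (nbhs z) _) (fun q _ Dq' => conj Logic.I (zpush_proj cd IJ w Dq'))) (zquot_smooth z) v.
move/lfunP: C1 => /(_ v); rewrite comp_lfunE.
by move=> C1; rewrite -[LHS]F2 -[RHS]C2; exact: esym C1.
Qed.

(** Along a link the basis is moved by the differential of [zpush], or by its inverse when the link
    points the other way. *)
Lemma cc_transport I J (z : Mfd (AI I)) (w : Mfd (AI J)) k (v : k.-tuple (tangent z)) :
  zproj z = zproj w -> basis_of fullv v ->
  exists2 u : k.-tuple (tangent w), map (dquot w) u = map (dquot z) v :> seq 'rV[R]_n
    & cc w (map_tuple (dincl w) u) [tuple] = cc z (map_tuple (dincl z) v) [tuple].
Proof.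
move=> /(zproj_eq cd)[L|L] bv; have [/proper_or_eq[E|IJ] _ P] := L.
- subst J; have -> : w = z by apply: val_inj; rewrite -P; exact (kphiII cd _ (zidx z)).
  by exists v.
- have [Q Q0 HQ] := zpush_link_cc IJ L; exists (map_tuple Q v).
    exact (map_map_eq (fun x => (HQ x).1) v).
  rewrite -(cc_compat IJ L (dincl_basis bv)); congr (cc w _ _).
  apply: val_inj; rewrite /= -!map_comp; exact: (eq_map (fun x => (HQ x).2)).
- subst J; have -> : w = z by apply: val_inj; rewrite -P; exact: esym (kphiII cd _ (zidx z)).
  by exists v.
have [Q Q0 HQ] := zpush_link_cc IJ L; have [QV VQ V0] := hom_bij Q0.
exists (map_tuple Q^-1%VF v).
  apply: (map_map_eq _ v) => x; have [H _] := HQ (Q^-1%VF x).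
  by rewrite -[LHS]H QV.
have bu : basis_of fullv (map Q^-1%VF v) by exact: bij_basis.
rewrite -(cc_compat IJ L (dincl_basis bu)); congr (cc z _ _).
apply: val_inj; rewrite /= -!map_comp; apply: eq_map => x /=.
by have [_ H] := HQ (Q^-1%VF x); rewrite -[LHS]H QV.
Qed.

Definition zrep (q : Mfd A) : zpt V nu := projT1 (cid (zproj_surj q)).

Lemma zrepP q : zproj (projT2 (zrep q)) = q.
Proof. by rewrite /zrep; case: cid. Qed.

Definition zlift_diff (p : zpt V nu) : 'Hom('rV[R]_n, tangent (zincl (projT2 p : Mfd (AI (projT1 p))))) :=
  (dincl (projT2 p : Mfd (AI (projT1 p))) \o (dquot (projT2 p : Mfd (AI (projT1 p))))^-1)%VF.

(** Evaluated at a chosen representative; [zor_spec] shows independence of the choice. The target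
    slot is ignored because a basis of a space of dimension 0 is empty. *)
Definition zor (q : Mfd A) : detelt (tangent q) 'rV[R]_0 := fun k l b _ =>
  cc (projT2 (zrep q) : Mfd (AI (projT1 (zrep q)))) (map_tuple (zlift_diff (zrep q)) b) [tuple].

Arguments zor q [k l] b w.

Lemma zor_spec I (z : Mfd (AI I)) k (v : k.-tuple (tangent z)) : basis_of fullv v ->
  zor (zquot A z) (map_tuple (dquot z) v) [tuple] = cc z (map_tuple (dincl z) v) [tuple].
Proof.
move=> bv; have E := zrepP (zquot A z).
have [u Hu <-] := cc_transport (esym E) bv.
rewrite /zor; congr (cc _ _ _); apply: val_inj; rewrite /= -map_comp.
have -> : [seq (zlift_diff (zrep (zquot A z)) \o dquot z) i | i <- v] =
    map (zlift_diff (zrep (zquot A z))) (map (dquot z) v) by rewrite -map_comp.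
rewrite -Hu -map_comp; apply: eq_map => x /=.
have [_ K1 _] := hom_bij (dquot_lker (projT2 (zrep (zquot A z)) : Mfd (AI _))).
by rewrite /zlift_diff comp_lfunE K1.
Qed.

Lemma zlift_basis (p : zpt V nu) (b : seq 'rV[R]_n) : basis_of fullv b ->
  basis_of (lker (D (projT2 p : Mfd (AI (projT1 p))))) (map (zlift_diff p) b).
Proof.
move=> bb; have [_ _ V0] := hom_bij (dquot_lker (projT2 p : Mfd (AI _))).
have E s : map (zlift_diff p) s = map (dincl (projT2 p : Mfd (AI _))) (map (dquot (projT2 p : Mfd (AI _)))^-1%VF s).
  by elim: s => //= x s ->; rewrite /zlift_diff comp_lfunE.
by rewrite E; exact: dincl_basis (bij_basis V0 bb).
Qed.

Lemma tuple_basis0 l (w : l.-tuple 'rV[R]_0) : basis_of fullv w -> l = 0%N.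
Proof. by move=> bw; rewrite -(size_basis bw) dimvf /= dim_matrix mulr0. Qed.

Lemma coker_surj (U W : vectType R) (f : 'Hom(U, W)) : limg f = fullv ->
  coker_basis f ([tuple] : 0.-tuple W).
Proof. by move=> H; rewrite /coker_basis H span_nil addv0 capv0 !eqxx nil_free. Qed.

Lemma zor_detelt (q : Mfd A) : is_detelt 0 (zor q).
Proof.
move=> k l v v' w w' P Q; rewrite lker0f !coker0 => bv bv' bw bw' HP HQ.
have l0 := tuple_basis0 bw; subst l.
set p := zrep q; have [_ cd0 _] := ccP (projT2 p : Mfd (AI (projT1 p))).
have cs := coker_surj (D_surj (projT2 p : Mfd (AI (projT1 p)))).
have := cd0 k 0%N (map_tuple (zlift_diff p) v) (map_tuple (zlift_diff p) v') [tuple] [tuple] P Q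
  (zlift_basis p bv) (zlift_basis p bv') cs cs (chg_map _ HP).
by apply=> -[].
Qed.

Lemma zor_nonzero (q : Mfd A) : det_nonzero 0 (zor q).
Proof.
move=> k l v w; rewrite lker0f coker0 => bv bw.
have l0 := tuple_basis0 bw; subst l.
set p := zrep q; have kI := zidx (projT2 p).
have [_ cI] := lamIP kI.
have [horI _] := hor; have [_ nz] := horI _ kI.
have H := contraction_nonzero (cI (zincl (projT2 p : Mfd (AI (projT1 p))))) (ccP (projT2 p : Mfd (AI (projT1 p)))) (nz _).
exact: H (zlift_basis p bv) (coker_surj (D_surj _)).
Qed.

(** Near [p0] the inverse of the quotient map, followed by the inclusion, immerses |Z| in a single
    U_I, and [zor] is there the contraction handled by [contraction_smooth]. *)
Lemma zor_smooth (x0 p0 : Mfd A) : mdom x0 p0 ->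
  exists W Q phi, [/\ nbhs p0 W, open Q /\ Q (mmap x0 p0), forall k, Ck k Q phi
    & forall q, W q -> mdom x0 q -> Q (mmap x0 q) ->
        zor q (frame x0 q) [tuple] = phi (mmap x0 q)].
Proof.
move=> xp; set p := zrep p0; set I := projT1 p; pose z0 : Mfd (AI I) := projT2 p.
have kI := zidx z0; have cI := @cAJ I; have cU := cKU cd kI.
have [_ HA] := zA; have [_ _ oR df] := HA I.
have [|g [gK Kg sq sg]] := diffeo_inverse df; first by exists z0.
pose S : set (Mfd A) := range (@zquot R T N K V nu n A I (AI I)).
have Sp : S p0 by exists z0 => //; exact: zrepP.
have [lamS lamC] := lamIP kI.
have [si HP] := lift_inverse cI cA cU oR (fun z _ => zquot_smooth z) (fun z _ => zincl_smooth eAI z)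
  sg (fun z => gK z Logic.I).
have HP' q : S q -> exists2 P : 'Hom('rV[R]_n, 'rV[R]_n), lker P = 0%VS & forall v,
    mdiff S (@zincl R T N K V nu n I (AI I) \o g) q v = dincl (g q) (P v) :> 'rV[R]_(mdim (kU K I)) /\
    dquot (g q) (P v) = v :> 'rV[R]_n.
  move=> Sq; have [P [P1 P2 P3]] := HP q Sq; exists P; first exact P1.
  move=> v; exact (conj (P2 v) (P3 v)).
apply: (contraction_smooth (S := S) (i := @zincl R T N K V nu n I (AI I) \o g) (lam := lamI I) (V := V I) (f := fun y => ks y + nu I y)).
- exact: cA.
- exact: cU.
- exact: lamS.
- exact: oR.
- exact: Sp.
- exact: xp.
- exact: si.
- by move=> q _; have [] := zP (g q).
- exact (cd_V cd kI).
- exact: (vsmooth_snu cd kI).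
- exact: dims z0.
- move=> q Sq; have [P P0 P1] := HP' q Sq; apply: lker0_intro => v v0.
  apply: (lker0_inj P0); apply: (lker0_inj (dincl_lker (g q))).
  exact (etrans (esym (P1 v).1) v0).
- by move=> q _; exact: D_surj (g q).
- move=> q v Sq; have [P P0 P1] := HP' q Sq.
  exact (etrans (congr1 (D (g q)) (P1 v).1) (@D_dincl I (g q) (P v))).
move=> q Sq; exists (cc (g q)); split; first exact: ccP.
move=> k b bb; have [_ Eq] := Kg q Sq; have [P P0 P1] := HP' q Sq.
have bg : basis_of fullv (map P b) by exact: bij_basis.
have H := zor_spec (z := g q) (v := map_tuple P b) bg.
have E1 : map_tuple (dquot (g q)) (map_tuple P b) = b :> k.-tuple 'rV[R]_n.
  apply: val_inj; apply: (etrans _ (map_id _)); exact (map_map_eq (fun v => (P1 v).2) b).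
have E2 : map_tuple (dincl (g q)) (map_tuple P b) =
    map_tuple (mdiff S (@zincl R T N K V nu n I (AI I) \o g) q) b :> k.-tuple 'rV[R]_(mdim (kU K I)).
  apply: val_inj; exact (map_map_eq (fun v => esym (P1 v).1) b).
have E3 q' : q' = q -> zor q' (b : k.-tuple 'rV[R]_n) [tuple] = zor q (b : k.-tuple 'rV[R]_n) [tuple].
  by move=> ->.
refine (etrans (esym (E3 _ Eq)) (etrans _ (etrans H _))).
  exact (congr1 (fun u : k.-tuple 'rV[R]_n => zor (zquot A (g q)) u [tuple]) (esym E1)).
exact (congr1 (fun u : k.-tuple 'rV[R]_(mdim (kU K I)) => cc (g q) u [tuple]) E2).
Qed.

Theorem core_orientation : exists o, zero_orientation sigma AI (A := A) o.
Proof.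
exists zor; split.
  by apply: orientation_of; [exact: cA|exact: zor_detelt|exact: zor_nonzero|exact: zor_smooth].
move=> I z; have kI := zidx z; have [_ lamC] := lamIP kI.
exists (lamI I (zincl z)), (cc z); split; [exact: lamC|exact: ccP|].
by move=> k v bv; exact: zor_spec.
Qed.
End CoreOrientation.

(** * Zero sets without boundary *)

Section ClosedZeroSets.
Variables (R : realType) (T : topologicalType) (N : nat) (K : katlas R T N).
Unset Implicit Arguments.
Variables (V : forall I, set (kU K I)) (nu : forall I, kU K I -> kE K I).
Variable sigma : ksection K.
Set Implicit Arguments.
Implicit Types I J L : {set 'I_N}.

Theorem core_zero_set n : core_data V nu n ->
  (forall I J, kidx K I -> kidx K J -> I \proper J -> index_condition K I J) ->
  orientation sigma -> admissible V nu ->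
  exists (A : charts R n (zset V nu)) (AI : forall I, charts R n (set_type (kZ V nu I)))
    (o : forall q : Mfd A, detelt (tangent q) 'rV[R]_0),
    [/\ zero_structure A AI, compact [set: zset V nu], zero_orientation sigma AI o
      & forall I (z : set_type (kZ V nu I)), mboundary (Mfd A) (zproj z) <-> mboundary (kU K I) (val z)].
Proof.
move=> cd hidx hor hadm.
pose AI I := projT1 (cid (zcharts cd I)).
have HAI I : [/\ is_manifold (Mfd (AI I)), embedding setT (@zincl R T N K V nu n I (AI I))
    & forall z : Mfd (AI I), mboundary (Mfd (AI I)) z <-> mboundary (kU K I) (val z)].
  exact: projT2 (cid (zcharts cd I)).
have mAI I : is_manifold (Mfd (AI I)) by have [] := HAI I.
have eAI I : embedding setT (@zincl R T N K V nu n I (AI I)) by have [] := HAI I.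
have bAI I (z : Mfd (AI I)) : mboundary (Mfd (AI I)) z <-> mboundary (kU K I) (val z).
  by have [_ _ H] := HAI I.
have [A [zA bA]] := zglue cd mAI eAI bAI.
have [zo Ho] := core_orientation cd hidx hor hadm mAI eAI zA.
by exists A, AI, zo; split=> //; exact (zset_compact cd).
Qed.

(** A surjective differential forces the index to be nonnegative, so the absolute value of [d] is
    the true dimension as soon as there is a zero. *)
Lemma surj_dim I (z : kU K I) (D : 'Hom(tangent z, kE K I)) (d : int) : limg D = fullv ->
  (mdim (kU K I))%:Z - (\dim {:kE K I})%:Z = d -> (`|d| + \dim {:kE K I})%N = mdim (kU K I) /\ 0 <= d.
Proof.
move=> sD <-; have := limg_ker_dim D fullv; rewrite capfv sD dim_tangent => <-.
by rewrite PoszD addrK; split=> //.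
Qed.

Lemma closed_core d :
  (forall I, kidx K I -> [/\ is_manifold (kU K I), mboundary (kU K I) = set0,
     vsmooth_on setT (@ks R T N K I) & (mdim (kU K I))%:Z - (\dim {:kE K I})%:Z = d]) ->
  (forall I J, kidx K I -> kidx K J -> I \proper J -> coord_change K I J) ->
  cocycle K -> conventions K ->
  (forall I J L, kidx K I -> kidx K J -> kidx K L -> I \subset J -> I \subset L ->
        kdom K I J `&` kdom K I L = kdom K I (J :|: L)%SET) ->
  (forall I J L, kidx K I -> kidx K J -> kidx K L -> I \subset J -> J \subset L ->
        kphi K I J @` kdom K I L =
        kdom K J L `&` [set y | ks y \in limg (khat K I J)]) ->
  (forall I, kidx K I -> open (V I)) ->
  (forall I J (x : kU K I) (y : kU K J), kidx K I -> kidx K J -> V I x -> V J y ->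
    kpi x = kpi y -> I \subset J \/ J \subset I) ->
  is_perturbation V nu ->
  (exists C : forall I, set (kU K I),
    (forall I, kidx K I -> compact (closure (C I)) /\ closure (C I) `<=` V I) /\
    kpi_image (kZ V nu) `<=` kpi_image C) ->
  transverse V nu -> core_data V nu `|d|.
Proof.
move=> HI Hcc Hcoc Hconv t2 t3 oV Vc pert HC tr.
have nb I (z : kU K I) : kidx K I -> ~ mboundary (kU K I) z.
  by move=> kI; have [_ -> _ _] := HI I kI.
split=> //.
- by move=> I kI; have [] := HI I kI.
- by move=> I kI; have [] := HI I kI.
- move=> I kI [z Zz]; have [_ _ _ Ed] := HI I kI.
  by have [] := surj_dim (tr I z Zz (nb I z kI)) Ed.
- move=> I J kI kJ IJ; have [[oD _] [eD lD] Hs _ _] := Hcc I J kI kJ IJ.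
  by split.
- by move=> I z Zz; apply: tr => //; apply: nb; case: Zz.
- by move=> I z Zz /nb; case; case: Zz.
- by move=> I J x kI kJ _ _; split=> /nb; case.
Qed.

Lemma reduction_comparable : is_reduction V ->
  forall I J (x : kU K I) (y : kU K J), kidx K I -> kidx K J -> V I x -> V J y ->
    kpi x = kpi y -> I \subset J \/ J \subset I.
Proof.
move=> [_ _ H _] I J x y kI kJ Vx Vy E; apply: H => //.
exists (kpi x); split; [exists x|exists y] => //; exact: subset_closure.
Qed.

Lemma core_nonneg n d : core_data V nu n ->
  (forall I, kidx K I -> (mdim (kU K I))%:Z - (\dim {:kE K I})%:Z = d) ->
  [set: zset V nu] !=set0 -> `|d|%N%:Z = d.
Proof.
move=> cd Hd [q _]; have [[I z] _] := zproj_surj q.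
have [_ d0] := surj_dim (cd_trans cd (zP z)) (Hd I (zidx z)).
by rewrite gez0_abs.
Qed.
End ClosedZeroSets.

Theorem closed_zero_set (R : realType) (T : topologicalType) (N : nat) (K : katlas R T N)
    (V : forall I, set (kU K I)) (nu : forall I, kU K I -> kE K I) (sigma : ksection K) (d : int) :
  core_data V nu `|d| ->
  (forall I, kidx K I -> mboundary (kU K I) = set0) ->
  (forall I, kidx K I -> (mdim (kU K I))%:Z - (\dim {:kE K I})%:Z = d) ->
  (forall I J, kidx K I -> kidx K J -> I \proper J -> index_condition K I J) ->
  orientation sigma -> admissible V nu ->
  exists (A : charts R `|d| (zset V nu)) (AI : forall I, charts R `|d| (set_type (kZ V nu I)))
    (o : forall q : Mfd A, detelt (tangent q) 'rV[R]_0), oriented_closed_zero_set d sigma AI o.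
Proof.
move=> cd Hb Hd hidx hor hadm.
have [A [AI [zo [zA cA oA bA]]]] := core_zero_set cd hidx hor hadm.
exists A, AI, zo; split=> //; first exact: core_nonneg cd Hd.
apply/seteqP; split=> // q; have [[I z] <-] := zproj_surj q.
by move=> /(bA I z); rewrite Hb //; exact: zidx z.
Qed.

Theorem atlas_zero_set (R : realType) (X : topologicalType) (N : nat) (d : int) (K : katlas R X N)
    (sigma : ksection K) (V : forall I, set (kU K I)) (nu : forall I, kU K I -> kE K I) :
  is_atlas K setT d -> tame K -> orientation sigma -> is_reduction V ->
  is_perturbation V nu -> admissible V nu -> precompact_pert V nu -> transverse V nu ->
  exists (A : charts R `|d| (zset V nu)) (AI : forall I, charts R `|d| (set_type (kZ V nu I)))
    (o : forall q : Mfd A, detelt (tangent q) 'rV[R]_0), oriented_closed_zero_set d sigma AI o.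
Proof.
move=> [_ Hch Hcc Hcoc Hconv] [_ t2 t3] hor red pert hadm [C [redC CV CZ]] tr.
apply: closed_zero_set => //.
- apply: closed_core => //.
  + by move=> I kI; have [[[mI bI] sI _ _ _] Ed] := Hch I kI.
  + by move=> I kI; have [H _ _ _] := red; have [] := H I kI.
  + exact: reduction_comparable.
  by exists C; split=> // I kI; have [] := CV I kI.
- by move=> I kI; have [[[_ bI] _ _ _ _] _] := Hch I kI.
- by move=> I kI; have [_] := Hch I kI.
- by move=> I J kI kJ IJ; have [_ _ _ _] := Hcc I J kI kJ IJ.
Qed.

(** * Collars and cobordisms *)

Section BoundaryDirections.
Variable R : realType.
Implicit Types M N : mfd R.

Lemma open_ray n (Q : set 'rV[R]_n) (x w : 'rV[R]_n) : open Q -> Q x ->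
  exists2 d : R, 0 < d & forall t : R, 0 < t < d -> Q (x + t *: w).
Proof.
move=> oQ Qx; have /nbhs_ballP[r /= r0 rQ] : nbhs x Q by exact: open_nbhs_nbhs.
have w1 : 0 < `|w| + 1 by rewrite ltr_wpDl.
exists (r / (`|w| + 1)); first by rewrite divr_gt0.
move=> t /andP[t0 tr]; apply: rQ; rewrite -ball_normE /ball_ /= opprD addNKr normrN normrZ gtr0_norm //.
apply: le_lt_trans (_ : t * (`|w| + 1) < r); last by rewrite -ltr_pdivlMr.
by rewrite ler_wpM2l ?(ltW t0) // lerDl.
Qed.

(* The curve leaving [p] along [w] cannot leave [N], which constrains its derivative. *)
Lemma bdry_dir M N (S : set M) (f : M -> N) p (w : 'rV[R]_(mdim M)) (i0 : 'I_(mdim N)) :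
  charted M -> is_manifold N -> thickS S p p -> smooth_at S f p -> mboundary N (f p) ->
  i0 = 0%N :> nat ->
  (forall e : R, 0 < e -> exists2 t : R, 0 < t < e &
     exists q, [/\ S q, mdom p q & mmap p q = mmap p p + t *: w]) ->
  0 <= (mdiff S f p w : 'rV[R]_(mdim N)) ord0 i0.
Proof.
move=> cM mN tS [cf [Q [g cr]]] bp i00 ent; have cN := manifold_charted mN.
have pp := mdom_refl cM p; have fp := mdom_refl cN (f p).
rewrite (mdiff_jac cM cN tS cf cr).
have [y Ey] : exists y, y = w *m jac g (mmap p p) by exists (w *m jac g (mmap p p)).
rewrite -Ey leNgt; apply/negP => neg.
set c := - y ord0 i0; have c0 : 0 < c by rewrite oppr_gt0.
have [j0 [j00 [Qh oQh Eh] fp0]] := (bdry_chart mN fp).1 bp.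
have ij : i0 = j0 by apply: val_inj; rewrite /= i00 j00.
have [oQ Qp sg Hg] := cr.
have dg := smooth_diff sg Qp.
(* With tolerance [c / 2] the first coordinate of the image at time [t] would be at most
   [- c * t / 2], which the half space forbids. *)
have [|d1 d10 H1] := @jac_dir _ _ _ g (mmap p p) w (c / 2) dg; first by rewrite divr_gt0.
have [d2 d20 H2] := open_ray w oQ Qp.
have [W nW HW] := within_near cf (mdom_nbhs cN fp).
have [Q' [oQ' Q'p HQ']] := chart_nbhs cM pp nW.
have [d3 d30 H3] := open_ray w oQ' Q'p.
have [|t /andP[t0 te] [q [Sq pq Eq]]] := ent (Num.min d1 (Num.min d2 d3)).
  by rewrite !lt_min d10 d20.
move: te; rewrite !lt_min => /and3P[t1 t2 t3].
have Wq : W q by apply: HQ' => //; rewrite Eq; apply: H3; rewrite t0.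
have fq : mdom (f p) (f q) by exact: HW.
have Gq : g (mmap p q) = mmap (f p) (f q) by apply: Hg => //; rewrite Eq; apply: H2; rewrite t0.
have Sp := thickS_mem cM pp tS.
have Gp : g (mmap p p) = mmap (f p) (f p) by exact: Hg.
have hq : 0 <= mmap (f p) (f q) ord0 i0.
  have : (mmap (f p) @` mdom (f p)) (mmap (f p) (f q)) by exists (f q).
  by rewrite Eh => -[/(_ i0 i00)].
have := H1 t; rewrite t0 t1 -Eq Gq Gp -Ey => /(_ isT) le.
have := le_trans (mx_norm_ge _ ord0 i0) le; rewrite !mxE ij fp0 subr0 -ij => le2.
have : mmap (f p) (f q) ord0 i0 - t * y ord0 i0 <= c / 2 * t by exact: le_trans (ler_norm _) le2.
have -> : y ord0 i0 = - c by rewrite /c opprK.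
rewrite mulrN opprK => le3; have : t * c <= c / 2 * t by lra.
rewrite [t * c]mulrC ler_pM2r // => le4.
have : c / 2 < c by rewrite ltr_pdivrMr // ltr_pMr // ltr1n.
by move=> /(le_lt_trans le4); rewrite ltxx.
Qed.

(** By [bdry_dir] the first coordinate of the differential is a linear functional that is
    nonnegative on the half space. Such a functional vanishes on the bounding hyperplane, hence is a
    nonnegative multiple of the first coordinate. *)
Lemma bdry_coord M N (S : set M) (f : M -> N) p (i0 : 'I_(mdim M)) (j0 : 'I_(mdim N)) :
  is_manifold M -> is_manifold N -> nbhs p S -> smooth_at S f p ->
  mboundary M p -> mboundary N (f p) -> i0 = 0%N :> nat -> j0 = 0%N :> nat ->
  exists2 c : R, 0 <= c & forall v : 'rV[R]_(mdim M),
    (mdiff S f p v : 'rV[R]_(mdim N)) ord0 j0 = c * v ord0 i0.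
Proof.
move=> mM mN nS sf bp bfp i00 j00; have cM := manifold_charted mM; have cN := manifold_charted mN.
have pp := mdom_refl cM p.
have tS := thickS_nbhs cM pp nS.
have [k0 [k00 [Qh oQh Eh] p0]] := (bdry_chart mM pp).1 bp.
have ik : i0 = k0 by apply: val_inj; rewrite /= i00 k00.
have Qhp : Qh (mmap p p) by have : (mmap p @` mdom p) (mmap p p) by [exists p]; rewrite Eh => -[].
have [Q' [oQ' Q'p HQ']] := chart_nbhs cM pp nS.
have key (w : 'rV[R]_(mdim M)) : 0 <= w ord0 i0 -> 0 <= (mdiff S f p w : 'rV[R]_(mdim N)) ord0 j0.
  move=> w0; apply: (bdry_dir cM mN tS sf bfp j00) => e e0.
  have [d1 d10 H1] := open_ray w oQh Qhp; have [d2 d20 H2] := open_ray w oQ' Q'p.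
  pose t := Num.min e (Num.min d1 d2) / 2.
  have m0 : 0 < Num.min e (Num.min d1 d2) by rewrite !lt_min e0 d10 d20.
  have t0 : 0 < t by rewrite divr_gt0.
  have : t < Num.min e (Num.min d1 d2) by rewrite /t; lra.
  rewrite !lt_min => /and3P[te t1 t2].
  exists t; first by rewrite t0.
  have : (mmap p @` mdom p) (mmap p p + t *: w).
    rewrite Eh; split; last by apply: H1; rewrite t0.
    move=> i i0'; have -> : i = i0 by apply: val_inj; rewrite /= i00 i0'.
    by rewrite !mxE ik p0 add0r -ik mulr_ge0 // ltW.
  move=> [q Dq Eq]; exists q; split=> //.
  by apply: HQ' => //; rewrite Eq; apply: H2; rewrite t0.
pose e0 : 'rV[R]_(mdim M) := delta_mx ord0 i0.
exists ((mdiff S f p e0 : 'rV[R]_(mdim N)) ord0 j0); first by apply: key; rewrite mxE !eqxx ler01.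
move=> v; set u := v - v ord0 i0 *: e0.
have u0 : u ord0 i0 = 0 by rewrite !mxE !eqxx mulr1 subrr.
have z : (mdiff S f p u : 'rV[R]_(mdim N)) ord0 j0 = 0.
  apply/eqP; rewrite eq_le key ?u0 // andbT -oppr_ge0.
  have h : 0 <= (- u) ord0 i0 by rewrite mxE u0 oppr0.
  by have := key _ h; rewrite linearN mxE.
have Ev : v = v ord0 i0 *: e0 + u by rewrite addrC subrK.
have := linearP (mdiff S f p) (v ord0 i0) e0 u; rewrite -Ev => ->.
by rewrite mxE z addr0 mxE mulrC.
Qed.
End BoundaryDirections.

(** * Maps on cylinders and collars *)

Section CylinderMaps.
Variables (R : realType).
Implicit Types B C : mfd R.

Lemma collar_end (a : bool) (e : R) : 0 < e -> collar_int a e a%:R.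
Proof. by case: a => /= e0; rewrite ?lexx ?andbT ?e0 //= ltrBlDr ltrDl. Qed.

Lemma collar_le (a : bool) (e e' : R) t : e <= e' -> collar_int a e t -> collar_int a e' t.
Proof. by case: a => /= le /andP[h1 h2]; apply/andP; split=> //; lra. Qed.

(** The inward direction of the collar coordinate: increasing at the end 0, decreasing at the end
    1. *)
Definition collar_dir (a : bool) : R := if a then -1 else 1.

Lemma collar_enter (a : bool) (e t : R) : collar_int a e t ->
  forall e' : R, 0 < e' -> exists2 s : R, 0 < s < e' & collar_int a e (t + s * collar_dir a).
Proof.
rewrite /collar_dir; case: a => /= /andP[h1 h2] e' e0.
  exists (Num.min e' (t - (1 - e)) / 2); have m0 : 0 < Num.min e' (t - (1 - e)).
  - by rewrite lt_min e0 subr_gt0.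
  - have := ge_min e' e' (t - (1 - e)); rewrite lexx /= => l1; apply/andP; split; lra.
  - by rewrite lt_min e0 subr_gt0.
  have := ge_min (t - (1 - e)) e' (t - (1 - e)); rewrite lexx orbT => l1; apply/andP; split; lra.
exists (Num.min e' (e - t) / 2); have m0 : 0 < Num.min e' (e - t).
- by rewrite lt_min e0 subr_gt0.
- have := ge_min e' e' (e - t); rewrite lexx /= => l1; apply/andP; split; lra.
- by rewrite lt_min e0 subr_gt0.
have := ge_min (e - t) e' (e - t); rewrite lexx orbT => l1; apply/andP; split; lra.
Qed.

Lemma collar_dir0 a : collar_dir a != 0.
Proof. by rewrite /collar_dir; case: a; rewrite ?oppr_eq0 oner_eq0. Qed.

Lemma thick_cyl B (I : set R) (S : set B) (t c : R) (x : B) : I t -> c != 0 ->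
  (forall e : R, 0 < e -> exists2 s : R, 0 < s < e & I (t + s * c)) -> thickS S x x ->
  @thickS R (cylinder B) (I `*` S) (t, x) (t, x).
Proof.
move=> It c0 HI tS; rewrite /thickS cyl_mmapE /=.
have := thick_prod It c0 HI tS; congr (thick _ _).
apply/seteqP; split=> v /=.
  move=> [Iv [q [Sq xq] E]]; exists (v ord0 (lshift _ ord0), q) => //.
  rewrite cyl_mmapE /= E -[RHS]hsubmxK; congr row_mx.
  by apply/matrixP => i j; rewrite !mxE !ord1.
move=> [[s q] [[Is Sq] [_ xq]] <-]; rewrite cyl_mmapE /= row_mxKr row_mxEl mxE.
by split=> //; exists q.
Qed.

Lemma thick_collar B a e (S : set B) t (x : B) : collar_int a e t -> thickS S x x ->
  @thickS R (cylinder B) (collar_int a e `*` S) (t, x) (t, x).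
Proof.
move=> It tS; apply: (thick_cyl It (collar_dir0 a) _ tS); exact: collar_enter.
Qed.

Lemma cyl_snd B (S : set (cylinder B)) (p : cylinder B) : charted B -> thickS S p p ->
  @smooth_at R (cylinder B) B S (fun q => q.2) p /\
  forall w : 'rV[R]_(1 + mdim B), (@mdiff R (cylinder B) B S (fun q => q.2) p w : 'rV[R]_(mdim B)) = rsubmx w.
Proof.
move=> cB tS; have cC := cylinder_charted cB.
have cr : @coord_rep R (cylinder B) (mdim B) p (S `&` (fun q => q.2) @^-1` mdom p.2)
    (mmap p.2 \o (fun q => q.2)) p setT (fun y => y *m col_mx 0 1%:M).
  split=> //; first exact: openT.
  - exact: smooth_mulmxr openT.
  - by move=> q [Sq Dq] _ _; rewrite -rsubmx_mul cyl_mmapE row_mxKr.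
have cf : (fun q : cylinder B => q.2) x @[x --> within S (nbhs p)] --> p.2.
  by apply: cvg_within_filter; exact: cvg_snd.
split; first by split=> //; exists setT, (fun y => y *m col_mx 0 1%:M).
move=> w; rewrite (mdiff_jac cC cB tS cf cr) jac_mulmxr -rsubmx_mul.
by [].
Qed.

Lemma cyl_at B (t : R) (x : B) : charted B ->
  @smooth_at R B (cylinder B) setT (fun y => (t, y)) x /\
  forall u : 'rV[R]_(mdim B), (@mdiff R B (cylinder B) setT (fun y => (t, y)) x u : 'rV[R]_(1 + mdim B)) = row_mx 0 u.
Proof.
move=> cB; have cC := cylinder_charted cB.
pose g (y : 'rV[R]_(mdim B)) : 'rV[R]_(1 + mdim B) := row_mx (const_mx t) y.
have s1 : smooth_open setT (fun _ : 'rV[R]_(mdim B) => const_mx t : 'rV[R]_1) by move=> k; exact: Ck_cst.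
have s2 := @smooth_id R (mdim B) setT.
have cr : @coord_rep R B (1 + mdim B) x (setT `&` (fun y => (t, y) : cylinder B) @^-1` mdom ((t, x) : cylinder B))
    (mmap ((t, x) : cylinder B) \o (fun y => (t, y) : cylinder B)) x setT g.
  split=> //; first exact: openT.
  exact: smooth_row_mx openT s1 s2.
have cf : ((t, y) : cylinder B) @[y --> within setT (nbhs x)] --> ((t, x) : cylinder B).
  apply/cvg_withinP => W [[W1 W2] /= [n1 n2] WW].
  by apply: filterS n2 => y W2y _; apply: WW; split=> //=; exact: nbhs_singleton.
split; first by split=> //; exists setT, g.
move=> u; have tS : thickS setT x x by apply: (thickST cB); exact (mdom_refl cB x).
rewrite (mdiff_jac cB cC tS cf cr) /g (jac_row_mx openT Logic.I s1 s2) jac_id.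
have -> : jac (fun _ : 'rV[R]_(mdim B) => const_mx t : 'rV[R]_1) (mmap x x) = 0.
  apply/row_matrixP => i; rewrite !rowE -jacE diff_cst mulmx0.
  by [].
by rewrite mul_mx_row mulmx0 mulmx1.
Qed.

Lemma cyl_map B C (I : set R) (S : set B) (g : B -> C) (p : cylinder B) : charted B -> charted C ->
  I p.1 -> S p.2 -> @thickS R (cylinder B) (I `*` S) p p -> thickS S p.2 p.2 -> smooth_at S g p.2 ->
  @smooth_at R (cylinder B) (cylinder C) (I `*` S) (fun q => (q.1, g q.2)) p /\
  forall w : 'rV[R]_(1 + mdim B),
   (@mdiff R (cylinder B) (cylinder C) (I `*` S) (fun q => (q.1, g q.2)) p w : 'rV[R]_(1 + mdim C)) =
   row_mx (lsubmx w) (mdiff S g p.2 (rsubmx w)).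
Proof.
move=> cB cC Ip Sp tIS tS [cg [Q [k cr]]].
have ccB := cylinder_charted cB; have ccC := cylinder_charted cC.
have [oQ Qp sk Hk] := cr.
pose Q' : set 'rV[R]_(1 + mdim B) := setT `&` (fun v => v *m col_mx 0 1%:M) @^-1` Q.
have oQ' : open Q' by exact: (open_preim openT oQ (smooth_mulmxr _ openT)).
pose k1 (v : 'rV[R]_(1 + mdim B)) : 'rV[R]_1 := v *m col_mx 1%:M 0.
pose k2 := k \o (fun v : 'rV[R]_(1 + mdim B) => v *m col_mx 0 1%:M).
pose k' (v : 'rV[R]_(1 + mdim B)) := row_mx (k1 v) (k2 v).
have s1 : smooth_open Q' k1 by exact: smooth_mulmxr.
have s2 : smooth_open Q' k2.
  apply: (@smooth_comp _ _ _ _ _ _ Q (fun v => v *m col_mx 0 1%:M) k) => //; first by move=> x [].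
  exact: smooth_mulmxr.
have Q'p : Q' (mmap p p) by split=> //=; rewrite -rsubmx_mul cyl_mmapE row_mxKr.
pose G (q : cylinder B) : cylinder C := (q.1, g q.2).
have cr' : @coord_rep R (cylinder B) (1 + mdim C) p ((I `*` S) `&` G @^-1` mdom (G p)) (mmap (G p) \o G) p Q' k'.
  split=> //; first exact: smooth_row_mx.
  move=> q [[Iq Sq] [_ gq]] [_ pq] [_]; rewrite /= /k' /k1 /k2 /= -rsubmx_mul -lsubmx_mul !cyl_mmapE row_mxKr row_mxKl /= => Qq.
  by rewrite Hk.
have cf : G x @[x --> within (I `*` S) (nbhs p)] --> G p.
  apply/cvg_withinP => W [[W1 W2] /= [n1 n2] WW].
  have H2 := (cvg_withinP _ _ _ _).1 cg W2 n2.
  exists (W1, [set q | S q -> W2 (g q)]) => //= q [/= h1 h2] [Iq Sq].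
  by apply: WW; split=> //=; exact: h2.
split; first by split=> //; exists Q', k'.
move=> w; rewrite (mdiff_jac ccB ccC tIS cf cr') /k' (jac_row_mx oQ' Q'p s1 s2) mul_mx_row.
rewrite /k1 jac_mulmxr -lsubmx_mul; congr row_mx.
have E : mmap p p *m col_mx 0 1%:M = mmap p.2 p.2 by rewrite -rsubmx_mul cyl_mmapE row_mxKr.
rewrite /k2 jac_comp; last first.
- by rewrite E; exact: smooth_diff sk Qp.
- exact: (smooth_diff (smooth_mulmxr _ openT)).
by rewrite jac_mulmxr E mulmxA -rsubmx_mul (mdiff_jac cB cC tS cg cr).
Qed.

Lemma cyl_interior B (p : cylinder B) : mboundary B = set0 -> ~ mboundary (cylinder B) p.
Proof.
move=> b0; apply; have : ~ mboundary B p.2 by rewrite b0.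
move=> /contrapT; rewrite nbhsE => -[Q [oQ Qp] QD].
apply: (@filterS _ (nbhs (mmap p p)) _ [set v : 'rV[R]_(1 + mdim B) | setT (v ord0 (lshift _ ord0)) /\ Q (rsubmx v)]).
  move=> v [_ /QD[q Dq E]]; exists (v ord0 (lshift _ ord0), q) => //.
  rewrite cyl_mmapE /= E -[RHS]hsubmxK; congr row_mx.
  by apply/matrixP => i j; rewrite !mxE !ord1.
apply: open_nbhs_nbhs; split; first by apply: open_row_mx => //; exact: openT.
by split=> //=; rewrite cyl_mmapE row_mxKr.
Qed.

Lemma cyl_basis m k (b : k.-tuple 'rV[R]_m) : basis_of fullv b ->
  basis_of fullv ((row_mx (const_mx 1 : 'rV[R]_1) 0 : 'rV[R]_(1 + m)) ::
    map (fun u : 'rV[R]_m => row_mx (0 : 'rV[R]_1) u) b).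
Proof.
move=> bb; have Ek : k = m by rewrite -(size_basis bb) dimvf /= dim_matrix mul1r.
rewrite basisEfree subvf /= size_map size_tuple dimvf /= dim_matrix mul1r.
apply/andP; split; last by rewrite Ek add1n.
set e0 : 'rV[R]_(1 + m) := row_mx _ _.
rewrite free_cons; apply/andP; split.
  apply/negP => H.
  have : forall x, x \in <<map (fun u : 'rV[R]_m => row_mx (0 : 'rV[R]_1) u) b>>%VS -> lsubmx x = 0.
    move=> x; pose L : 'Hom('rV[R]_(1 + m), 'rV[R]_1) := linfun lsubmx.
    have : (<<map (fun u : 'rV[R]_m => row_mx (0 : 'rV[R]_1) u) b>> <= lker L)%VS.
      apply/span_subvP => _ /mapP[u _ ->]; rewrite memv_ker lfunE /= row_mxKl.
      by [].
    by move=> /subvP sub /sub; rewrite memv_ker lfunE => /eqP.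
  move=> /(_ _ H) /matrixP /(_ ord0 ord0); rewrite row_mxKl !mxE => /eqP.
  by rewrite oner_eq0.
pose L : 'Hom('rV[R]_m, 'rV[R]_(1 + m)) := linfun (mulmxr (row_mx (0 : 'M[R]_(m, 1)) 1%:M)).
have LE u : L u = row_mx 0 u by rewrite lfunE /= mul_mx_row mulmx0 mulmx1.
have E : map (fun u : 'rV[R]_m => row_mx (0 : 'rV[R]_1) u) b = map L b.
  by apply: eq_map => u; rewrite LE.
rewrite E; apply: (basis_free (U := (L @: fullv)%VS)); apply: map_basis bb.
apply: lker0_intro => u; rewrite LE => /eqP; rewrite row_mx_eq0 => /andP[_ /eqP].
by [].
Qed.
End CylinderMaps.

Section BoundarylessSource.
Variables (R : realType) (B U : mfd R).

(** A source without boundary can be left along [u] and along [- u], and [bdry_dir] applies to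
    both. *)
Lemma boundaryless_coord (f : B -> U) x (u : 'rV[R]_(mdim B)) (i0 : 'I_(mdim U)) :
  is_manifold B -> is_manifold U -> mboundary B = set0 -> smooth_at setT f x ->
  mboundary U (f x) -> i0 = 0%N :> nat -> (mdiff setT f x u : 'rV[R]_(mdim U)) ord0 i0 = 0.
Proof.
move=> mB mU b0 sf bf i00; have cB := manifold_charted mB.
have xx := mdom_refl cB x.
have key (w : 'rV[R]_(mdim B)) : 0 <= (mdiff setT f x w : 'rV[R]_(mdim U)) ord0 i0.
  apply: (bdry_dir cB mU (thickM x cB) sf bf i00) => e e0.
  have : ~ mboundary B x by rewrite b0.
  move=> /contrapT; rewrite nbhsE => -[Q [oQ Qx] QD].
  have [dl dl0 H] := open_ray w oQ Qx.
  exists (Num.min e dl / 2); have m0 : 0 < Num.min e dl by rewrite lt_min e0 dl0.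
    have := ge_min e e dl; rewrite lexx /= => l1; apply/andP; split; lra.
  have /QD[q Dq Eq] : Q (mmap x x + (Num.min e dl / 2) *: w).
    have := ge_min dl e dl; rewrite lexx orbT => l1; apply: H; apply/andP; split; lra.
  by exists q.
apply/eqP; rewrite eq_le key andbT -oppr_ge0.
by have := key (- u); rewrite linearN mxE.
Qed.
End BoundarylessSource.

(** A one-sided collar of a boundary piece, detached from charts and footprints so that its
    differential geometry can be developed on its own. *)
Record collar_map (R : realType) (B U : mfd R) (F : cylinder B -> U) (a : bool) (eps : R) : Prop := CollarMap {
  cm_B : is_manifold B;
  cm_U : is_manifold U;
  cm_bB : mboundary B = set0;
  cm_dim : mdim U = (mdim B).+1;
  cm_eps : 0 < eps;
  cm_open : open (F @` (collar_int a eps `*` setT));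
  cm_diffeo : @diffeo R (cylinder B) U (collar_int a eps `*` setT) (F @` (collar_int a eps `*` setT)) F;
  cm_bdry : forall x, mboundary U (F (a%:R, x)) }.

Section Collar.
Variables (R : realType) (B U : mfd R) (F : cylinder B -> U) (a : bool) (eps : R).
Let D : set (cylinder B) := collar_int a eps `*` setT.
Hypothesis cm : collar_map F a eps.
Let mB := cm_B cm.
Let mU := cm_U cm.
Let bB := cm_bB cm.
Let dUB := cm_dim cm.
Let eps0 := cm_eps cm.
Let oD := cm_open cm.
Let dF := cm_diffeo cm.
Let bF x := @cm_bdry _ _ _ _ _ _ cm x.

Let cB : charted B. Proof. exact: manifold_charted. Qed.
Let cU : charted U. Proof. exact: manifold_charted. Qed.
Let cC : charted (cylinder B). Proof. exact: cylinder_charted. Qed.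

Lemma collar_at x : D (a%:R, x).
Proof. by split=> //; exact: collar_end. Qed.

Lemma collar_thick p : D p -> thickS D p p.
Proof. by case: p => t x [It _]; apply: thick_collar => //; exact: thickM. Qed.

Lemma collar_inj p q : D p -> D q -> F p = F q -> p = q.
Proof. by move=> Dp Dq; have [[_ inj _] _ _] := dF; apply: inj; rewrite inE. Qed.

Lemma collar_smooth p : D p -> smooth_at D F p.
Proof. by have [_ s _] := dF; exact: s. Qed.

Lemma collar_lker p : D p -> lker (mdiff D F p) = 0%VS.
Proof.
move=> Dp; apply: (diffeo_lker cC cU dF); first exact: collar_thick.
apply: (thickS_nbhs cU (mdom_refl cU _)); by apply: open_nbhs_nbhs; split=> //; exists p.
Qed.

Lemma collar_limg p : D p -> limg (mdiff D F p) = fullv.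
Proof.
move=> Dp; apply/eqP; rewrite eqEdim subvf /=.
have := limg_ker_dim (mdiff D F p) fullv; rewrite capfv collar_lker // dimv0 add0n => ->.
by rewrite !dim_tangent dUB.
Qed.

(** Away from the end the collar interval is a neighbourhood of [t], so the collar map is an
    immersion of equal dimension at an interior point of the cylinder. *)
Lemma collar_interior t x : collar_int a eps t -> t != a%:R -> ~ mboundary U (F (t, x)).
Proof.
move=> It ta; have Dp : D (t, x) by [].
have n : nbhs ((t, x) : cylinder B) D.
  exists (collar_int a eps, setT); last by move=> [s y] [].
  split; last exact: filterT.
  move: It ta; rewrite /collar_int; case: (a) => /= /andP[h1 h2] ta.
    have t1 : t < 1 by rewrite lt_neqAle ta.
    have n1 : nbhs t [set s : R | 1 - eps < s] by apply: open_nbhs_nbhs; split=> //; exact: open_gt.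
    have n2 : nbhs t [set s : R | s < 1] by apply: open_nbhs_nbhs; split=> //; exact: open_lt.
    by apply: filterS (filterI n1 n2) => s /= [-> /ltW ->].
  have t1 : 0 < t by rewrite lt_neqAle eq_sym ta.
  have n1 : nbhs t [set s : R | 0 < s] by apply: open_nbhs_nbhs; split=> //; exact: open_gt.
  have n2 : nbhs t [set s : R | s < eps] by apply: open_nbhs_nbhs; split=> //; exact: open_lt.
  by apply: filterS (filterI n1 n2) => s /= [/ltW -> ->].
apply: (interior_map cC cU _ n (collar_smooth Dp) (collar_lker Dp)); first by rewrite dUB.
exact: cyl_interior.
Qed.

Lemma collar_bdry t x : collar_int a eps t -> mboundary U (F (t, x)) -> t = a%:R.
Proof.
move=> It b; apply: contrapT => /eqP ta; exact: (collar_interior It ta b).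
Qed.

Lemma slice_smooth t x : collar_int a eps t -> smooth_at setT (fun y => F (t, y)) x.
Proof.
move=> It; have [s _] := cyl_at t x cB.
by apply: (@smooth_at_comp R B (cylinder B) U setT D (fun y => (t, y)) F x cB cC cU Logic.I _ s (collar_smooth _)).
Qed.

Lemma slice_diff t x (u : 'rV[R]_(mdim B)) : collar_int a eps t ->
  (mdiff setT (fun y => F (t, y)) x u : 'rV[R]_(mdim U)) =
  mdiff D F ((t, x) : cylinder B) (row_mx (0 : 'rV[R]_1) u).
Proof.
move=> It; have [s E] := cyl_at t x cB.
have Dp : D (t, x) by [].
have Ht : forall y, setT y -> D (t, y) by [].
have := @mdiff_comp R B (cylinder B) U setT D (fun y => (t, y)) F x cB cC cU (thickM x cB) (collar_thick Dp) Ht s (collar_smooth Dp).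
by move=> /lfunP/(_ u); rewrite comp_lfunE => H; exact (etrans H (congr1 (mdiff D F ((t, x) : cylinder B)) (E u))).
Qed.

(* f is constant in the collar coordinate, so its differential only sees the B-component. *)
Lemma collar_const (E : vectType R) (V : set U) (f : U -> E) (S : set B) e t x
    (w : 'rV[R]_(1 + mdim B)) :
  0 < e <= eps -> collar_int a e t -> nbhs x S -> 
  nbhs (F (t, x)) V -> vsmooth_at V f (F (t, x)) ->
  nbhs (F (a%:R, x)) V -> vsmooth_at V f (F (a%:R, x)) ->
  (forall s y, collar_int a e s -> S y -> V (F (s, y)) /\ f (F (s, y)) = f (F (a%:R, y))) ->
  vdiff V f (F (t, x)) (mdiff D F ((t, x) : cylinder B) w) =
  vdiff S (fun y => f (F (a%:R, y))) x (rsubmx w).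
Proof.
move=> /andP[e0 ee] It nS nV sf nVa sfa H.
have Sx := nbhs_singleton nS.
pose D' : set (cylinder B) := collar_int a e `*` S.
have sub : D' `<=` D by move=> [s y] [Is _]; split=> //; exact: collar_le Is.
have Dp : D (t, x) by apply: sub.
have tS : thickS S x x by exact: (thickS_nbhs cB (mdom_refl cB x)).
have tD' : @thickS R (cylinder B) D' (t, x) (t, x) by exact: thick_collar.
have tV : thickS V (F (t, x)) (F (t, x)) by exact: (thickS_nbhs cU (mdom_refl cU _)).
have tVa : thickS V (F (a%:R, x)) (F (a%:R, x)) by exact: (thickS_nbhs cU (mdom_refl cU _)).
have sD' : smooth_at D' F (t, x) by exact: smooth_at_sub sub (collar_smooth Dp).
have -> : mdiff D F (t, x) w = mdiff D' F (t, x) w :> 'rV[R]_(mdim U).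
  symmetry; apply: (mdiff_ext cC cU tD' (collar_thick Dp) _ (collar_smooth Dp)).
  by exists setT; [exact: filterT|move=> q _ /sub].
have DV : forall q, D' q -> V (F q) by move=> [s y] [Is Sy]; have [] := H s y Is Sy.
have /lfunP/(_ w) := vdiff_comp cC cU tD' tV DV sD' sf; rewrite comp_lfunE => <-.
have [ss Es] := cyl_snd cB tD'.
have sfb : vsmooth_at S (fun y => f (F (a%:R, y))) x.
  apply: (vsmooth_comp cB cU Sx _ (smooth_at_sub (@subsetT _ _) (slice_smooth x (collar_end a eps0))) sfa).
  by move=> y Sy; have [] := H a%:R y (collar_end a e0) Sy.
have D'S : forall q, D' q -> S q.2 by move=> q [].
have /lfunP/(_ w) := vdiff_comp cC cB tD' tS D'S ss sfb; rewrite comp_lfunE Es => <-.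
congr (fun_of_lfun _ w); apply: (vdiff_ext cC tD' tD').
  by exists setT; [exact: filterT|move=> [s y] _ [Is Sy]; split=> //=; have [] := H s y Is Sy].
by apply: (vsmooth_comp cC cB _ D'S ss sfb).
Qed.

Lemma collar_embedded x W : nbhs x W -> exists2 N, nbhs (F (a%:R, x)) N & forall y, N (F (a%:R, y)) -> W y.
Proof.
move=> nW; have [|g [gK _ _ sg]] := diffeo_inverse dF.
  by exists (a%:R, x); exact: collar_at.
have Rx : (F @` D) (F (a%:R, x)) by exists (a%:R, x); [exact: collar_at|].
have nD : nbhs (F (a%:R, x)) (F @` D) by exact: open_nbhs_nbhs.
have Ex := gK _ (collar_at x).
have nW' : nbhs (g (F (a%:R, x))) [set q : cylinder B | W q.2].
  rewrite Ex; exists (setT, W); last by move=> [s y] [].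
  by split=> //; exact: filterT.
have H := (cvg_withinP _ _ _ _).1 (sg _ Rx).1 _ nW'.
exists ((F @` D) `&` [set u | (F @` D) u -> W (g u).2]); first exact: filterI.
by move=> y [Dy /(_ Dy)]; rewrite gK //; exact: collar_at.
Qed.

(** Nonnegativity is [bdry_dir] for the inward collar direction. If the value were 0, the first
    coordinate would vanish on the collar vector and, by [boundaryless_coord], on all slice vectors,
    contradicting surjectivity of the collar differential. *)
Lemma collar_dt_sign x (i0 : 'I_(mdim U)) : i0 = 0%N :> nat ->
  0 < collar_dir R a * (mdiff D F ((a%:R, x) : cylinder B) (row_mx (const_mx 1 : 'rV[R]_1) 0) : 'rV[R]_(mdim U)) ord0 i0.
Proof.
move=> i00; have Da := collar_at x.
set dt : 'rV[R]_(1 + mdim B) := row_mx _ _.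
have h0 : 0 <= collar_dir R a * (mdiff D F ((a%:R, x) : cylinder B) dt : 'rV[R]_(mdim U)) ord0 i0.
  have := bdry_dir (M := cylinder B) (w := collar_dir R a *: dt) cC mU (collar_thick Da) (collar_smooth Da) (@bF x) i00.
  rewrite linearZ mxE; apply=> e e0.
  have [s se Is] := collar_enter (collar_end a eps0) e0.
  exists s => //; exists (a%:R + s * collar_dir R a, x); split=> //.
    by split=> //; exact (mdom_refl cB x).
  rewrite !cyl_mmapE /= /dt !scale_row_mx !scaler0 add_row_mx addr0; congr row_mx.
  by apply/matrixP => i j; rewrite !mxE mulr1.
rewrite lt_neqAle h0 andbT eq_sym mulf_neq0 ?collar_dir0 //.
apply/eqP => z; have : (delta_mx ord0 i0 : 'rV[R]_(mdim U)) \in limg (mdiff D F ((a%:R, x) : cylinder B)).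
  by rewrite collar_limg // memvf.
move=> /memv_imgP[w _ Ew].
have : (mdiff D F ((a%:R, x) : cylinder B) w : 'rV[R]_(mdim U)) ord0 i0 = 0.
  have -> : w = (w : 'rV[R]_(1 + mdim B)) ord0 (lshift _ ord0) *: dt + row_mx (0 : 'rV[R]_1) (rsubmx w).
    rewrite /dt scale_row_mx scaler0 add_row_mx addr0 add0r -[LHS]hsubmxK; congr row_mx.
    by apply/matrixP => i j; rewrite !mxE !ord1 mulr1.
  have L := linearP (mdiff D F ((a%:R, x) : cylinder B)) ((w : 'rV[R]_(1 + mdim B)) ord0 (lshift _ ord0)) dt (row_mx 0 (rsubmx w)).
  have sl := slice_diff x (rsubmx w) (collar_end a eps0).
  have z2 := boundaryless_coord (rsubmx w) mB mU bB (slice_smooth x (collar_end a eps0)) (@bF x) i00.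
  rewrite L; move: z z2; rewrite sl => z z2.
  by rewrite mxE z2 addr0 mxE z mulr0.
by rewrite -Ew mxE !eqxx => /eqP; rewrite oner_eq0.
Qed.

Lemma collar_basis k t x (b : k.-tuple 'rV[R]_(mdim B)) : collar_int a eps t -> basis_of fullv b ->
  basis_of fullv (mdiff D F ((t, x) : cylinder B) (row_mx (const_mx 1 : 'rV[R]_1) 0) ::
    map (mdiff D F ((t, x) : cylinder B)) (map (fun u : 'rV[R]_(mdim B) => row_mx (0 : 'rV[R]_1) u) b)).
Proof.
move=> It bb; have Dp : D (t, x) by [].
by have := map_basis (collar_lker Dp) (cyl_basis bb); rewrite collar_limg.
Qed.
End Collar.

(** * The boundary atlases of a cobordism *)

Section CobordismCharts.
Variables (R : realType) (Y : topologicalType) (N : nat) (d : int).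
Variables (c : collared R Y) (K : kcob R Y N).
Hypothesis Hcob : is_cobordism c K d.
Hypothesis Htame : tame (cobK K).
Local Notation KK := (cobK K).
Local Notation ba := (bdy_atlas c K).
Implicit Types I J L : {set 'I_N}.

Lemma kF_bdy a I p : (0 < #|I|)%N -> kF (ba a) I p <-> kF KK I p /\ cbd c a p.
Proof.
move=> /card_gt0P[i iI]; split=> [H|[H1 H2] j jI]; last by split; [exact: H1|].
by split; [move=> j jI; have [] := H j jI|have [] := H i iI].
Qed.

Lemma bidx_idx a I : kidx (ba a) I -> kidx KK I.
Proof. by move=> [I0 [p /(kF_bdy _ _ I0)[H _]]]; split=> //; exists p. Qed.

Lemma bidx_sub a I J : kidx (ba a) J -> kidx KK I -> I \subset J -> kidx (ba a) I.
Proof.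
move=> [J0 [p H]] [I0 _] /fintype.subsetP IJ; split=> //; exists p => i iI.
by apply: H; exact: IJ.
Qed.

Lemma ichart_nobdy a I : is_ichart c K I -> ~ kidx (ba a) I.
Proof.
move=> [_ [_ H]] [I0 [p /(kF_bdy _ _ I0)[Fp bp]]].
by apply: (H p (subset_closure Fp)); case: a bp; [right|left].
Qed.

Lemma bidx_bchart a I : kidx (ba a) I -> is_bchart c K I.
Proof.
move=> kI; have [_ _ H _ _] := Hcob.
by have [[//|/ichart_nobdy/(_ kI)[]] _] := H I (bidx_idx kI).
Qed.

Lemma cob_man I : kidx KK I -> is_manifold (kU KK I).
Proof.
move=> kI; have [_ _ H _ _] := Hcob; have [[Hb|Hi] _] := H I kI; first by have [[]] := Hb.
by have [[[]]] := Hi.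
Qed.

Lemma cob_s I : kidx KK I -> vsmooth_on setT (@ks R Y N KK I).
Proof.
move=> kI; have [_ _ H _ _] := Hcob; have [[Hb|Hi] _] := H I kI; first by have [[]] := Hb.
by have [[]] := Hi.
Qed.

Lemma cob_dim I : kidx KK I -> (mdim (kU KK I))%:Z - (\dim {:kE KK I})%:Z = d.
Proof. by move=> kI; have [_ _ H _ _] := Hcob; have [] := H I kI. Qed.

Lemma cob_bdryE I (x : kU KK I) : kidx KK I ->
  mboundary (kU KK I) x <-> exists a, kidx (ba a) I /\ exists y : cobU K a I, cobincl y = x.
Proof.
move=> kI; have [_ _ H _ _] := Hcob; have [[Hb|Hi] _] := H I kI.
  have [_ _ -> _ _] := Hb; split=> [[a ka [y _ <-]]|[a [ka [y <-]]]].
    by exists a; split=> //; exists y.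
  by exists a => //; exists y.
have [[[_ -> ] _ _ _ _] _] := Hi; split=> // -[a [ka _]].
by case: (ichart_nobdy Hi ka).
Qed.

Lemma bdy_bdry a I (y : cobU K a I) : kidx (ba a) I -> mboundary (kU KK I) (cobincl y).
Proof. by move=> ka; apply/(cob_bdryE _ (bidx_idx ka)); exists a; split=> //; exists y. Qed.

Lemma bdy_chart a I : kidx (ba a) I -> is_chart (ba a) (cbd c a) I.
Proof. by move=> ka; have [_ _ _ _ H] := bidx_bchart ka; have [] := H a ka. Qed.

Lemma bdy_dim a I : kidx (ba a) I -> mdim (kU KK I) = (mdim (cobU K a I)).+1.
Proof. by move=> ka; have [_ _ _ _ H] := bidx_bchart ka; have [] := H a ka. Qed.

Lemma cob_collar a I : kidx (ba a) I -> exists eps,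
  collar_map (@cobcol R Y N K a I) a eps /\
  forall t x, collar_int a eps t -> ks (@cobcol R Y N K a I (t, x)) = ks (cobincl x).
Proof.
move=> ka; have [_ _ _ _ H] := bidx_bchart ka.
have [dm [[mB bB] _ _ _ _] [eps /andP[e0 _] [oD df Hs]]] := H a ka.
exists eps; split; last by move=> t x It; have [] := Hs t x It.
split=> //; first exact: cob_man (bidx_idx ka).
by move=> x; exact (@bdy_bdry a I x ka).
Qed.

Lemma cobincl_inj a I : kidx (ba a) I -> injective (@cobincl R Y N K a I).
Proof.
move=> ka x y E; have [eps [cm _]] := cob_collar ka.
by have [] := collar_inj cm (collar_at cm x) (collar_at cm y) E.
Qed.

Lemma bdy_disjoint I (x : cobU K false I) (y : cobU K true I) :
  kidx (ba false) I -> kidx (ba true) I -> cobincl x <> cobincl y.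
Proof.
move=> k0 k1 E; have [_ _ _ H _] := bidx_bchart k0.
have : (range (@cobincl R Y N K false I) `&` range (@cobincl R Y N K true I)) (cobincl x).
  by split; [exists x|exists y].
by rewrite H.
Qed.

Lemma cob_cc I J : kidx KK I -> kidx KK J -> I \proper J -> cob_coord_change c K I J.
Proof. by have [_ _ _ H _] := Hcob; exact: H. Qed.

Lemma bdy_cc a I J : kidx (ba a) I -> kidx (ba a) J -> I \proper J -> coord_change (ba a) I J.
Proof.
move=> kI kJ IJ; have [_ H] := cob_cc (bidx_idx kI) (bidx_idx kJ) IJ.
by have [/(_ kJ)[]] := H a.
Qed.

(** If [J] did not meet the end [a], the domain of the coordinate change would avoid a collar of
    that end and contain no boundary point of it. *)
Lemma bdy_push a I J (x : cobU K a I) : kidx (ba a) I -> kidx KK J -> I \proper J ->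
  kdom KK I J (cobincl x) ->
  kidx (ba a) J /\ kphi KK I J (cobincl x) = cobincl (cobphi J x).
Proof.
move=> kI kJ IJ Dx; have [_ H] := cob_cc (bidx_idx kI) kJ IJ; have [H1 H2] := H a.
have [kbJ|nJ] := pselect (kidx (ba a) J); last first.
  have [eps e0 Hd] := H2 kI nJ; have := Hd _ x (collar_end a e0).
  by case.
split=> //; have [_ [eps e0 Hd]] := H1 kbJ; have [_ Hphi _] := Hd _ (collar_end a e0).
exact: Hphi.
Qed.

Lemma kphi_injC I J (u v : kU KK I) : kidx KK I -> kidx KK J -> I \proper J ->
  kdom KK I J u -> kdom KK I J v -> kphi KK I J u = kphi KK I J v -> u = v.
Proof.
move=> kI kJ IJ Du Dv; have [[_ [[_ [[_ inj _] _ _] _] _] _ _ _] _] := cob_cc kI kJ IJ.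
by apply: inj; rewrite inE.
Qed.

(** Uses the product form of the images, not only of the domains, in the collars: a boundary point
    in the image of phi_IJ comes from the boundary piece of U_I. *)
Lemma bdy_pull a I J (u : kU KK I) (y : cobU K a J) : kidx KK I -> kidx (ba a) J -> I \proper J ->
  kdom KK I J u -> kphi KK I J u = cobincl y ->
  exists x : cobU K a I, [/\ kidx (ba a) I, cobincl x = u & cobphi J x = y].
Proof.
move=> kI kJ IJ Du E; have kbI := bidx_sub kJ kI (proper_sub IJ).
have [_ H] := cob_cc kI (bidx_idx kJ) IJ; have [H1 _] := H a.
have [_ [eps e0 Hd]] := H1 kJ; have [_ Hphi Him] := Hd _ (collar_end a e0).
have [|x Dx Ex] := (Him y).1; first by exists u.
exists x; split=> //; apply: (kphi_injC kI (bidx_idx kJ) IJ Dx Du).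
have := Hphi x Dx; rewrite -[cobcol (a%:R, x)]/(cobincl x) => ->.
by rewrite Ex E.
Qed.

Lemma cob_phib I J (x : kU KK I) : kidx KK I -> kidx KK J -> I \proper J -> kdom KK I J x ->
  mboundary (kU KK I) x <-> mboundary (kU KK J) (kphi KK I J x).
Proof.
move=> kI kJ IJ Dx; rewrite (cob_bdryE _ kI) (cob_bdryE _ kJ); split=> -[a [ka [y Ey]]].
  have Dy : kdom KK I J (cobincl y) by rewrite Ey.
  have [kb E] := bdy_push ka kJ IJ Dy.
  by exists a; split=> //; exists (cobphi J y); rewrite -E Ey.
by have [x' [kb Ex _]] := bdy_pull kI ka IJ Dx (esym Ey); exists a; split=> //; exists x'.
Qed.

Lemma cobincl_smooth a I (x : cobU K a I) : kidx (ba a) I ->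
  smooth_at setT (@cobincl R Y N K a I) x.
Proof. by move=> ka; have [eps [cm _]] := cob_collar ka; exact (slice_smooth cm x (collar_end a (cm_eps cm))). Qed.

Lemma cobincl_cont a I : kidx (ba a) I -> continuous (@cobincl R Y N K a I).
Proof.
move=> ka x W nW; have := (cvg_withinP _ _ _ _).1 (cobincl_smooth x ka).1 W nW.
by apply: filterS => q; exact.
Qed.

Lemma bdy_man a I : kidx (ba a) I -> is_manifold (cobU K a I) /\ mboundary (cobU K a I) = set0.
Proof. by move=> ka; have [] := bdy_chart ka. Qed.

Lemma cobincl_lker a I (x : cobU K a I) : kidx (ba a) I ->
  lker (mdiff setT (@cobincl R Y N K a I) x) = 0%VS.
Proof.
move=> ka; have [eps [cm _]] := cob_collar ka; have Ia := collar_end a (cm_eps cm).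
apply: lker0_intro => v v0.
have H := etrans (esym (slice_diff cm x v Ia)) v0.
have /eqP := lker0_inj (collar_lker cm (collar_at cm x)) H.
by rewrite row_mx_eq0 => /andP[_ /eqP].
Qed.

(** The boundary piece is closed in U_I: a cluster point of its points is a boundary point, and it
    cannot belong to the other end. The collar then turns clustering in U_I into clustering in the
    piece. *)
Lemma cobincl_compact a I (A : set (kU KK I)) : kidx (ba a) I -> compact A ->
  compact (@cobincl R Y N K a I @^-1` A).
Proof.
move=> ka cA Fl PF FA; have kI := bidx_idx ka; have mU := cob_man kI; have cU := manifold_charted mU.
have [eps [cm _]] := cob_collar ka.
have [u [Au cu]] := cA (@cobincl R Y N K a I @ Fl) _ FA.
have ub : mboundary (kU KK I) u.
  apply: contrapT => nb; have int : nbhs (mmap u u) (mmap u @` mdom u) by exact: contrapT.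
  have uu := mdom_refl cU u.
  have nW : nbhs u (mdom u `&` mmap u @^-1` (mmap u @` mdom u)^°).
    apply: filterI; first exact (mdom_nbhs cU uu).
    by apply: (mmap_cont cU uu); exact: nbhs_interior.
  have [_ [[x _ <-] [ux ix]]] := cu (range (@cobincl R Y N K a I)) _ (filterS (fun y _ => ex_intro2 _ _ y Logic.I erefl) filterT) nW.
  by have /(bdryE cU ux) := @bdy_bdry a I x ka; apply.
have [x0 Ex] : exists x0 : cobU K a I, cobincl x0 = u.
  have [a' [ka' [y Ey]]] := (cob_bdryE u kI).1 ub.
  (* The collar of the other end is a neighbourhood of [u]; its only boundary points belong to that
     end, which is disjoint from the end [a]. *)
  have [E|E] := eqVneq a' a; first by subst a'; exists y.
  have [eps' [cm' _]] := cob_collar ka'.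
  have nW : nbhs u (@cobcol R Y N K a' I @` (collar_int a' eps' `*` setT)).
    apply: open_nbhs_nbhs; split; first exact: cm_open cm'.
    by exists (a'%:R, y); [exact: collar_at cm' y|].
  have [_ [[x _ <-] [[t y'] [It _] Et]]] := cu (range (@cobincl R Y N K a I)) _ (filterS (fun y _ => ex_intro2 _ _ y Logic.I erefl) filterT) nW.
  have bx := @bdy_bdry a I x ka; rewrite -Et in bx.
  have Ea : t = a'%:R by exact (@collar_bdry _ _ _ _ _ _ cm' t y' It bx).
  rewrite Ea in Et.
  exfalso; have {}Et : cobincl y' = cobincl x by [].
  clear -Hcob E ka ka' Et; move: E ka ka' x y' Et; case: a; case: a' => // _ ka ka' x y' Et.
    exact: (bdy_disjoint ka' ka Et).
  exact: (bdy_disjoint ka ka' (esym Et)).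
exists x0; split; first by rewrite /= Ex.
move=> B W FB nW; have [W' nW' HW'] := collar_embedded cm nW.
rewrite -[cobcol _]/(cobincl x0) Ex in nW'.
have [_ [[x Bx <-] W'x]] := cu (@cobincl R Y N K a I @` B) W' (filterS (fun b Bb => ex_intro2 _ _ b Bb erefl) FB) nW'.
by exists x; split=> //; exact: HW'.
Qed.

Lemma bdy_kpi a I J (x : cobU K a I) (y : cobU K a J) :
  kpi (K := ba a) x = kpi (K := ba a) y -> kpi (cobincl x) = kpi (cobincl y).
Proof.
move=> /gen_proj_eq H; apply/gen_proj_eq.
pose f (p : kpt (ba a)) : kpt KK := existT (fun I => kU KK I : Type) (projT1 p) (cobincl (projT2 p)).
apply: (@rst_mono _ _ _ _ f _ (existT _ I x) (existT _ J y) H) => p q [kp kq pq D E].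
apply: rst_step; split=> //=; [exact: bidx_idx kp|exact: bidx_idx kq|].
by have [_ ->] := bdy_push kp (bidx_idx kq) pq D; rewrite -E.
Qed.

Lemma bdy_cocycle a : cocycle (ba a).
Proof.
move=> I J L kI kJ kL IJ JL.
have [_ _ _ _ [coc _ _]] := Hcob.
have [E H] := coc I J L (bidx_idx kI) (bidx_idx kJ) (bidx_idx kL) IJ JL.
split=> // x D1 D2; have [_ P1] := bdy_push kI (bidx_idx kJ) IJ D1.
have D2' : kdom KK J L (kphi KK I J (cobincl x)) by rewrite P1.
have [D3 E3] := H _ D1 D2'; split=> //.
apply: (cobincl_inj kL).
have [_ P2] := bdy_push kJ (bidx_idx kL) JL D2.
have IL := fintype.proper_trans IJ JL.
have [_ P3] := bdy_push kI (bidx_idx kL) IL D3.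
have {}P2 : kphi KK J L (cobincl (cobphi J x)) = cobincl (cobphi L (cobphi J x)) by [].
by rewrite /= -P2 -P1 E3 P3.
Qed.

Lemma bdy_tame2 a I J L : kidx (ba a) I -> kidx (ba a) J -> kidx (ba a) L ->
  I \subset J -> I \subset L -> kdom (ba a) I J `&` kdom (ba a) I L = kdom (ba a) I (J :|: L)%SET.
Proof.
move=> kI kJ kL IJ IL; have [_ t2 _] := Htame.
have E := t2 I J L (bidx_idx kI) (bidx_idx kJ) (bidx_idx kL) IJ IL.
apply/seteqP; split=> x /=.
  by move=> [D1 D2]; have : (kdom KK I J `&` kdom KK I L) (cobincl x) by []; rewrite E.
by move=> D; have : kdom KK I (J :|: L)%SET (cobincl x) by []; rewrite -E.
Qed.

(** The inclusion from right to left finds a preimage in U_I only; [bdy_pull] shows that it lies on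
    the boundary piece. *)
Lemma bdy_tame3 a I J L : kidx (ba a) I -> kidx (ba a) J -> kidx (ba a) L ->
  I \subset J -> J \subset L -> kphi (ba a) I J @` kdom (ba a) I L =
        kdom (ba a) J L `&` [set y | ks y \in limg (khat (ba a) I J)].
Proof.
move=> kI kJ kL IJ JL; have [_ t2 t3] := Htame.
have E := t3 I J L (bidx_idx kI) (bidx_idx kJ) (bidx_idx kL) IJ JL.
have [_ _ _ _ [_ _ bconv]] := Hcob.
case/proper_or_eq: (IJ) => [EIJ|pIJ].
  subst J; have [_ id1 id2 _] := bconv a I kI.
  apply/seteqP; split=> [_ [x Dx <-]|x [Dx _]].
    by rewrite id1; split=> //; rewrite /= id2 lim1g memvf.
  by exists x; rewrite ?id1.
have E2 := t2 I J L (bidx_idx kI) (bidx_idx kJ) (bidx_idx kL) IJ (fintype.subset_trans IJ JL).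
have DIJ u : kdom KK I L u -> kdom KK I J u.
  move=> D; have : (kdom KK I J `&` kdom KK I L) u by rewrite E2 (elimT finset.setUidPr JL).
  by case.
apply/seteqP; split=> [_ [x Dx <-]|y [Dy sy]].
  have [_ P] := bdy_push kI (bidx_idx kJ) pIJ (DIJ _ Dx).
  have : (kphi KK I J @` kdom KK I L) (cobincl (cobphi J x)) by exists (cobincl x).
  by rewrite E => -[].
have : (kdom KK J L `&` [set y | ks y \in limg (khat KK I J)]) (cobincl y) by [].
rewrite -E => -[u Du Eu].
have [x [_ Ex Ey]] := bdy_pull (bidx_idx kI) kJ pIJ (DIJ _ Du) Eu.
by exists x => //; rewrite /= Ex.
Qed.

Lemma bdy_conv a : conventions (ba a).
Proof. by have [_ _ _ _ []] := Hcob. Qed.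

Lemma bdy_dims a I : kidx (ba a) I -> (mdim (kU (ba a) I))%:Z - (\dim {:kE (ba a) I})%:Z = d - 1.
Proof.
move=> ka; have := cob_dim (bidx_idx ka); rewrite (bdy_dim ka) /= => <-.
by lia.
Qed.

Lemma bdy_kds a I (x : cobU K a I) eps (w : 'rV[R]_(1 + mdim (cobU K a I))) :
  kidx (ba a) I -> collar_map (@cobcol R Y N K a I) a eps ->
  (forall t x, collar_int a eps t -> ks (@cobcol R Y N K a I (t, x)) = ks (cobincl x)) ->
  forall t, collar_int a eps t ->
  kds (@cobcol R Y N K a I (t, x)) (mdiff (M := cylinder (cobU K a I)) (collar_int a eps `*` setT) (@cobcol R Y N K a I) (t, x) w) =
  kds (K := ba a) x (rsubmx w).
Proof.
move=> ka cm Hs t It; have kI := bidx_idx ka.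
have e0 : 0 < eps <= eps by rewrite lexx (cm_eps cm).
by apply: (collar_const cm (S := setT) w e0 It filterT filterT (cob_s kI Logic.I) filterT (cob_s kI Logic.I)) => s y Is _; split=> //; exact: Hs.
Qed.
End CobordismCharts.

(** * Transversality and compactness at the boundary *)

Section CobordismZeroSets.
Variables (R : realType) (Y : topologicalType) (N : nat) (d : int).
Variables (c : collared R Y) (K : kcob R Y N).
Local Notation KK := (cobK K).
Local Notation ba := (bdy_atlas c K).
Unset Implicit Arguments.
Variables (V : forall I, set (kU KK I)) (nu : forall I, kU KK I -> kE KK I).
Set Implicit Arguments.
Local Notation bV := (bdy_red c V).
Local Notation bnu := (bdy_pert c nu).
Implicit Types I J L : {set 'I_N}.
Hypothesis Hcob : is_cobordism c K d.
Hypothesis Htame : tame KK.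
Hypothesis red : is_cob_reduction c V.
Hypothesis pert : is_cob_perturbation c V nu.
Hypothesis adm : admissible V nu.
Hypothesis pre : cob_precompact_pert c V nu.
Hypothesis tr : transverse V nu.

Lemma cobV_open I : kidx KK I -> open (V I).
Proof. by move=> kI; have [[H _ _ _] _] := red; have [] := H I kI. Qed.

Lemma cob_snu_smooth I : kidx KK I -> vsmooth_on (V I) (fun x => ks x + nu I x).
Proof.
move=> kI x Vx; have [[sn _] _] := pert; apply: vsmooth_add; last exact: sn.
exact (rsmooth_sub (@subsetT _ _) (cob_s Hcob kI (p := x) Logic.I)).
Qed.

Lemma bV_open a I : kidx (ba a) I -> open (bV a I).
Proof.
move=> ka; rewrite openE => x [_ Vx].
have nV : nbhs (cobincl x) (V I) by apply: open_nbhs_nbhs; split=> //; exact: cobV_open (bidx_idx ka).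
have H : nbhs x (@cobincl R Y N K a I @^-1` V I) by exact (cobincl_cont Hcob ka nV).
by apply: filterS H => y Vy; split.
Qed.

(** Collects a common collar width on which [s], [nu] and V_I are all products. There [s + nu] does
    not depend on the collar coordinate, so by [collar_const] its differential is that of its
    boundary restriction. *)
Lemma bdy_ext a I (x : cobU K a I) : kidx (ba a) I -> V I (cobincl x) ->
  exists eps e, [/\ collar_map (@cobcol R Y N K a I) a eps, 0 < e <= eps
    & forall t, collar_int a e t ->
      [/\ V I (cobcol (t, x)), ks (cobcol (t, x)) + nu I (cobcol (t, x)) = ks (cobincl x) + nu I (cobincl x)
        & forall w : 'rV[R]_(1 + mdim (cobU K a I)),
          kdsnu V nu (cobcol (t, x)) (mdiff (M := cylinder (cobU K a I)) (collar_int a eps `*` setT) (@cobcol R Y N K a I) (t, x) w) =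
          kdsnu (bV a) (bnu a) x (rsubmx w)]].
Proof.
move=> ka Vx; have kI := bidx_idx ka.
have [eps [cm Hs]] := cob_collar Hcob ka.
have [_ redc] := red; have [[e1 e10 H1] _] := redc a I ka.
have [_ pertc] := pert; have [e2 e20 H2] := pertc a I ka.
(* The three widths come from the chart, the reduction and the perturbation. *)
pose e := Num.min eps (Num.min e1 e2).
have e0 : 0 < e by rewrite !lt_min (cm_eps cm) e10 e20.
have le0 : e <= eps by rewrite ge_min lexx.
have le1 : e <= e1 by rewrite !ge_min lexx orbT.
have le2 : e <= e2 by rewrite !ge_min lexx !orbT.
have H t y : collar_int a e t -> bV a I y -> V I (cobcol (t, y)) /\
    ks (cobcol (t, y)) + nu I (cobcol (t, y)) = ks (cobincl y) + nu I (cobincl y).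
  move=> It by_; split; first by apply/(H1 t y (collar_le le1 It)).
  have E1 := Hs t y (collar_le le0 It); have E2 := H2 t y (collar_le le2 It) by_.
  exact (congr2 +%R E1 E2).
have bx : bV a I x by [].
exists eps, e; split=> //; first by rewrite e0.
move=> t It; have [Vt Et] := H t x It bx; split=> // w.
have nV u : V I u -> nbhs u (V I) by move=> Vu; apply: open_nbhs_nbhs; split=> //; exact: cobV_open.
have nS : nbhs x (bV a I) by apply: open_nbhs_nbhs; split=> //; exact: bV_open.
have ee : 0 < e <= eps by rewrite e0.
exact (collar_const cm w ee It nS (nV _ Vt) (cob_snu_smooth kI Vt) (nV _ Vx) (cob_snu_smooth kI Vx) H).
Qed.

Lemma bZ_Z a I (x : cobU K a I) : kZ (bV a) (bnu a) I x -> kidx (ba a) I /\ kZ V nu I (cobincl x).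
Proof. by move=> [ka [_ Vx] z]; split=> //; split=> //; exact: bidx_idx ka. Qed.

Lemma Z_bZ a I (x : cobU K a I) : kidx (ba a) I -> kZ V nu I (cobincl x) -> kZ (bV a) (bnu a) I x.
Proof. by move=> ka [_ Vx z]; split. Qed.

Lemma collar_inner a (e : R) : 0 < e -> exists2 t, collar_int a e t & t != a%:R.
Proof.
move=> e0; have h : 0 < e / 2 by rewrite divr_gt0.
case: a; [exists (1 - e / 2)|exists (e / 2)] => /=.
- apply/andP; split; lra.
- by rewrite lt_eqF //; lra.
- apply/andP; split; lra.
- by rewrite gt_eqF.
Qed.

(** A boundary zero extends to zeros [(t, x)] in the collar. For [t] inside, these are interior
    points, where transversality is assumed, and every value of the differential there is already a
    value of the boundary differential. *)
Lemma bdy_trans a I (x : cobU K a I) : kZ (bV a) (bnu a) I x -> limg (kdsnu (bV a) (bnu a) x) = fullv.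
Proof.
move=> Zx; have [ka [kI Vx z]] := bZ_Z Zx.
have [eps [e [cm ee H]]] := bdy_ext ka Vx; have [e0 le] := andP ee.
have [t It ta] := collar_inner a e0.
have [Vt Et Hd] := H t It.
have Zt : kZ V nu I (cobcol (t, x)) by split=> //; rewrite Et.
have It' := collar_le le It.
have ft := tr Zt (collar_interior cm It' ta).
apply/eqP; rewrite eqEsubv subvf /= -ft; apply/subvP => _ /memv_imgP[v _ ->].
have : v \in limg (mdiff (M := cylinder (cobU K a I)) (collar_int a eps `*` setT) (@cobcol R Y N K a I) (t, x)).
  by rewrite (collar_limg cm) // memvf.
by move=> /memv_imgP[w _ ->]; rewrite Hd memv_img // memvf.
Qed.

Lemma bdy_slice_dsnu a I (x : cobU K a I) (u : 'rV[R]_(mdim (cobU K a I))) : kidx (ba a) I -> V I (cobincl x) ->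
  kdsnu V nu (cobincl x) (mdiff setT (@cobincl R Y N K a I) x u) = kdsnu (bV a) (bnu a) x u.
Proof.
move=> ka Vx; have [eps [e [cm ee H]]] := bdy_ext ka Vx; have [e0 le] := andP ee.
have [_ _ Hd] := H _ (collar_end a e0).
have E := slice_diff cm x u (collar_end a (cm_eps cm)).
apply: (etrans (congr1 (kdsnu V nu (cobincl x)) E)).
by apply: (etrans (Hd _)); rewrite row_mxKr.
Qed.

(** At a boundary zero the slice directions alone already give surjectivity. *)
Lemma cob_trans I (z : kU KK I) : kZ V nu I z -> limg (kdsnu V nu z) = fullv.
Proof.
move=> Zz; have [kI Vz z0] := Zz.
have [b|] := pselect (mboundary (kU KK I) z); last exact: tr.
have [a [ka [x Ex]]] := (cob_bdryE Hcob z kI).1 b; subst z.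
have := bdy_trans (Z_bZ ka Zz) => ft.
apply/eqP; rewrite eqEsubv subvf /= -ft; apply/subvP => _ /memv_imgP[v _ ->].
by rewrite -bdy_slice_dsnu // memv_img // memvf.
Qed.

(** The collar vector serves: [s + nu] is constant along it, and [collar_dt_sign] makes its first
    coordinate nonzero. *)
Lemma cob_bdryv I (z : kU KK I) : kZ V nu I z -> mboundary (kU KK I) z ->
  exists (v : tangent z) (i0 : 'I_(mdim (kU KK I))),
     [/\ kdsnu V nu z v = 0, i0 = 0%N :> nat & (v : 'rV[R]_(mdim (kU KK I))) ord0 i0 != 0].
Proof.
move=> Zz b; have [kI Vz z0] := Zz.
have [a [ka [x Ex]]] := (cob_bdryE Hcob z kI).1 b; subst z.
have [eps [e [cm ee H]]] := bdy_ext ka Vz; have [e0 le] := andP ee.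
have [_ _ Hd] := H _ (collar_end a e0).
pose dt : 'rV[R]_(1 + mdim (cobU K a I)) := row_mx (const_mx 1) 0.
have i0P : (0 < mdim (kU KK I))%N by rewrite (cm_dim cm).
exists (mdiff (M := cylinder (cobU K a I)) (collar_int a eps `*` setT) (@cobcol R Y N K a I) (a%:R, x) dt), (Ordinal i0P).
split=> //; first by apply: (etrans (Hd dt)); rewrite row_mxKr linear0.
have := collar_dt_sign cm x (i0 := Ordinal i0P) erefl.
by move=> /lt0r_neq0; rewrite mulf_eq0 negb_or => /andP[].
Qed.

Lemma cob_core : core_data V nu `|d|.
Proof.
have [_ _ _ _ [coc conv _]] := Hcob; have [_ t2 t3] := Htame.
split=> //.
- by move=> I kI; exact: (cob_man Hcob kI).
- by move=> I kI; exact: (cob_s Hcob kI).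
- by move=> I kI [z Zz]; have [] := surj_dim (cob_trans Zz) (cob_dim Hcob kI).
- by move=> I J kI kJ IJ; have [[[oD _] [eD lD] Hs _ _] _] := cob_cc Hcob kI kJ IJ; split.
- exact: cobV_open.
- by have [rd _] := red; exact: reduction_comparable rd.
- by have [] := pert.
- have [C [[rC _] CV CZ]] := pre; exists C; split=> // I kI.
- by move=> I z; exact: cob_trans.
- by move=> I z; exact: cob_bdryv.
- by move=> I J x kI kJ IJ Dx; exact: (cob_phib Hcob).
Qed.

Lemma cob_index I J : kidx KK I -> kidx KK J -> I \proper J -> index_condition KK I J.
Proof. by move=> kI kJ IJ; have [[_ _ _ _ H] _] := cob_cc Hcob kI kJ IJ. Qed.

Lemma bdy_perturbation a : is_perturbation (bV a) (bnu a).
Proof.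
have [[sn Hn] _] := pert; split=> [I ka x [_ Vx]|I J kI kJ IJ x [_ Vx] Dx [_ VJ]].
  have kI := bidx_idx ka; have [mB _] := bdy_man Hcob ka.
  apply: (vsmooth_comp (manifold_charted mB) (manifold_charted (cob_man Hcob kI)) (S' := V I) _ _ _ (sn I kI _ Vx)).
  - by split.
  - by move=> y [].
  - exact: smooth_at_sub (@subsetT _ _) (cobincl_smooth Hcob x ka).
have [_ E] := bdy_push Hcob kI (bidx_idx kJ) IJ Dx.
have VJ' : V J (kphi KK I J (cobincl x)) by rewrite E.
by rewrite /bdy_pert /= -(Hn I J (bidx_idx kI) (bidx_idx kJ) IJ _ Vx Dx VJ') E.
Qed.

Lemma bdy_transverse a : transverse (bV a) (bnu a).
Proof. by move=> I z Zz _; exact: bdy_trans. Qed.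

Lemma bdy_slice_dnu a I (x : cobU K a I) (u : 'rV[R]_(mdim (cobU K a I))) : kidx (ba a) I -> V I (cobincl x) ->
  vdiff (bV a I) (bnu a I) x u = vdiff (V I) (nu I) (cobincl x) (mdiff setT (@cobincl R Y N K a I) x u).
Proof.
move=> ka Vx; have kI := bidx_idx ka; have [mB _] := bdy_man Hcob ka.
have cB := manifold_charted mB; have cU := manifold_charted (cob_man Hcob kI).
have [[sn _] _] := pert; have [sb _] := bdy_perturbation a.
have tb : thickS (bV a I) x x.
  by apply: (thickS_nbhs cB (mdom_refl cB x)); apply: open_nbhs_nbhs; split=> //; exact: bV_open.
have tV : thickS (V I) (cobincl x) (cobincl x).
  by apply: (thickS_nbhs cU (mdom_refl cU _)); apply: open_nbhs_nbhs; split=> //; exact: cobV_open.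
have bx : bV a I x by [].
have := vdiff_push (B := \1%VF) cB cU (thickM x cB) tb tV (cobincl_smooth Hcob x ka) (sb I ka x bx) (sn I kI _ Vx) _ u.
move=> H; rewrite H; first by rewrite id_lfunE.
exists (bV a I); first by apply: open_nbhs_nbhs; split=> //; exact: bV_open.
by move=> y by_ _; split=> //; [case: by_|rewrite id_lfunE].
Qed.

Lemma bdy_admissible a : admissible (bV a) (bnu a).
Proof.
move=> I J kI kJ IJ y [_ Vy] [x [[_ Vx] Dx] E].
have [_ P] := bdy_push Hcob kI (bidx_idx kJ) IJ Dx.
have H := adm (bidx_idx kI) (bidx_idx kJ) IJ Vy.
apply/subvP => _ /memv_imgP[u _ ->]; rewrite bdy_slice_dnu //.
apply: (subvP (H _)); last exact: memv_img (memvf _).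
by exists (cobincl x) => //; rewrite P; congr cobincl.
Qed.

(** The boundary data satisfy the hypotheses of the closed case in dimension [d - 1]. Precompactness
    is the only one not inherited directly: it combines [cobincl_compact] with a return of
    equivalent points to the boundary. *)
Lemma bdy_core a : core_data (bV a) (bnu a) `|d - 1|.
Proof.
apply: closed_core.
- move=> I ka; have [mB bB] := bdy_man Hcob ka; split=> //; last exact: (bdy_dims Hcob ka).
  by have [_ sB _ _ _] := bdy_chart Hcob ka.
- by move=> I J; exact: (bdy_cc Hcob).
- exact: (bdy_cocycle Hcob).
- exact: (bdy_conv Hcob).
- by move=> I J L; exact: (bdy_tame2 Htame).
- by move=> I J L; exact: (bdy_tame3 Hcob Htame).
- by move=> I; exact: bV_open.
- move=> I J x y kI kJ [_ Vx] [_ Vy] E; have [rd _] := red.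
  exact: (reduction_comparable rd (bidx_idx kI) (bidx_idx kJ) Vx Vy (bdy_kpi Hcob E)).
- exact: bdy_perturbation.
- have [C [[rC _] CV CZ]] := pre; exists (bdy_red c C a); split.
    move=> I ka; have kI := bidx_idx ka; have [cC sC] := CV I kI.
    have sub : closure (bdy_red c C a I) `<=` @cobincl R Y N K a I @^-1` closure (C I).
      move=> x clx W nW; have [y [[_ Cy] Wy]] := clx _ (cobincl_cont Hcob ka nW).
      by exists (cobincl y).
    split; last by move=> x /sub /sC Vx; split.
    apply: subclosed_compact sub; first exact: closed_closure.
    exact: (cobincl_compact Hcob ka cC).
  (* A boundary zero is equivalent in the full cobordism to a point [y] of C_J. Their single-step
     relation lets [bdy_push] or [bdy_pull] place [y] on the same end, so the equivalence already
     holds in the boundary atlas. *)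
  move=> q [I [x [kI Zx ->]]]; have [ka Zx'] := bZ_Z Zx.
  have [|J [y [kJ Cy E]]] := CZ (kpi (cobincl x)); first by exists I, (cobincl x); split=> //; exact (bidx_idx ka).
  have Vy : V J y by have [_ sC] := CV J kJ; apply: sC; exact: subset_closure.
  have [_ Vx _] := Zx'; have kI' := bidx_idx ka.
  have [IJ|JI] := cd_Vc cob_core kI' kJ Vx Vy E.
    have [D P] := @kpi_eq _ _ _ _ _ _ _ cob_core (existT _ I (cobincl x)) (existT _ J y) kI' kJ IJ E.
    rewrite /= in D P.
    case/proper_or_eq: (IJ) => [EIJ|pIJ].
      subst J; exists I, x; split=> //; split=> //.
      by move: P; rewrite (kphiII cob_core) // => ->.
    have [kbJ P'] := bdy_push Hcob ka kJ pIJ D.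
    exists J, (cobphi J x); split=> //; first by split=> //; rewrite -P' P.
    by apply/gen_proj_eq; apply: rst_step; split.
  have [D P] := @kpi_eq _ _ _ _ _ _ _ cob_core (existT _ J y) (existT _ I (cobincl x)) kJ kI' JI (esym E).
  rewrite /= in D P.
  case/proper_or_eq: (JI) => [EIJ|pJI].
    subst J; exists I, x; split=> //; split=> //.
    by move: P; rewrite (kphiII cob_core) // => <-.
  have [x' [kbJ Ex' Px']] := bdy_pull Hcob kJ ka pJI D P.
  exists J, x'; split=> //; first by split=> //; rewrite Ex'.
  apply/gen_proj_eq; apply: rst_sym; apply: rst_step; split=> //=.
  by rewrite Ex'.
- exact: bdy_transverse.
Qed.
End CobordismZeroSets.

(** Injectivity of the contraction: [top_compat] with identity maps and no completing vectors. *)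
Lemma contraction_unique (R : realType) (V W : vectType R) (D : 'Hom(V, W)) (lam lam' c : detelt V W)
    k l (v : k.-tuple V) (w : l.-tuple W) :
  Defs.is_contraction D lam c -> Defs.is_contraction D lam' c ->
  basis_of fullv v -> basis_of fullv w -> lam' k l v w = lam k l v w.
Proof.
move=> con con' bv bw.
have id0 (E : vectType R) : lker (\1%VF : 'End(E)) = 0%VS.
  by apply: lker0_intro => x; rewrite id_lfunE.
have idE (E : vectType R) (s : seq E) : map (\1%VF : 'End(E)) s = s.
  by elim: s => //= x s ->; rewrite id_lfunE.
have H := @top_compat R V W V W \1%VF \1%VF D D lam c lam' c (id0 V) _ _ con con' _ k l 0 v w [tuple].
rewrite !sqE; move: H; rewrite /= !cats0 !idE; apply=> //.
- by move=> x; rewrite !id_lfunE.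
- by rewrite lim1g.
- by move=> k' l' v' w' _ _; congr (c _ _ _ _); apply: val_inj; rewrite /= idE.
Qed.

(** * Boundary orientations *)

Section Suspension.
Variables (R : realType) (B V W : vectType R) (tau : V) (A : 'Hom(B, V)).
Hypothesis bA : forall k (b : k.-tuple B), basis_of fullv b -> basis_of fullv (tau :: map A b).
Variables (D : 'Hom(V, W)) (Db : 'Hom(B, W)).
Hypotheses (Dtau : D tau = 0) (DA : forall u, D (A u) = Db u).

Definition susp k (b : k.-tuple B) : k.+1.-tuple V := [tuple of tau :: map_tuple A b].

(* The element [eta (x) zeta] with [tau /\ A eta (x) zeta = lam]. *)
Definition susp_elt (lam : detelt V W) : detelt B W := fun k l v w => lam k.+1 l (susp v) w.

Lemma susp_dim : \dim {:V} = (\dim {:B}).+1.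
Proof.
have := size_basis (X := susp (vbasis {:B})) (bA (vbasisP _)).
by [].
Qed.

Lemma susp_limg : limg D = limg Db.
Proof.
have b0 := vbasisP {:B}; have b1 := bA b0.
have -> : limg Db = <<map Db (vbasis {:B})>>%VS by rewrite -limg_span (span_basis b0).
rewrite -(span_basis b1) limg_span /= Dtau span_cons.
have -> : <[0 : W]>%VS = 0%VS by apply/eqP; rewrite -subv0; apply/subvP => x /vlineP[r ->]; rewrite scaler0 mem0v.
rewrite add0v -map_comp; congr (span _); apply: eq_map => u /=; exact: DA.
Qed.

Lemma susp_ker k (v : k.-tuple B) : basis_of (lker Db) v -> basis_of (lker D) (susp v).
Proof.
move=> bv; have [r [v2 b1]] := ext_basis (basis_free bv).
have b2 := bA (b := [tuple of v ++ v2]) b1.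
have fr : free (susp v).
  by move: (basis_free b2); rewrite /= map_cat -cat_cons => /catl_free.
rewrite basisEdim; apply/andP; split; last first.
  have := limg_ker_dim D fullv; have := limg_ker_dim Db fullv; rewrite !capfv susp_limg susp_dim => e1 e2.
  rewrite size_tuple -(size_basis bv); move: e1 e2; lia.
have sub : (<<susp v>> <= lker D)%VS.
  apply/span_subvP => x; rewrite inE => /orP[/eqP ->|/mapP[u uv ->]]; first by rewrite memv_ker Dtau.
  by rewrite memv_ker DA -memv_ker -(span_basis bv) memv_span.
suff -> : lker D = <<susp v>>%VS by exact: subvv.
apply/esym/eqP; rewrite eqEdim sub (eqP fr) size_tuple.
have := limg_ker_dim D fullv; have := limg_ker_dim Db fullv; rewrite !capfv susp_limg susp_dim => e1 e2.
rewrite -(size_basis bv); move: e1 e2; lia.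
Qed.

Lemma susp_chg k (T : 'M[R]_k) (v v' : k.-tuple B) : chg T v v' ->
  chg (block_mx (1%:M : 'M[R]_1) 0 0 T : 'M[R]_k.+1) (susp v) (susp v').
Proof.
move=> H; have H1 := chg_map A H.
have := @chg_cat R V 1 k 1%:M 0 0 T [tuple tau] [tuple tau] (map_tuple A v) (map_tuple A v').
have E (u : k.-tuple B) : [tuple of [tuple tau] ++ map_tuple A u] = susp u by exact: val_inj.
rewrite !E; apply=> i.
  by rewrite [X in _ = _ + X]big1 ?addr0 => [|j _]; [exact: chg1|rewrite mxE scale0r].
by rewrite [X in _ = X + _]big1 ?add0r => [|j _]; [exact: H1|rewrite mxE scale0r].
Qed.

Lemma susp_detelt lam : is_detelt 0 lam -> is_detelt 0 (susp_elt lam).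
Proof.
move=> lam0 k l v v' w w' P Q; rewrite lker0f !coker0 => bv bv' bw bw' HP HQ.
have cQ : chg Q w w'.
  move=> i; have := HQ i; have -> : limg (0 : 'Hom(B, W)) = 0%VS.
    by apply/eqP; rewrite -subv0; apply/subvP => _ /memv_imgP[x _ ->]; rewrite lfunE mem0v.
  by rewrite memv0 subr_eq0 => /eqP.
have uP := chg_unit bv bv' HP; have uQ := chg_unit bw bw' cQ.
have uP1 : (block_mx (1%:M : 'M[R]_1) 0 0 P : 'M[R]_k.+1) \in unitmx.
  exact: chg_unit (bA bv) (bA bv') (susp_chg HP).
have := detelt_chg lam0 (bA bv : basis_of fullv (susp v)) bw uP1 uQ (susp_chg HP) cQ.
by rewrite (@det_ublock _ 1 k) det1 mul1r.
Qed.

(** [D] kills [tau] and restricts to [Db] along [A], so prefixing [tau] turns a basis adapted to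
    [Db] into one adapted to [D]; the completing vectors and their images are the same on both
    sides. *)
Lemma susp_contraction lam sg bsg : Defs.is_contraction D lam sg -> is_detelt Db bsg ->
  (forall k l (v : k.-tuple B) (w : l.-tuple W), basis_of (lker Db) v -> coker_basis Db w ->
     sg k.+1 l (susp v) w = bsg k l v w) ->
  Defs.is_contraction Db (susp_elt lam) bsg.
Proof.
move=> [lam0 _ cE] b0 H; split=> //; first exact: susp_detelt.
move=> k l r v1 v2 w1 bv b1 b2.
have E1 : tau :: map A (v1 ++ v2) = (tau :: map A v1) ++ map A v2 by rewrite map_cat.
have E2 : map D (map A v2) = map Db v2 by rewrite -map_comp; apply: eq_map => u /=; exact: DA.
have cw : coker_basis Db w1 by apply: (cat_coker (u := map_tuple Db v2)) b2; exact: img_basis bv b1.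
have b3 := bA (b := [tuple of v1 ++ v2]) b1.
have b4 : basis_of fullv [tuple of susp v1 ++ map_tuple A v2] by move: b3; rewrite /= E1.
have b5 : basis_of fullv [tuple of w1 ++ map_tuple D (map_tuple A v2)] by move: b2; rewrite /= E2.
have H1 := cE _ _ _ (susp v1) (map_tuple A v2) w1 (susp_ker bv) b4 b5.
rewrite -(H k l v1 w1) // -H1 /susp_elt !sqE /=.
by rewrite E2 map_cat.
Qed.
End Suspension.

Section SuspensionCompare.
Variables (R : realType) (B V W : vectType R) (tau : V) (A : 'Hom(B, V)).
Hypothesis bA : forall k (b : k.-tuple B), basis_of fullv b -> basis_of fullv (tau :: map A b).
Variables (D D' : 'Hom(V, W)) (Db Db' : 'Hom(B, W)).
Hypotheses (Dtau : D tau = 0) (DA : forall u, D (A u) = Db u).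
Hypotheses (Dtau' : D' tau = 0) (DA' : forall u, D' (A u) = Db' u).
Hypothesis sb' : limg Db' = fullv.

(** [lamb] is given only through its contraction. By [contraction_unique] it agrees on bases with
    the suspension of [lam], and the claim becomes the compatibility of suspension with the
    perturbed contraction. *)
Lemma susp_compare lam sg c lamb bsg cb k (v : k.-tuple B) :
  Defs.is_contraction D lam sg -> Defs.is_contraction D' lam c ->
  Defs.is_contraction Db lamb bsg -> Defs.is_contraction Db' lamb cb ->
  (forall k l (v : k.-tuple B) (w : l.-tuple W), basis_of (lker Db) v -> coker_basis Db w ->
     sg k.+1 l (susp tau A v) w = bsg k l v w) ->
  basis_of (lker Db') v -> c k.+1 0%N (susp tau A v) [tuple] = cb k 0%N v [tuple].
Proof.
move=> con con' conb conb' H bv.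
have [_ b0 _] := conb.
have cons := susp_contraction bA Dtau DA con b0 H.
have [r [v2 b1]] := ext_basis (basis_free bv).
have bw := img_basis bv b1; rewrite sb' in bw.
have [_ _ cE] := con'; have [_ _ cbE] := conb'.
have E1 : tau :: map A (v ++ v2) = (tau :: map A v) ++ map A v2 by rewrite map_cat.
have E2 : map D' (map A v2) = map Db' v2 by rewrite -map_comp; apply: eq_map => u /=; exact: DA'.
have b3 := bA (b := [tuple of v ++ v2]) b1.
have b4 : basis_of fullv [tuple of susp tau A v ++ map_tuple A v2] by move: b3; rewrite /= E1.
have b5 : basis_of fullv [tuple of [tuple] ++ map_tuple D' (map_tuple A v2)] by move: bw; rewrite /= E2.
have H1 := cE _ _ _ (susp tau A v) (map_tuple A v2) [tuple] (susp_ker bA Dtau' DA' bv) b4 b5.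
have H2 := cbE _ _ _ v v2 [tuple] bv b1 bw.
have U := contraction_unique (v := [tuple of v ++ v2]) (w := map_tuple Db' v2) cons conb b1 bw.
rewrite -H1 -H2; move: U; rewrite /susp_elt !sqE /= => U.
by rewrite E2 -cat_cons -E1 -U.
Qed.
End SuspensionCompare.

Section ChartDifferentials.
Variable R : realType.

Lemma cyl_chart (B : mfd R) (x0 : B) t0 (q : cylinder B) (w : 'rV[R]_(1 + mdim B)) : charted B -> mdom x0 q.2 ->
  rdiff (mdom ((t0, x0) : cylinder B)) (mmap ((t0, x0) : cylinder B)) q w =
  row_mx (lsubmx w) (rdiff (mdom x0) (mmap x0) q.2 (rsubmx w)).
Proof.
move=> cB xq; have cC := cylinder_charted cB; have qq := mdom_refl cB q.2.
have [_ _ _ _ tr] := cB q.2; have [Q1 [k cr]] := tr x0 q.2 qq xq.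
have cr1 : coord_rep q.2 (mdom x0) (mmap x0) q.2 Q1 k.
  by have [? ? ? H] := cr; split=> // p xp qp Qp; exact: H.
have t1 : thickS (mdom x0) q.2 q.2 by apply: (thickS_nbhs cB qq); exact: mdom_nbhs.
have t2 : @thickS R (cylinder B) (mdom ((t0, x0) : cylinder B)) q q.
  by apply: (thickS_nbhs cC (mdom_refl cC q)); exact: (mdom_nbhs cC).
have [oQ1 Q1q sk Hk] := cr1.
pose Q' : set 'rV[R]_(1 + mdim B) := setT `&` (fun v => v *m col_mx 0 1%:M) @^-1` Q1.
have oQ' : open Q' by exact: (open_preim openT oQ1 (smooth_mulmxr _ openT)).
pose k1 (v : 'rV[R]_(1 + mdim B)) : 'rV[R]_1 := v *m col_mx 1%:M 0.
pose k2 := k \o (fun v : 'rV[R]_(1 + mdim B) => v *m col_mx 0 1%:M).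
have s1 : smooth_open Q' k1 by exact: smooth_mulmxr.
have s2 : smooth_open Q' k2.
  apply: (@smooth_comp _ _ _ _ _ _ Q1 (fun v => v *m col_mx 0 1%:M) k) => //; first by move=> x [].
  exact: smooth_mulmxr.
have E : mmap q q *m col_mx 0 1%:M = mmap q.2 q.2 by rewrite -rsubmx_mul cyl_mmapE row_mxKr.
have Q'q : Q' (mmap q q) by split=> //=; rewrite E.
have cr' : @coord_rep R (cylinder B) (1 + mdim B) q (mdom ((t0, x0) : cylinder B)) (mmap ((t0, x0) : cylinder B))
    q Q' (fun v => row_mx (k1 v) (k2 v)).
  split=> //; first exact: smooth_row_mx.
  move=> p [_ xp] [_ qp] [_]; rewrite /= /k1 /k2 /= -rsubmx_mul -lsubmx_mul !cyl_mmapE row_mxKr row_mxKl /= => Qp.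
  by rewrite Hk.
rewrite (rdiffP t2 cr') (jac_row_mx oQ' Q'q s1 s2) mul_mx_row.
rewrite /k1 jac_mulmxr -lsubmx_mul; congr row_mx.
rewrite /k2 jac_comp; last first.
- by rewrite E; exact: smooth_diff sk Q1q.
- exact: (smooth_diff (smooth_mulmxr _ openT)).
by rewrite jac_mulmxr E mulmxA -rsubmx_mul (rdiffP t1 cr1).
Qed.
End ChartDifferentials.

Section CollarSuspension.
Variables (R : realType) (B U : mfd R) (F : cylinder B -> U) (a : bool) (eps : R).
Let D : set (cylinder B) := collar_int a eps `*` setT.
Hypothesis cm : collar_map F a eps.

Definition col_dt (x : B) : tangent (F (a%:R, x)) :=
  mdiff D F ((a%:R, x) : cylinder B) (row_mx (const_mx 1 : 'rV[R]_1) 0).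

Definition col_slice (x : B) : 'Hom(tangent x, tangent (F (a%:R, x))) :=
  mdiff setT (fun y => F (a%:R, y)) x.

Lemma col_basis x k (b : k.-tuple (tangent x)) : basis_of fullv b ->
  basis_of fullv (col_dt x :: map (col_slice x) b).
Proof.
move=> bb; have := collar_basis cm x (collar_end a (cm_eps cm)) bb; rewrite -map_comp.
set s := map _ b; suff -> : s = map (col_slice x) b by [].
apply: eq_map => u; exact: (esym (slice_diff cm x u (collar_end a (cm_eps cm)))).
Qed.

End CollarSuspension.

(** [top_eval] for the basis formed by the collar vector and the slice images of a coordinate frame:
    in charts these are the rows of the Jacobian of the collar map at the end of the collar. *)
Lemma susp_smooth (R : realType) (E : vectType R) (B U : mfd R) (F : cylinder B -> U) (a : bool) (eps : R)
    (lam : forall p : U, detelt (tangent p) E) :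
  collar_map F a eps -> smooth_top lam ->
  smooth_top (fun x : B => susp_elt (col_dt F a eps x) (col_slice F a x) (lam (F (a%:R, x)))).
Proof.
(* As for contractions, [U] is taken apart so that its dimension becomes literally that of the
   cylinder. *)
case: U F lam => T m ch; set U := Mfd ch => F lam cm slam; have [lam0 _] := slam.
have cB := manifold_charted (cm_B cm); have cU := manifold_charted (cm_U cm).
have cC := cylinder_charted cB; have dm := cm_dim cm; rewrite /= in dm; subst m.
split; first by move=> x; apply: susp_detelt => // k b; exact: (col_basis cm).
move=> x0 l w bw; have El : \dim {:E} = l by rewrite (size_basis bw).
subst l.
exists (fun x => susp_elt (col_dt F a eps x) (col_slice F a x) (lam (F (a%:R, x))) (frame x0 x) w); last first.
  by move=> p v xp Hv; rewrite (frame_uniq cB xp Hv).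
move=> p0 xp; set u0 := F (a%:R, p0).
have Ia := collar_end a (cm_eps cm).
pose D : set (cylinder B) := collar_int a eps `*` setT.
pose D1 : set (cylinder B) := [set p | [/\ D p, mdom x0 p.2 & mdom u0 (F p)]].
pose ii (q : B) := F (a%:R, q).
pose S1 : set B := [set q | mdom x0 q /\ mdom u0 (ii q)].
have S1D q : S1 q -> D1 ((a%:R, q) : cylinder B) by move=> [h1 h2]; split.
have D1D : D1 `<=` D by move=> p [].
have S1p : S1 p0 by split=> //; exact: (mdom_refl cU).
have sii q : smooth_at setT ii q by exact: (slice_smooth cm q Ia).
have S1n q : S1 q -> nbhs q S1.
  move=> [xq uq].
  have [W nW HW] := within_near (sii q).1 (mdom_nbhs cU uq).
  by apply: filterS (filterI nW (mdom_nbhs cB xq)) => z [Wz xz]; split=> //; exact: HW.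
have th1 q : S1 q -> @thickS R (cylinder B) D1 (a%:R, q) (a%:R, q).
  move=> S1q; have [xq uq] := S1q.
  have [W nW HW] := within_near (collar_smooth cm (p := (a%:R, q)) (conj Ia Logic.I)).1 (mdom_nbhs cU uq).
  have n2 : nbhs ((a%:R, q) : cylinder B) (W `&` [set p | mdom x0 p.2]).
    apply: filterI => //; exists (setT, mdom x0); last by move=> [s y] [].
    by split; [exact: filterT|exact: mdom_nbhs].
  apply: (thickS_sub cC (mdom_refl cC ((a%:R, q) : cylinder B)) (collar_thick cm (p := (a%:R, q)) (conj Ia Logic.I)) n2).
  by move=> p [Dp [Wp xp']]; split=> //; exact: HW.
have sD1 q : S1 q -> smooth_at D1 F ((a%:R, q) : cylinder B).
  by move=> S1q; apply: (smooth_at_sub D1D); exact: (collar_smooth cm).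
have [Q [G cr0']] := smooth_at_charts cC cU (S1D p0 S1p) (sD1 p0 S1p) (x := ((a%:R, x0) : cylinder B)) (conj Logic.I xp) (mdom_refl cU u0).
have cr0 : @coord_rep R (cylinder B) _ (a%:R, x0) D1 (mmap u0 \o F) (a%:R, p0) Q G.
  by apply: crep_sub cr0' => q H; split=> //; case: H.
have [oQ Qp sG HG] := cr0.
pose e (y : 'rV[R]_(mdim B)) : 'rV[R]_(1 + mdim B) := row_mx (const_mx a%:R) y.
have se : smooth_open setT e.
  apply: smooth_row_mx; first exact: openT.
  - by move=> k; exact: Ck_cst.
  - exact: smooth_id.
pose Q1 : set 'rV[R]_(mdim B) := setT `&` e @^-1` Q.
have oQ1 : open Q1 by exact: (open_preim openT oQ se).
have se1 : smooth_open Q1 e by exact: smooth_sub se.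
have eE q : e (mmap x0 q) = mmap ((a%:R, x0) : cylinder B) (a%:R, q) by [].
pose Mat y : 'M[R]_(1 + mdim B) := jac G (e y).
have Q1Q y : Q1 y -> Q (e y) by case.
have sMat k i j : Ck k Q1 (fun y => Mat y i j).
  exact: (Ck_comp oQ1 oQ Q1Q (se1 k) (smooth_jac i j k oQ sG)).
have cr : coord_rep x0 S1 (mmap u0 \o ii) p0 Q1 (G \o e).
  split=> //; first exact: (smooth_comp oQ1 oQ Q1Q se1 sG).
  by move=> q S1q xq Qq; rewrite /= eE HG //; [exact: S1D|case: Qq].
pose X (q : B) : (1 + mdim B).-tuple (tangent (ii q)) :=
  [tuple of [tuple col_dt F a eps q] ++ map_tuple (col_slice F a q) (frame x0 q)].
have key q (v : 'rV[R]_(1 + mdim B)) : S1 q -> Q1 (mmap x0 q) ->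
    rdiff (mdom u0) (mmap u0) (ii q) (mdiff D F ((a%:R, q) : cylinder B) v) =
    row_mx (lsubmx v) (rdiff (mdom x0) (mmap x0) q (rsubmx v)) *m Mat (mmap x0 q).
  move=> S1q [_ Qq]; have [xq uq] := S1q.
  have e1 : (mdiff D F ((a%:R, q) : cylinder B) v : 'rV[R]_(mdim B).+1) = mdiff D1 F ((a%:R, q) : cylinder B) v.
    symmetry; apply: (mdiff_ext cC cU (th1 q S1q) (collar_thick cm (p := (a%:R, q)) (conj Ia Logic.I)) _
      (collar_smooth cm (p := (a%:R, q)) (conj Ia Logic.I))).
    by exists setT; [exact: filterT|move=> z _ /D1D].
  have crq : @coord_rep R (cylinder B) _ (a%:R, x0) D1 (mmap u0 \o F) (a%:R, q) Q G by [].
  have e2 := mdiff_chart cC cU (th1 q S1q) (sD1 q S1q) (x0 := ((a%:R, x0) : cylinder B)) (conj Logic.I xq)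
    (fun z Dz => let: And3 _ _ h := Dz in h) crq v.
  have e3 := cyl_chart (a%:R) (q := ((a%:R, q) : cylinder B)) v cB xq.
  exact (etrans (congr1 (rdiff (mdom u0) (mmap u0) (ii q)) e1) (etrans e2 (congr1 (mulmx^~ (Mat (mmap x0 q))) e3))).
have HX q : S1 q -> Q1 (mmap x0 q) ->
    forall i, rdiff (mdom u0) (mmap u0) (ii q) (tnth (X q) i) = row i (Mat (mmap x0 q)).
  move=> S1q Qq i; have [xq uq] := S1q.
  case: (split_ordP i) => j ->; rewrite ?tnth_lshift ?tnth_rshift.
    rewrite (tnth_nth 0) ord1 /= key // row_mxKl row_mxKr linear0 rowE; congr (_ *m _).
    apply/rowP => b; rewrite [RHS]mxE; case: (split_ordP b) => b' ->.
      by rewrite row_mxEl mxE !ord1 !eqxx.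
    by rewrite row_mxEr mxE.
  rewrite tnth_map (_ : col_slice F a q _ = mdiff D F ((a%:R, q) : cylinder B) (row_mx 0 (tnth (frame x0 q) j))).
    rewrite key // row_mxKl row_mxKr frame_delta // rowE; congr (_ *m _).
    apply/rowP => b; rewrite [RHS]mxE; case: (split_ordP b) => b' ->.
      by rewrite row_mxEl mxE eq_lrshift andbF.
    by rewrite row_mxEr mxE (inj_eq (@rshift_inj _ _)).
  exact: (slice_diff cm q _ Ia).
have bX q : S1 q -> basis_of fullv (X q).
  by move=> [xq uq]; apply: (col_basis cm (frame_basis cB xq)).
have Q1p : Q1 (mmap x0 p0) by split.
have det0 : \det (Mat (mmap x0 p0)) != 0.
  rewrite -unitfE -unitmxE; have [_ up] := S1p.
  exact: (chg_unit (frame_basis cU up) (bX p0 S1p) (chg_frame cU up (HX p0 S1p Q1p))).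
pose Bm (_ : 'rV[R]_(mdim B)) : 'M[R]_(\dim {:E}) := \matrix_i rv (tnth w i).
have [||||Q' [phi [oQ' Q'p sphi Hphi]]] := @top_eval R B U E lam S1 ii x0 p0 u0 Q1 (G \o e) Mat Bm X (fun _ => w) cB cU slam S1p _ _ cr sMat _ det0 HX.
- by move=> q [].
- by move=> q [].
- by move=> k i j; exact: Ck_cst.
- by move=> q _ _ _; split=> // i; rewrite rowK.
apply: (vsmooth_local cB (S' := S1)) (vsmooth_of_Ck cB xp oQ' Q'p sphi _); last first.
  move=> q S1q xq Qq; have [_ _ <-] := Hphi q S1q Qq.
  by rewrite /susp_elt !sqE.
by exists S1; [exact: S1n|move=> q S1q xq; split=> //; rewrite /susp_elt !sqE].
Qed.

(** The orientation condition and the chart come with different collar widths; the differential at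
    the end of the collar depends on neither. *)
Lemma collar_eps (R : realType) (B U : mfd R) (F : cylinder B -> U) (a : bool) (eps e : R) (x : B) (w : 'rV[R]_(1 + mdim B)) :
  collar_map F a eps -> 0 < e ->
  (mdiff (M := cylinder B) (collar_int a e `*` setT) F (a%:R, x) w : 'rV[R]_(mdim U)) =
  mdiff (M := cylinder B) (collar_int a eps `*` setT) F (a%:R, x) w.
Proof.
move=> cm e0; have cB := manifold_charted (cm_B cm); have cU := manifold_charted (cm_U cm).
have cC := cylinder_charted cB; have eps0 := cm_eps cm.
have Da (e' : R) : 0 < e' -> (collar_int a e' `*` [set: B]) (a%:R, x) by move=> ?; split=> //; exact: collar_end.
apply: (mdiff_ext cC cU (thick_collar (collar_end a e0) (thickM x cB)) (collar_thick cm (Da _ eps0)) _ (collar_smooth cm (Da _ eps0))).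
exists ([set s : R | `|a%:R - s| < eps] `*` setT).
  exists ([set s : R | `|a%:R - s| < eps], setT) => //; split; last exact: filterT.
  by apply/nbhs_ballP; exists eps => // s; rewrite -ball_normE.
move=> [s y] [/= ds _] [Is _]; split=> //; split=> //=.
move: Is ds; rewrite /collar_int; case: (a) => /= /andP[h1 h2].
  by rewrite ger0_norm ?subr_ge0 // => h3; apply/andP; split=> //; lra.
by rewrite ler0_norm ?subr_le0 // => h3; apply/andP; split=> //; lra.
Qed.

(** * The induced orientation of the boundary atlas *)

Section BoundaryOrientation.
Variables (R : realType) (Y : topologicalType) (N : nat) (d : int).
Variables (c : collared R Y) (K : kcob R Y N).
Hypothesis Hcob : is_cobordism c K d.
Hypothesis Htame : tame (cobK K).
Local Notation KK := (cobK K).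
Local Notation ba a := (bdy_atlas c K a).
Unset Implicit Arguments.
Variables (sigma : ksection KK) (bsigma : forall a, ksection (ba a)).
Set Implicit Arguments.
Hypothesis Hori : cob_orientation sigma bsigma.

Lemma susp_sigma a I (x : cobU K a I) eps k l (v : k.-tuple (tangent x)) (w : l.-tuple (kE KK I)) :
  kidx (ba a) I -> collar_map (@cobcol R Y N K a I) a eps ->
  basis_of (lker (kds (K := ba a) x)) v -> coker_basis (kds (K := ba a) x) w ->
  sigma I (cobincl x) k.+1 l (susp (col_dt (@cobcol R Y N K a I) a eps x) (col_slice (@cobcol R Y N K a I) a x) v) w =
  bsigma a I x k l v w.
Proof.
move=> ka cm bv bw; have [_ /(_ a I ka)[_ [e e0 H]]] := Hori.
have Ia := collar_end a e0.
have := H _ x Ia k l v w bv bw; rewrite !sqE => <-; rewrite /=.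
congr (sq _ _ _); congr (_ :: _).
  by rewrite /col_dt (collar_eps x _ cm e0).
apply: eq_map => u.
exact: (etrans (slice_diff cm x u (collar_end a (cm_eps cm))) (esym (collar_eps x _ cm e0))).
Qed.

Lemma col_kds a I (x : cobU K a I) eps : kidx (ba a) I -> collar_map (@cobcol R Y N K a I) a eps ->
  (forall t x, collar_int a eps t -> ks (@cobcol R Y N K a I (t, x)) = ks (cobincl x)) ->
  kds (cobincl x) (col_dt (@cobcol R Y N K a I) a eps x) = 0 /\
  forall u, kds (cobincl x) (col_slice (@cobcol R Y N K a I) a x u) = kds (K := ba a) x u.
Proof.
move=> ka cm Hs; have Ia := collar_end a (cm_eps cm); split.
  have := bdy_kds Hcob x (row_mx (const_mx 1 : 'rV[R]_1) 0) ka cm Hs Ia.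
  by rewrite row_mxKr linear0.
move=> u; have := bdy_kds Hcob x (row_mx (0 : 'rV[R]_1) (u : 'rV[R]_(mdim (cobU K a I)))) ka cm Hs Ia.
rewrite row_mxKr => <-.
exact (congr1 (kds (cobincl x)) (slice_diff cm x u Ia)).
Qed.

(** In the collars phi_IJ is the product of the identity with the boundary coordinate change, and
    the chain rule is applied to both factorisations on a common collar. *)
Lemma bdy_transition a I J (x : cobU K a I) eI eJ (w : 'rV[R]_(1 + mdim (cobU K a I))) :
  kidx (ba a) I -> kidx (ba a) J -> I \proper J ->
  collar_map (@cobcol R Y N K a I) a eI -> collar_map (@cobcol R Y N K a J) a eJ ->
  kdom KK I J (cobincl x) ->
  (mdiff (kdom KK I J) (kphi KK I J) (cobincl x)
    (mdiff (M := cylinder (cobU K a I)) (collar_int a eI `*` setT) (@cobcol R Y N K a I) (a%:R, x) w) : 'rV[R]_(mdim (kU KK J))) =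
  mdiff (M := cylinder (cobU K a J)) (collar_int a eJ `*` setT) (@cobcol R Y N K a J) (a%:R, cobphi J x)
    (row_mx (lsubmx w) (mdiff (kdom (ba a) I J) (@cobphi R Y N K a I J) x (rsubmx w))).
Proof.
move=> kaI kaJ IJ cmI cmJ dx.
have kI := bidx_idx kaI; have kJ := bidx_idx kaJ.
have [[[od _] [[sphi _ _] _] _ _ _] /(_ a)[/(_ kaJ)[ccb [e1 e10 H1]] _]] := cob_cc Hcob kI kJ IJ.
have [[odb _] [[sb _ _] _] _ _ _] := ccb.
have cBI := manifold_charted (cm_B cmI); have cBJ := manifold_charted (cm_B cmJ).
have cUI := manifold_charted (cm_U cmI); have cUJ := manifold_charted (cm_U cmJ).
have cCI := cylinder_charted cBI; have cCJ := cylinder_charted cBJ.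
pose e := Num.min e1 (Num.min eI eJ).
have e0 : 0 < e by rewrite !lt_min e10 (cm_eps cmI) (cm_eps cmJ).
have [l1 lI lJ] : [/\ e <= e1, e <= eI & e <= eJ] by split; rewrite /e !ge_min lexx ?orbT.
set db := kdom (ba a) I J.
pose D' : set (cylinder (cobU K a I)) := collar_int a e `*` db.
pose G (q : cylinder (cobU K a I)) : cylinder (cobU K a J) := (q.1, cobphi J q.2).
pose p : cylinder (cobU K a I) := (a%:R, x).
have Ia := collar_end a e0.
have nb : nbhs x db by exact: open_nbhs_nbhs.
have tb : thickS db x x by exact: (thickS_nbhs cBI (mdom_refl cBI x)).
have tD' : thickS D' p p by exact: thick_collar.
have D'I q : D' q -> (collar_int a eI `*` [set: cobU K a I]) q by move=> [h1 _]; split=> //; exact: collar_le h1.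
have pI : (collar_int a eI `*` [set: cobU K a I]) p by apply: D'I.
have pJ : (collar_int a eJ `*` [set: cobU K a J]) (G p) by split=> //; exact: collar_le Ia.
have tk : thickS (kdom KK I J) (cobincl x) (cobincl x).
  by apply: (thickS_nbhs cUI (mdom_refl cUI _)); exact: open_nbhs_nbhs.
have s1 := smooth_at_sub D'I (collar_smooth cmI pI).
have D'd q : D' q -> kdom KK I J (cobcol (k := K) q).
  by case: q => s y [/= Is dy]; have [h _ _] := H1 s (collar_le l1 Is); apply/(h y).2.
have E1 := mdiff_comp cCI cUI cUJ tD' tk D'd s1 (sphi _ dx).
have [sG EG] := cyl_map cBI cBJ (I := collar_int a e) (p := p) Ia dx tD' tb (sb x dx).
have D'J q : D' q -> (collar_int a eJ `*` [set: cobU K a J]) (G q) by move=> [h1 _]; split=> //; exact: collar_le h1.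
have E2 := mdiff_comp cCI cCJ cUJ tD' (collar_thick cmJ pJ) D'J sG (collar_smooth cmJ pJ).
have E3 : (mdiff D' (kphi KK I J \o @cobcol R Y N K a I) p w : 'rV[R]_(mdim (kU KK J))) =
    mdiff D' (@cobcol R Y N K a J \o G) p w.
  apply: (mdiff_ext cCI cUJ tD' tD').
    exists setT; first exact: filterT.
    by move=> [s y] _ [/= Is dy]; split=> //; have [_ h _] := H1 s (collar_le l1 Is); exact: h.
  exact: (smooth_at_comp cCI cCJ cUJ _ D'J sG (collar_smooth cmJ pJ)).
have F1 := congr1 (fun L : 'Hom(_, _) => L w) E1; have F2 := congr1 (fun L : 'Hom(_, _) => L w) E2.
rewrite /= !comp_lfunE in F1 F2.
have E4 : mdiff D' (@cobcol R Y N K a I) p w = mdiff (M := cylinder (cobU K a I)) (collar_int a eI `*` setT) (@cobcol R Y N K a I) p w :> 'rV[R]_(mdim (kU KK I)).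
  apply: (mdiff_ext cCI cUI tD' (collar_thick cmI pI) _ (collar_smooth cmI pI)).
  by exists setT; [exact: filterT|move=> q _ /D'I].
exact (etrans (congr1 (mdiff (kdom KK I J) (kphi KK I J) (cobincl x)) (esym E4))
  (etrans (esym F1) (etrans E3 (etrans F2 (congr1 (mdiff (M := cylinder (cobU K a J)) (collar_int a eJ `*` setT) (@cobcol R Y N K a J) (G p)) (EG w)))))).
Qed.

(** All properties of [bsigma] are those of [sigma] read through suspension. Compatibility uses that
    phi_IJ maps the collar vector to the collar vector and acts on slice vectors by the boundary
    coordinate change, as shown by [bdy_transition]. *)
Lemma bdy_orientation a : orientation (bsigma a).
Proof.
have [[Hs Hc] Hb] := Hori.
split=> [I ka|I J kaI kaJ IJ x dx k l v w bv bw].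
  have kI := bidx_idx ka; have [[lam slam con] nz] := Hs I kI.
  have [eps [cm Hks]] := cob_collar Hcob ka; have [b0 _] := Hb a I ka.
  split.
    exists (fun x : cobU K a I => susp_elt (col_dt (@cobcol R Y N K a I) a eps x)
      (col_slice (@cobcol R Y N K a I) a x) (lam (cobincl x))).
      exact: (susp_smooth cm slam).
    move=> x; have [Dt DA] := col_kds x ka cm Hks.
    apply: (susp_contraction (D := kds (cobincl x)) (sg := sigma I (cobincl x)) _ Dt DA (con _) (b0 x)).
      by move=> k b; exact: (col_basis cm).
    by move=> k l v w bv bw; exact: susp_sigma.
  move=> x k l v w bv bw; rewrite -(susp_sigma ka cm bv bw); have [Dt DA] := col_kds x ka cm Hks.
  have bA k' b := @col_basis _ _ _ _ _ _ cm x k' b.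
  apply: nz; first exact: (susp_ker bA Dt DA bv).
  by rewrite /coker_basis (susp_limg bA Dt DA).
have kI := bidx_idx kaI; have kJ := bidx_idx kaJ.
have [eI [cmI HI]] := cob_collar Hcob kaI; have [eJ [cmJ HJ]] := cob_collar Hcob kaJ.
have [[_ _] [[_ _ lkb] lh] _ _ ix] := bdy_cc Hcob kaI kaJ IJ.
have [ixk ixc] := ix x dx.
have [_ Ep] := bdy_push Hcob kaI kJ IJ dx.
have bv' : basis_of (lker (kds (K := ba a) (kphi (ba a) I J x))) (map_tuple (mdiff (kdom (ba a) I J) (kphi (ba a) I J) x) v).
  by rewrite -ixk; apply: map_basis bv; exact: lkb.
have bw' : coker_basis (kds (K := ba a) (kphi (ba a) I J x)) (map_tuple (khat (ba a) I J) w).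
  have /and3P[fw /eqP sw /eqP cw] := bw; have [s1 s2] := ixc _ sw cw.
  have bs : basis_of <<w>>%VS w by rewrite basisEfree fw subvv /= (eqP fw) leqnn.
  have bk := map_basis lh bs.
  by rewrite /coker_basis /= (basis_free bk) (span_basis bk) s1 s2 !eqxx.
rewrite -(susp_sigma kaI cmI bv bw) -(susp_sigma kaJ cmJ bv' bw').
have [DtI DAI] := col_kds x kaI cmI HI.
have bAI k' b := @col_basis _ _ _ _ _ _ cmI x k' b.
have bs1 := susp_ker bAI DtI DAI bv.
have bs2 : coker_basis (kds (cobincl x)) w by rewrite /coker_basis (susp_limg bAI DtI DAI).
rewrite -(Hc I J kI kJ IJ (cobincl x) dx _ _ _ _ bs1 bs2).
have tr := fun w0 => bdy_transition w0 kaI kaJ IJ cmI cmJ dx.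
set t1 := susp _ _ _; set t2 := map_tuple (mdiff (kdom KK I J) _ _) _.
have Et : (t1 : seq 'rV[R]_(mdim (kU KK J))) = t2.
  rewrite /=; congr (_ :: _).
    by rewrite /col_dt tr row_mxKl row_mxKr linear0.
  rewrite -!map_comp; apply: eq_map => u /=.
  have E1 : (col_slice (@cobcol R Y N K a I) a x u : 'rV[R]_(mdim (kU KK I))) = _ := slice_diff cmI x u (collar_end a (cm_eps cmI)).
  have E2 := congr1 (mdiff (kdom KK I J) (kphi KK I J) (cobincl x)) E1.
  have E3 := tr (row_mx 0 (u : 'rV[R]_(mdim (cobU K a I)))); rewrite row_mxKl row_mxKr in E3.
  have E4 := slice_diff cmJ (cobphi J x) (mdiff (kdom (ba a) I J) (@cobphi R Y N K a I J) x u) (collar_end a (cm_eps cmJ)).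
  exact (etrans E4 (esym (etrans E2 E3))).
have Et' : (t1 : k.+1.-tuple 'rV[R]_(mdim (kU KK J))) = t2 by exact: val_inj.
have P : forall (p p' : kU KK J) (b b' : k.+1.-tuple 'rV[R]_(mdim (kU KK J))), p = p' -> b = b' ->
    sigma J p k.+1 l b (map_tuple (khat KK I J) w) = sigma J p' k.+1 l b' (map_tuple (khat KK I J) w).
  by move=> p p' b b' -> ->.
exact: (P _ _ _ _ (esym Ep) Et').
Qed.
End BoundaryOrientation.

Lemma compact_homeo (S T : topologicalType) (f : S -> T) : compact [set: S] -> hausdorff_space T ->
  continuous f -> injective f -> homeo_onto setT (range f) f.
Proof.
move=> cS hT cf inj; split.
- by split; [move=> x _; exists x|move=> x y _ _; exact: inj|].
- by apply: continuous_subspaceT.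
move=> O oO; exists (~` (f @` (~` O))).
  apply: closed_openC; apply: compact_closed => //; apply: continuous_compact.
    by apply: continuous_subspaceT.
  by apply: (subclosed_compact _ cS) => //; exact: open_closedC.
apply/seteqP; split=> [y [x [_ Ox] <-]|y [[x _ <-] H]].
  by split; [exists x|move=> [x' nO /inj E]; apply: nO; rewrite E].
by exists x => //; split=> //; apply: contrapT => nO; apply: H; exists x.
Qed.

(** * The boundary of the zero set of a cobordism *)

Section BoundaryInclusion.
Variables (R : realType) (Y : topologicalType) (N : nat) (d : int).
Variables (c : collared R Y) (K : kcob R Y N).
Local Notation KK := (cobK K).
Local Notation ba a := (bdy_atlas c K a).
Unset Implicit Arguments.
Variables (V : forall I, set (kU KK I)) (nu : forall I, kU KK I -> kE KK I).
Set Implicit Arguments.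
Hypothesis Hcob : is_cobordism c K d.
Hypothesis red : is_cob_reduction c V.
Hypothesis pert : is_cob_perturbation c V nu.
Local Notation bV a := (bdy_red c V a).
Local Notation bnu a := (bdy_pert c nu a).
Implicit Types I J L : {set 'I_N}.

Variable n : nat.
Hypothesis cd : core_data V nu n.

Definition zb a I (x : set_type (kZ (bV a) (bnu a) I)) : set_type (kZ V nu I) :=
  zp (proj2 (bZ_Z (zP x))).

Lemma zb_val a I (x : set_type (kZ (bV a) (bnu a) I)) : val (zb x) = cobincl (val x).
Proof. by []. Qed.

Lemma zb_bidx a I (x : set_type (kZ (bV a) (bnu a) I)) : kidx (ba a) I.
Proof. exact: (proj1 (bZ_Z (zP x))). Qed.

(** The boundary inclusion of zero sets, defined at a chosen representative; [zjump_zproj] shows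
    that any other gives the same point. *)
Definition zjump a (q : zset (bV a) (bnu a)) : zset V nu :=
  zproj (zb (projT2 (projT1 (cid (zproj_surj q))))).

Section End.
Variables (a : bool) (m : nat).
Hypothesis cdb : core_data (bV a) (bnu a) m.

Lemma zb_link I J (x : set_type (kZ (bV a) (bnu a) I)) (y : set_type (kZ (bV a) (bnu a) J)) :
  zlink x y <-> zlink (zb x) (zb y).
Proof.
have kI := zb_bidx x; have kJ := zb_bidx y.
have kI' := bidx_idx kI; have kJ' := bidx_idx kJ.
split=> -[IJ dx Ex]; split=> //; have [EIJ|pIJ] := proper_or_eq IJ.
- move: Ex dx; subst J; rewrite (kphiII cdb) // => Ex _.
  by rewrite (kphiII cd) // !zb_val Ex.
- by have [_ E] := bdy_push Hcob kI kJ' pIJ dx; rewrite !zb_val -Ex E.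
- move: Ex dx; subst J; rewrite (kphiII cd) // !zb_val => Ex _.
  by rewrite (kphiII cdb) //; exact: (cobincl_inj Hcob kI).
have [_ E] := bdy_push Hcob kI kJ' pIJ dx.
by apply: (cobincl_inj Hcob kJ); rewrite -[LHS]E.
Qed.

Lemma zjump_zproj I (x : set_type (kZ (bV a) (bnu a) I)) : zjump (zproj x) = zproj (zb x).
Proof.
rewrite /zjump; case: cid => -[J y] /= E.
have [/zb_link L|/zb_link L] := zproj_eq cdb E; [|symmetry]; exact: (zlink_proj cd L).
Qed.

Lemma zjump_inj : injective (@zjump a).
Proof.
move=> q q'; have [[I x] <-] := zproj_surj q; have [[J y] <-] := zproj_surj q'.
rewrite !zjump_zproj /= => /(zproj_eq cd)[/zb_link L|/zb_link L]; [|symmetry]; exact: (zlink_proj cdb L).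
Qed.

Variable A : charts R n (zset V nu).
Variable AI : forall I, charts R n (set_type (kZ V nu I)).
Hypothesis zA : zero_structure A AI.
Variable B : charts R m (zset (bV a) (bnu a)).
Variable BI : forall I, charts R m (set_type (kZ (bV a) (bnu a) I)).
Hypothesis zB : zero_structure B BI.

Let mA : is_manifold (Mfd A). Proof. by case: zA. Qed.
Let mAI I : is_manifold (Mfd (AI I)). Proof. by have [_ H] := zA; have [] := H I. Qed.
Let eAI I : embedding setT (@zincl R Y N KK V nu n I (AI I)).
Proof. by have [_ H] := zA; have [] := H I. Qed.
Let mB : is_manifold (Mfd B). Proof. by case: zB. Qed.
Let mBI I : is_manifold (Mfd (BI I)). Proof. by have [_ H] := zB; have [] := H I. Qed.
Let eBI I : embedding setT (@zincl R Y N (ba a) (bV a) (bnu a) m I (BI I)).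
Proof. by have [_ H] := zB; have [] := H I. Qed.
Let cMA := manifold_charted mA.
Let cMAI I := manifold_charted (@mAI I).
Let cMB := manifold_charted mB.
Let cMBI I := manifold_charted (@mBI I).

Definition zjmap : Mfd B -> Mfd A := @zjump a.
Definition zbmap I : Mfd (BI I) -> Mfd (AI I) := @zb a I.

Lemma zbmap_comp_smooth I (x : Mfd (BI I)) : smooth_at setT (@zincl R Y N KK V nu n I (AI I) \o @zbmap I) x.
Proof.
have kI := zb_bidx x; have kI' := bidx_idx kI.
have cU := manifold_charted (cd_man cd kI').
have cb : charted (cobU K a I) := manifold_charted (cd_man cdb kI).
exact: (@smooth_at_comp _ (Mfd (BI I)) (cobU K a I) (kU KK I) setT setT (@zincl R Y N (ba a) (bV a) (bnu a) m I (BI I))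
  (@cobincl R Y N K a I) x (@cMBI I) cb cU Logic.I (fun _ _ => Logic.I) (zincl_smooth eBI x) (cobincl_smooth Hcob (val x) kI)).
Qed.

Lemma zbmap_smooth I (x : Mfd (BI I)) : smooth_at setT (@zbmap I) x.
Proof. exact: (zlift cd mAI eAI (@cMBI I) Logic.I (@zbmap_comp_smooth I x)). Qed.

Lemma zbmap_diff I (x : Mfd (BI I)) (w : 'rV[R]_m) :
  (mdiff setT (@zincl R Y N KK V nu n I (AI I)) (zbmap x) (mdiff setT (@zbmap I) x w) : 'rV[R]_(mdim (kU KK I))) =
  mdiff setT (@cobincl R Y N K a I) (val x) (mdiff setT (@zincl R Y N (ba a) (bV a) (bnu a) m I (BI I)) x w).
Proof.
have kI := zb_bidx x; have kI' := bidx_idx kI.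
have cU := manifold_charted (cd_man cd kI').
have cb : charted (cobU K a I) := manifold_charted (cd_man cdb kI).
have E1 := mdiff_comp (@cMBI I) (@cMAI I) cU (thickM x (@cMBI I)) (thickM (zbmap x) (@cMAI I)) (fun _ _ => Logic.I)
  (zbmap_smooth x) (zincl_smooth eAI (zbmap x)).
have E2 := @mdiff_comp _ (Mfd (BI I)) (cobU K a I) (kU KK I) setT setT (@zincl R Y N (ba a) (bV a) (bnu a) m I (BI I))
  (@cobincl R Y N K a I) x (@cMBI I) cb cU (thickM x (@cMBI I)) (thickM (val x : cobU K a I) cb)
  (fun _ _ => Logic.I) (zincl_smooth eBI x) (cobincl_smooth Hcob (val x) kI).
have F1 := congr1 (fun L : 'Hom(_, _) => L w) E1; have F2 := congr1 (fun L : 'Hom(_, _) => L w) E2.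
rewrite /= !comp_lfunE in F1 F2.
exact (etrans (esym F1) F2).
Qed.

Lemma zbmap_lker I (x : Mfd (BI I)) : lker (mdiff setT (@zbmap I) x) = 0%VS.
Proof.
have kI := zb_bidx x.
apply: lker0_intro => w w0; have E := zbmap_diff x w.
have z : mdiff setT (@cobincl R Y N K a I) (val x) (mdiff setT (@zincl R Y N (ba a) (bV a) (bnu a) m I (BI I)) x w) = 0.
  exact (etrans (esym E) (etrans (congr1 (mdiff setT (@zincl R Y N KK V nu n I (AI I)) (zbmap x)) w0) (linear0 _))).
have z1 := lker0_inj (cobincl_lker Hcob (val x) kI) z.
by have [_ _ lk] := eBI I; exact: lker0_inj (lk x Logic.I) z1.
Qed.

Lemma zjmap_smooth (q : Mfd B) : smooth_at setT zjmap q.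
Proof.
have [[I x] Eq] := zproj_surj q; rewrite -Eq /=.
have [_ H] := zB; have [_ _ oR df] := H I.
have [|g [gK _ _ sg]] := diffeo_inverse df; first by exists x.
have si : smooth_on setT (@zquot R Y N KK V nu n A I (AI I) \o @zbmap I).
  move=> y _; exact: (smooth_at_comp (@cMBI I) (@cMAI I) cMA Logic.I (fun _ _ => Logic.I) (zbmap_smooth y) (zquot_smooth zA (zbmap y))).
have gK' y : g (zquot B (y : Mfd (BI I))) = y by exact: gK.
have [s _] := lift_inverse (@cMBI I) cMB cMA oR (fun y _ => zquot_smooth zB y) si sg gK'.
have Rx : range (@zquot R Y N (ba a) (bV a) (bnu a) m B I (BI I)) (zproj x) by exists x.
apply: (smooth_at_local cMB cMA Logic.I _ (s _ Rx)).
exists (range (@zquot R Y N (ba a) (bV a) (bnu a) m B I (BI I))); first exact: open_nbhs_nbhs.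
move=> _ [y _ <-] _; split; first by exists y.
by rewrite /= gK'; exact: zjump_zproj.
Qed.

Lemma zjmap_diff I (x : Mfd (BI I)) (w : 'rV[R]_m) :
  (mdiff setT zjmap (zquot B x) (mdiff setT (@zquot R Y N (ba a) (bV a) (bnu a) m B I (BI I)) x w) : 'rV[R]_n) =
  mdiff setT (@zquot R Y N KK V nu n A I (AI I)) (zbmap x) (mdiff setT (@zbmap I) x w).
Proof.
have E1 := mdiff_comp (@cMBI I) (@cMAI I) cMA (thickM x (@cMBI I)) (thickM (zbmap x) (@cMAI I)) (fun _ _ => Logic.I)
  (zbmap_smooth x) (zquot_smooth zA (zbmap x)).
have E2 := mdiff_comp (@cMBI I) cMB cMA (thickM x (@cMBI I)) (thickM (zquot B x : Mfd B) cMB) (fun _ _ => Logic.I)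
  (zquot_smooth zB x) (zjmap_smooth (zquot B x)).
have s : smooth_at setT (@zquot R Y N KK V nu n A I (AI I) \o @zbmap I) x.
  exact: (smooth_at_comp (@cMBI I) (@cMAI I) cMA Logic.I (fun _ _ => Logic.I) (zbmap_smooth x) (zquot_smooth zA (zbmap x))).
have E3 : (mdiff setT (zjmap \o @zquot R Y N (ba a) (bV a) (bnu a) m B I (BI I)) x w : 'rV[R]_n) =
    mdiff setT (@zquot R Y N KK V nu n A I (AI I) \o @zbmap I) x w.
  apply: (mdiff_ext (@cMBI I) cMA (thickM x (@cMBI I)) (thickM x (@cMBI I)) _ s).
  by exists setT; [exact: filterT|move=> y _ _; split=> //; exact: zjump_zproj].
have F1 := congr1 (fun L : 'Hom(_, _) => L w) E1; have F2 := congr1 (fun L : 'Hom(_, _) => L w) E2.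
rewrite /= !comp_lfunE in F1 F2.
exact (etrans (esym F2) (etrans E3 F1)).
Qed.

Lemma zjmap_lker (q : Mfd B) : lker (mdiff setT zjmap q) = 0%VS.
Proof.
have [[I x] Eq] := zproj_surj q; rewrite -Eq /=.
pose X : Mfd (BI I) := x.
have [dK _ _] := hom_bij (dquot_lker mBI zB X).
apply: lker0_intro => v v0.
pose w : 'rV[R]_m := ((mdiff setT (@zquot R Y N (ba a) (bV a) (bnu a) m B I (BI I)) X)^-1)%VF v.
have Ev : mdiff setT (@zquot R Y N (ba a) (bV a) (bnu a) m B I (BI I)) X w = v := dK v.
have E := zjmap_diff X w.
have z : mdiff setT (@zquot R Y N KK V nu n A I (AI I)) (zbmap X) (mdiff setT (@zbmap I) X w) = 0.
  exact (etrans (esym E) (etrans (congr1 (mdiff setT zjmap (zquot B X)) Ev) v0)).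
have z1 := lker0_inj (zbmap_lker X) (lker0_inj (dquot_lker mAI zA (zbmap X)) z).
exact (etrans (esym Ev) (etrans (congr1 (mdiff setT (@zquot R Y N (ba a) (bV a) (bnu a) m B I (BI I)) X) z1) (linear0 _))).
Qed.

(** The boundary zero set is compact and |Z| is Hausdorff, so a continuous injection is a
    homeomorphism onto its image. *)
Lemma zjmap_embedding : embedding setT zjmap.
Proof.
split; first by move=> q _; exact: zjmap_smooth.
  apply: compact_homeo; first exact: (zset_compact cdb).
  - by case: mA.
  - by move=> q; have [h _] := zjmap_smooth q; move=> W /((cvg_withinP _ _ _ _).1 h W); apply: filterS => z /(_ Logic.I).
  - exact: zjump_inj.
by move=> q _; exact: zjmap_lker.
Qed.

(** Inward conormals at a boundary zero in U_I and in |Z| are compared by [bdry_coord], applied to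
    the local inverse of the quotient map followed by the inclusion. This transfers the sign of the
    collar vector to |Z|. *)
Lemma zquot_coord I (z : Mfd (AI I)) (i0 : 'I_n) (j0 : 'I_(mdim (kU KK I))) :
  mboundary (Mfd A) (zproj z) -> mboundary (kU KK I) (val z) -> i0 = 0%N :> nat -> j0 = 0%N :> nat ->
  exists2 r : R, 0 <= r & forall w : 'rV[R]_n,
    (mdiff setT (@zincl R Y N KK V nu n I (AI I)) z w : 'rV[R]_(mdim (kU KK I))) ord0 j0 =
    r * (mdiff setT (@zquot R Y N KK V nu n A I (AI I)) z w : 'rV[R]_n) ord0 i0.
Proof.
move=> bA bU i00 j00; have kI := zidx z; have mU := cd_man cd kI.
have [_ H] := zA; have [_ _ oR df] := H I.
have [|g [gK _ _ sg]] := diffeo_inverse df; first by exists z.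
have gK' y : g (zquot A (y : Mfd (AI I))) = y by exact: gK.
have [si HP] := lift_inverse (@cMAI I) cMA (manifold_charted mU) oR (fun y _ => zquot_smooth zA y)
  (fun y _ => zincl_smooth eAI y) sg gK'.
have Rz : range (@zquot R Y N KK V nu n A I (AI I)) (zquot A z) by exists z.
have nR := zrange_nbhs zA z.
have bU' : mboundary (kU KK I) ((@zincl R Y N KK V nu n I (AI I) \o g) (zquot A z)) by rewrite /= gK'.
have [r r0 Hr] := bdry_coord mA mU nR (si _ Rz) bA bU' i00 j00.
exists r; first exact: r0.
move=> w; have [P [_ P1 P2]] := HP _ Rz.
set v : 'rV[R]_n := mdiff setT (@zquot R Y N KK V nu n A I (AI I)) z w.
have Ew : P v = w.
  apply: (elimT lker0P (introT eqP (dquot_lker mAI zA z))).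
  exact (etrans (mdiff_point setT (@zquot R Y N KK V nu n A I (AI I)) (P v) (esym (gK' z))) (P2 v)).
rewrite -Hr; congr (fun_of_matrix _ ord0 j0).
exact (etrans (congr1 (mdiff setT (@zincl R Y N KK V nu n I (AI I)) z) (esym Ew))
  (etrans (mdiff_point setT (@zincl R Y N KK V nu n I (AI I)) (P v) (esym (gK' z))) (esym (P1 v)))).
Qed.
End End.
End BoundaryInclusion.

Lemma preimage_basis (R : realType) (V W : vectType R) (f : 'Hom(V, W)) (s : seq V) :
  lker f = 0%VS -> basis_of (limg f) (map f s) -> basis_of fullv s.
Proof.
move=> f0 bs; have k0 : lker f == 0%VS by rewrite f0.
rewrite basisEdim -(limg_ker0 _ _ k0) limg_span (span_basis bs) subvv /=.
by have := size_basis (X := in_tuple (map f s)) bs; rewrite limg_dim_eq ?f0 ?capv0 // size_map => <-.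
Qed.

(* Coefficients are dual to vectors, so scaling the vector divides the coefficient. *)
Lemma detelt_replace (R : realType) (U : vectType R) (om : detelt U 'rV[R]_0) k (x v : U) (b : k.-tuple U) (r : R) (mu : 'I_k -> R) :
  is_detelt 0 om -> basis_of fullv (x :: b) -> v = r *: x + \sum_i mu i *: tnth b i -> r != 0 ->
  r * om k.+1 0%N [tuple of v :: b] [tuple] = om k.+1 0%N [tuple of x :: b] [tuple].
Proof.
move=> o0 bx Ev r0; pose T := block_mx (r%:M : 'M[R]_1) (\row_j mu j) 0 (1%:M : 'M[R]_k).
have E (u : U) : [tuple of [tuple u] ++ b] = [tuple of u :: b] by exact: val_inj.
have cT : chg (T : 'M[R]_k.+1) [tuple of x :: b] [tuple of v :: b].
  rewrite -!E; apply: (@chg_cat R U 1 k) => i.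
    rewrite ord1 [LHS](tnth_nth 0) [LHS]Ev; congr (_ + _); first by rewrite big_ord1 mxE mulr1n [tnth _ _](tnth_nth 0).
    by apply: eq_bigr => j _; rewrite mxE.
  by rewrite [X in _ = X + _]big1 ?add0r => [|j _]; [exact: chg1|rewrite mxE scale0r].
have dT : \det T = r by rewrite (@det_ublock _ 1 k) det_scalar1 det1 mulr1.
have uT : T \in unitmx by rewrite unitmxE dT unitfE.
have b0 : basis_of (fullv : {vspace 'rV[R]_0}) [tuple].
  rewrite basisEdim dimvf /= dim_matrix mulr0 leqnn andbT.
  by apply/subvP => y _; have -> : y = 0 by [apply/rowP; case]; exact: mem0v.
have := detelt_chg (P := (T : 'M[R]_k.+1)) (Q := 1%:M) o0 bx b0 uT (unitmx1 _ _) cT (chg1 _).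
by rewrite det1 mul1r => <-; rewrite dT.
Qed.

(** * Signs of the boundary orientations *)

Section BoundarySigns.
Variables (R : realType) (Y : topologicalType) (N : nat) (d : int).
Variables (c : collared R Y) (K : kcob R Y N).
Local Notation KK := (cobK K).
Local Notation ba a := (bdy_atlas c K a).
Unset Implicit Arguments.
Variables (V : forall I, set (kU KK I)) (nu : forall I, kU KK I -> kE KK I).
Variables (sigma : ksection KK) (bsigma : forall a, ksection (ba a)).
Set Implicit Arguments.
Hypothesis Hcob : is_cobordism c K d.
Hypothesis red : is_cob_reduction c V.
Hypothesis pert : is_cob_perturbation c V nu.
Hypothesis Hori : cob_orientation sigma bsigma.
Local Notation bV a := (bdy_red c V a).
Local Notation bnu a := (bdy_pert c nu a).
Implicit Types I J L : {set 'I_N}.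
Variables (n m : nat) (a : bool).
Hypothesis cd : core_data V nu n.
Hypothesis cdb : core_data (bV a) (bnu a) m.
Variable A : charts R n (zset V nu).
Variable AI : forall I, charts R n (set_type (kZ V nu I)).
Hypothesis zA : zero_structure A AI.
Hypothesis bdA : forall I (z : set_type (kZ V nu I)), mboundary (Mfd A) (zproj z) <-> mboundary (kU KK I) (val z).
Variable B : charts R m (zset (bV a) (bnu a)).
Variable BI : forall I, charts R m (set_type (kZ (bV a) (bnu a) I)).
Hypothesis zB : zero_structure B BI.
Unset Implicit Arguments.
Variables (o : forall q : Mfd A, detelt (tangent q) 'rV[R]_0) (ob : forall q : Mfd B, detelt (tangent q) 'rV[R]_0).
Set Implicit Arguments.
Hypothesis oA : zero_orientation sigma AI o.
Hypothesis oB : zero_orientation (bsigma a) BI ob.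

Let mA : is_manifold (Mfd A). Proof. by case: zA. Qed.
Let mAI I : is_manifold (Mfd (AI I)). Proof. by have [_ H] := zA; have [] := H I. Qed.
Let eAI I : embedding setT (@zincl R Y N KK V nu n I (AI I)).
Proof. by have [_ H] := zA; have [] := H I. Qed.
Let mB : is_manifold (Mfd B). Proof. by case: zB. Qed.
Let mBI I : is_manifold (Mfd (BI I)). Proof. by have [_ H] := zB; have [] := H I. Qed.
Let eBI I : embedding setT (@zincl R Y N (ba a) (bV a) (bnu a) m I (BI I)).
Proof. by have [_ H] := zB; have [] := H I. Qed.

Let din I (z : Mfd (AI I)) := mdiff setT (@zincl R Y N KK V nu n I (AI I)) z.
Let dqu I (z : Mfd (AI I)) := mdiff setT (@zquot R Y N KK V nu n A I (AI I)) z.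
Let dib I (x : Mfd (BI I)) := mdiff setT (@zincl R Y N (ba a) (bV a) (bnu a) m I (BI I)) x.
Let dqb I (x : Mfd (BI I)) := mdiff setT (@zquot R Y N (ba a) (bV a) (bnu a) m B I (BI I)) x.
Let zbm I : Mfd (BI I) -> Mfd (AI I) := @zb R Y N c K V nu a I.
Let dzb I (x : Mfd (BI I)) := mdiff setT (@zbm I) x.

Lemma zjump_mboundary (q : Mfd B) : mboundary (Mfd A) (@zjump R Y N c K V nu a q).
Proof.
have [[I x] <-] := zproj_surj q; rewrite (zjump_zproj Hcob cd cdb).
exact ((bdA (zb x)).2 (@bdy_bdry _ _ _ _ _ _ Hcob a I (val x) (zb_bidx x))).
Qed.

Lemma din_limg I (z : Mfd (AI I)) : limg (din z) = lker (kdsnu V nu (zincl z)).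
Proof.
have := dincl_basis cd mAI eAI (z := z) (vbasisP fullv); rewrite /din => /span_basis <-.
by rewrite -limg_span (span_basis (vbasisP fullv)).
Qed.

(* [s] is the collar vector, seen in the tangent space of the zero set. *)
Lemma conormal_lift I (x : Mfd (BI I)) : exists s : 'rV[R]_n,
  (forall i0 : 'I_n, i0 = 0%N :> nat -> 0 < collar_dir R a * (dqu (zbm x) s : 'rV[R]_n) ord0 i0) /\
  forall k (u : k.-tuple (tangent x)), basis_of fullv u ->
    basis_of fullv (s :: map (dzb x) u) /\
    o (zquot A (zbm x)) k.+1 0%N [tuple of dqu (zbm x) s :: map_tuple (dqu (zbm x)) (map_tuple (dzb x) u)] [tuple] =
    ob (zquot B x) k 0%N (map_tuple (dqb x) u) [tuple].
Proof.
have kI := zb_bidx x; have kI' := bidx_idx kI.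
have [eps [cm Hks]] := cob_collar Hcob kI.
have [_ Zx] := bZ_Z (zP x); have [_ Vx _] := Zx.
have [eps' [e [cm' /andP[e0 _] H]]] := bdy_ext Hcob red pert kI Vx.
pose F := @cobcol R Y N K a I.
set y : cobU K a I := val x.
pose tau := col_dt F a eps y; pose Ac := col_slice F a y.
have [Dt DA] := col_kds Hcob y kI cm Hks.
have Dt' : kdsnu V nu (cobincl y) tau = 0.
  have [_ _ H3] := H a%:R (collar_end a e0).
  have := H3 (row_mx (const_mx 1 : 'rV[R]_1) 0); rewrite row_mxKr linear0 => <-.
  exact (congr1 (kdsnu V nu (cobincl y)) (esym (collar_eps y _ cm (cm_eps cm')))).
have DA' u : kdsnu V nu (cobincl y) (Ac u) = kdsnu (bV a) (bnu a) y u by exact: (bdy_slice_dsnu Hcob red pert).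
have bA k b := @col_basis _ _ _ _ _ _ cm y k b.
(* The collar vector is annihilated by d(s + nu), hence is tangent to the zero set. *)
have : tau \in limg (din (zbm x)) by rewrite din_limg memv_ker; apply/eqP; exact: Dt'.
move=> /memv_imgP[s _ Es]; exists s; split.
  move=> i0 i00; have mU := cd_man cd kI'.
  have bU : mboundary (kU KK I) (val (zbm x)) by exact (@bdy_bdry _ _ _ _ _ _ Hcob a I (val x) kI).
  have [j0 [j00 _ _]] := (bdry_chart mU (mdom_refl (manifold_charted mU) _)).1 bU.
  (* The factor [r] is nonnegative, and nonzero because the collar vector has nonzero first
     coordinate in U_I, so the sign survives. *)
  have [r r0 Hr] := zquot_coord cd zA ((bdA (zbm x)).2 bU) bU i00 j00.
  have := collar_dt_sign cm y j00.
  have E1 : (tau : 'rV[R]_(mdim (kU KK I))) ord0 j0 = r * (dqu (zbm x) s : 'rV[R]_n) ord0 i0.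
    exact (etrans (congr1 (fun t : 'rV[R]_(mdim (kU KK I)) => t ord0 j0) Es) (Hr s)).
  move: E1; rewrite /tau /col_dt => ->; rewrite mulrCA => P.
  have r1 : r != 0 by apply: contraTneq P => ->; rewrite mul0r ltxx.
  by move: P; rewrite pmulr_rgt0 // lt_neqAle eq_sym r1.
move=> k u bu.
have bi := dincl_basis cdb mBI eBI (z := x) bu.
have bs := susp_ker bA Dt' DA' bi.
have Em : map (din (zbm x)) (s :: map (dzb x) u) = tau :: map Ac (map (dib x) u).
  rewrite /= -Es; congr (_ :: _); rewrite -!map_comp; apply: eq_map => w /=.
  exact: (zbmap_diff Hcob cd cdb zA zB x w).
have bf : basis_of fullv (s :: map (dzb x) u).
  apply: (preimage_basis (dincl_lker eAI (zbm x))).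
  have b2 := eq_ind_r (fun l : seq (tangent (zincl (zbm x))) => is_true (basis_of (lker (kdsnu V nu (zincl (zbm x)))) l)) bs Em.
  exact (eq_ind_r (fun W : {vspace tangent (zincl (zbm x))} => is_true (basis_of W (map (din (zbm x)) (s :: map (dzb x) u)))) b2 (din_limg (zbm x))).
split=> //.
have [_ /(_ I (zbm x))[lam [cc [c1 c2 c3]]]] := oA.
have [_ /(_ I x)[lamb [cb [b1 b2 b3]]]] := oB.
rewrite b3 //.
have := c3 _ [tuple of s :: map_tuple (dzb x) u] bf; rewrite !sqE /= => ->.
have := susp_compare bA Dt DA Dt' DA' (cd_trans cdb (zP x)) c1 c2 b1 b2
  (fun k l v w => susp_sigma Hori kI cm (v := v) (w := w)) bi.
by rewrite !sqE /= -Em.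
Qed.

Hypothesis bdB : mboundary (Mfd B) = set0.
Let zj : Mfd B -> Mfd A := @zjump R Y N c K V nu a.

(** The outward vector is [r *: s0] plus boundary directions, with [s0] the collar vector in |Z|.
    Outward vectors have negative first coordinate and that of [s0] has the sign of [collar_dir], so
    [r] is negative at the end 0 and positive at the end 1, which is the required sign. *)
Lemma boundary_sign (q : Mfd B) k (b : k.-tuple (tangent q)) (v : tangent (zj q)) :
  basis_of fullv b -> outward v ->
  0 < (-1) ^+ (~~ a) * ob q k 0%N b [tuple] *
    o (zj q) k.+1 0%N [tuple of v :: map_tuple (mdiff setT zj q) b] [tuple].
Proof.
move=> bb ov; have bq : mboundary (Mfd A) (zj q) by exact (zjump_mboundary (q := q)).
have [[I x0] Eq] := zproj_surj q; move: b v bb ov bq; rewrite -{}Eq /= => b v bb ov bq.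
pose x : Mfd (BI I) := x0.
have [s [sP sE]] := conormal_lift x.
pose u := map_tuple ((dqb x)^-1)%VF b.
have [dK Kd i0] := hom_bij (dquot_lker mBI zB x).
have Eu : map_tuple (dqb x) u = b by apply: val_inj; rewrite /= -map_comp map_id_in // => y _ /=; exact: dK.
have bu : basis_of fullv u by exact: (bij_basis i0 bb).
have [bs Eo] := sE k u bu.
pose b' : k.-tuple 'rV[R]_n := map_tuple (mdiff setT zj (zquot B x)) b.
pose s0 : 'rV[R]_n := dqu (zbm x) s.
have Eb : map_tuple (dqu (zbm x)) (map_tuple (dzb x) u) = b' :> k.-tuple 'rV[R]_n.
  rewrite /b' -Eu; apply: val_inj; rewrite /= -!map_comp; apply: eq_map => w /=.
  exact: (esym (zjmap_diff Hcob cd cdb zA zB x _)).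
have bs0 : basis_of fullv (s0 :: b').
  have := bij_basis (dquot_lker mAI zA (zbm x)) bs; rewrite -Eb; exact.
have Ej : zj (zproj x0) = zquot A (zbm x) by exact: (zjump_zproj Hcob cd cdb).
have [j0 [j00 _ _]] := (bdry_chart mA (mdom_refl (manifold_charted mA) _)).1 bq.
have b0 w : w \in b' -> w ord0 j0 = 0.
  move=> /mapP[w' _ ->].
  exact: (boundaryless_coord w' mB mA bdB (zjmap_smooth Hcob cd cdb zA zB (zquot B x)) bq j00).
have vs : (v : 'rV[R]_n) \in <<[tuple s0] ++ b'>>%VS by rewrite /= (span_basis bs0) memvf.
have [r' [mu Ev]] := cat_span vs; rewrite big_ord1 [tnth _ _](tnth_nth 0) /= in Ev.
set r := r' ord0 in Ev.
have v0 : (v : 'rV[R]_n) ord0 j0 = r * s0 ord0 j0.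
  by rewrite Ev mxE summxE big1 ?addr0 => [|i _]; rewrite mxE // b0 ?mulr0 ?mem_tnth.
have := ov j0 j00; rewrite v0 => neg.
have := sP j0 j00; rewrite -/s0 => pos.
have r0 : r != 0 by apply: contraTneq neg => ->; rewrite mul0r ltxx.
have sr : 0 < (-1) ^+ (~~ a) * r.
  move: pos neg; rewrite /collar_dir; case: (a) => /=; rewrite ?expr0 ?expr1 ?mulN1r ?mul1r ?oppr_gt0 => pos.
    by rewrite nmulr_llt0.
  by rewrite pmulr_llt0.
have [[[zo _] _] _] := oA; have [[_ nz] _] := oB.
have H := detelt_replace (om := o (zquot A (zbm x))) (zo _) bs0 Ev r0.
have nb : ob (zquot B x) k 0%N b [tuple] != 0.
  apply: nz; first by rewrite lker0f.
  rewrite coker0 basisEdim dimvf /= dim_matrix mulr0 leqnn andbT.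
  by apply/subvP => y _; have -> : y = 0 by [apply/rowP; case]; exact: mem0v.
rewrite Eu Eb in Eo.
have P (p p' : Mfd A) (t : k.+1.-tuple 'rV[R]_n) : p = p' -> o p k.+1 0%N t [tuple] = o p' k.+1 0%N t [tuple].
  by move=> ->.
set z := o (zj (zproj x0)) _ _ _ _.
have Ez : z = o (zquot A (zbm x)) k.+1 0%N [tuple of (v : 'rV[R]_n) :: b'] [tuple] by exact: P Ej.
set y := ob _ _ _ _ _.
have Ey : y = r * z by rewrite Ez; exact (esym (etrans H Eo)).
have : y != 0 by exact: nb.
rewrite Ey mulf_eq0 negb_or => /andP[_ z0].
(* As [y = r * z], the product in the goal is the positive number [(-1) ^+ (~~ a) * r] times
   [z ^+ 2]. *)
have z2 : 0 < z ^+ 2 by rewrite exprn_even_gt0.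
by have := mulr_gt0 sr z2; rewrite expr2 !mulrA.
Qed.
End BoundarySigns.

(** Turns the existence of structures at each end into functions of the end, each typed over the
    previous choices. *)
Lemma dep_choice3 (S : Type) (T : S -> Type) (U : forall a, T a -> Type) (W : forall a t, U a t -> Type)
    (P : forall a t u, W a t u -> Prop) : (forall a, exists t u w, P a t u w) ->
  exists (t : forall a, T a) (u : forall a, U a (t a)) (w : forall a, W a (t a) (u a)), forall a, P a (t a) (u a) (w a).
Proof.
move=> H; pose H1 a := projT2 (cid (H a)); pose H2 a := projT2 (cid (H1 a)).
exists (fun a => projT1 (cid (H a))), (fun a => projT1 (cid (H1 a))), (fun a => projT1 (cid (H2 a))) => a.
exact: projT2 (cid (H2 a)).
Qed.

(** * Boundary decomposition and assembly *)

Section CobordismTheorem.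
Variables (R : realType) (Y : topologicalType) (N : nat) (d : int).
Variables (c : collared R Y) (K : kcob R Y N).
Local Notation KK := (cobK K).
Local Notation ba a := (bdy_atlas c K a).
Unset Implicit Arguments.
Variables (V : forall I, set (kU KK I)) (nu : forall I, kU KK I -> kE KK I).
Variables (sigma : ksection KK) (bsigma : forall a, ksection (ba a)).
Set Implicit Arguments.
Hypothesis Hcob : is_cobordism c K d.
Local Notation bV a := (bdy_red c V a).
Local Notation bnu a := (bdy_pert c nu a).
Implicit Types I J L : {set 'I_N}.

Lemma zjump_range (A : set (zset V nu)) n (m : bool -> nat) : core_data V nu n ->
  (forall a, core_data (bV a) (bnu a) (m a)) ->
  (forall I (z : set_type (kZ V nu I)), A (zproj z) <-> mboundary (kU KK I) (val z)) ->
  A = range (@zjump R Y N c K V nu false) `|` range (@zjump R Y N c K V nu true).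
Proof.
move=> cd cdb bA; apply/seteqP; split=> [q|q].
  have [[I z] <-] := zproj_surj q => /= /(bA I z) bz.
  have /(cob_bdryE Hcob (val z) (zidx z))[a [kI [y Ey]]] := bz.
  have Zy : kZ (bV a) (bnu a) I y by apply: (Z_bZ kI); rewrite Ey; exact: zP.
  have [p Ep] : exists p : zset (bV a) (bnu a), zjump p = zproj z.
    exists (zproj (zp Zy)).
    by rewrite (zjump_zproj Hcob cd (cdb a)); congr zproj; apply: val_inj; rewrite zb_val.
  by move: p Ep; case: (a) => p Ep; [right|left]; exists p.
have H a (p : zset (bV a) (bnu a)) : A (zjump p).
  have [[I x] <-] := zproj_surj p; rewrite (zjump_zproj Hcob cd (cdb a)).
  by apply/(bA I (zb x)); exact (@bdy_bdry _ _ _ _ _ _ Hcob a I (val x) (zb_bidx x)).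
by case=> -[p _ <-]; exact: H.
Qed.

(** A link between boundary zeros of different ends would, after [bdy_push], exhibit a point of one
    chart lying on both of its boundary pieces. *)
Lemma zjump_disjoint n (m : bool -> nat) : core_data V nu n -> (forall a, core_data (bV a) (bnu a) (m a)) ->
  range (@zjump R Y N c K V nu false) `&` range (@zjump R Y N c K V nu true) = set0.
Proof.
move=> cd cdb; apply/seteqP; split=> // _ [[p _ <-] [q _]].
have [[I x] <-] := zproj_surj p; have [[J y] <-] := zproj_surj q.
rewrite (zjump_zproj Hcob cd (cdb false)) (zjump_zproj Hcob cd (cdb true)) /=.
have key a b I' J' (x' : set_type (kZ (bV a) (bnu a) I')) (y' : set_type (kZ (bV b) (bnu b) J')) :
    a != b -> zlink (zb x') (zb y') -> False.
  move=> ab [IJ dx Ex]; have kI := zb_bidx x'; have kJ := zb_bidx y'.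
  have [u [ku Eu]] : exists u : cobU K a J', kidx (ba a) J' /\ cobincl u = cobincl (val y').
    have [EIJ|pIJ] := proper_or_eq IJ.
      move: Ex dx; subst J'; rewrite (kphiII cd) //; first by move=> Ex _; exists (val x').
      exact: bidx_idx kI.
    by have [k1 E] := bdy_push Hcob kI (bidx_idx kJ) pIJ dx; exists (cobphi J' (val x')); rewrite -E.
  move: y' ab Eu kJ {Ex dx}; case: a x' kI u ku => x' kI u ku; case: b => y' // _ Eu kJ.
    exact: (bdy_disjoint Hcob kJ ku (esym Eu)).
  exact: (bdy_disjoint Hcob ku kJ Eu).
by move=> /(zproj_eq cd)[/key|/key]; apply.
Qed.

Hypothesis Htame : tame KK.
Hypothesis red : is_cob_reduction c V.
Hypothesis pert : is_cob_perturbation c V nu.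
Hypothesis adm : admissible V nu.
Hypothesis pre : cob_precompact_pert c V nu.
Hypothesis tr : transverse V nu.
Hypothesis Hori : cob_orientation sigma bsigma.

Theorem cobordism_zero_set :
    exists (n : nat) (A : charts R n (zset V nu))
      (AI : forall I, charts R n (set_type (kZ V nu I)))
      (o : forall q : Mfd A, detelt (tangent q) 'rV[R]_0)
      (nb : bool -> nat)
      (bA : forall a, charts R (nb a) (zset (bdy_red c V a) (bdy_pert c nu a)))
      (bAI : forall a I, charts R (nb a)
         (set_type (kZ (bdy_red c V a) (bdy_pert c nu a) I)))
      (bo : forall a (q : Mfd (bA a)), detelt (tangent q) 'rV[R]_0)
      (j : forall a, Mfd (bA a) -> Mfd A),
      [/\ [set: zset V nu] !=set0 -> n%:Z = d,
          zero_structure A AI /\ zero_orientation sigma AI o,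
          forall a, oriented_closed_zero_set (d - 1) (bsigma a) (bAI a) (bo a),
          forall a I (x : kZ (bdy_red c V a) (bdy_pert c nu a) I)
            (z : kZ V nu I),
            val z = cobincl (val x) -> j a (zproj x) = zproj z
        & oriented_cobordism o bo j].
Proof.
have cd := cob_core Hcob Htame red pert pre tr.
have cdb a := bdy_core Hcob Htame red pert pre tr a.
have [ors _] := Hori.
have [A [AI [oo [zA cA oA bdA]]]] := core_zero_set cd (@cob_index _ _ _ _ _ _ Hcob) ors adm.
have HB a : exists (B : charts R `|d - 1| (zset (bV a) (bnu a)))
    (BI : forall I, charts R `|d - 1| (set_type (kZ (bV a) (bnu a) I)))
    (ob : forall q : Mfd B, detelt (tangent q) 'rV[R]_0),
    oriented_closed_zero_set (d - 1) (bsigma a) BI ob.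
  have H1 I : kidx (ba a) I -> mboundary (kU (ba a) I) = set0 by move=> kI; have [_] := bdy_man Hcob kI.
  have H2 I : kidx (ba a) I -> (mdim (kU (ba a) I))%:Z - (\dim {:kE (ba a) I})%:Z = d - 1.
    by move=> kI; exact: (bdy_dims Hcob kI).
  have H3 I J : kidx (ba a) I -> kidx (ba a) J -> I \proper J -> index_condition (ba a) I J.
    by move=> kI kJ IJ; have [_ _ _ _] := bdy_cc Hcob kI kJ IJ.
  exact (closed_zero_set (cdb a) H1 H2 H3 (bdy_orientation Hcob Hori a) (@bdy_admissible _ _ _ _ _ _ _ _ Hcob red pert adm a)).
have [B [BI [ob oB]]] := dep_choice3 HB.
exists `|d|%N, A, AI, oo, (fun=> `|d - 1|%N), B, BI, ob, (fun a => @zjump R Y N c K V nu a).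
split.
- by apply: (core_nonneg cd) => I kI; exact: (cob_dim Hcob kI).
- by split.
- exact: oB.
- move=> a I x z Ez; rewrite (zjump_zproj Hcob cd (cdb a)); congr zproj.
  by apply: val_inj; rewrite zb_val.
have mA : is_manifold (Mfd A) by case: zA.
split.
- by split.
- by case: oA.
- by move=> a; have [_ zB _ _ _] := oB a; exact: (zjmap_embedding Hcob cd (cdb a) zA zB).
- split; last exact: zjump_disjoint cd cdb.
  exact (zjump_range cd cdb bdA).
move=> a q k b v bb ov; have [_ zB _ bdB oBa] := oB a.
exact: (boundary_sign Hcob red pert Hori cd (cdb a) zA bdA zB oA oBa bdB bb ov).
Qed.
End CobordismTheorem.

Theorem proposition8p1p13 (R : realType) :
  (forall (X : metricType R) (N : nat) (d : int) (K : katlas R X N)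
      (sigma : ksection K) (V : forall I, set (kU K I))
      (nu : forall I, kU K I -> kE K I),
    compact [set: X] -> is_atlas K setT d -> tame K -> orientation sigma ->
    is_reduction V ->
    is_perturbation V nu -> admissible V nu -> precompact_pert V nu ->
    transverse V nu ->
    exists (n : nat) (A : charts R n (zset V nu))
      (AI : forall I, charts R n (set_type (kZ V nu I)))
      (o : forall q : Mfd A, detelt (tangent q) 'rV[R]_0),
      oriented_closed_zero_set d sigma AI o)
  /\
  (forall (Y : metricType R) (N : nat) (d : int) (c : collared R Y)
      (K : kcob R Y N) (sigma : ksection (cobK K))
      (bsigma : forall a, ksection (bdy_atlas c K a))
      (V : forall I, set (kU (cobK K) I))
      (nu : forall I, kU (cobK K) I -> kE (cobK K) I),
    compact [set: Y] -> is_cobordism c K d -> tame (cobK K) ->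
    cob_orientation sigma bsigma ->
    is_cob_reduction c V ->
    is_cob_perturbation c V nu -> admissible V nu ->
    cob_precompact_pert c V nu -> transverse V nu ->
    exists (n : nat) (A : charts R n (zset V nu))
      (AI : forall I, charts R n (set_type (kZ V nu I)))
      (o : forall q : Mfd A, detelt (tangent q) 'rV[R]_0)
      (nb : bool -> nat)
      (bA : forall a, charts R (nb a) (zset (bdy_red c V a) (bdy_pert c nu a)))
      (bAI : forall a I, charts R (nb a)
         (set_type (kZ (bdy_red c V a) (bdy_pert c nu a) I)))
      (bo : forall a (q : Mfd (bA a)), detelt (tangent q) 'rV[R]_0)
      (j : forall a, Mfd (bA a) -> Mfd A),
      [/\ [set: zset V nu] !=set0 -> n%:Z = d,
          zero_structure A AI /\ zero_orientation sigma AI o,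
          forall a, oriented_closed_zero_set (d - 1) (bsigma a) (bAI a) (bo a),
          forall a I (x : kZ (bdy_red c V a) (bdy_pert c nu a) I)
            (z : kZ V nu I),
            val z = cobincl (val x) -> j a (zproj x) = zproj z
        & oriented_cobordism o bo j]).
Proof.
split=> [X N d K sigma V nu _ at_ ta ori rd pt ad pr tr|Y N d c K sigma bsigma V nu _ Hc ta ori rd pt ad pr tr].
  by exists `|d|%N; exact: (atlas_zero_set at_ ta ori rd pt ad pr tr).
exact: (cobordism_zero_set Hc ta rd pt ad pr tr ori).
Qed.
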